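(* Let $V$ be a set of $n$ vertices with source $s\in V$, and let $\sigma=e_1,\ldots,e_m$ be a sequence of distinct directed edges on $V$ with weights in $[1,W]$, arriving online one at a time. Before any edge arrives, the algorithm receives a prediction $\hat\sigma$, a sequence of $m$ distinct edges. For an edge $e$ of $\sigma$ let $\mathrm{index}(e)$ be its position in $\sigma$ and $\widehat{\mathrm{index}}(e)$ its position in $\hat\sigma$, with $\widehat{\mathrm{index}}(e):=m+1$ if $e$ does not occur in $\hat\sigma$. Let $\eta_e=|\mathrm{index}(e)-\widehat{\mathrm{index}}(e)|$, and for an integer $\tau\ge 0$ let $\mathrm{HIGH}(\tau)$ be the set of edges $e$ of $\sigma$ with $\eta_e>\tau$. Then there is a learned online single-source shortest-path algorithm that, given $\hat\sigma$, has the following guarantees: (1) after each insertion it maintains $(1+\epsilon)$-approximate shortest-path distances from $s$ in the graph of edges that have arrived, i.e. after the $t$-th insertion it maintains an array $D$ with $d^t(v)\le D[v]\le (1+\epsilon)\,d^t(v)$ for every $v\in V$, where $d^t(v)$ is the shortest-path distance from $s$ to $v$ in the graph on $V$ with edges $e_1,\ldots,e_t$; (2) the total running time over all edge insertions is $\tilde O\big(m\cdot\min_{\tau}\{\tau+|\mathrm{HIGH}(\tau)|\}\cdot\log W/\epsilon\big)$.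
   Context: $\epsilon>0$ is an approximation parameter with $\epsilon=O(1)$. The $\tilde O$ notation suppresses logarithmic factors. The length of a path is the sum of its edge weights.
   Formalization: In the running-time bound the factors min_τ{τ+|HIGH(τ)|} and log W are replaced by max(1,·), since for a perfect prediction or W=1 the bound as written is 0, while each insertion takes at least one step. *)

(* Defs.v *)
From HB Require Import structures.
From mathcomp Require Import all_boot all_order all_algebra.
From mathcomp Require Import all_classical all_reals all_analysis.

Set Implicit Arguments.
Unset Strict Implicit.
Unset Printing Implicit Defensive.

Import Order.TTheory GRing.Theory Num.Theory.
Local Open Scope classical_set_scope.
Local Open Scope ring_scope.

(* Weighted digraphs on 'I_n. An edge carries its weight, so that "e occurs in
   the prediction" means that it is predicted with its actual weight. *)

Definition edge (R : realType) (n : nat) : Type := ('I_n * 'I_n * R)%type.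
HB.instance Definition _ (R : realType) (n : nat) :=
  Equality.copy (edge R n) ('I_n * 'I_n * R)%type.

Definition etail (R : realType) (n : nat) (e : edge R n) : 'I_n := e.1.1.
Definition ehead (R : realType) (n : nat) (e : edge R n) : 'I_n := e.1.2.
Definition weight (R : realType) (n : nat) (e : edge R n) : R := e.2.

Fixpoint is_path (R : realType) (n : nat) (G : seq (edge R n))
    (u : 'I_n) (p : seq (edge R n)) (v : 'I_n) : bool :=
  if p is e :: q then [&& e \in G, etail e == u & is_path G (ehead e) q v]
  else u == v.

Definition path_length (R : realType) (n : nat) (p : seq (edge R n)) : R :=
  \sum_(e <- p) weight e.

(* +oo when v is not reachable from s. *)
Definition dist (R : realType) (n : nat) (G : seq (edge R n)) (s v : 'I_n) :
    \bar R :=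
  ereal_inf [set (path_length p)%:E | p in [set p | is_path G s p v]].

(* Positions are counted from 1. Since seq.index returns the size of the list on
   non-members, an edge absent from an m-term list has position m + 1. *)
Definition position (R : realType) (n : nat) (l : seq (edge R n))
    (e : edge R n) : nat := (index e l).+1.

Definition eta (R : realType) (n : nat) (sigma hat : seq (edge R n))
    (e : edge R n) : nat :=
  `|(position sigma e)%:Z - (position hat e)%:Z|%N.

Definition high (R : realType) (n : nat) (sigma hat : seq (edge R n))
    (tau : nat) : seq (edge R n) :=
  undup [seq e <- sigma | (tau < eta sigma hat e)%N].

Definition tau_cost (R : realType) (n : nat) (sigma hat : seq (edge R n))
    (tau : nat) : nat := (tau + size (high sigma hat tau))%N.

Lemma tau_cost_ex (R : realType) (n : nat) (sigma hat : seq (edge R n)) :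
  exists k, `[< exists tau, tau_cost sigma hat tau = k >].
Proof. by exists (tau_cost sigma hat 0); apply/asboolP; exists 0%N. Qed.

Definition min_tau_cost (R : realType) (n : nat) (sigma hat : seq (edge R n)) :
    nat := ex_minn (tau_cost_ex sigma hat).

(* The machine: a real RAM with two memories, each made of arrays named by
   program constants and indexed by computed naturals. One memory stores
   machine words (naturals below a word bound B), the other stores reals with
   exact field operations and comparisons; there is no way to round a real to
   a word. *)

Inductive iexp : Type :=
| ICst of nat
| IGet of nat & iexp
| IAdd of iexp & iexp
| ISub of iexp & iexp
| IMul of iexp & iexp
| IDiv of iexp & iexp.

Inductive rexp : Type :=
| RInt of iexp
| RGet of nat & iexp
| RAdd of rexp & rexp
| RSub of rexp & rexp
| RMul of rexp & rexp
| RDiv of rexp & rexp.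

Inductive bexp : Type :=
| BILe of iexp & iexp
| BRLe of rexp & rexp
| BNot of bexp
| BAnd of bexp & bexp.

Inductive cmd : Type :=
| Skip
| ISet of nat & iexp & iexp
| RSet of nat & iexp & rexp
| Seq of cmd & cmd
| If of bexp & cmd & cmd
| While of bexp & cmd.

Record state (R : realType) : Type := State {
  imem : nat -> nat -> nat;
  rmem : nat -> nat -> R
}.

Definition upd (T : Type) (mem : nat -> nat -> T) (a i : nat) (x : T) :
    nat -> nat -> T :=
  fun b j => if (b == a) && (j == i) then x else mem b j.

Definition iupd (R : realType) (st : state R) (a i x : nat) : state R :=
  State (upd (imem st) a i x) (rmem st).

Definition rupd (R : realType) (st : state R) (a i : nat) (x : R) : state R :=
  State (imem st) (upd (rmem st) a i x).

Fixpoint ival (R : realType) (st : state R) (e : iexp) : nat :=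
  match e with
  | ICst k => k
  | IGet a e1 => imem st a (ival st e1)
  | IAdd e1 e2 => (ival st e1 + ival st e2)%N
  | ISub e1 e2 => (ival st e1 - ival st e2)%N
  | IMul e1 e2 => (ival st e1 * ival st e2)%N
  | IDiv e1 e2 => (ival st e1 %/ ival st e2)%N
  end.

Fixpoint rval (R : realType) (st : state R) (e : rexp) : R :=
  match e with
  | RInt e1 => (ival st e1)%:R
  | RGet a e1 => rmem st a (ival st e1)
  | RAdd e1 e2 => rval st e1 + rval st e2
  | RSub e1 e2 => rval st e1 - rval st e2
  | RMul e1 e2 => rval st e1 * rval st e2
  | RDiv e1 e2 => rval st e1 / rval st e2
  end.

Fixpoint bval (R : realType) (st : state R) (b : bexp) : bool :=
  match b with
  | BILe e1 e2 => (ival st e1 <= ival st e2)%N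
  | BRLe e1 e2 => rval st e1 <= rval st e2
  | BNot b1 => ~~ bval st b1
  | BAnd b1 b2 => bval st b1 && bval st b2
  end.

(* Every word computed during the evaluation is below B; in particular every
   address is. *)
Fixpoint ifits (R : realType) (B : nat) (st : state R) (e : iexp) : bool :=
  (ival st e < B)%N &&
  match e with
  | ICst _ => true
  | IGet _ e1 => ifits B st e1
  | IAdd e1 e2 | ISub e1 e2 | IMul e1 e2 | IDiv e1 e2 =>
      ifits B st e1 && ifits B st e2
  end.

Fixpoint rfits (R : realType) (B : nat) (st : state R) (e : rexp) : bool :=
  match e with
  | RInt e1 | RGet _ e1 => ifits B st e1
  | RAdd e1 e2 | RSub e1 e2 | RMul e1 e2 | RDiv e1 e2 =>
      rfits B st e1 && rfits B st e2
  end.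

Fixpoint bfits (R : realType) (B : nat) (st : state R) (b : bexp) : bool :=
  match b with
  | BILe e1 e2 => ifits B st e1 && ifits B st e2
  | BRLe e1 e2 => rfits B st e1 && rfits B st e2
  | BNot b1 => bfits B st b1
  | BAnd b1 b2 => bfits B st b1 && bfits B st b2
  end.

(* exec B c st st' T: started in st, c terminates in st' after T steps; there is
   no execution if a word overflows. Expressions of a fixed program have bounded
   size, so assignments and tests are charged one step each. *)
Inductive exec (R : realType) (B : nat) :
    cmd -> state R -> state R -> nat -> Prop :=
| exec_skip st : exec B Skip st st 1
| exec_iset a e1 e2 st :
    ifits B st e1 -> ifits B st e2 ->
    exec B (ISet a e1 e2) st (iupd st a (ival st e1) (ival st e2)) 1
| exec_rset a e1 e2 st :
    ifits B st e1 -> rfits B st e2 ->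
    exec B (RSet a e1 e2) st (rupd st a (ival st e1) (rval st e2)) 1
| exec_seq c1 c2 st1 st2 st3 T1 T2 :
    exec B c1 st1 st2 T1 -> exec B c2 st2 st3 T2 ->
    exec B (Seq c1 c2) st1 st3 (T1 + T2)
| exec_if b c1 c2 st st' T :
    bfits B st b -> exec B (if bval st b then c1 else c2) st st' T ->
    exec B (If b c1 c2) st st' T.+1
| exec_while_false b c st :
    bfits B st b -> ~~ bval st b -> exec B (While b c) st st 1
| exec_while_true b c st1 st2 st3 T1 T2 :
    bfits B st1 b -> bval st1 b ->
    exec B c st1 st2 T1 -> exec B (While b c) st2 st3 T2 ->
    exec B (While b c) st1 st3 (T1 + T2).+1.

Lemma exec_det (R : realType) (B : nat) (c : cmd) (st st1 st2 : state R)
    (T1 T2 : nat) :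
  exec B c st st1 T1 -> exec B c st st2 T2 -> st1 = st2 /\ T1 = T2.
Proof.
move=> H1; elim: H1 st2 T2 => {c st st1 T1}.
- by move=> st st2 T2 H; inversion H; subst.
- by move=> a e1 e2 st _ _ st2 T2 H; inversion H; subst.
- by move=> a e1 e2 st _ _ st2 T2 H; inversion H; subst.
- move=> c1 c2 s1 s2 s3 T1 T1' _ IH1 _ IH2 st2 T2 H.
  inversion H as [| | | ? ? ? ? ? ? ? E1 E2 | | |]; subst.
  by case: (IH1 _ _ E1) => ? ?; subst; case: (IH2 _ _ E2) => ? ?; subst.
- move=> b c1 c2 s s' T _ _ IH st2 T2 H.
  inversion H as [| | | | ? ? ? ? ? ? ? E | |]; subst.
  by case: (IH _ _ E) => ? ?; subst.
- move=> b c s _ /negP nb st2 T2 H.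
  inversion H as [| | | | | | ? ? ? ? ? ? ? ? tb]; subst => //.
- move=> b c s1 s2 s3 T1 T1' _ tb _ IH1 _ IH2 st2 T2 H.
  inversion H as [| | | | | ? ? ? ? nb | ? ? ? ? ? ? ? ? ? E1 E2]; subst.
    by rewrite tb in nb.
  by case: (IH1 _ _ E1) => ? ?; subst; case: (IH2 _ _ E2) => ? ?; subst.
Qed.

(* Memory layout.
   Words: array 0 holds n, m, s; arrays 1 and 2 hold the tails and heads of the
   predicted edges; cells 0 and 1 of array 3 receive the tail and head of an
   arriving edge.
   Reals: array 0 holds eps, W; array 1 holds the predicted weights; cell 0 of
   array 2 receives the weight of an arriving edge; array 3 is the output D.
   All other cells are initially 0. *)

Definition initial_state (R : realType) (n : nat) (s : 'I_n) (W eps : R)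
    (hat : seq (edge R n)) : state R :=
  State
    (fun a i => match a with
       | 0 => nth 0%N [:: n; size hat; val s] i
       | 1 => nth 0%N [seq val (etail e) | e <- hat] i
       | 2 => nth 0%N [seq val (ehead e) | e <- hat] i
       | _ => 0%N
       end)
    (fun a i => match a with
       | 0 => nth 0 [:: eps; W] i
       | 1 => nth 0 [seq weight e | e <- hat] i
       | _ => 0
       end).

Definition receive (R : realType) (n : nat) (e : edge R n) (st : state R) :
    state R :=
  rupd (iupd (iupd st 3 0 (val (etail e))) 3 1 (val (ehead e))) 2 0 (weight e).

(* D[v]; a negative entry of the array stands for +oo. *)
Definition D (R : realType) (n : nat) (st : state R) (v : 'I_n) : \bar R :=
  let x := rmem st 3 (val v) in if x < 0 then +oo%E else x%:E.

(* preprocess is run once on the prediction, before any edge arrives; insert is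
   run after each arrival. *)
Record algorithm : Type := Algorithm { preprocess : cmd; insert : cmd }.

(* st t is the memory after t insertions and time t the number of steps of the
   insertion of tnth sigma t; both are determined by the algorithm, the initial
   state and the edges that have arrived, by exec_det. *)
Definition run (R : realType) (n m : nat) (B : nat) (A : algorithm)
    (st0 : state R) (sigma : m.-tuple (edge R n))
    (st : nat -> state R) (time : 'I_m -> nat) : Prop :=
  (exists T, exec B (preprocess A) st0 (st 0%N) T) /\
  forall t : 'I_m,
    exec B (insert A) (receive (tnth sigma t) (st t)) (st t.+1) (time t).

(* Main.v *)
(* The weights being at least 1, every distance is either infinite or at most n W, so a
   distance can shrink by a factor 1 + delta at most N = O(log (n W) / delta) times.
   The algorithm guesses an error bound K = 2^k, doubled after K arrivals that are
   not within K of their predicted position. For every a < L = O(log m) it keeps a set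
   S_a of alarmed vertices, those whose distance would shrink noticeably if all the
   edges predicted to arrive before the next rebuild of level a were present; levels
   with 2^a > K are rebuilt every 2^a steps, the others on a clock that advances by the
   multiplier mu of the arriving edge. An insertion runs Dijkstra's algorithm on
   S_top only, top being the highest level that is due, and then recomputes S_(top-1),
   ..., S_1, each inside the previous one. A vertex outside S_a is certified until the
   next rebuild of level a, which costs a factor 1 + O(L delta) per level and hence
   1 + eps overall. An alarm is either followed by a real drop of the distance, which
   happens N times per vertex, or its witness path uses an edge that did not arrive;
   such edges are blamed, and an edge that has been blamed for more than 4 m N units of
   work doubles its multiplier, after which it is used less often by the low levels. *)

Require Import Defs.
From HB Require Import structures.
From mathcomp Require Import all_boot all_order all_algebra.
From mathcomp Require Import all_classical all_reals all_analysis.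
From mathcomp Require Import zify ring lra.

Set Implicit Arguments.
Unset Strict Implicit.
Unset Printing Implicit Defensive.

Import Order.TTheory GRing.Theory Num.Theory.
Local Open Scope ring_scope.

(** * The guessed error bound *)

Section Clock.
Local Open Scope nat_scope.
Variables (m : nat) (idf : nat -> nat).

(** The obstacle is a predicted edge that does not come: it can lie on the witness path of an alarm
    at every rebuild. For the levels with 2^a > K this is harmless. Only O(K) edges of a phase are
    overdue, and they spoil O(K) rebuilds of each level. The lower levels are rebuilt too often for
    such a count, and there multipliers trade clock for length: an unarrived edge with multiplier mu
    is used at level a only if mu < 2^a, and it is lengthened by the factor 1 + delta mu / 2^a. The
    trade works in both directions. As the clock advances by mu, the multipliers of the edges
    arriving between two rebuilds of level a sum to less than 2^a, so the lengthening costs a factor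
    1 + 2 delta on any simple path. Conversely a witness path has a key of at most M <= (1 +
    delta)^N, so the multipliers of its unarrived edges sum to at most N 2^a; hence the growth of
    the multipliers, and with it the additional advance of the clock, is paid by the alarms. The
    alarm threshold of the lower levels is 1 + O(L delta) instead of 1 + delta, because an alarm
    must force a drop although the later distance carries the error of the higher levels. *)

Definition near K t := [&& idf t < m, idf t <= t + K & t <= idf t + K].

(** The exponent of the guess and the number of its failures before arrival [t]; the exponent grows
    at failure number [2 ^ k + 1]. The id [idf t] of an arriving edge is its position in the
    prediction, counted from 0, or at least [m] if it is not predicted. *)
Fixpoint kc t : nat * nat :=
  if t is t'.+1 then
    let: (k, c) := kc t' in
    if near (2 ^ k) t' then (k, c)
    else if c.+1 <= 2 ^ k then (k, c.+1) else (k.+1, 0)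
  else (0, 0).

(** The guess after arrival [t] has been counted, which step [t] itself already uses, whereas [ev]
    tests the arrival against the previous guess. *)
Definition kap t := (kc t.+1).1.
Definition ev t := ~~ near (2 ^ (kc t).1) t.
Definition full t := ev t || (t == 0).

Lemma kcS t : kc t.+1 =
  if ~~ ev t then kc t
  else if (kc t).2.+1 <= 2 ^ (kc t).1 then ((kc t).1, (kc t).2.+1)
  else ((kc t).1.+1, 0).
Proof. by rewrite /ev negbK /=; case: (kc t) => k c /=. Qed.

Lemma kc_le t : (kc t).2 <= 2 ^ (kc t).1.
Proof.
by elim: t => // t IH; rewrite kcS; case: ifP => // _; case: ifP.
Qed.

Lemma kap_step t : kap t <= kap t.+1 <= (kap t).+1.
Proof. by rewrite /kap [in X in _ <= X <= _]kcS; case: ifP => //= _; [|case: ifP => //= _]; lia. Qed.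

Lemma kap_mono t t' : t <= t' -> kap t <= kap t'.
Proof.
move=> /subnK <-; elim: (t' - t) => // k IH; rewrite addSn.
by apply: leq_trans IH _; have /andP[] := kap_step (k + t).
Qed.

Lemma kap_new t : kap t < kap t.+1 -> ev t.+1.
Proof. by rewrite /kap [in X in _ < X -> _]kcS; case: ifP => [_|/negbFE //]; rewrite ltnn. Qed.

Lemma ev_kap t : ~~ ev t -> near (2 ^ kap t) t.
Proof. by move=> e; rewrite /kap kcS e -[near _ _]negbK. Qed.

Lemma nearW K K' t : K <= K' -> near K t -> near K' t.
Proof. by rewrite /near => h /and3P[-> h1 h2]; apply/andP; split; lia. Qed.

(** Once [2 ^ k] reaches [x], every failure is one of the at most [x] arrivals that are not near for
    [x], so the counter never exceeds [2 ^ k] again. The least such [k] has [2 ^ k < 2 * x]. The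
    case [x = 0] stands apart because the guess is never below 1. *)
Lemma kap_bound x T : \sum_(t < T) ~~ near x t <= x ->
  2 ^ (kc T).1 <= maxn 1 (2 * x).
Proof.
move=> hx; have [x0|x0] := posnP x; first rewrite x0 in hx *.
  suff -> : kc T = (0, 0) by [].
  move: hx; rewrite leqn0 => /eqP.
  elim: T => // T IH; rewrite big_ord_recr /= => /eqP; rewrite addn_eq0 => /andP[/eqP /IH e /eqP e'].
  rewrite e; case: ifP => //; have := @nearW 0 1 T isT.
  by case: (near 0 T) e' => // _ ->.
have hk : x <= 2 ^ up_log 2 x by apply: up_logP.
set k0 := up_log 2 x in hk.
suff [h _] : (kc T).1 <= k0 /\ ((kc T).1 = k0 -> (kc T).2 <= \sum_(t < T) ~~ near x t).
  have : 2 ^ (kc T).1 <= 2 ^ k0 by rewrite leq_exp2l.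
  have [x1|x1] := leqP x 1.
    have -> : k0 = 0 by rewrite /k0 (_ : x = 1) ?up_log1 //; lia.
    by lia.
  have := up_log_bounds (isT : 1 < 2) x1; rewrite -/k0 => /andP[h1 h2].
  have k00 : 0 < k0 by case: (k0) h2 => //; rewrite expn0; lia.
  have e2 : 2 ^ k0 = 2 * 2 ^ k0.-1 by rewrite -expnS prednK.
  by move: h1; rewrite -/k0 e2; lia.
elim: T hx => [|T IH] hx; first by rewrite big_ord0.
have [h1 h2] : (kc T).1 <= k0 /\ ((kc T).1 = k0 -> (kc T).2 <= \sum_(t < T) ~~ near x t).
  by apply: IH; apply: leq_trans hx; rewrite big_ord_recr /= leq_addr.
rewrite kcS; case: ifP => [ne|/negbFE e].
  by split=> // /h2 h3; rewrite big_ord_recr /=; apply: leq_trans h3 (leq_addr _ _).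
have step : (kc T).1 = k0 -> (kc T).2.+1 <= \sum_(t < T.+1) ~~ near x t.
  move=> ek; rewrite big_ord_recr /=; have := h2 ek.
  have : ~~ near x T.
    by apply: contra e => nx; rewrite ek; apply: nearW nx.
  by set A := (\sum_(_ < _) _); case: (near x T); lia.
case: ifP => /= h; first by split=> // /step.
split; last by [].
rewrite ltn_neqAle h1 andbT; apply/eqP => ek.
by move: h; rewrite ek => /negbT; rewrite -ltnNge; have := step ek; lia.
Qed.

(** The counter restarts with each guess and stays at most [2 ^ k]; the additional 1 is for [t1],
    where the phase begins. *)
Lemma full_count t1 t2 k : t1 < t2 -> (forall t, t1 <= t < t2 -> kap t = k) ->
  \sum_(t1 <= t < t2) full t <= 2 ^ k + 1.
Proof.
move=> lt hk; have : \sum_(t1.+1 <= t < t2) full t <= (kc t2).2.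
  have : t1.+1 <= t2 by []. 
  elim: t2 {lt} hk => // T IH hk; rewrite ltnS leq_eqVlt => /orP[/eqP <-|lt].
    by rewrite big_geq.
  rewrite big_nat_recr //; have h1 : \sum_(t1.+1 <= t < T) full t <= (kc T).2.
    by apply: IH => // t ht; apply: hk; lia.
  have eT : (kc T).1 = k.
    by have := hk T.-1; rewrite /kap prednK; [apply; lia|lia].
  have eT' : (kc T.+1).1 = k by apply: hk; lia.
  have -> : full T = ev T by rewrite /full (_ : (T == 0) = false) ?orbF //; lia.
  move: eT'; rewrite kcS; case: (ev T) => /=; last by move=> _; rewrite addn0.
  by move: h1; set A := (\sum_(_ <= _ < _) _); case: ifP => /= _; [lia|rewrite eT; lia].
rewrite (big_ltn lt); set A := (\sum_(_ <= _ < _) _) => h; have := kc_le t2.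
have -> : (kc t2).1 = k by have := hk t2.-1; rewrite /kap prednK; [apply; lia|lia].
by case: (full t1); lia.
Qed.

(** A pigeonhole argument. The ids of the near arrivals of the phase and the bad ids are disjoint
    and lie in an interval of [t2 - t1 + 3 * 2 ^ k] integers, while all but [2 ^ k + 1] of the
    [t2 - t1] arrivals are near. *)
Lemma overdue_count t1 t2 k (bad : pred nat) : t1 < t2 ->
  (forall t, t1 <= t < t2 -> kap t = k) ->
  {in [pred t | t1 <= t < t2] &, injective idf} ->
  (forall j, bad j -> t1 <= j + 2 ^ k /\ j + 2 ^ k < t2) ->
  (forall j t, bad j -> t1 <= t < t2 -> idf t = j -> j + 2 ^ k < t) ->
  forall T, \sum_(j < T) bad j <= 4 * 2 ^ k + 1.
Proof.
move=> lt hk inj hb hb' T; set K := 2 ^ k.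
pose good := [seq idf t | t <- iota t1 (t2 - t1) & ~~ full t].
pose badl := [seq j <- iota 0 T | bad j].
have ub : uniq badl by rewrite filter_uniq ?iota_uniq.
have ug : uniq good.
  rewrite map_inj_in_uniq ?filter_uniq ?iota_uniq // => x y.
  by rewrite !mem_filter !mem_iota => /andP[_ hx] /andP[_ hy]; apply: inj; rewrite inE; lia.
have goodP j : j \in good -> exists t, [/\ t1 <= t < t2, idf t = j, j <= t + K & t <= j + K].
  move=> /mapP[t]; rewrite mem_filter mem_iota => /andP[nf ht] ->.
  exists t; split=> //; first by lia.
    by move: nf; rewrite /full negb_or => /andP[/ev_kap + _]; rewrite hk ?/near; [case/and3P|lia].
  by move: nf; rewrite /full negb_or => /andP[/ev_kap + _]; rewrite hk ?/near; [case/and3P|lia].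
have sub : {subset good ++ badl <= iota (t1 - K) (t2 - t1 + 3 * K)}.
  move=> j; rewrite mem_cat mem_iota mem_filter => /orP[/goodP[t [ht _ h1 h2]]|/andP[/hb [h1 h2] _]]; lia.
have u : uniq (good ++ badl).
  rewrite cat_uniq ug ub andbT; apply/hasPn => j; rewrite mem_filter => /andP[bj _].
  apply/negP => /goodP[t [ht et _ h2]]; have := hb' j t bj ht et; rewrite -/K; lia.
have := uniq_leq_size u sub; rewrite size_cat size_iota.
have -> : size badl = \sum_(j < T) bad j.
  by rewrite size_filter -sum1_count big_mkcond /= -{1}[T]subn0 -/(index_iota 0 T) big_mkord; apply: eq_bigr => j _; case: (bad j).
have -> : size good = t2 - t1 - \sum_(t1 <= t < t2) full t.
  rewrite size_map size_filter.
  have := count_predC full (iota t1 (t2 - t1)); rewrite size_iota.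
  have -> : count full (iota t1 (t2 - t1)) = \sum_(t1 <= t < t2) full t.
    by rewrite -sum1_count big_mkcond /=; apply: eq_bigr => t _; case: (full t).
  by rewrite -/(predC full); set A := count (predC _) _; set A' := (\sum_(_ <= _ < _) _); lia.
by have := full_count lt hk; rewrite -/K; lia.
Qed.

End Clock.

(** * Counting drops of a distance *)

Section Drops.
Context {R : realFieldType}.
Variables (delta M : R) (N : nat).
Hypothesis delta_gt0 : 0 < delta.
Hypothesis MN : M <= (1 + delta) ^+ N.

(** An integer logarithm to base [1 + delta], capped at [N]. *)
Definition lg (x : R) : nat := (\sum_(k < N) ((1 + delta) ^+ k.+1 <= x)%R)%N.

Lemma lg_le x : (lg x <= N)%N.
Proof.
rewrite /lg -[X in (_ <= X)%N]card_ord -sum1_card; apply: leq_sum => i _.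
by case: (_ <= _).
Qed.

Lemma lg_mono x y : x <= y -> (lg x <= lg y)%N.
Proof.
move=> h; apply: leq_sum => i _; case: (boolP (_ <= x)) => // /le_trans -> //.
Qed.

(** Each threshold reached by [y] yields the next one reached by [x], and [x] reaches the first
    threshold in addition. Nothing is lost at the upper end, since [y < x <= M] keeps [y] below the
    last threshold. *)
Lemma lg_drop x y : 1 <= y -> x <= M -> (1 + delta) * y <= x -> (lg y < lg x)%N.
Proof.
move=> y1 xM h; have d0 := delta_gt0.
have hy : 0 <= delta * (y - 1) by rewrite mulr_ge0 ?subr_ge0 // ltW.
rewrite /lg; have MN' := MN; case: N MN' => [|N'] MN'.
  by exfalso; move: MN' h; rewrite expr0; lra.
rewrite big_ord_recr /= [X in (_ < X)%N]big_ord_recl /=.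
have -> : (1 + delta) ^+ 1 <= x by rewrite expr1; lra.
have -> : ((1 + delta) ^+ N'.+1 <= y) = false.
  by apply: negbTE; rewrite -ltNge; apply: lt_le_trans MN'; lra.
rewrite addn0 ltnS; apply: leq_sum => i _ /=; rewrite /bump /= add1n.
case: (boolP (_ <= y)) => // hi; rewrite exprS (le_trans _ h) //.
by rewrite ler_pM2l //; lra.
Qed.

(** The sum of [lg (D l)] over a window of [w] consecutive indices is a potential, at most [w * N]
    at the start. Moving the window by one step replaces [lg (D l)] by [lg (D (l + w))], which is
    smaller whenever [P l] holds. *)
Lemma drop_count (D : nat -> R) (P : pred nat) w T :
  (forall l l', (l <= l' <= T + w)%N -> D l' <= D l) ->
  (forall l, (l < T)%N -> D l <= M) ->
  (forall l, (l < T)%N -> P l -> 1 <= D (l + w)%N /\ (1 + delta) * D (l + w)%N <= D l) ->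
  (\sum_(l < T) P l <= w * N)%N.
Proof.
move=> mono DM drop.
suff h T' : (T' <= T)%N ->
    (\sum_(l < T') P l + \sum_(T' <= l < T' + w) lg (D l) <= w * N)%N.
  by apply: leq_trans (h T (leqnn _)); rewrite leq_addr.
elim: T' => [_|T' IH lt].
  rewrite big_ord0 !add0n; apply: leq_trans (leq_sum _ (fun i _ => lg_le _)) _.
  by rewrite sum_nat_const_nat subn0.
have := IH (ltnW lt); case: w mono drop {IH} => [|w'] mono drop.
  rewrite !addn0 !big_geq // !addn0 big_ord_recr /=.
  case PT: (P T'); last by rewrite addn0.
  have [h1 h2] := drop T' lt PT.
  by exfalso; move: h1 h2; have d0 := delta_gt0; rewrite addn0; nra.
rewrite big_ltn; last by lia.
have e1 : (\sum_(l < T'.+1) P l = \sum_(l < T') P l + P T')%N by rewrite big_ord_recr.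
have e2 : (\sum_(T'.+1 <= l < T'.+1 + w'.+1) lg (D l) =
   \sum_(T'.+1 <= l < T' + w'.+1) lg (D l) + lg (D (T' + w'.+1)))%N.
  by rewrite addSn big_nat_recr //; lia.
rewrite e1 e2; set A := (\sum_(_ < _) _)%N; set B' := (\sum_(_ <= _ < _) _)%N.
have : (P T' + lg (D (T' + w'.+1)%N) <= lg (D T'))%N.
  case PT: (P T'); last by rewrite add0n; apply: lg_mono; apply: mono; lia.
  by have [h1 h2] := drop T' lt PT; apply: lg_drop => //; apply: DM.
by lia.
Qed.

End Drops.

Notation kap0 := kap.
Notation full0 := full.
Notation ev0 := ev.

(** * Paths of edge ids *)

Section IdPaths.
Context {R : realFieldType}.
Variables (tl hd : nat -> nat) (wt : nat -> R).

Fixpoint ipath (P : pred nat) (u : nat) (p : seq nat) (v : nat) : bool :=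
  if p is j :: p' then [&& P j, tl j == u & ipath P (hd j) p' v] else u == v.

Definition plen (p : seq nat) : R := \sum_(j <- p) wt j.

Lemma plen_cat p1 p2 : plen (p1 ++ p2) = plen p1 + plen p2.
Proof. by rewrite /plen big_cat. Qed.

Lemma plen_cons j p : plen (j :: p) = wt j + plen p.
Proof. by rewrite /plen big_cons. Qed.

Lemma plen_nil : plen [::] = 0.
Proof. by rewrite /plen big_nil. Qed.

Lemma ipath_cat P u p1 w p2 v :
  ipath P u p1 w -> ipath P w p2 v -> ipath P u (p1 ++ p2) v.
Proof.
elim: p1 u => [|j p1 IH] u /=; first by move/eqP ->.
by move=> /and3P[-> -> /IH h] /h.
Qed.

Lemma ipath_all P u p v : ipath P u p v -> all P p.
Proof. by elim: p u => //= j p IH u /and3P[-> _ /IH]. Qed.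

Lemma ipath_sub (P P' : pred nat) u (p : seq nat) v : {in p, forall j, P j -> P' j} ->
  ipath P u p v -> ipath P' u p v.
Proof.
elim: p u => //= j p IH u h /and3P[Pj -> /IH ->]; first by rewrite h ?mem_head.
by move=> k kp; apply: h; rewrite inE kp orbT.
Qed.

Lemma plen_ge0 (P : pred nat) p : (forall j, P j -> 1 <= wt j) -> all P p -> 0 <= plen p.
Proof.
move=> h; elim: p => [|j p IH] /=; first by rewrite plen_nil.
by move=> /andP[/h h1 /IH h2]; rewrite plen_cons; lra.
Qed.

(* The part of a path after its last vertex outside S. *)
Lemma ipath_split (S : pred nat) P u p v : ipath P u p v ->
  exists p1 w p2, [/\ p = p1 ++ p2, ipath P u p1 w, ipath P w p2 v,
    all (fun j => S (hd j)) p2 & ~~ S w \/ (p1 = [::] /\ w = u)].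
Proof.
elim: p u => [|j p IH] u /=.
  by move=> /eqP <-; exists [::], u, [::]; split=> //=; right.
move=> /and3P[Pj tj /IH [p1 [w [p2 [-> h1 h2 h3 h4]]]]].
have [Sw|Sw] := boolP (S w); last first.
  by exists (j :: p1), w, p2; split=> //=; [rewrite Pj tj|left].
case: h4 => [|[e1 e2]]; first by rewrite Sw.
exists [::], u, (j :: p2); split=> //=; [by rewrite e1|by rewrite Pj tj -e2|by rewrite -e2 Sw|by right].
Qed.

(** A repeated head closes a cycle of nonnegative length, which is cut out. On a path without
    repeated edges, sums of multipliers can be compared with sums over the arrivals. *)
Lemma ipath_simple (P : pred nat) u p v : (forall j, P j -> 1 <= wt j) -> ipath P u p v ->
  exists p', [/\ ipath P u p' v, uniq [seq hd j | j <- p'], {subset p' <= p} &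
    plen p' <= plen p].
Proof.
move=> hw; elim: p u => [|j p IH] u /=.
  by move=> /eqP <-; exists [::]; split=> //=.
move=> /and3P[Pj tj /[dup] hp /IH [p' [h1 h2 h3 h4]]].
have w1 := hw j Pj.
have pos q x y : ipath P x q y -> 0 <= plen q by move=> /ipath_all; apply: plen_ge0.
have [/mapP[k kp ek]|nin] := boolP (hd j \in [seq hd k | k <- p']); last first.
  exists (j :: p'); split=> /=; rewrite ?Pj ?tj ?nin //.
    by move=> x; rewrite !inE => /orP[-> //|/h3 ->]; rewrite orbT.
  by rewrite !plen_cons; lra.
have [a [b e]] : exists a b, p' = a ++ k :: b.
  exists (take (index k p') p'), (drop (index k p').+1 p').
  by rewrite -{1}(cat_take_drop (index k p') p') (drop_nth 0%N) ?nth_index ?index_mem.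
rewrite e in h1 h2 h3 h4.
have [hb hla] : ipath P (hd k) b v /\ 0 <= plen a.
  move: h1; elim: (a) (hd j) => [|i a' IHa] x /=.
    by rewrite plen_nil => /and3P[].
  by move=> /and3P[/hw hi _ /IHa [-> hla]]; rewrite plen_cons; split=> //; lra.
exists (j :: b); split=> /=.
- by rewrite Pj tj ek.
- move: h2; rewrite map_cat cat_uniq /= => /and3P[_ _]; by rewrite -ek.
- move=> x; rewrite !inE => /orP[-> //|xb]; rewrite (h3 x) ?orbT //.
  by rewrite mem_cat inE xb !orbT.
- have wk : 1 <= wt k.
    by apply: hw; have := ipath_all h1; rewrite all_cat /= => /and3P[].
  move: h4; rewrite plen_cat !plen_cons; lra.
Qed.

End IdPaths.

Lemma uniq_sum_sub (s1 s2 : seq nat) (F : nat -> nat) :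
  uniq s1 -> {subset s1 <= s2} -> (\sum_(i <- s1) F i <= \sum_(i <- s2) F i)%N.
Proof.
move=> u sub; elim: s1 s2 u sub => [|x s1 IH] s2 /=; first by rewrite big_nil.
move=> /andP[nx u] sub; rewrite big_cons.
have xs : x \in s2 by apply: sub; rewrite mem_head.
rewrite (perm_big _ (perm_to_rem xs)) /= big_cons leq_add2l; apply: IH => // y ys.
have : y \in x :: rem x s2.
  by rewrite -(perm_mem (perm_to_rem xs)) sub // inE ys orbT.
by rewrite inE => /orP[/eqP e|//]; move: nx; rewrite -e ys.
Qed.

(** * Products of penalties against sums of multipliers *)

Section Penalties.
Context {R : realFieldType}.
Variable delta : R.
Hypothesis delta_ge0 : 0 <= delta.
Hypothesis delta_le : delta <= 1 / 2.

Lemma bernoulli (x : R) k : -1 <= x -> 1 + k%:R * x <= (1 + x) ^+ k.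
Proof.
move=> hx; elim: k => [|k IH]; first by rewrite mul0r addr0 expr0.
rewrite exprS -natr1; have k0 : (0 : R) <= k%:R by apply: ler0n.
apply: le_trans (_ : (1 + x) * (1 + k%:R * x) <= _); first by nra.
by rewrite ler_wpM2l //; lra.
Qed.

(** With [x = delta / b], the product of [(1 + x) ^ b] and [(1 - x) ^ b] is at most 1, and Bernoulli
    bounds the second factor below by [1 - delta]. Finally 1 / (1 - delta) <= 1 + 2 delta, as delta
    <= 1 / 2. *)
Lemma pen_pow b : (0 < b)%N -> (1 + delta / b%:R) ^+ b <= 1 + 2 * delta.
Proof.
move=> b0; have d0 := delta_ge0; have d1 := delta_le.
have bR : (0 : R) < b%:R by rewrite ltr0n.
set x := delta / b%:R; have x0 : 0 <= x by rewrite divr_ge0 // ltW.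
have xb : b%:R * x = delta by rewrite /x mulrC divfK // gt_eqF.
have x1 : x <= delta by rewrite ler_pdivrMr // ler_peMr // ler1n.
have h : 1 - delta <= (1 - x) ^+ b.
  by have := @bernoulli (- x) b; rewrite mulrN xb; apply; lra.
have h2 : ((1 + x) * (1 - x)) ^+ b <= 1 by apply: exprn_ile1; nra.
move: h2; rewrite exprMn => h2.
have y0 : 0 <= (1 + x) ^+ b by apply: exprn_ge0; lra.
set y := (1 + x) ^+ b in h2 y0 *.
have : y * (1 - delta) <= 1 by apply: le_trans h2; rewrite ler_wpM2l.
nra.
Qed.

(** By Bernoulli each factor is at most [1 + delta / b] to the power [f j], and these exponents add
    up to at most [b]. *)
Lemma pen_prod (b : nat) (f : nat -> nat) (s : seq nat) : (0 < b)%N ->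
  (\sum_(j <- s) f j <= b)%N ->
  \prod_(j <- s) (1 + delta * (f j)%:R / b%:R) <= 1 + 2 * delta.
Proof.
move=> b0 hs; have d0 := delta_ge0; apply: le_trans (pen_pow b0).
have bR : (0 : R) < b%:R by rewrite ltr0n.
have x0 : 0 <= delta / b%:R by rewrite divr_ge0 // ltW.
apply: le_trans (_ : (1 + delta / b%:R) ^+ (\sum_(j <- s) f j) <= _); last first.
  by apply: ler_weXn2l => //; lra.
rewrite expr_sum.
apply: ler_prod => j _; apply/andP; split.
  by rewrite addr_ge0 // divr_ge0 ?mulr_ge0.
have -> : delta * (f j)%:R / b%:R = (f j)%:R * (delta / b%:R) by rewrite mulrA [_ * delta]mulrC.
by apply: bernoulli; lra.
Qed.

(* AM-GM turns a bound on the product of the penalties of a path into a bound on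
   the sum of its multipliers. *)
Lemma pen_lower (b f : nat) : (0 < b)%N -> (f <= b)%N ->
  (1 + delta) ^+ f <= (1 + delta * f%:R / b%:R) ^+ b.
Proof.
move=> b0 fb; have d0 := delta_ge0; have bR : (0 : R) < b%:R by rewrite ltr0n.
(* AM-GM is applied to [b] numbers, of which [f] are [1 + delta] and the others are 1. *)
pose E (i : 'I_b) : R := if (i < f)%N then 1 + delta else 1.
have E0 : {in [set: 'I_b], forall i, 0 <= E i *+ #|[set: 'I_b]|}.
  by move=> i _; rewrite mulrn_wge0 // /E; case: ifP => _; lra.
have := leif_AGM_scaled E0; rewrite cardsT card_ord => -[+ _].
have sE (G : 'I_b -> R) : \prod_(i in [set: 'I_b]) G i = \prod_(i < b) G i.
  by apply: eq_bigl => i; rewrite inE.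
have sS : \sum_(i in [set: 'I_b]) E i = b%:R + delta * f%:R.
  have -> : \sum_(i in [set: 'I_b]) E i = \sum_(i < b) E i by apply: eq_bigl => i; rewrite inE.
  rewrite (eq_bigr (fun i : 'I_b => 1 + delta * (i < f)%N%:R)); last first.
    by move=> i _; rewrite /E; case: ifP => _; rewrite ?mulr1 ?mulr0 ?addr0.
  rewrite big_split /= sumr_const card_ord -mulr_sumr; congr (_ + _ * _).
  rewrite -natr_sum; congr _%:R.
  rewrite -big_mkcond /= sum1_card -[RHS](card_ord f) -sum1_card -[RHS]sum1_card.
  by rewrite (big_ord_widen _ (fun=> 1%N) fb).
have sP : \prod_(i in [set: 'I_b]) (E i *+ b) = (1 + delta) ^+ f * b%:R ^+ b.
  rewrite sE (eq_bigr (fun i => E i * b%:R)); last by move=> i _; rewrite mulr_natr.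
  rewrite big_split /= prodr_const card_ord; congr (_ * _).
  rewrite -big_mkcond /= -(big_ord_widen _ (fun=> 1 + delta) fb) /=.
  by rewrite prodr_const card_ord.
rewrite sP sS => h.
rewrite -(ler_pM2r (_ : 0 < b%:R ^+ b)) ?exprn_gt0 // (le_trans h) // -exprMn mulrDl mul1r divfK //.
by rewrite gt_eqF.
Qed.
End Penalties.

(** * Approximation guarantee *)

Section Trace.
Context {R : realFieldType}.
Variables (n m L N s : nat) (idf tl hd : nat -> nat) (wt : nat -> R) (valid : pred nat).
Variables (delta ts M : R).
Variables (D : nat -> nat -> R) (S : nat -> nat -> nat -> bool).
Variables (mu : nat -> nat -> nat) (Th top : nat -> nat).

Notation kap := (kap m idf).
Notation ev := (ev m idf).
Notation full := (full m idf).

Definition arrived t j := j \in [seq idf i | i <- iota 0 t].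
(** The lowest level whose period exceeds the guess. The levels below it follow the clock [Th], the
    others follow [t]. *)
Definition qlev t := (kap t).+1.
Definition aligned t := (2 ^ qlev t %| t)%N.
(** The next multiple of the rebuild period plus the tolerance: a near arrival before that rebuild
    cannot have a larger id. A low level uses the period of [qlev t], because every aligned time
    rebuilds all low levels. *)
Definition hibound a t :=
  ((t %/ 2 ^ maxn a (qlev t)).+1 * 2 ^ maxn a (qlev t) + 2 ^ kap t)%N.
Definition cand a t j := [&& j < m, valid j, t <= j + 2 ^ kap t & j <= hibound a t]%N.
(** Both divisibility of [t] by [2 ^ c] and the crossing of a multiple of [2 ^ c] by the clock pass
    to smaller [c], so the levels that are due are exactly those below [top t]. *)
Definition rb t c :=
  if full t then true else if aligned t then (2 ^ c %| t)%N
  else (c < qlev t)%N && (Th t %/ 2 ^ c != (Th t + mu t (idf t)) %/ 2 ^ c)%N.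
Definition theta a t : R := if (a < qlev t)%N then ts else 1 + delta.
Definition usable (muc : nat -> nat) a t j :=
  arrived t.+1 j || (cand a t j && ((a < qlev t)%N ==> (muc j < 2 ^ a)%N)).
Definition pen (muc : nat -> nat) a t j : R :=
  if (a < qlev t)%N && ~~ arrived t.+1 j then 1 + delta * (muc j)%:R / (2 ^ a)%:R else 1.

(** The interface between the analysis and the program: what follows in this section speaks of this
    record and not of machine states. [S t.+1 a] and [D t.+1] are the lists and distances after
    arrival [t], and [valid] marks the predicted edges of admissible weight. *)
Record trace_ok : Prop := TraceOk {
  tr_delta_gt0 : 0 < delta;
  tr_delta_le : delta <= 1 / 2;
  tr_ts_ge1 : 1 <= ts;
  tr_L_gt0 : (0 < L)%N;
  tr_q_lt : forall t, (t < m)%N -> (qlev t < L)%N;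
  tr_idf_inj : {in [pred t | t < m]%N &, injective idf};
  tr_idf_wt : forall t, (t < m)%N -> 1 <= wt (idf t);
  tr_valid_wt : forall j, valid j -> 1 <= wt j;
  tr_idf_valid : forall t, (t < m)%N -> (idf t < m)%N -> valid (idf t);
  tr_topP : forall t c, (t < m)%N -> (c < L)%N -> rb t c = (c < top t)%N;
  tr_top_le : forall t, (t < m)%N -> (0 < top t <= L)%N;
  tr_ThS : forall t, (t < m)%N ->
  Th t.+1 = (if full t || aligned t then 0 else Th t + mu t (idf t))%N;
  tr_mu_mono : forall t j, (t < m)%N -> (mu t j <= mu t.+1 j)%N;
  tr_S_keep : forall t a v, (t < m)%N -> (0 < a < L)%N -> ~~ rb t a ->
  S t.+1 a v = S t a v;
  tr_S_keepL : forall t v, (t < m)%N -> ~~ full t -> S t.+1 L v = S t L v;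
  tr_S_nest : forall t a v, (t < m)%N -> (0 < a < L)%N -> S t.+1 a v -> S t.+1 a.+1 v;
  tr_S_top : forall t j, (t < m)%N -> arrived t.+1 j -> S t.+1 L (hd j);
  tr_D_s : forall t, (t <= m)%N -> D t s = 0;
  tr_D_ge0 : forall t v, (t <= m)%N -> 0 <= D t v <= M;
  tr_D_init : forall v, v != s -> D 0%N v = M;
  tr_D_le : forall t v, (t < m)%N -> D t.+1 v <= D t v;
  tr_D_out : forall t v, (t < m)%N -> ~~ S t.+1 (top t) v -> D t.+1 v = D t v;
  tr_D_relax : forall t j, (t < m)%N -> arrived t.+1 j -> S t.+1 (top t) (hd j) ->
  D t.+1 (hd j) <= D t.+1 (tl j) + wt j;
  tr_D_sup : forall t v, (t < m)%N -> D t.+1 v < D t v ->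
  exists j, [/\ arrived t.+1 j, hd j = v & D t.+1 v = D t.+1 (tl j) + wt j];
  (* Vertices outside S_a are certified for every set of edges that may arrive
     before level a is rebuilt. *)
  tr_cert : forall t a, (t < m)%N -> (0 < a < top t)%N -> exists muc,
  (forall j, (muc j <= mu t.+1 j)%N) /\
  forall u p v, ipath tl hd (usable muc a t) u p v ->
    all (fun j => S t.+1 a.+1 (hd j)) p -> ~~ S t.+1 a v ->
    D t.+1 v <= theta a t * (\prod_(j <- p) pen muc a t j) * (D t.+1 u + plen wt p);
  tr_M_pow : M <= 2 ^+ N
}.

Hypothesis tok : trace_ok.

Definition delta_gt0 := tr_delta_gt0 tok.
Definition delta_le := tr_delta_le tok.
Definition ts_ge1 := tr_ts_ge1 tok.
Definition L_gt0 := tr_L_gt0 tok.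
Definition q_lt := tr_q_lt tok.
Definition idf_inj := tr_idf_inj tok.
Definition idf_wt := tr_idf_wt tok.
Definition valid_wt := tr_valid_wt tok.
Definition idf_valid := tr_idf_valid tok.
Definition topP := tr_topP tok.
Definition top_le := tr_top_le tok.
Definition ThS := tr_ThS tok.
Definition mu_mono := tr_mu_mono tok.
Definition S_keep := tr_S_keep tok.
Definition S_keepL := tr_S_keepL tok.
Definition S_nest := tr_S_nest tok.
Definition S_top := tr_S_top tok.
Definition D_s := tr_D_s tok.
Definition D_ge0 := tr_D_ge0 tok.
Definition D_init := tr_D_init tok.
Definition D_le := tr_D_le tok.
Definition D_out := tr_D_out tok.
Definition D_relax := tr_D_relax tok.
Definition D_sup := tr_D_sup tok.
Definition cert := tr_cert tok.
Definition M_pow := tr_M_pow tok.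

Lemma arrivedP t j : arrived t j -> exists2 i, (i < t)%N & idf i = j.
Proof. by move=> /mapP[i]; rewrite mem_iota => h ->; exists i. Qed.

Lemma arrived_idf t i : (i < t)%N -> arrived t (idf i).
Proof. by move=> h; apply: map_f; rewrite mem_iota. Qed.

Lemma arrivedW t t' j : (t <= t')%N -> arrived t j -> arrived t' j.
Proof. by move=> h /arrivedP[i hi <-]; apply: arrived_idf; lia. Qed.

Lemma arrived_wt t j : (t <= m)%N -> arrived t j -> 1 <= wt j.
Proof. by move=> h /arrivedP[i hi <-]; apply: idf_wt; lia. Qed.

Lemma D_mono t t' v : (t <= t' <= m)%N -> D t' v <= D t v.
Proof.
move=> /andP[/subnK <-]; elim: (t' - t)%N => // k IH; rewrite addSn => h.
by apply: le_trans (D_le v h) (IH (ltnW h)).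
Qed.

Lemma kap_keep t : ~~ full t -> kap t = kap t.-1.
Proof.
rewrite /full negb_or => /andP[e t0]; rewrite /kap0 kcS e.
by case: t t0 {e}.
Qed.

Lemma rb_full t c : full t -> rb t c.
Proof. by rewrite /rb => ->. Qed.

Lemma rb_down t a b : (t < m)%N -> (a <= b < L)%N -> rb t b -> rb t a.
Proof. by move=> ht hab; rewrite !topP //; lia. Qed.

Lemma last_rb t a : (t < m)%N -> exists l, [/\ (l <= t)%N, rb l a &
  forall t', (l < t' <= t)%N -> ~~ rb t' a].
Proof.
elim: t => [|t IH] ht.
  by exists 0%N; split=> //; [apply: rb_full; rewrite /full0 eqxx orbT|lia].
have [h|h] := boolP (rb t.+1 a); first by exists t.+1; split=> //; lia.
have [l [h1 h2 h3]] := IH (ltnW ht); exists l; split=> //; first by lia.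
move=> t' ht'; have [->//|ne] := eqVneq t' t.+1; apply: h3; lia.
Qed.

Lemma S_nestW t' b c v : (t' < m)%N -> (0 < b <= c)%N -> (c <= L)%N ->
  S t'.+1 b v -> S t'.+1 c v.
Proof.
move=> h1 /andP[b0 /subnK <-]; elim: (c - b)%N => // k IH hk hS.
by rewrite addSn; apply: S_nest => //; [lia|apply: IH => //; lia].
Qed.

Section Since.
Variables (l t a : nat).
Hypotheses (ht : (t < m)%N) (lt : (l <= t)%N) (ha : (0 < a < L)%N).
Hypothesis nrb : forall t', (l < t' <= t)%N -> ~~ rb t' a.

Lemma since_full t' : (l < t' <= t)%N -> ~~ full t'.
Proof. by move=> h; apply: contra (nrb h) => /rb_full. Qed.

Lemma since_kap t' : (l <= t' <= t)%N -> kap t' = kap l.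
Proof.
move=> /andP[/subnK <-]; elim: (t' - l)%N => // k IH h.
rewrite kap_keep; last by apply: since_full; lia.
by rewrite addSn /= IH //; lia.
Qed.

Lemma since_S b v : (a <= b <= L)%N -> S t.+1 b v = S l.+1 b v.
Proof.
move=> hb; have h : (l <= t <= t)%N by lia.
have : forall t', (l <= t' <= t)%N -> S t'.+1 b v = S l.+1 b v; last exact.
move=> t' /andP[/subnK <-]; elim: (t' - l)%N => // k IH hk.
rewrite addSn -(IH _); last by lia.
have nr : ~~ rb (k + l).+1 a by apply: nrb; lia.
have [->|bL] := eqVneq b L.
  by apply: S_keepL; [lia|apply: since_full; lia].
by apply: S_keep; [lia|lia|apply: contra nr; apply: rb_down; lia].
Qed.

Lemma since_D v : ~~ S l.+1 a v -> D t.+1 v = D l.+1 v.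
Proof.
move=> nS.
have : forall t', (l <= t' <= t)%N -> D t'.+1 v = D l.+1 v; last by apply; lia.
move=> t' /andP[/subnK <-]; elim: (t' - l)%N => // k IH hk.
rewrite addSn -(IH _); last by lia.
have hk' : ((k + l).+1 < m)%N by lia.
apply: D_out => //; apply: contra nS => h.
have hr : ~~ rb (k + l).+1 a by apply: nrb; lia.
have htop : (top (k + l).+1 <= a)%N by move: hr; rewrite topP //; lia.
have htp := top_le hk'.
have hS : S (k + l).+2 a v by apply: S_nestW h; lia.
suff <- : S (k + l).+2 a v = S l.+1 a v by [].
have -> : (k + l).+2 = (k.+1 + l).+1 by [].
elim: (k.+1) (hk) => // i IHi hi.
rewrite addSn -IHi; last by lia.
by apply: S_keep; [lia|lia|apply: nrb; lia].
Qed.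

Lemma since_near t' : (l < t' <= t)%N -> [/\ (idf t' < m)%N, (idf t' <= t' + 2 ^ kap l)%N &
  (t' <= idf t' + 2 ^ kap l)%N].
Proof.
move=> h; have := since_full h; rewrite /full0 negb_or => /andP[/ev_kap + _].
by rewrite since_kap ?/near; [case/and3P|lia].
Qed.

Lemma since_block P' t' : (l < t' <= t)%N -> (2 ^ a %| P')%N -> 
  (forall t', (l < t' <= t)%N -> ~~ (P' %| t')%N) -> (0 < P')%N -> (t' < (l %/ P').+1 * P')%N.
Proof.
move=> h _ hP P0; rewrite ltnNge; apply/negP => hle.
have hl := ltn_ceil l P0.
by have /negP := hP ((l %/ P').+1 * P')%N ltac:(lia); apply; rewrite dvdn_mull.
Qed.

(** An arrival since the rebuild is near, for otherwise everything would have been rebuilt. Moreover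
    no multiple of the period lies in between, as level [a] would have been rebuilt there; this
    bounds the id from above. *)
Lemma since_cand t' : (l < t' <= t)%N -> cand a l (idf t').
Proof.
move=> h; have [h1 h2 h3] := since_near h.
apply/and4P; split=> //; [by apply: idf_valid => //; lia|by lia|].
rewrite /hibound; set P' := (2 ^ maxn a (qlev l))%N.
have P0 : (0 < P')%N by rewrite expn_gt0.
suff : (t' < (l %/ P').+1 * P')%N by lia.
apply: since_block h _ _ P0; first by rewrite dvdn_exp2l // leq_maxl.
move=> t2 h2'; apply/negP => hd2.
have nr := nrb h2'; have nf := since_full h2'.
have q2 : qlev t2 = qlev l by rewrite /qlev since_kap //; lia.
have al : aligned t2.
  by rewrite /aligned q2; apply: dvdn_trans hd2; rewrite dvdn_exp2l // leq_maxr.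
move: nr; rewrite /rb (negPf nf) al => /negP; apply.
by apply: dvdn_trans hd2; rewrite dvdn_exp2l // leq_maxl.
Qed.

Lemma since_Th : (a < qlev l)%N -> forall t', (l <= t' <= t)%N ->
  Th t'.+1 = (Th l.+1 + \sum_(l.+1 <= i < t'.+1) mu i (idf i))%N /\
  (Th t'.+1 %/ 2 ^ a = Th l.+1 %/ 2 ^ a)%N.
Proof.
move=> haq t' /andP[/subnK <-]; elim: (t' - l)%N => [|k IH] hk.
  by rewrite add0n big_geq // addn0.
have [e1 e2] : Th (k + l).+1 = (Th l.+1 + \sum_(l.+1 <= i < (k + l).+1) mu i (idf i))%N /\
  (Th (k + l).+1 %/ 2 ^ a = Th l.+1 %/ 2 ^ a)%N by apply: IH; lia.
have hk' : (l < (k + l).+1 <= t)%N by lia.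
have nf := since_full hk'; have nr := nrb hk'.
have q2 : qlev (k + l).+1 = qlev l by rewrite /qlev since_kap //; lia.
have nal : ~~ aligned (k + l).+1.
  apply: contra nr => al; rewrite /rb (negPf nf) al.
  by apply: dvdn_trans al; rewrite dvdn_exp2l // q2; lia.
move: nr; rewrite /rb (negPf nf) (negPf nal) q2 haq /= negbK => /eqP e3.
rewrite addSn ThS; last by lia.
rewrite (negPf nf) (negPf nal) /= -e3 e2; split=> //.
by rewrite e1 [in RHS]big_nat_recr /= ?addnA //; lia.
Qed.

(** The multipliers at the arrivals add up to the advance of the clock, which is below [2 ^ a]
    because no multiple of [2 ^ a] was crossed. Multipliers only grow, so those frozen at the
    rebuild are smaller still. *)
Lemma since_pen muc p : (a < qlev l)%N -> (forall j, (muc j <= mu l.+1 j)%N) ->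
  uniq p -> all (arrived t.+1) p ->
  (forall j, j \in p -> ~~ arrived l.+1 j -> (muc j < 2 ^ a)%N) /\
  \prod_(j <- p) pen muc a l j <= 1 + 2 * delta.
Proof.
move=> haq hmuc up /allP hp.
have [eT eB] := since_Th haq (ltac:(lia) : (l <= t <= t)%N).
have b0 : (0 < 2 ^ a)%N by rewrite expn_gt0.
set sm := (\sum_(l.+1 <= i < t.+1) mu i (idf i))%N in eT.
have smb : (sm < 2 ^ a)%N.
  by have := ltn_ceil (Th l.+1) b0; have := leq_trunc_div (Th t.+1) (2 ^ a); rewrite eB eT; lia.
have mu_monoW i i' j : (i <= i' <= m)%N -> (mu i j <= mu i' j)%N.
  move=> /andP[/subnK <-]; elim: (i' - i)%N => // k IH h.
  by apply: leq_trans (IH _) _; [lia|rewrite addSn; apply: mu_mono; lia].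
have arr j : j \in p -> ~~ arrived l.+1 j -> exists2 i, (l < i <= t)%N & idf i = j.
  move=> /hp /arrivedP[i hi ei] na; exists i => //; rewrite andbC -ltnS hi /= ltnNge.
  by apply: contra na => hil; rewrite -ei; apply: arrived_idf; lia.
pose p' := [seq j <- p | ~~ arrived l.+1 j].
have sub : {subset p' <= [seq idf i | i <- index_iota l.+1 t.+1]}.
  move=> j; rewrite mem_filter => /andP[na /arr /(_ na) [i hi <-]].
  by apply: map_f; rewrite mem_index_iota.
pose g j := (\sum_(l.+1 <= i < t.+1 | idf i == j) mu i j)%N.
have mug j : j \in p' -> (muc j <= g j)%N.
  rewrite mem_filter => /andP[na /arr /(_ na) [i hi ei]]; rewrite /g.
  rewrite big_mkcond (bigD1_seq i) ?mem_index_iota ?iota_uniq //= ei eqxx.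
  apply: leq_trans (hmuc j) (leq_trans (mu_monoW _ i j _) (leq_addr _ _)); lia.
have sum_le : (\sum_(j <- p') muc j <= sm)%N.
  apply: leq_trans (_ : \sum_(j <- p') g j <= _)%N.
    by rewrite big_seq [X in (_ <= X)%N]big_seq; apply: leq_sum.
  apply: leq_trans (uniq_sum_sub g _ sub) _; first by rewrite filter_uniq.
  rewrite big_map /sm big_seq [X in (_ <= X)%N]big_seq.
  apply: leq_sum => i; rewrite mem_index_iota => hi.
  rewrite /g big_mkcond (bigD1_seq i) ?mem_index_iota ?iota_uniq //= eqxx.
  rewrite big_seq_cond big1 ?addn0 // => i' /andP[]; rewrite mem_index_iota => hi' ne.
  by case: eqP => // /idf_inj e; move: ne; rewrite e ?eqxx // inE; lia.
split.
  move=> j jp na; apply: leq_ltn_trans smb; apply: leq_trans sum_le.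
  rewrite (bigD1_seq j) ?filter_uniq //= ?leq_addr //.
  by rewrite mem_filter na jp.
have -> : \prod_(j <- p) pen muc a l j =
    \prod_(j <- p') (1 + delta * (muc j)%:R / (2 ^ a)%:R).
  rewrite big_filter [RHS]big_mkcond /=; apply: eq_bigr => j _.
  by rewrite /pen haq.
apply: pen_prod => //; [exact: ltW delta_gt0|exact: delta_le|exact: leq_trans sum_le (ltnW smb)].
Qed.

End Since.

Definition e1 : R := 1 + 2 * delta.
(** The accumulated error outside [S_a]: one factor [1 + delta] for each high level from [a] on, and
    for each low level from [a] on the threshold [ts] times the bound [e1] on the penalties. *)
Definition er t a : R :=
  (1 + delta) ^+ (L - maxn a (qlev t)) * (ts * e1) ^+ (qlev t - a).

Lemma er_ge1 t a : 1 <= er t a.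
Proof.
have d0 := delta_gt0; have t1 := ts_ge1.
by rewrite /er mulr_ege1 // exprn_ege1 //; [lra|rewrite mulr_ege1 // /e1; lra].
Qed.

Lemma er_step t a : (a < L)%N -> (qlev t < L)%N ->
  er t a = theta a t * (if (a < qlev t)%N then e1 else 1) * er t a.+1.
Proof.
move=> haL hq; rewrite /er /theta; case: ifP => h.
  have -> : maxn a (qlev t) = qlev t by lia.
  have -> : maxn a.+1 (qlev t) = qlev t by lia.
  have -> : (qlev t - a = (qlev t - a.+1).+1)%N by lia.
  by rewrite exprS; ring.
have -> : maxn a (qlev t) = a by lia.
have -> : maxn a.+1 (qlev t) = a.+1 by lia.
have -> : (qlev t - a = 0)%N by lia.
have -> : (qlev t - a.+1 = 0)%N by lia.
have -> : (L - a = (L - a.+1).+1)%N by lia.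
by rewrite exprS; ring.
Qed.

(** Induction from level [L] downwards; a vertex outside [S_L] has no arrived in-edge. A vertex
    outside [S_a] but inside [S_(a+1)] has kept its distance since the last rebuild [l] of level
    [a]. The path is cut at its last vertex [w] outside [S_(a+1)]: the induction hypothesis covers
    the part up to [w], and the certificate issued at [l] covers the rest, whose edges had arrived
    or were candidates then. *)
Lemma approx_out t a v p : (t < m)%N -> (0 < a <= L)%N -> ~~ S t.+1 a v ->
  ipath tl hd (arrived t.+1) s p v -> D t.+1 v <= er t a * plen wt p.
Proof.
move=> ht /andP[a0 aL]; have d0 := delta_gt0.
have wts j : arrived t.+1 j -> 1 <= wt j by apply: arrived_wt.
move: (erefl (L - a)%N) a0 aL; move: {2}(L - a)%N => k.
elim: k a v p => [|k IH] a v p ek a0 aL nS hp.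
  have eaL : a = L by lia.
  case/lastP: p hp => [|p j] hp.
    by move: hp => /= /eqP <-; rewrite D_s // plen_nil mulr0.
  have [hv aj] : hd j = v /\ arrived t.+1 j.
    elim: (p) s hp => [|i p' IHp] u /=; last by move=> /and3P[_ _ /IHp].
    by move=> /and3P[-> _ /eqP].
  by move: nS; rewrite eaL -hv S_top.
have haL : (0 < a < L)%N by lia.
have k1 : (L - a.+1)%N = k by lia.
have a1L : (a.+1 <= L)%N by lia.
have hq := q_lt ht.
have [nS1|S1] := boolP (~~ S t.+1 a.+1 v).
  apply: le_trans (IH a.+1 v p k1 isT a1L nS1 hp) _.
  have pl : 0 <= plen wt p by apply: plen_ge0 (ipath_all hp).
  rewrite ler_wpM2r // [X in _ <= X]er_step //.
  have e0 := er_ge1 t a.+1; have t1 := ts_ge1.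
  rewrite -{1}[er t a.+1]mul1r ler_wpM2r //; first by lra.
  by rewrite mulr_ege1 // /theta ?/e1; case: ifP => _; lra.
have [l [hlt hrl hl]] := last_rb a ht.
have hlm : (l < m)%N by exact: leq_ltn_trans hlt ht.
have htop : (0 < a < top l)%N by rewrite -topP ?hrl; lia.
have ql : qlev l = qlev t by rewrite /qlev (since_kap ht hlt haL hl) // hlt leqnn.
have Sa1 x : S t.+1 a.+1 x = S l.+1 a.+1 x by apply: (since_S ht hlt haL hl); lia.
have Sa x : S t.+1 a x = S l.+1 a x by apply: (since_S ht hlt haL hl); lia.
have l1m : (l.+1 <= m)%N by [].
have [muc [hmuc hcert]] := cert hlm htop.
(* The bound on the product of the penalties needs distinct edges. *)
have [p0 [hp0 up0 _ le0]] := ipath_simple wts hp.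
have up0' : uniq p0 by apply: map_uniq up0.
apply: le_trans (_ : er t a * plen wt p0 <= _); last first.
  by rewrite ler_wpM2l //; have := er_ge1 t a; lra.
have [p1 [w [p2 [ep hp1 hp2 hS2 hw]]]] := ipath_split (S t.+1 a.+1) hp0.
have Dw : D t.+1 w <= er t a.+1 * plen wt p1.
  case: hw => [nSw|[-> ->]]; first by apply: (IH a.+1 w p1 k1 isT a1L nSw hp1).
  by rewrite D_s // plen_nil mulr0.
have pl2 : 0 <= plen wt p2 by apply: plen_ge0 (ipath_all hp2).
have up2 : uniq p2 by move: up0'; rewrite ep cat_uniq => /and3P[].
have hpen : \prod_(j <- p2) pen muc a l j <= (if (a < qlev t)%N then e1 else 1).
  case: ifP => haq; last first.
    by rewrite big1 // => j _; rewrite /pen ql haq.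
  have [] := since_pen ht hlt haL hl _ hmuc up2 (ipath_all hp2) => //; by rewrite ql.
have hus j : j \in p2 -> arrived t.+1 j -> usable muc a l j.
  move=> jp aj; rewrite /usable; have [//|na] := boolP (arrived l.+1 j).
  have [i hi ei] := arrivedP aj.
  have hli : (l < i <= t)%N.
    rewrite andbC -ltnS hi ltnNge; apply: contra na => h; by rewrite -ei; apply: arrived_idf.
  rewrite -ei (since_cand ht hlt haL hl hli) /=; apply/implyP => haq.
  have [+ _] := since_pen ht hlt haL hl haq hmuc up2 (ipath_all hp2); apply; rewrite ?ei //.
have hc := hcert w p2 v (ipath_sub hus hp2).
have Dv : D t.+1 v = D l.+1 v by apply: (since_D ht hlt haL hl); rewrite -Sa.
have Dwl : D l.+1 w = D t.+1 w \/ D t.+1 w = 0.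
  case: hw => [nSw|[_ ->]]; last by right; rewrite D_s.
  left; symmetry; apply: (since_D ht hlt haL hl); apply: contra nSw; rewrite -Sa => h.
  by apply: S_nest h.
have Dw' : D l.+1 w <= er t a.+1 * plen wt p1.
  case: Dwl => [->//|e]; case: hw => [nSw|[e1' e2']].
    suff -> : D l.+1 w = D t.+1 w by [].
    symmetry; apply: (since_D ht hlt haL hl); apply: contra nSw; rewrite -Sa => h.
    by apply: S_nest h.
  by rewrite e2' D_s ?e1' ?plen_nil ?mulr0.
rewrite Dv; apply: le_trans (hc _ _) _.
- by apply: sub_all hS2 => j; rewrite Sa1.
- by rewrite -Sa.
have e0 := er_ge1 t a.+1; have t1 := ts_ge1.
have pl1 : 0 <= plen wt p1 by apply: plen_ge0 (ipath_all hp1).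
rewrite ep plen_cat (@er_step t a (proj2 (andP haL)) hq).
have -> : theta a l = theta a t by rewrite /theta ql.
have th1 : 1 <= theta a t by rewrite /theta; case: ifP => _; lra.
have /andP[Dw0 _] : 0 <= D l.+1 w <= M by apply: D_ge0.
have X0 : 0 <= D l.+1 w + plen wt p2 by rewrite addr_ge0.
have hX : D l.+1 w + plen wt p2 <= er t a.+1 * (plen wt p1 + plen wt p2) by nra.
move: hX hpen X0 th1; move: (er t a.+1) (theta a t) (\prod_(j <- p2) _) (D l.+1 w + _) => E th pr X.
set i1 := (if _ then _ else _); have i1_ge1 : 1 <= i1 by rewrite /i1 /e1; case: ifP => _; lra.
move=> hX hpen X0 th1; rewrite -!mulrA ler_wpM2l //; first by lra.
apply: le_trans (_ : i1 * X <= _); first by rewrite ler_wpM2r.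
by rewrite ler_wpM2l //; lra.
Qed.

(* Right after a relaxation every distance has the accuracy of the vertices
   outside S_top. *)
Lemma approx_top t v p : (t < m)%N -> ipath tl hd (arrived t.+1) s p v ->
  D t.+1 v <= er t (top t) * plen wt p.
Proof.
move=> ht hp; have htop := top_le ht.
have [p1 [w [p2 [ep hp1 hp2 hS2 hw]]]] := ipath_split (S t.+1 (top t)) hp.
have e0 := er_ge1 t (top t).
have Dw : D t.+1 w <= er t (top t) * plen wt p1.
  case: hw => [nSw|[-> ->]]; first by apply: approx_out.
  by rewrite D_s // plen_nil mulr0.
have pl2 : 0 <= plen wt p2.
  by apply: plen_ge0 (ipath_all hp2) => j; apply: arrived_wt.
have : D t.+1 v <= D t.+1 w + plen wt p2.
  elim: p2 (w) hp2 hS2 {ep pl2} => [|j p' IHp] x /=.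
    by move=> /eqP <- _; rewrite plen_nil addr0.
  move=> /and3P[aj /eqP <- /IHp h] /andP[Sj /h h'].
  by apply: le_trans h' _; rewrite plen_cons addrA lerD2r; apply: D_relax.
by rewrite ep plen_cat; nra.
Qed.

(** A value below [M] is never smaller than the length of some arrived path. The inner induction
    follows supporting edges backwards: weights are at least 1, so an integer bound [k] on the
    distance decreases with every edge, and [M_pow] provides an initial one. *)
Lemma D_path t v : (t <= m)%N -> D t v < M ->
  exists2 p, ipath tl hd (arrived t) s p v & plen wt p <= D t v.
Proof.
elim: t v => [|t IH] v ht hv.
  have [->|ne] := eqVneq v s; first by exists [::]; rewrite //= plen_nil; have /andP[] := D_ge0 s ht.
  by move: hv; rewrite D_init // ltxx.
have : exists k, D t.+1 v <= k%:R.
  by exists (2 ^ N)%N; rewrite natrX; apply: le_trans (ltW hv) M_pow.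
case=> k; elim: k v hv => [|k IHk] v hv hk.
all: have := D_le v ht; rewrite le_eqVlt => /orP[/eqP e|lt];
  first (have [|p h1 h2] := IH v (ltnW ht); [by rewrite -e|exists p; [|by rewrite e]];
    apply: ipath_sub h1 => j _; apply: arrivedW; lia).
all: have [j [aj hj eD]] := D_sup ht lt; have w1 := arrived_wt ht aj.
  by have /andP[] := D_ge0 (tl j) ht; move: hk; rewrite eD; lra.
have [|//|p h1 h2] := IHk (tl j).
- by move: hv; rewrite eD; lra.
- by move: hk; rewrite eD -natr1; lra.
exists (rcons p j); last by rewrite -cats1 plen_cat plen_cons plen_nil eD addr0 lerD2r.
rewrite -cats1; apply: ipath_cat h1 _; by rewrite /= aj hj !eqxx.
Qed.

Lemma D_ge1 t v : (t <= m)%N -> v != s -> 1 <= M -> 1 <= D t v.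
Proof.
move=> ht ne M1; have /andP[_] := D_ge0 v ht; rewrite le_eqVlt => /orP[/eqP -> //|lt].
have [[|j p] /= hp hl] := D_path ht lt; first by move: hp ne => /eqP <-; rewrite eqxx.
move: hp => /and3P[aj _ hp]; apply: le_trans hl; rewrite plen_cons.
have := arrived_wt ht aj; have := plen_ge0 (fun j => @arrived_wt t j ht) (ipath_all hp); lra.
Qed.

(** * Amortized cost *)

Local Ltac qlia := repeat match goal with
  | H : is_true (dvdn _ _) |- _ => clear H
  | H : is_true (~~ dvdn _ _) |- _ => clear H
  | H : is_true (Order.le _ _) |- _ => clear H
  | H : is_true (Order.lt _ _) |- _ => clear H
  | H : forall _, _ |- _ => clear H
  end; lia.

Variables (dg : nat -> nat -> nat) (dgm : nat -> nat) (W4 PM Cb : nat).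
Variables (psi chi : nat -> nat -> nat).

(** The degree sum of a list measures the time of Dijkstra's algorithm on it up to logarithmic
    factors. [Wm] uses degrees that do not depend on time, so that the same list has the same weight
    at different times. *)
Definition W t a := (\sum_(v < n | S t.+1 a v) dg t v)%N.
Definition Wm t a := (\sum_(v < n | S t.+1 a v) dgm v)%N.
Definition sublevels t := minn (top t) (qlev t).
Definition alarmW t := (\sum_(1 <= a < sublevels t) W t a)%N.

(** Two potentials account for blame. [psi] grows at least by the weight of the alarms blamed on an
    edge and is bounded by [PM], so an edge causes only so many false alarms. [chi] weighs blame by
    multipliers: it dominates the multipliers through [co_chi_mu] and is itself paid by the alarms
    through [co_chi_step]. *)
Record cost_ok : Prop := CostOk {
  co_dg_le : forall t v, (dg t v <= dgm v)%N;
  co_dg_keep : forall t v, (t.+1 < m)%N -> ~~ full t.+1 -> dg t.+1 v = dg t v;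
  co_dgm_sum : (\sum_(v < n) dgm v <= W4)%N;
  co_MN : M <= (1 + delta) ^+ N;
  co_N_gt0 : (0 < N)%N;
  co_M_ge1 : 1 <= M;
  co_ts_err : (1 + delta) ^+ L.+1 <= ts;
  co_mL : (m < 2 ^ L.-1)%N;
  co_psi_mono : forall t j, (t < m)%N -> (psi t j <= psi t.+1 j)%N;
  co_psi_max : forall t j, (t <= m)%N -> (psi t j <= PM)%N;
  co_chi_mu : forall t j, (t <= m)%N -> ((mu t j).-1 * Cb <= chi t j)%N;
  co_chi0 : forall j, chi 0%N j = 0%N;
  co_CbN : (W4 * N <= Cb)%N;
  co_alarm_up : forall t a v, (t < m)%N -> (qlev t <= a < top t)%N ->
  (v < n)%N -> S t.+1 a v -> exists u p,
  [/\ ipath tl hd (fun j => arrived t.+1 j || cand a t j) u p v,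
      all (fun j => S t.+1 a.+1 (hd j)) p &
      (1 + delta) * (D t.+1 u + plen wt p) < D t.+1 v];
  (* An alarm whose witness uses an edge of Z is paid by the blame of Z. *)
  co_alarm_sub : forall t (Z : pred nat), (t < m)%N ->
  exists X : nat -> nat -> bool,
  (\sum_(1 <= a < sublevels t) \sum_(v < n | S t.+1 a v && X a v) dg t v <=
     \sum_(j < m | Z j) (psi t.+1 j - psi t j))%N /\
  forall a v, (0 < a < sublevels t)%N -> (v < n)%N -> S t.+1 a v -> ~~ X a v ->
    exists u p, ipath tl hd (fun j => arrived t.+1 j || (cand a t j && ~~ Z j)) u p v /\
      ts * (D t.+1 u + plen wt p) < D t.+1 v;
  co_chi_step : forall t, (t < m)%N ->
  (\sum_(j < m) chi t.+1 j <= \sum_(j < m) chi t j +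
     N * \sum_(1 <= a < sublevels t) 2 ^ a * W t a)%N
}.

Hypothesis cok : cost_ok.

Definition dg_le := co_dg_le cok.
Definition dg_keep := co_dg_keep cok.
Definition dgm_sum := co_dgm_sum cok.
Definition MN := co_MN cok.
Definition N_gt0 := co_N_gt0 cok.
Definition M_ge1 := co_M_ge1 cok.
Definition ts_err := co_ts_err cok.
Definition mL := co_mL cok.
Definition psi_mono := co_psi_mono cok.
Definition psi_max := co_psi_max cok.
Definition chi_mu := co_chi_mu cok.
Definition chi0 := co_chi0 cok.
Definition CbN := co_CbN cok.
Definition alarm_up := co_alarm_up cok.
Definition alarm_sub := co_alarm_sub cok.
Definition chi_step := co_chi_step cok.

Lemma WWm t a : (W t a <= Wm t a)%N.
Proof. by apply: leq_sum => v _; apply: dg_le. Qed.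

Lemma Wm_le t a : (Wm t a <= W4)%N.
Proof.
apply: leq_trans dgm_sum; rewrite /Wm big_mkcond /=.
by apply: leq_sum => v _; case: ifP.
Qed.

Lemma W_le t a : (W t a <= W4)%N.
Proof. exact: leq_trans (WWm _ _) (Wm_le _ _). Qed.

Lemma usable_wt a t j : (t < m)%N -> arrived t.+1 j || cand a t j -> 1 <= wt j.
Proof.
by move=> ht /orP[/arrived_wt -> //|/and4P[_ /valid_wt]].
Qed.

Lemma telesc (f phi g : nat -> nat) t1 t2 : (t1 <= t2)%N ->
  (forall t, (t1 <= t < t2)%N -> f t + phi t.+1 <= phi t + g t)%N ->
  (\sum_(t1 <= t < t2) f t <= phi t1 + \sum_(t1 <= t < t2) g t)%N.
Proof.
move=> h12 h.
suff : (\sum_(t1 <= t < t2) f t + phi t2 <= phi t1 + \sum_(t1 <= t < t2) g t)%N by lia.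
elim: t2 h12 h => [|T IH]; first by rewrite leqn0 => /eqP -> _; rewrite !big_geq // addn0 add0n.
rewrite leq_eqVlt => /orP[/eqP <- _|lt h]; first by rewrite !big_geq // addn0 add0n.
rewrite !big_nat_recr //=.
have h1 := h T ltac:(lia).
have h2 := IH lt (fun t ht => h t ltac:(lia)).
move: h1 h2; set A := (\sum_(_ <= _ < _) _)%N; set B := (\sum_(_ <= _ < _) _)%N; lia.
Qed.

Lemma mult_count P a b lo h : (0 < P)%N ->
  (\sum_(a <= x < b) ((P %| x) && (lo <= x <= lo + h)) <= h %/ P + 2)%N.
Proof.
move=> P0; pose l := [seq x <- index_iota a b | (P %| x)%N && (lo <= x <= lo + h)%N].
have -> : (\sum_(a <= x < b) ((P %| x) && (lo <= x <= lo + h)))%N = size [seq (x %/ P)%N | x <- l].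
  rewrite size_map size_filter -sum1_count [RHS]big_mkcond /=.
  by apply: eq_bigr => x _; case: (_ && _).
rewrite -[X in (_ <= X)%N](size_iota (lo %/ P)); apply: uniq_leq_size.
  rewrite map_inj_in_uniq ?filter_uniq ?iota_uniq // => x y.
  rewrite !mem_filter => /andP[/andP[/divnK ex _] _] /andP[/andP[/divnK ey _] _] e.
  by rewrite -ex e ey.
move=> y /mapP[x]; rewrite mem_filter => /andP[/andP[_ /andP[h1 h2]] _] ->.
rewrite mem_iota leq_div2r //=.
have /leq_ltn_trans := leq_div2r P h2; apply; rewrite divnD //; case: (P <= _ + _)%N;
move: (lo %/ P)%N (h %/ P)%N => i1 i2; lia.
Qed.

Lemma sum_mult P a b (G : nat -> nat) : (0 < P)%N ->
  (\sum_(a <= x < b | P %| x) G x <= \sum_(i < b) G (i * P))%N.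
Proof.
move=> P0; rewrite -big_filter; set l := seq.filter _ _.
have -> : (\sum_(x <- l) G x = \sum_(i <- [seq (x %/ P)%N | x <- l]) G (i * P))%N.
  rewrite big_map; rewrite big_seq [RHS]big_seq; apply: eq_bigr => x.
  by rewrite mem_filter => /andP[/divnK -> _].
rewrite -(big_mkord xpredT (fun i => G (i * P)%N)); apply: uniq_sum_sub.
  rewrite map_inj_in_uniq ?filter_uniq ?iota_uniq // => x y.
  by rewrite !mem_filter => /andP[/divnK ex _] /andP[/divnK ey _] e; rewrite -ex e ey.
move=> y /mapP[x]; rewrite mem_filter !mem_index_iota => /andP[_ h] ->.
by rewrite /= (leq_ltn_trans (leq_div x P)) //; case/andP: h.
Qed.

(** * Cost of a phase in which the guess is constant *)

Section Phase.
Variables (t1 t2 k : nat).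
Hypotheses (t12 : (t1 < t2)%N) (t2m : (t2 <= m)%N).
Hypothesis hk : forall t, (t1 <= t < t2)%N -> kap t = k.
Hypothesis f1 : full t1.

Let K := (2 ^ k)%N.
Let q := k.+1.
Let F := (\sum_(t1 <= t < t2) full t)%N.

Lemma K_gt0 : (0 < K)%N. Proof. by rewrite expn_gt0. Qed.
Lemma q2K : (2 ^ q = 2 * K)%N. Proof. by rewrite expnS. Qed.
Lemma qE t : (t1 <= t < t2)%N -> qlev t = q. Proof. by move=> h; rewrite /qlev hk. Qed.
Lemma F_le : (F <= K + 1)%N. Proof. exact: full_count. Qed.
Lemma qL : (q < L)%N. Proof. by rewrite -(@qE t1) ?q_lt //; lia. Qed.

Definition overdue j := [&& j < m, t1 <= j + K, j + K < t2 & ~~ arrived (j + K).+1 j]%N.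

Lemma overdue_le T : (\sum_(j < T) overdue j <= 4 * K + 1)%N.
Proof.
apply: (overdue_count t12 hk).
- by move=> x y; rewrite !inE => hx hy; apply: idf_inj; rewrite inE; lia.
- by move=> j /and4P[].
- move=> j t /and4P[_ _ _ na] ht e; rewrite ltnNge; apply: contra na => h.
  by rewrite -e; apply: arrived_idf; lia.
Qed.

Lemma not_overdue j : ~~ overdue j -> (j < m)%N -> (t1 <= j + K)%N -> (j + K < t2)%N ->
  arrived (j + K).+1 j.
Proof. by rewrite /overdue => h h1 h2 h3; move: h; rewrite h1 h2 h3 /= negbK. Qed.

(** What can invalidate the argument for a rebuild nearby: a full rebuild, an overdue edge, or an
    end of the phase. Times and ids are compared directly, since on time means at most [K] apart. *)
Definition cause x := [|| (t1 <= x < t2)%N && full x, overdue x, x == t1 | x == t2].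
Definition unclean c b := has (fun x => [&& cause x, b <= x + 3 * 2 ^ c & x <= b + 3 * 2 ^ c]%N)
  (iota 0 m.+1).

(** There are at most [(K + 1) + (4 * K + 1) + 2 <= 9 * K] causes, and each lies within [3 * 2 ^ c]
    of at most 8 multiples of [2 ^ c]. *)
Lemma unclean_count c : (\sum_(t1 <= b < t2) ((2 ^ c %| b) && unclean c b) <= 81 * K)%N.
Proof.
have P0 : (0 < 2 ^ c)%N by rewrite expn_gt0.
have nc : (\sum_(x < m.+1) cause x <= 9 * K)%N.
  apply: leq_trans (_ : (F + \sum_(x < m.+1) overdue x + \sum_(x < m.+1) ((x == t1 :> nat) + (x == t2 :> nat)) <= _))%N.
    have -> : F = (\sum_(x < m.+1) ((t1 <= x < t2) && full x))%N.
      rewrite /F big_nat_cond big_mkcond /=.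
      rewrite -(big_mkord xpredT (fun x => nat_of_bool ((t1 <= x < t2)%N && full x))).
      rewrite (@big_cat_nat _ _ _ t2 0) //=; last by lia.
      rewrite [X in (_ + X)%N]big_nat_cond [X in (_ + X)%N]big1 ?addn0; last first.
        by move=> i /andP[hi _]; rewrite (_ : (t1 <= i < t2)%N = false) //; lia.
      rewrite (@big_cat_nat _ _ _ t1 0) //=; last by lia.
      rewrite [X in (X + _)%N]big_nat_cond [X in (X + _)%N]big1 ?add0n; last first.
        by move=> i /andP[hi _]; rewrite (_ : (t1 <= i < t2)%N = false) //; lia.
      apply: eq_big_nat => i hi; by rewrite hi.
    rewrite -!big_split /=; apply: leq_sum => x _; rewrite /cause.
    by case: (_ && _); case: (overdue x); case: (_ == t1); case: (_ == t2).
  have e1 y : (\sum_(x < m.+1) (x == y :> nat) <= 1)%N.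
    have [h|h] := ltnP y m.+1.
      rewrite (bigD1 (Ordinal h)) //= eqxx big1 // => i ne.
      by case: eqP => // e; move: ne; rewrite -val_eqE /= e eqxx.
    by rewrite big1 // => i _; case: eqP => // e; have := ltn_ord i; lia.
  rewrite big_split /=; have := overdue_le m.+1; have := e1 t1; have := e1 t2.
  have := F_le; have := K_gt0.
  by set x1 := (\sum_(_ < _) _)%N; set x2 := (\sum_(_ < _) _)%N; set x3 := (\sum_(_ < _) _)%N; lia.
have step b : (((2 ^ c %| b) && unclean c b) <=
   \sum_(x < m.+1) cause x * ((2 ^ c %| b) && ((x - 3 * 2 ^ c <= b) && (b <= (x - 3 * 2 ^ c) + 6 * 2 ^ c))))%N.
  case: (boolP (_ && _)) => // /andP[-> /hasP[x]].
  rewrite mem_iota => hx /and3P[cx h1 h2].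
  have hx' : (x < m.+1)%N by lia.
  rewrite (bigD1 (Ordinal hx')) //= cx.
  have -> : (x - 3 * 2 ^ c <= b)%N by lia.
  have -> : (b <= x - 3 * 2 ^ c + 6 * 2 ^ c)%N by lia.
  by lia.
apply: leq_trans (leq_sum _ (fun b _ => step b)) _.
rewrite exchange_big /=.
apply: leq_trans (_ : (\sum_(x < m.+1) cause x * 8 <= _))%N.
  apply: leq_sum => x _; rewrite -big_distrr /= leq_mul2l; apply/orP; right.
  by apply: leq_trans (mult_count _ _ _ _ P0) _; rewrite mulnK.
by rewrite -big_distrl /=; move: nc; set x1 := (\sum_(_ < _) _)%N; lia.
Qed.

Lemma cleanP c b x : ~~ unclean c b -> (x <= m)%N -> (b <= x + 3 * 2 ^ c)%N ->
  (x <= b + 3 * 2 ^ c)%N -> ~~ cause x.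
Proof.
move=> /hasPn h hx h1 h2; have := h x; rewrite mem_iota => /(_ ltac:(lia)).
by rewrite h1 h2 !andbT.
Qed.

Lemma clean_range c b : ~~ unclean c b -> (t1 <= b < t2)%N ->
  (t1 + 3 * 2 ^ c < b)%N /\ (b + 3 * 2 ^ c < t2)%N.
Proof.
move=> h hb; split; rewrite ltnNge; apply/negP => hc.
  have := @cleanP c b t1 h ltac:(lia) ltac:(lia) ltac:(lia).
  by rewrite /cause eqxx !orbT.
have := @cleanP c b t2 h t2m ltac:(lia) ltac:(lia).
by rewrite /cause eqxx !orbT.
Qed.

Lemma clean_full c b t : ~~ unclean c b -> (t1 <= b < t2)%N ->
  (b <= t + 3 * 2 ^ c)%N -> (t <= b + 3 * 2 ^ c)%N -> (t1 <= t < t2)%N /\ ~~ full t.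
Proof.
move=> h hb h1 h2; have [r1 r2] := clean_range h hb.
have ht : (t1 <= t < t2)%N by lia.
split=> //; have : ~~ cause t by apply: cleanP h _ h1 h2; lia.
by rewrite /cause ht negb_or /= => /andP[].
Qed.

Lemma clean_overdue c b j : ~~ unclean c b -> (j <= m)%N ->
  (b <= j + 3 * 2 ^ c)%N -> (j <= b + 3 * 2 ^ c)%N -> ~~ overdue j.
Proof.
move=> h hj h1 h2; have := cleanP h hj h1 h2.
by rewrite /cause !negb_or => /and4P[].
Qed.

Definition alpha c := (\sum_(t1 <= b < t2 | (2 ^ c %| b)%N) Wm b c)%N.

Lemma qc c : (q <= c)%N -> (2 * K <= 2 ^ c)%N.
Proof. by move=> h; rewrite -q2K leq_exp2l. Qed.

Lemma al_mult c b : (t1 <= b < t2)%N -> (q <= c)%N -> (2 ^ c %| b)%N -> aligned b.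
Proof. by move=> hb hc; apply: dvdn_trans; rewrite qE // dvdn_exp2l. Qed.

Lemma rb_mult c b : (t1 <= b < t2)%N -> (q <= c)%N -> (2 ^ c %| b)%N -> rb b c.
Proof. by move=> hb hc h; rewrite /rb (al_mult hb hc h) h; case: ifP. Qed.

Lemma nrb_mult c b : (t1 <= b < t2)%N -> (q <= c)%N -> ~~ full b -> ~~ (2 ^ c %| b)%N -> ~~ rb b c.
Proof.
move=> hb hc nf h; rewrite /rb (negPf nf); case: ifP => // _.
by rewrite qE // negb_and ltnNge hc.
Qed.

Lemma between_mult P b t : (0 < P)%N -> (P %| b)%N -> (b < t < b + P)%N -> ~~ (P %| t)%N.
Proof.
move=> P0 /dvdnP[x ->] h; apply/negP => /dvdnP[y e]; rewrite {}e in h.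
have /andP[h1 h2] := h; move: h1 h2; rewrite -mulSnr !ltn_pmul2r //; lia.
Qed.

(** The candidates on the witness path have ids at most [b + 2 ^ c + K]. Not being overdue, they
    arrive by [b + 2 ^ c + 2 * K], hence by [b + 2 ^ c.+1]. The relaxation at that time runs on a
    list that has not changed since [b] and contains [S_(c+1)], in which all heads of the path
    lie. *)
Lemma upper_drop c b v : (q <= c)%N -> (c.+1 < L)%N -> (t1 <= b < t2)%N ->
  (2 ^ c.+1 %| b)%N -> ~~ unclean c b -> (v < n)%N -> S b.+1 c v ->
  (b + 2 ^ c.+1 < t2)%N /\ (1 + delta) * D (b + 2 ^ c.+1).+1 v <= D b.+1 v.
Proof.
move=> hc hcL hb hdv hcl hv hS; have [r1 r2] := clean_range hcl hb.
have e2 : (2 ^ c.+1 = 2 * 2 ^ c)%N by rewrite expnS.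
have P0 : (0 < 2 ^ c)%N by rewrite expn_gt0.
have KC := qc hc.
set t' := (b + 2 ^ c.+1)%N; have ht' : (t1 <= t' < t2)%N by rewrite /t'; qlia.
split; first by qlia.
have bm : (b < m)%N by qlia.
have t'm : (t' < m)%N by qlia.
have hdc : (2 ^ c %| b)%N by apply: dvdn_trans hdv; rewrite dvdn_exp2l.
have ctop : (qlev b <= c < top b)%N.
  by rewrite qE // hc /= -topP //; [apply: rb_mult|qlia].
have [u [p [hp hall hlt]]] := alarm_up bm ctop hv hS.
have nf t : (b - 3 * 2 ^ c <= t <= b + 3 * 2 ^ c)%N -> (t1 <= t < t2)%N /\ ~~ full t.
  by move=> h; apply: (clean_full hcl hb); qlia.
have [_ nft'] := nf t' ltac:(rewrite /t'; qlia).
have arr j : arrived b.+1 j || cand c b j -> arrived t'.+1 j.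
  move=> /orP[|/and4P[jm _ j1 j2]]; first by apply: arrivedW; rewrite /t'; qlia.
  have hh : hibound c b = (b + 2 ^ c + K)%N.
    rewrite /hibound qE // (_ : maxn c q = c); last by qlia.
    by rewrite mulSn divnK // hk // addnC; qlia.
  rewrite hh hk // -/K in j1 j2.
  apply: arrivedW (not_overdue _ jm _ _); [by rewrite /t'; qlia| |qlia|qlia].
  by apply: (clean_overdue hcl); qlia.
have dt' : (2 ^ c.+1 %| t')%N by rewrite /t' dvdn_addr.
have topt' : (c.+1 < top t')%N by rewrite -topP //; apply: rb_mult => //; qlia.
have toptL : (top t' < L)%N.
  rewrite ltn_neqAle; have /andP[_ ->] := top_le t'm; rewrite andbT; apply/eqP => eT.
  have : rb t' L.-1 by rewrite topP ?eT; qlia.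
  have al : aligned t' by apply: (al_mult ht' _ dt'); qlia.
  rewrite /rb (negPf nft') al => /dvdn_leq => /(_ ltac:(rewrite /t'; qlia)); have := mL; qlia.
have nr t : (b < t <= t'.-1)%N -> ~~ rb t (top t').
  move=> h; have [hr nft] := nf t ltac:(qlia).
  apply: nrb_mult => //; first by qlia.
  apply/negP => hdt; have /negP := @between_mult (2 ^ c.+1) b t ltac:(rewrite expn_gt0 //) hdv ltac:(qlia); apply.
  by apply: dvdn_trans hdt; rewrite dvdn_exp2l; qlia.
have hS' x : S b.+1 c.+1 x -> S t'.+1 (top t') x.
  move=> hx; rewrite S_keep //; [|by qlia|by rewrite topP ?ltnn].
  have -> : S t' (top t') x = S b.+1 (top t') x.
    have := @since_S b t'.-1 (top t') ltac:(qlia) ltac:(qlia) ltac:(qlia) nr (top t') x ltac:(qlia).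
    by rewrite prednK //; qlia.
  by apply: S_nestW hx; qlia.
have : D t'.+1 v <= D t'.+1 u + plen wt p.
  elim: p (u) hp hall {hlt} => [|j p IH] x /=.
    by move=> /eqP <- _; rewrite plen_nil addr0.
  move=> /and3P[/arr aj /eqP <- hp] /andP[hj hall].
  apply: le_trans (IH _ hp hall) _; rewrite plen_cons addrA lerD2r.
  by apply: D_relax => //; apply: hS'.
have := @D_mono b.+1 t'.+1 u ltac:(rewrite /t'; qlia); have d0 := delta_gt0.
nra.
Qed.

(** Each alarm counted here is followed by a drop before the next multiple of [2 ^ c.+1], so a
    vertex is alarmed at most [N] times. The source stands apart because its distance is 0, and for
    the same reason it is never alarmed. *)
Lemma even_sum c : (q <= c)%N -> (c.+1 < L)%N ->
  (\sum_(t1 <= b < t2 | (2 ^ c.+1 %| b)%N && ~~ unclean c b) Wm b c <= N * W4)%N.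
Proof.
move=> hc hcL; set P := (2 ^ c.+1)%N.
have P0 : (0 < P)%N by rewrite expn_gt0.
pose Q b v := [&& t1 <= b, b < t2, ~~ unclean c b & S b.+1 c v]%N.
apply: leq_trans (_ : \sum_(t1 <= b < t2 | (P %| b)%N) \sum_(v < n) dgm v * Q b v <= _)%N.
  rewrite big_nat_cond [X in (_ <= X)%N]big_nat_cond big_mkcond [X in (_ <= X)%N]big_mkcond /=.
  apply: leq_sum => b _; rewrite andbA; case: (_ && (P %| b)%N) / andP => [[hb _]|]; last by [].
  case: ifP => // /= ncl; rewrite /Wm big_mkcond /=; apply: leq_sum => v _.
  by rewrite /Q (ncl : ~~ unclean c b); move/andP: hb => [-> ->] /=; case: ifP; rewrite ?muln1.
apply: leq_trans (sum_mult _ _ _ P0) _; rewrite exchange_big /=.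
apply: leq_trans (_ : \sum_(v < n) dgm v * N <= _)%N; last first.
  by rewrite -big_distrl /= mulnC leq_mul2l dgm_sum orbT.
apply: leq_sum => v _; rewrite -big_distrr /= leq_mul2l; apply/orP; right.
have [ev|nev] := eqVneq (val v) s.
  rewrite big1 // => i _; apply/eqP; rewrite eqb0; apply/negP => /and4P[h1 h2 h3 h4].
  have [h5 h6] := @upper_drop c (i * P)%N v hc hcL ltac:(lia) (dvdn_mull _ (dvdnn _)) h3 (ltn_ord v) h4.
  have hb : (i * P < m)%N by lia.
  have ctop : (qlev (i * P) <= c < top (i * P))%N.
    rewrite qE ?hc /= -?topP //; [|lia|lia]; apply: rb_mult => //; first by lia.
    by apply: dvdn_mull; rewrite dvdn_exp2l.
  have [u [p [hp hall hlt]]] := alarm_up hb ctop (ltn_ord v) h4.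
  move: hlt; rewrite ev D_s; last by lia.
  have /andP[u0 _] : 0 <= D (i * P).+1 u <= M by apply: D_ge0; lia.
  have pl : 0 <= plen wt p by apply: plen_ge0 (ipath_all hp) => j; exact: usable_wt.
  by have d0 := delta_gt0; nra.
rewrite -[X in (_ <= X)%N]mul1n.
(* The drops are counted along the times [i * P]; the cap at [m] keeps all indices within the
   run. *)
apply: (@drop_count R delta M N delta_gt0 MN (fun i => D (minn (i * P).+1 m) v)
  (fun i => Q (i * P)%N v) 1 t2).
- by move=> l l' h; apply: D_mono; rewrite leq_min; nia.
- by move=> l _; have /andP[] := D_ge0 v (geq_minr (l * P).+1 m).
- move=> i hi /and4P[h1 h2 h3 h4].
  have [h5 h6] := @upper_drop c (i * P)%N v hc hcL ltac:(lia) (dvdn_mull _ (dvdnn _)) h3 (ltn_ord v) h4.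
  have -> : minn (i * P).+1 m = (i * P).+1 by lia.
  have -> : minn ((i + 1) * P).+1 m = (i * P + P).+1 by rewrite /P in h5 *; lia.
  split=> //; apply: D_ge1 => //; last exact: M_ge1.
  by move: h5; rewrite -/P; lia.
Qed.

Lemma Wm_nest t a : (t < m)%N -> (0 < a < L)%N -> (Wm t a <= Wm t a.+1)%N.
Proof.
move=> ht ha; rewrite /Wm big_mkcond [X in (_ <= X)%N]big_mkcond /=.
by apply: leq_sum => v _; case: ifP => // /(S_nest ht ha) ->.
Qed.

Lemma Wm_keep t a : (t.+1 < m)%N -> (0 < a < L)%N -> ~~ rb t.+1 a -> Wm t.+1 a = Wm t a.
Proof. by move=> ht ha nr; apply: eq_bigl => v; apply: S_keep. Qed.

Lemma W_keep t a : (t.+1 < m)%N -> (0 < a < L)%N -> ~~ rb t.+1 a -> W t.+1 a = W t a.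
Proof.
move=> ht ha nr; rewrite /W; apply: eq_big => [v|v _]; first exact: S_keep.
by apply: dg_keep => //; apply: contra nr => /rb_full.
Qed.

(** At an odd multiple [b] of [2 ^ c] the list of level [c.+1] is still the one built at
    [b - 2 ^ c], an even multiple. So these weights are terms of [alpha c.+1]. *)
Lemma odd_sum c : (q <= c)%N -> (c.+1 < L)%N ->
  (\sum_(t1 <= b < t2 | [&& (2 ^ c %| b)%N, ~~ (2 ^ c.+1 %| b)%N & ~~ unclean c b])
     Wm b c.+1 <= alpha c.+1)%N.
Proof.
move=> hc hcL; have P0 : (0 < 2 ^ c)%N by rewrite expn_gt0.
have e2 : (2 ^ c.+1 = 2 * 2 ^ c)%N by rewrite expnS.
rewrite -big_filter; set l := seq.filter _ _.
have lP b : b \in l -> [/\ (2 ^ c.+1 %| b - 2 ^ c)%N, (t1 <= b - 2 ^ c)%N, (b - 2 ^ c < t2)%N,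
    (2 ^ c <= b)%N & Wm b c.+1 = Wm (b - 2 ^ c) c.+1].
  rewrite mem_filter mem_index_iota => /andP[/and3P[h1 h2 h3] hb].
  have [r1 r2] := clean_range h3 hb.
  have hdv : (2 ^ c.+1 %| b - 2 ^ c)%N.
    move: h1 h2; rewrite e2 => /dvdnP[x ->].
    have [[y ->]|[y ->]] : (exists y, x = (2 * y)%N) \/ (exists y, x = (2 * y + 1)%N).
      by case: (boolP (odd x)) => h; [right|left]; exists (x %/ 2)%N; lia.
      by rewrite -mulnA mulnCA dvdn_mull ?mulnA // mulnC dvdn_mull.
    by move=> _; rewrite mulnDl mul1n addnK [(2 * y)%N]mulnC -mulnA dvdn_mull.
  split=> //; [lia|lia|lia|].
  set b' := (b - 2 ^ c)%N; apply: eq_bigl => v.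
  apply: (@since_S b' b c.+1 _ _ _ _ c.+1 v); [lia|rewrite /b'; lia|lia| |lia].
  move=> t ht; have [hr nf] := @clean_full c b t h3 hb ltac:(rewrite /b' in ht; lia) ltac:(lia).
  apply: nrb_mult => //; first by lia.
  apply: (@between_mult _ b') => //; first by rewrite expn_gt0.
  by rewrite /b' in ht *; lia.
have -> : (\sum_(b <- l) Wm b c.+1 = \sum_(x <- [seq (b - 2 ^ c)%N | b <- l]) Wm x c.+1)%N.
  by rewrite big_map big_seq [RHS]big_seq; apply: eq_bigr => b /lP[].
rewrite /alpha -[X in (_ <= X)%N]big_filter; apply: uniq_sum_sub.
  rewrite map_inj_in_uniq ?filter_uniq ?iota_uniq // => x y /lP[_ _ _ hx _] /lP[_ _ _ hy _] e.
  by rewrite -(subnK hx) e subnK.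
move=> y /mapP[b /lP[h1 h2 h3 _ _] ->]; rewrite mem_filter h1 mem_index_iota /=.
by rewrite h2 h3.
Qed.

Lemma unclean_sum c (G : nat -> nat) : (forall b, G b <= W4)%N ->
  (\sum_(t1 <= b < t2 | (2 ^ c %| b)%N && unclean c b) G b <= 81 * K * W4)%N.
Proof.
move=> h; apply: leq_trans (_ : (\sum_(t1 <= b < t2) ((2 ^ c %| b) && unclean c b)) * W4 <= _)%N.
  rewrite big_distrl /= big_mkcond; apply: leq_sum => b _.
  by case: ifP => _; rewrite ?mul1n ?h.
by rewrite leq_mul2r unclean_count orbT.
Qed.

(** At clean odd multiples [S_c] is contained in [S_(c+1)] and [odd_sum] applies, clean even
    multiples fall under [even_sum], and unclean multiples are few. *)
Lemma alpha_rec c : (q <= c)%N -> (c.+1 < L)%N ->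
  (alpha c <= alpha c.+1 + N * W4 + 81 * K * W4)%N.
Proof.
move=> hc hcL.
have h1 := odd_sum hc hcL; have h2 := even_sum hc hcL.
have h3 := @unclean_sum c (Wm^~ c) (fun b => Wm_le b c).
apply: leq_trans (leq_add (leq_add h1 h2) h3); rewrite /alpha.
have mk (P : pred nat) G : (\sum_(t1 <= b < t2 | P b) G b =
    \sum_(t1 <= b < t2) (if (t1 <= b < t2)%N && P b then G b else 0))%N.
  by rewrite big_nat_cond big_mkcond.
rewrite mk [X in (_ <= X + _ + _)%N]mk [X in (_ <= _ + X + _)%N]mk [X in (_ <= _ + X)%N]mk -!big_split /=; apply: leq_sum => b _.
case hb: (t1 <= b < t2)%N => //=.
have hdv : (2 ^ c.+1 %| b)%N -> (2 ^ c %| b)%N by apply: dvdn_trans; rewrite dvdn_exp2l.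
have hn : (Wm b c <= Wm b c.+1)%N by apply: Wm_nest; [lia|have := qL; lia].
move: hdv; case: (2 ^ c %| b)%N; case: (2 ^ c.+1 %| b)%N => //= h; try by have := h isT.
all: by case: (unclean c b) => //=; lia.
Qed.

(** As [2 ^ L.-1] exceeds [m], its only multiple in the phase can be 0. *)
Lemma alpha_top : (alpha L.-1 <= W4)%N.
Proof.
have P0 : (0 < 2 ^ L.-1)%N by rewrite expn_gt0.
rewrite /alpha -big_filter; set l := seq.filter _ _.
have : {subset l <= [:: 0%N]}.
  move=> b; rewrite mem_filter mem_index_iota inE => /andP[h hb].
  by case: b h hb => // b /dvdn_leq h hb; have := mL; have := h isT; lia.
move=> /(uniq_sum_sub (Wm^~ L.-1)); rewrite filter_uniq ?iota_uniq // => /(_ isT) h.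
by apply: leq_trans h _; rewrite big_seq1 Wm_le.
Qed.

Lemma alpha_le c : (q <= c < L)%N -> (alpha c <= L * ((N + 82 * K) * W4))%N.
Proof.
move=> hc; suff : (alpha c <= (L - c) * ((N + 82 * K) * W4))%N.
  by move=> h; apply: leq_trans h _; rewrite leq_mul2r leq_subr orbT.
have K0 := K_gt0.
move: (erefl (L - c)%N); move: {2}(L - c)%N => i; elim: i c hc => [|i IH] c hc e; first by lia.
have [e1|ne] := eqVneq c L.-1.
  have -> : (L - c = 1)%N by lia.
  by rewrite e1; apply: leq_trans alpha_top _; nia.
apply: leq_trans (alpha_rec _ _) _; [lia|lia|].
have h := IH c.+1 ltac:(lia) ltac:(lia).
have -> : (L - c = (L - c.+1).+1)%N by lia.
by rewrite mulSn; nia.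
Qed.

Lemma top_aligned t : (t1 <= t < t2)%N -> ~~ full t -> aligned t ->
  [/\ (q < top t < L)%N, (2 ^ (top t).-1 %| t)%N & ~~ (2 ^ top t %| t)%N].
Proof.
move=> ht nf al; have tm : (t < m)%N by lia.
have hr c : (c < L)%N -> (2 ^ c %| t)%N = (c < top t)%N.
  by move=> h; rewrite -topP // /rb (negPf nf) al.
have t0 : (0 < t)%N by case: t nf {ht al tm hr} => //; rewrite /full0 eqxx orbT.
have hq := qL; have mL' := mL.
have tq : (q < top t)%N by rewrite -hr //; move: al; rewrite /aligned qE.
have tL : (top t < L)%N.
  rewrite ltn_neqAle; have /andP[_ ->] := top_le tm; rewrite andbT; apply/eqP => e.
  have L0 := L_gt0; have : (2 ^ L.-1 %| t)%N by rewrite hr ?e prednK.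
  by move=> /dvdn_leq => /(_ t0); lia.
by split; [lia|rewrite hr; lia|rewrite hr // ltnn].
Qed.

(** At such a time [top t = c.+1], where [2 ^ c] is the largest power of two dividing [t]. So the
    relaxation on [S_(c+1)] happens at an odd multiple of [2 ^ c], as in [odd_sum]. *)
Lemma aligned_cost : (\sum_(t1 <= t < t2 | ~~ full t && aligned t) W t (top t) <=
  L * (L * ((N + 82 * K) * W4) + 81 * K * W4))%N.
Proof.
apply: leq_trans (_ : \sum_(q <= c < L.-1) (alpha c.+1 + 81 * K * W4) <= _)%N; last first.
  apply: leq_trans (_ : \sum_(q <= c < L.-1) (L * ((N + 82 * K) * W4) + 81 * K * W4) <= _)%N.
    rewrite big_nat_cond [X in (_ <= X)%N]big_nat_cond; apply: leq_sum => c /andP[hc _].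
    by rewrite leq_add2r alpha_le //; lia.
  by rewrite sum_nat_const_nat leq_mul2r; apply/orP; right; lia.
apply: leq_trans (_ : \sum_(q <= c < L.-1) \sum_(t1 <= t < t2)
   [&& ~~ full t, aligned t & top t == c.+1] * Wm t c.+1 <= _)%N.
  rewrite exchange_big /= big_nat_cond big_mkcond [X in (_ <= X)%N]big_nat_cond [X in (_ <= X)%N]big_mkcond.
  apply: leq_sum => t _; case ht: (t1 <= t < t2)%N => //=; case: ifP => // /andP[nf al].
  have [h1 _ _] := top_aligned ht nf al.
  rewrite (bigD1_seq (top t).-1) ?iota_uniq ?mem_index_iota /=; [|lia|by []].
  by rewrite nf al prednK ?eqxx /= ?mul1n; [apply: leq_trans (WWm _ _) (leq_addr _ _)|lia].
rewrite big_nat_cond [X in (_ <= X)%N]big_nat_cond; apply: leq_sum => c /andP[hc _].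
have h1 := @odd_sum c ltac:(lia) ltac:(lia).
have h3 := @unclean_sum c (Wm^~ c.+1) (fun b => Wm_le b c.+1).
apply: leq_trans (leq_add h1 h3).
rewrite big_nat_cond big_mkcond [X in (_ <= X + _)%N]big_nat_cond [X in (_ <= _ + X)%N]big_nat_cond.
rewrite [X in (_ <= X + _)%N]big_mkcond [X in (_ <= _ + X)%N]big_mkcond -big_split /=.
apply: leq_sum => t _; case ht: (t1 <= t < t2)%N => //=.
case nf: (full t) => //=; case al: (aligned t) => //=; case: eqP => //= e.
have [_ h4 h5] := top_aligned ht (negbT nf) al; rewrite e /= in h4 h5.
by rewrite h4 h5 /=; case: (unclean c t) => /=; lia.
Qed.

Lemma sub_top t : (t1 <= t < t2)%N -> ~~ full t -> ~~ aligned t -> (0 < top t <= q)%N.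
Proof.
move=> ht nf al; have /andP[-> _] := top_le (ltac:(lia) : (t < m)%N).
rewrite leqNgt -topP ?qL //; last by lia.
by rewrite /rb (negPf nf) (negPf al) qE // ltnn.
Qed.

(** When [top t = c], the clock crosses a multiple of [2 ^ c.-1] but none of [2 ^ c], which happens
    at most once between two rebuilds of level [c]. The potential keeps the weight of [S_c] until
    then, that is, while [Th %/ 2 ^ c.-1] is even. *)
Lemma low_cost c : (0 < c < q)%N ->
  (\sum_(t1 <= t < t2) [&& ~~ full t, ~~ aligned t & top t == c] * W t c <=
   W4 + \sum_(t1 <= t < t2) (c < top t) * W t c)%N.
Proof.
move=> hc; have hq := qL.
pose phi t := if odd (Th t %/ 2 ^ c.-1) then 0%N else W t.-1 c.
apply: leq_trans (_ : phi t1 + \sum_(t1 <= t < t2) (c < top t) * W t c <= _)%N; last first.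
  by rewrite leq_add2r /phi; case: ifP => // _; apply: W_le.
apply: telesc (ltnW t12) _ => t ht.
have phi_le x : (phi x.+1 <= W x c)%N by rewrite /phi; case: ifP.
have tm : (t < m)%N by lia.
have [ct|ct] := boolP (c < top t)%N.
  have -> : (top t == c) = false by lia.
  by rewrite !andbF mul0n mul1n; apply: leq_trans (phi_le t) (leq_addl _ _).
rewrite mul0n addn0.
have nr : ~~ rb t c by rewrite topP //; lia.
have nf : ~~ full t by apply: contra nr => /rb_full.
have nal : ~~ aligned t.
  apply: contra nr => al; rewrite /rb (negPf nf) al.
  by apply: dvdn_trans al; rewrite qE // dvdn_exp2l //; lia.
have t0 : (0 < t)%N by case: (t) nf => //; rewrite /full0 eqxx orbT.
have eW : W t c = W t.-1 c.
  by rewrite -{1}(prednK t0) W_keep // ?prednK //; lia.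
have e2 : (2 ^ c = 2 ^ c.-1 * 2)%N by rewrite -{1}(prednK (proj1 (andP hc))) expnSr.
move: nr; rewrite /rb (negPf nf) (negPf nal) qE // (_ : (c < q)%N) /=; last by lia.
rewrite negbK e2 !divnMA => /eqP eT.
rewrite /phi ThS // (negPf nf) (negPf nal) /= eW.
have : rb t c.-1 = (c.-1 < top t)%N by apply: topP => //; lia.
rewrite /rb (negPf nf) (negPf nal) qE // (_ : (c.-1 < q)%N) /=; last by lia.
move: eT; set x := (Th t %/ _)%N; set y := ((_ + _) %/ _)%N => eT.
have xy : (x <= y)%N by apply: leq_div2r; apply: leq_addr.
case: (eqVneq (top t) c) => [->|ne].
  move=> hr; have {}hr : x != y by rewrite hr; lia.
  have [/negPf -> ->] : ~~ odd x /\ odd y by split; lia.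
  by lia.
have -> : (c.-1 < top t)%N = false by lia.
by move=> /negbFE /eqP ->.
Qed.

(** Off the aligned times [top t = q] means that the clock crosses a multiple of [K]. The potential
    is [Th %% K] times the weight of [S_q]: a crossing releases [K] units, and a step adds the
    advance [mu] of the clock, split as 1 and [mu - 1]. *)
Lemma q_cost : (K * \sum_(t1 <= t < t2) [&& ~~ full t, ~~ aligned t & top t == q] * W t q <=
  K * W4 + (\sum_(t1 <= t < t2) (~~ full t && ~~ aligned t) * Wm t q +
   \sum_(t1 <= t < t2) (~~ full t && ~~ aligned t) * ((mu t (idf t)).-1 * W4)))%N.
Proof.
have hq := qL; have K0 := K_gt0.
rewrite -big_split big_distrr /=.
pose phi t := (Th t %% K * Wm t.-1 q)%N.
apply: leq_trans (_ : phi t1 + \sum_(t1 <= t < t2) ((~~ full t && ~~ aligned t) * Wm t q +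
   (~~ full t && ~~ aligned t) * ((mu t (idf t)).-1 * W4)) <= _)%N; last first.
  rewrite leq_add2r /phi; apply: leq_mul; last exact: Wm_le.
  by apply: ltnW; rewrite ltn_mod.
apply: telesc (ltnW t12) _ => t ht; have tm : (t < m)%N by lia.
have [/orP h|] := boolP (full t || aligned t).
  have -> : phi t.+1 = 0%N by rewrite /phi ThS // (introT orP h) mod0n.
  by case: h => ->; rewrite ?andbF /= !mul0n muln0 leq0n.
rewrite negb_or => /andP[nf nal]; rewrite nf nal /= !mul1n.
have t0 : (0 < t)%N by case: (t) nf => //; rewrite /full0 eqxx orbT.
have nr : ~~ rb t q by rewrite /rb (negPf nf) (negPf nal) qE // ltnn.
have eW : Wm t q = Wm t.-1 q by rewrite -{1}(prednK t0) Wm_keep // ?prednK //; lia.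
rewrite /phi ThS // (negPf nf) (negPf nal) /= -eW.
have hmu : (mu t (idf t) <= 1 + (mu t (idf t)).-1)%N by lia.
move: hmu; set x := mu t _; set w := Wm t q => hmu.
have ww : (x * w <= w + x.-1 * W4)%N.
  apply: leq_trans (leq_mul hmu (leqnn _)) _; rewrite mulnDl mul1n leq_add2l leq_mul2l.
  by rewrite Wm_le orbT.
suff h : (K * ((top t == q) * W t q) + (Th t + x) %% K * w <= Th t %% K * w + x * w)%N.
  by apply: leq_trans h _; rewrite leq_add2l.
have kq : rb t k = (k < top t)%N by apply: topP => //; rewrite /q in hq; lia.
have dT := divn_eq (Th t) K; have dT' := divn_eq (Th t + x)%N K.
have WW : (W t q <= w)%N by apply: WWm.
case: eqP => [et|_] /=.
  move: kq; rewrite /rb (negPf nf) (negPf nal) qE // -/K et ltnSn /= => ne.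
  have xy : (Th t %/ K < (Th t + x) %/ K)%N.
    by rewrite ltn_neqAle ne leq_div2r // leq_addr.
  have h : (K + (Th t + x) %% K <= Th t %% K + x)%N by nia.
  rewrite mul1n -mulnDl; apply: leq_trans (leq_mul h (leqnn w)); rewrite mulnDl leq_add2r.
  by rewrite leq_mul2l WW orbT.
rewrite mul0n muln0 add0n -mulnDl leq_mul2r; apply/orP; right.
have : ((Th t + x) %% K = (Th t %% K + x) %% K)%N by rewrite modnDml.
by move=> ->; apply: leq_mod.
Qed.

(** [S_q] changes only at full and aligned times. Each change pays in advance for the fewer than
    [2 * K] steps until the next multiple of [2 * K = 2 ^ q]. *)
Lemma sub_Wm : (\sum_(t1 <= t < t2) (~~ full t && ~~ aligned t) * Wm t q <=
  2 * K * W4 + 2 * K * (F * W4 + alpha q))%N.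
Proof.
have hq := qL; have K0 := K_gt0.
pose phi t := ((2 * K - t %% (2 * K)) %% (2 * K) * Wm t.-1 q)%N.
have ph t : (phi t <= 2 * K * Wm t.-1 q)%N.
  by rewrite /phi leq_mul2r; apply/orP; right; apply: ltnW; rewrite ltn_mod; lia.
have -> : (2 * K * (F * W4 + alpha q) =
   \sum_(t1 <= t < t2) 2 * K * (full t * W4 + (2 ^ q %| t) * Wm t q))%N.
  rewrite -big_distrr /= big_split /= -big_distrl /=; congr (_ * (_ + _))%N.
  by rewrite /alpha big_mkcond; apply: eq_bigr => t _; case: (_ %| _)%N; rewrite ?mul1n ?mul0n.
apply: leq_trans (_ : phi t1 + \sum_(t1 <= t < t2) 2 * K * (full t * W4 + (2 ^ q %| t) * Wm t q) <= _)%N; last first.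
  rewrite leq_add2r; apply: leq_trans (ph t1) _; rewrite leq_mul2l Wm_le orbT //.
apply: telesc (ltnW t12) _ => t ht; have tm : (t < m)%N by lia.
have hp := ph t.+1; rewrite /= in hp; have hW := Wm_le t q.
case nf: (full t) => /=.
  by rewrite mul0n mul1n; apply: leq_trans hp _; nia.
have al : aligned t = (2 ^ q %| t)%N by rewrite /aligned qE.
rewrite al; case nal: (2 ^ q %| t)%N => /=; first by rewrite mul0n add0n mul1n; apply: leq_trans hp (leq_addl _ _).
rewrite mul1n muln0 addn0.
have t0 : (0 < t)%N by case: (t) nf => //; rewrite /full0 eqxx orbT.
have nr : ~~ rb t q by rewrite /rb nf al nal qE // ltnn.
have eW : Wm t q = Wm t.-1 q by rewrite -{1}(prednK t0) Wm_keep // ?prednK //; lia.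
rewrite /phi /= -eW -mulSn leq_mul2r; apply/orP; right.
move: nal; rewrite q2K /dvdn => /negbT; rewrite -lt0n => h.
have h2 : (t %% (2 * K) < 2 * K)%N by rewrite ltn_mod; lia.
rewrite (modn_small (_ : 2 * K - t %% (2 * K) < _)%N); last by lia.
have [e|e] := eqVneq (t %% (2 * K))%N (2 * K).-1.
  have -> : (t.+1 %% (2 * K) = 0)%N.
    by rewrite -addn1 -modnDml e addn1 prednK ?modnn //; lia.
  by rewrite subn0 modnn; lia.
have -> : (t.+1 %% (2 * K) = (t %% (2 * K)).+1)%N.
  by rewrite -addn1 -modnDml addn1 modn_small //; lia.
by rewrite modn_small; lia.
Qed.

(** Near arrivals have distinct ids below [m], so the sum is at most that of [mu t2 j - 1] over the
    predicted edges, which [chi] dominates. All low levels have [2 ^ a <= K], so [chi] grows by at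
    most [N * K] times the weight of the alarms; the factor [N] cancels against [W4 * N <= Cb]. *)
Lemma extra_mult : (W4 * \sum_(t1 <= t < t2) (~~ full t && ~~ aligned t) * (mu t (idf t)).-1 <=
  K * \sum_(0 <= t < t2) alarmW t)%N.
Proof.
have N0 := N_gt0; rewrite -(leq_pmul2l N0).
have mu_monoW i i' j : (i <= i' <= m)%N -> (mu i j <= mu i' j)%N.
  move=> /andP[/subnK <-]; elim: (i' - i)%N => // x IH h.
  by apply: leq_trans (IH _) _; [lia|rewrite addSn; apply: mu_mono; lia].
have st1 : (\sum_(t1 <= t < t2) (~~ full t && ~~ aligned t) * (mu t (idf t)).-1 <=
    \sum_(j < m) (mu t2 j).-1)%N.
  apply: leq_trans (_ : \sum_(t1 <= t < t2 | ~~ full t) (mu t2 (idf t)).-1 <= _)%N.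
    rewrite big_nat_cond [X in (_ <= X)%N]big_nat_cond big_mkcond [X in (_ <= X)%N]big_mkcond /=.
    apply: leq_sum => t _; rewrite andbT; case ht: (t1 <= t < t2)%N => //=.
    case: (full t) => //=; have := @mu_monoW t t2 (idf t) ltac:(lia).
    by case: (aligned t) => /=; lia.
  rewrite -big_filter -(big_map idf xpredT (fun j => (mu t2 j).-1)).
  rewrite -(big_mkord xpredT (fun j => (mu t2 j).-1)); apply: uniq_sum_sub.
    rewrite map_inj_in_uniq ?filter_uniq ?iota_uniq // => x y.
    rewrite !mem_filter !mem_index_iota => /andP[_ hx] /andP[_ hy]; apply: idf_inj; rewrite inE; lia.
  move=> j /mapP[t]; rewrite mem_filter mem_index_iota => /andP[nf ht] ->.
  rewrite mem_index_iota /=; move: nf; rewrite /full0 negb_or => /andP[/ev_kap + _].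
  by rewrite /near => /and3P[].
have st2 : (Cb * \sum_(j < m) (mu t2 j).-1 <= \sum_(j < m) chi t2 j)%N.
  rewrite big_distrr /=; apply: leq_sum => j _; rewrite mulnC; exact: chi_mu.
have st3 T : (T <= t2)%N -> (\sum_(j < m) chi T j <= N * (K * \sum_(0 <= t < T) alarmW t))%N.
  elim: T => [|T IH] hT; first by rewrite big1 // => j _; apply: chi0.
  apply: leq_trans (chi_step (ltac:(lia) : (T < m)%N)) _.
  rewrite big_nat_recr //= !mulnDr; apply: leq_add; first by apply: IH; lia.
  rewrite leq_mul2l; apply/orP; right; rewrite /alarmW big_distrr /=.
  rewrite big_nat_cond [X in (_ <= X)%N]big_nat_cond; apply: leq_sum => a /andP[ha _].
  rewrite leq_mul2r; apply/orP; right; rewrite leq_exp2l //.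
  have : (kap T <= k)%N by rewrite -(hk (_ : t1 <= t2.-1 < t2)%N); [apply: kap_mono; lia|lia].
  by move: ha; rewrite /sublevels /qlev; lia.
have := st3 t2 (leqnn _); apply: leq_trans; apply: leq_trans st2.
rewrite mulnA [(N * W4)%N]mulnC; apply: leq_mul; [exact: CbN|exact: st1].
Qed.

(** Without overdue edges the witness path has arrived completely by [t + 4 * K]. At the next
    aligned time the relaxation is accurate up to the error [(1 + delta) ^ L] of the high levels,
    and the alarm exceeded the threshold [ts >= (1 + delta) ^ L.+1], which leaves one factor
    [1 + delta] as a drop. *)
Lemma good_drop t a v u p : (t1 <= t)%N -> (t + 8 * K < t2)%N -> (0 < a < sublevels t)%N ->
  ipath tl hd (fun j => arrived t.+1 j || (cand a t j && ~~ overdue j)) u p v ->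
  ts * (D t.+1 u + plen wt p) < D t.+1 v ->
  v != s /\ (1 + delta) * D (t.+1 + 8 * K) v <= D t.+1 v.
Proof.
move=> ht1 ht2 ha hp hlt; have K0 := K_gt0; have hq := qL; have d0 := delta_gt0; have ts1 := ts_ge1.
have tm : (t < m)%N by qlia.
have pl : 0 <= plen wt p.
  apply: plen_ge0 (ipath_all hp) => j hj; apply: (@usable_wt a t) => //.
  by case/orP: hj => [->//|/andP[-> _]]; rewrite orbT.
have /andP[u0 _] : 0 <= D t.+1 u <= M by apply: D_ge0.
have /andP[_ vM] : 0 <= D t.+1 v <= M by apply: D_ge0.
split; first by apply: contraTneq hlt => ->; rewrite D_s // -leNgt mulr_ge0 ?addr_ge0 //; lra.
(* The first multiple of [2 * K = 2 ^ q] after [t + 4 * K]. It is at most [t + 6 * K] and so falls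
   into the window of [8 * K] steps. *)
set t' := (((t + 4 * K) %/ (2 * K)).+1 * (2 * K))%N.
have K2 : (0 < 2 * K)%N by qlia.
have t'1 : (t + 4 * K < t')%N by rewrite /t' ltn_ceil.
have t'2 : (t' <= t + 6 * K)%N by rewrite /t' mulSn; have := leq_trunc_div (t + 4 * K) (2 * K); qlia.
have ht' : (t1 <= t' < t2)%N by qlia.
have t'm : (t' < m)%N by qlia.
have tt : (t1 <= t < t2)%N by qlia.
have uM : D t.+1 u < M by nra.
have dt' : (2 * K %| t')%N by rewrite /t' dvdn_mull.
move: t'1 t'2 ht' t'm dt'; clearbody t' => t'1 t'2 ht' t'm dt'.
have [pu hpu lpu] := D_path (ltac:(qlia) : (t.+1 <= m)%N) uM.
have arr : {in pu ++ p, forall j, arrived t.+1 j || (cand a t j && ~~ overdue j) -> arrived t'.+1 j}.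
  move=> j _ /orP[|/andP[/and4P[jm _ j1 j2] nov]]; first by apply: arrivedW; qlia.
  have hh : (hibound a t <= t + 3 * K)%N.
    rewrite /hibound qE // (_ : maxn a q = q); last by move: ha; rewrite /sublevels qE //; qlia.
    by rewrite q2K hk // -/K mulSn; have := leq_trunc_div t (2 * K); qlia.
  rewrite hk // -/K in j1.
  apply: arrivedW (not_overdue nov jm _ _); qlia.
have hpp : ipath tl hd (arrived t'.+1) s (pu ++ p) v.
  apply: ipath_sub arr _; apply: ipath_cat hp.
  by apply: ipath_sub hpu => j _ ->.
have := approx_top t'm hpp; rewrite plen_cat => hD.
have rq : rb t' q by apply: rb_mult => //; rewrite q2K.
have tq : (q < top t')%N by rewrite -topP.
have er_le : er t' (top t') <= (1 + delta) ^+ L.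
  rewrite /er qE // (_ : (q - top t' = 0)%N) ?expr0 ?mulr1; last by qlia.
  by apply: ler_weXn2l; [lra|qlia].
have mono : D (t.+1 + 8 * K) v <= D t'.+1 v by apply: D_mono; qlia.
have h1 : D t'.+1 v <= (1 + delta) ^+ L * (D t.+1 u + plen wt p).
  apply: le_trans hD _; apply: ler_pM => //; first by have := er_ge1 t' (top t'); lra.
    by rewrite addr_ge0 //; apply: plen_ge0 (ipath_all hpu) => j; apply: arrived_wt.
  by rewrite lerD2r.
apply: le_trans (ltW hlt).
apply: le_trans (_ : (1 + delta) ^+ L.+1 * (D t.+1 u + plen wt p) <= _); last first.
  by rewrite ler_wpM2r ?addr_ge0 //; apply: ts_err.
by rewrite exprS -mulrA ler_wpM2l //; [lra|apply: le_trans mono h1].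
Qed.

(** An alarm with a witness free of overdue edges is followed by a drop within [8 * K] steps, hence
    occurs at most [8 * K * N] times per level and vertex; the last [8 * K] steps of the phase are
    counted in full. All other alarms are charged to the blame of the at most [4 * K + 1] overdue
    edges. *)
Lemma alarm_phase :
  (\sum_(t1 <= t < t2) alarmW t <= q * ((8 * K * N + 8 * K) * W4) + (4 * K + 1) * PM)%N.
Proof.
have K0 := K_gt0.
pose g t v := [&& (t1 <= t)%N, (t < t2)%N & (t + 8 * K < t2)%N ==>
  ((v != s) && ((1 + delta) * D (t.+1 + 8 * K)%N v <= D t.+1 v))].
apply: leq_trans (_ : \sum_(t1 <= t < t2) (\sum_(1 <= a < q) \sum_(v < n) dgm v * g t v +
    \sum_(j < m | overdue j) (psi t.+1 j - psi t j)) <= _)%N.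
  rewrite big_nat_cond [X in (_ <= X)%N]big_nat_cond; apply: leq_sum => t /andP[ht _].
  have [X [h1 XP]] := alarm_sub overdue (ltac:(lia) : (t < m)%N).
  apply: leq_trans (leq_add (leqnn _) h1).
  rewrite /alarmW.
  have sq : (sublevels t <= q)%N by rewrite /sublevels qE // geq_minr.
  apply: leq_trans (_ : \sum_(1 <= a < sublevels t) \sum_(v < n) dgm v * g t v +
     \sum_(1 <= a < sublevels t) \sum_(v < n | S t.+1 a v && X a v) dg t v <= _)%N.
    rewrite -big_split /= big_nat_cond [X in (_ <= X)%N]big_nat_cond; apply: leq_sum => a /andP[ha _].
    rewrite /W big_mkcond [X in (_ <= _ + X)%N]big_mkcond -big_split /=; apply: leq_sum => v _.
    case hS: (S _ _ _) => //=; case hX: (X _ _) => /=; first by rewrite leq_addl.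
    suff -> : g t v by rewrite muln1 addn0 dg_le.
    rewrite /g; move/andP: (ht) => [-> ->] /=; apply/implyP => h8.
    have [u [p [hp hlt]]] := XP a v ha (ltn_ord v) hS (negbT hX).
    by have [|-> ->] := good_drop _ h8 ha hp hlt; first by lia.
  rewrite leq_add2r; have [s1|s1] := leqP 1 (sublevels t); last by rewrite big_geq; lia.
  by rewrite [X in (_ <= X)%N](@big_cat_nat _ _ _ (sublevels t)) //= leq_addr.
rewrite big_split /=; apply: leq_add.
  rewrite exchange_big /=.
  apply: leq_trans (_ : \sum_(1 <= a < q) (8 * K * N + 8 * K) * W4 <= _)%N; last first.
    by rewrite sum_nat_const_nat leq_mul2r; apply/orP; right; lia.
  rewrite big_nat_cond [X in (_ <= X)%N]big_nat_cond; apply: leq_sum => a /andP[ha _].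
  rewrite exchange_big /=.
  apply: leq_trans (_ : \sum_(v < n) dgm v * (8 * K * N + 8 * K) <= _)%N; last first.
    by rewrite -big_distrl /= mulnC leq_mul2l dgm_sum orbT.
  apply: leq_sum => v _; rewrite -big_distrr /= leq_mul2l; apply/orP; right.
  apply: leq_trans (_ : \sum_(t < t2) ((t + 8 * K < t2)%N && g t v) +
    \sum_(t1 <= t < t2) (t2 <= t + 8 * K)%N <= _)%N.
    rewrite -(big_mkord xpredT (fun t => nat_of_bool ((t + 8 * K < t2)%N && g t v))).
    rewrite [X in (_ <= X + _)%N](@big_cat_nat _ _ _ t1) //=; last by lia.
    rewrite -addnA; apply: leq_trans (leq_addl _ _); rewrite -big_split /=; apply: leq_sum => t _.
    by case: ltnP; case: (g _ _).
  apply: leq_add; last first.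
    apply: leq_trans (_ : \sum_(t2 - 8 * K <= t < t2) 1 <= _)%N; last first.
      by rewrite sum_nat_const_nat; lia.
    have [h|h] := leqP t1 (t2 - 8 * K)%N.
      rewrite (@big_cat_nat _ _ _ (t2 - 8 * K)) //=; last by lia.
      rewrite [X in (X + _ <= _)%N]big_nat_cond [X in (X + _ <= _)%N]big1 ?add0n; last first.
        by move=> t /andP[ht _]; rewrite (_ : (t2 <= t + 8 * K)%N = false) //; lia.
      by apply: leq_sum => t _; apply: leq_b1.
    rewrite [X in (_ <= X)%N](@big_cat_nat _ _ _ t1) //=; [|lia|lia].
    by apply: leq_trans (leq_addl _ _); apply: leq_sum => t _; apply: leq_b1.
  apply: (@drop_count R delta M N delta_gt0 MN (fun i => D (minn i.+1 m) v)
    (fun t => (t + 8 * K < t2)%N && g t v) (8 * K) t2).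
  - by move=> l l' h; apply: D_mono; rewrite leq_min; lia.
  - by move=> l _; have /andP[] := D_ge0 v (geq_minr l.+1 m).
  - move=> t ht /andP[h0 /and3P[h1 h2]]; rewrite h0 /= => /andP[ne hdr].
    have -> : minn t.+1 m = t.+1 by lia.
    have -> : minn (t + 8 * K).+1 m = (t.+1 + 8 * K)%N by lia.
    by split=> //; apply: D_ge1 => //; [lia|exact: M_ge1].
apply: leq_trans (_ : \sum_(j < m | overdue j) PM <= _)%N; last first.
  apply: leq_trans (_ : (\sum_(j < m) overdue j) * PM <= _)%N; last by rewrite leq_mul2r overdue_le orbT.
  rewrite big_distrl big_mkcond /=; apply: leq_sum => j _.
  by case: (overdue j); rewrite ?mul1n.
rewrite exchange_big /=; apply: leq_sum => j _.
have mono t t' : (t <= t' <= m)%N -> (psi t j <= psi t' j)%N.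
  move=> /andP[/subnK <-]; elim: (t' - t)%N => // x IH h.
  by apply: leq_trans (IH _) _; [lia|rewrite addSn; apply: psi_mono; lia].
have tele T : (t1 <= T <= t2)%N -> (\sum_(t1 <= t < T) (psi t.+1 j - psi t j) + psi t1 j <= psi T j)%N.
  elim: T => [|T IH] hT; first by rewrite big_geq //; have -> : t1 = 0%N by lia.
  have [e|ne] := eqVneq t1 T.+1; first by rewrite big_geq ?e.
  rewrite big_nat_recr /=; last by lia.
  have := IH ltac:(lia); have := @psi_mono T j ltac:(lia).
  by set A := (\sum_(_ <= _ < _) _)%N; lia.
have := tele t2 ltac:(lia); have := @psi_max t2 j t2m.
by set A := (\sum_(_ <= _ < _) _)%N; lia.
Qed.

(** The relaxations are sorted by the time at which they occur: full rebuilds, aligned times, and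
    the remaining times with [top t < q] or [top t = q]. The last kind is estimated after
    multiplication by [K]. *)
Lemma phase_cost : (\sum_(t1 <= t < t2) W t (top t) <=
  (K + 1) * W4 + L * (L * ((N + 82 * K) * W4) + 81 * K * W4) +
  (L * W4 + \sum_(t1 <= t < t2) alarmW t) +
  (W4 + (2 * W4 + 2 * ((K + 1) * W4 + L * ((N + 82 * K) * W4))) + \sum_(0 <= t < t2) alarmW t))%N.
Proof.
have K0 := K_gt0; have hq := qL.
apply: leq_trans (_ : \sum_(t1 <= t < t2) full t * W4 +
  \sum_(t1 <= t < t2 | ~~ full t && aligned t) W t (top t) +
  \sum_(1 <= c < q) \sum_(t1 <= t < t2) [&& ~~ full t, ~~ aligned t & top t == c] * W t c +
  \sum_(t1 <= t < t2) [&& ~~ full t, ~~ aligned t & top t == q] * W t q <= _)%N.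
  rewrite [X in (_ <= _ + X + _)%N]exchange_big /= [X in (_ <= _ + X + _ + _)%N]big_mkcond -!big_split /=.
  rewrite big_nat_cond [X in (_ <= X)%N]big_nat_cond; apply: leq_sum => t /andP[ht _].
  case nf: (full t) => /=; first by rewrite mul1n -!addnA; apply: leq_trans (W_le _ _) (leq_addr _ _).
  case al: (aligned t) => /=; first by rewrite mul0n add0n -!addnA leq_addr.
  have htop := sub_top ht (negbT nf) (negbT al); rewrite mul0n !add0n.
  have [->|ne] := eqVneq (top t) q; first by rewrite mul1n leq_addl.
  rewrite mul0n addn0 (bigD1_seq (top t)) ?iota_uniq ?mem_index_iota //=; last by lia.
  by rewrite eqxx mul1n leq_addr.
apply: leq_add; last first.
  rewrite -(leq_pmul2l K0); apply: leq_trans q_cost _.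
  have h1 := sub_Wm; have h2 := extra_mult; have h3 := F_le.
  have h4 := @alpha_le q ltac:(lia).
  have e : (\sum_(t1 <= t < t2) (~~ full t && ~~ aligned t) * ((mu t (idf t)).-1 * W4) =
    W4 * \sum_(t1 <= t < t2) (~~ full t && ~~ aligned t) * (mu t (idf t)).-1)%N.
    by rewrite big_distrr /=; apply: eq_bigr => t _; rewrite mulnA mulnC.
  rewrite e !mulnDr; rewrite -!addnA leq_add2l.
  move: h1 h2; set A := (\sum_(_ <= _ < _) _)%N; set B := (W4 * _)%N; set G := (\sum_(_ <= _ < _) _)%N.
  move=> h1 h2; apply: leq_trans (leq_add h1 h2) _.
  have h5 : (F * W4 <= (K + 1) * W4)%N by rewrite leq_mul2r h3 orbT.
  move: h4 h5; set al := (alpha q); set x := (F * W4)%N; set y := ((K + 1) * W4)%N.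
  by set z := (L * _)%N => h4 h5; nia.
apply: leq_add; first apply: leq_add; [|exact: aligned_cost|].
  by rewrite -big_distrl /= leq_mul2r; apply/orP; right; apply: F_le.
apply: leq_trans (_ : \sum_(1 <= c < q) (W4 + \sum_(t1 <= t < t2) (c < top t) * W t c) <= _)%N.
  by rewrite big_nat_cond [X in (_ <= X)%N]big_nat_cond; apply: leq_sum => c /andP[hc _]; apply: low_cost.
rewrite big_split /=; apply: leq_add.
  by rewrite sum_nat_const_nat leq_mul2r; apply/orP; right; lia.
rewrite exchange_big /= big_nat_cond [X in (_ <= X)%N]big_nat_cond; apply: leq_sum => t /andP[ht _].
rewrite /alarmW /sublevels qE // (eq_bigr (fun c => if (c < top t)%N then W t c else 0%N)); last first.
  by move=> c _; case: (_ < _)%N; rewrite ?mul1n ?mul0n.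
rewrite -big_mkcond /= [X in (_ <= X)%N]big_nat_cond big_nat_cond.
rewrite -big_filter -[X in (_ <= X)%N]big_filter; apply: uniq_sum_sub; first by rewrite filter_uniq ?iota_uniq.
by move=> c; rewrite !mem_filter !mem_index_iota; lia.
Qed.

End Phase.

(** * Summation over the phases *)

Lemma phases_sum (f : nat -> nat) Bd T : (T <= m)%N ->
  (forall t1 t2 k, (t1 < t2)%N -> (t2 <= T)%N -> (forall t, (t1 <= t < t2)%N -> kap t = k) ->
     full t1 -> (\sum_(t1 <= t < t2) f t <= Bd)%N) ->
  (\sum_(0 <= t < T) f t <= (kap T.-1).+1 * Bd)%N.
Proof.
elim/ltn_ind: T => T IH Tm H.
have [->|T0] := posnP T; first by rewrite big_geq.
have ex : exists t, kap t == kap T.-1 by exists T.-1.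
case: (ex_minnP ex) => t1 /eqP e1 min1.
have t1T : (t1 < T)%N by have := min1 T.-1 (eqxx _); lia.
have hk t : (t1 <= t < T)%N -> kap t = kap T.-1.
  move=> ht; apply/eqP; rewrite eqn_leq; apply/andP; split; first by apply: kap_mono; lia.
  by rewrite -e1; apply: kap_mono; lia.
have f1 : full t1.
  rewrite /full0; case: t1 e1 min1 t1T {hk} => [|t1] e1 min1 t1T; first by rewrite orbT.
  rewrite kap_new // ltn_neqAle kap_mono // andbT e1; apply/negP => h.
  by have := min1 t1 h; rewrite ltnn.
rewrite (@big_cat_nat _ _ _ t1) //=; last by lia.
have h1 := H _ _ _ t1T (leqnn _) hk f1.
have h2 : (\sum_(0 <= t < t1) f t <= kap T.-1 * Bd)%N.
  have [->|p1] := posnP t1; first by rewrite big_geq.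
  apply: leq_trans (IH t1 t1T _ _) _; [lia| |].
    by move=> a b k h3 h4; apply: H; lia.
  rewrite leq_mul2r; apply/orP; right; rewrite -e1 ltn_neqAle kap_mono ?leq_pred // andbT.
  by apply/negP; rewrite e1 => h; have := min1 t1.-1 h; lia.
by rewrite mulSn addnC leq_add.
Qed.

Lemma event_count : (\sum_(0 <= t < m) full t <= (kap m.-1).+1 * (2 ^ kap m.-1 + 1))%N.
Proof.
apply: phases_sum => // t1 t2 k h1 h2 h3 _; apply: leq_trans (full_count h1 h3) _.
rewrite leq_add2r leq_exp2l // -(h3 t1); last by lia.
by apply: kap_mono; lia.
Qed.

(** There are at most [L] phases, and in each the guess is replaced by its last value. With
    [Z = Kx * N * W4], the terms of [phase_cost] contribute [2 + 164 + 17 + 173 + 16 = 372] times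
    [L ^ 2 * Z] and [5 + 5] times [L ^ 2 * Kx * PM]. *)
Lemma total_cost : (\sum_(0 <= t < m) W t (top t) <=
  2 ^ kap m.-1 * L ^ 3 * (372 * (N * W4) + 10 * PM))%N.
Proof.
have [m0|m0] := posnP m; first by rewrite big_geq ?m0.
have kL : ((kap m.-1).+1 < L)%N by apply: (@q_lt m.-1); rewrite prednK.
set Kx := (2 ^ kap m.-1)%N; have Kx0 : (0 < Kx)%N by rewrite expn_gt0.
have kx t1 t2 k : (t1 < t2)%N -> (t2 <= m)%N -> (forall t, (t1 <= t < t2)%N -> kap t = k) ->
    (k <= kap m.-1)%N.
  by move=> h1 h2 h3; rewrite -(h3 t1) ?kap_mono //; lia.
have N0 := N_gt0.
pose Aw := (L * (16 * Kx * N * W4) + 5 * Kx * PM)%N.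
have hA : (\sum_(0 <= t < m) alarmW t <= L * Aw)%N.
  apply: leq_trans (_ : (kap m.-1).+1 * Aw <= _)%N; last by rewrite leq_mul2r ltnW ?orbT.
  apply: phases_sum => // t1 t2 k h1 h2 h3 f1; have := alarm_phase h1 h2 h3; cbv zeta; (try move=> /(_ f1)) => /leq_trans; apply.
  have hk := kx _ _ _ h1 h2 h3.
  have K1 : (2 ^ k <= Kx)%N by rewrite leq_exp2l.
  have kL' : (k.+1 <= L)%N by lia.
  have K0 : (0 < 2 ^ k)%N by rewrite expn_gt0.
  rewrite /Aw; apply: leq_add; last by rewrite leq_mul2r; apply/orP; right; lia.
  apply: leq_mul => //; rewrite leq_mul2r; apply/orP; right; nia.
pose A := (L * ((N + 82 * Kx) * W4))%N.
apply: leq_trans (_ : L * ((Kx + 1) * W4 + L * (A + 81 * Kx * W4) + (L * W4 + Aw) +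
   (W4 + (2 * W4 + 2 * ((Kx + 1) * W4 + A)) + L * Aw)) <= _)%N.
  set Bd := (_ + _ + _ + _)%N.
  apply: leq_trans (_ : (kap m.-1).+1 * Bd <= _)%N; last by rewrite leq_mul2r ltnW ?orbT.
  apply: phases_sum => // t1 t2 k h1 h2 h3 f1; have := phase_cost h1 h2 h3; cbv zeta; (try move=> /(_ f1)) => /leq_trans; apply.
  have hk := kx _ _ _ h1 h2 h3.
  have K1 : (2 ^ k <= Kx)%N by rewrite leq_exp2l.
  have kL' : (k.+1 <= L)%N by lia.
  have K0 : (0 < 2 ^ k)%N by rewrite expn_gt0.
  have hAA : (L * ((N + 82 * 2 ^ k) * W4) <= A)%N.
    by rewrite /A leq_mul2l leq_mul2r leq_add2l leq_mul2l K1 !orbT.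
  have h81 : (81 * 2 ^ k * W4 <= 81 * Kx * W4)%N by rewrite leq_mul2r leq_mul2l K1 !orbT.
  have hK1 : ((2 ^ k + 1) * W4 <= (Kx + 1) * W4)%N by rewrite leq_mul2r leq_add2r K1 orbT.
  have hal : (\sum_(t1 <= t < t2) alarmW t <= Aw)%N.
    have := alarm_phase h1 h2 h3; cbv zeta; (try move=> /(_ f1)) => /leq_trans; apply.
    rewrite /Aw; apply: leq_add; last by rewrite leq_mul2r; apply/orP; right; lia.
    apply: leq_mul => //; rewrite leq_mul2r; apply/orP; right; nia.
  have hal2 : (\sum_(0 <= t < t2) alarmW t <= L * Aw)%N.
    apply: leq_trans hA; rewrite [X in (_ <= X)%N](@big_cat_nat _ _ _ t2) //=; first exact: leq_addr.
  rewrite /Bd; apply: leq_add; first apply: leq_add; first apply: leq_add => //.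
  - by rewrite leq_mul2l leq_add ?orbT.
  - by rewrite leq_add2l.
  - by apply: leq_add => //; rewrite leq_add2l leq_add2l leq_mul2l leq_add.
have L1 := L_gt0; rewrite /A /Aw.
have LL : (L <= L ^ 2)%N by rewrite -mulnn leq_pmulr.
have h1 : (N + 82 * Kx <= 83 * (Kx * N))%N by nia.
have hW : (Kx * W4 <= Kx * N * W4)%N by nia.
set Z := (Kx * N * W4)%N in hW *; set Y := (Kx * PM)%N.
have hA' : (L * ((N + 82 * Kx) * W4) <= 83 * (L * Z))%N.
  have : ((N + 82 * Kx) * W4 <= 83 * Z)%N.
    by rewrite /Z -mulnA mulnA; rewrite mulnA leq_mul2r; apply/orP; right; lia.
  by move=> h; apply: leq_trans (leq_mul (leqnn L) h) _; rewrite mulnCA.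
have W1 : (W4 <= Z)%N by rewrite /Z; nia.
have -> : (16 * Kx * N * W4 = 16 * Z)%N by rewrite /Z !mulnA.
have -> : (5 * Kx * PM = 5 * Y)%N by rewrite /Y mulnA.
have -> : (Kx * L ^ 3 * (372 * (N * W4) + 10 * PM) = L * (L ^ 2 * (372 * Z + 10 * Y)))%N.
  by rewrite /Z /Y (expnS L 2); ring.
rewrite leq_mul2l; apply/orP; right.
have hK1 : ((Kx + 1) * W4 <= 2 * Z)%N by rewrite mulnDl; lia.
have h81 : (81 * Kx * W4 <= 81 * Z)%N by rewrite -mulnA leq_mul2l hW orbT.
move: hA' hK1 h81; set x := (L * ((N + _) * W4))%N; set y := ((Kx + 1) * W4)%N; set w := (81 * Kx * W4)%N.
move=> hA' hK1 h81.
have e1 : (L * (x + w) <= 164 * (L ^ 2 * Z))%N.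
  apply: leq_trans (_ : L * (83 * (L * Z) + 81 * (L * Z)) <= _)%N.
    rewrite leq_mul2l; apply/orP; right; apply: leq_add => //; apply: leq_trans h81 _; nia.
  by rewrite -mulnDl expnS expn1; nia.
have e2 : (L * (L * (16 * Z) + 5 * Y) <= 16 * (L ^ 2 * Z) + 5 * (L ^ 2 * Y))%N.
  by rewrite mulnDr expnS expn1; nia.
have lz : (L * Z <= L ^ 2 * Z)%N by rewrite leq_mul2r LL orbT.
have ly : (Y <= L ^ 2 * Y)%N by rewrite -{1}(mul1n Y) leq_mul2r expn_gt0 L1 orbT.
have zz : (Z <= L ^ 2 * Z)%N by rewrite -{1}(mul1n Z) leq_mul2r expn_gt0 L1 orbT.
have lw : (L * W4 <= L ^ 2 * Z)%N by apply: leq_mul.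
have -> : (L * (16 * Z) = 16 * (L * Z))%N by rewrite mulnCA.
have -> : (L ^ 2 * (372 * Z + 10 * Y) = 372 * (L ^ 2 * Z) + 10 * (L ^ 2 * Y))%N by ring.
move: e1 e2 lz ly zz lw; set p1 := (L * (x + w))%N.
have -> : (L * (16 * Z) = 16 * (L * Z))%N by rewrite mulnCA.
set p2 := (L * (16 * _ + _))%N; set p3 := (L ^ 2 * Z)%N; set p4 := (L ^ 2 * Y)%N; set p5 := (L * Z)%N; set p6 := (L * W4)%N.
by lia.
Qed.

End Trace.

Local Open Scope classical_set_scope.
Local Open Scope ring_scope.

(** * Total correctness with running times *)

Section Hoare.
Local Open Scope nat_scope.
Context {R : realType}.
Variable B : nat.
Implicit Types (st : state R) (c : cmd) (Q : state R -> nat -> Prop).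

(** The existence of an execution is a full specification of state and time, because executions are
    unique. *)
Definition wpt c Q st : Prop := exists st' T, exec B c st st' T /\ Q st' T.

Lemma wpt_conseq c Q1 Q2 st :
  (forall st' T, Q1 st' T -> Q2 st' T) -> wpt c Q1 st -> wpt c Q2 st.
Proof. by move=> H [st' [T [E /H q]]]; exists st', T. Qed.

Lemma wpt_skip Q st : Q st 1 -> wpt Skip Q st.
Proof. by exists st, 1; split=> //; constructor. Qed.

Lemma wpt_iset a e1 e2 Q st :
  ifits B st e1 -> ifits B st e2 ->
  Q (iupd st a (ival st e1) (ival st e2)) 1 -> wpt (ISet a e1 e2) Q st.
Proof. by move=> f1 f2 q; eexists _, _; split; [apply: exec_iset|]. Qed.

Lemma wpt_rset a e1 e2 Q st :
  ifits B st e1 -> rfits B st e2 ->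
  Q (rupd st a (ival st e1) (rval st e2)) 1 -> wpt (RSet a e1 e2) Q st.
Proof. by move=> f1 f2 q; eexists _, _; split; [apply: exec_rset|]. Qed.

Lemma wpt_seq c1 c2 Q st :
  wpt c1 (fun st1 T1 => wpt c2 (fun st2 T2 => Q st2 (T1 + T2)) st1) st ->
  wpt (Seq c1 c2) Q st.
Proof.
move=> [st1 [T1 [E1 [st2 [T2 [E2 q]]]]]]; exists st2, (T1 + T2).
by split=> //; apply: exec_seq E1 E2.
Qed.

Lemma wpt_if b c1 c2 Q st :
  bfits B st b ->
  (bval st b -> wpt c1 (fun st' T => Q st' T.+1) st) ->
  (~~ bval st b -> wpt c2 (fun st' T => Q st' T.+1) st) ->
  wpt (If b c1 c2) Q st.
Proof.
move=> fb; case hb: (bval st b) => H1 H2.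
  have [//|st' [T [E q]]] := H1.
  by exists st', T.+1; split=> //; apply: exec_if; rewrite ?hb.
have [//|st' [T [E q]]] := H2.
by exists st', T.+1; split=> //; apply: exec_if; rewrite ?hb.
Qed.

(** The ghost value [g] indexes the invariant and [pot g] bounds the time that remains. The strict
    decrease pays for the test of each round; the extra unit at the end pays for the test that
    fails. *)
Lemma wpt_while (G : Type) (I : G -> state R -> Prop) (pot : G -> nat) b c Q g st :
  I g st ->
  (forall g st, I g st -> bfits B st b) ->
  (forall g st, I g st -> bval st b ->
     wpt c (fun st' T => exists2 g', I g' st' & T + pot g' < pot g) st) ->
  (forall g' st' T, I g' st' -> ~~ bval st' b -> T + pot g' <= (pot g).+1 ->
     Q st' T) ->
  wpt (While b c) Q st.
Proof.
move=> Ig Hf Hs HQ.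
suff [st' [T [g' [E [Ig' nb le]]]]] : exists st' T g', exec B (While b c) st st' T /\
    [/\ I g' st', ~~ bval st' b & T + pot g' <= (pot g).+1].
  by exists st', T; split=> //; apply: HQ Ig' nb le.
have [k le_k] := ubnP (pot g).
elim: k g st Ig le_k {HQ} => // k IH g st Ig le_k.
have [hb|hb] := boolP (bval st b); last first.
  exists st, 1, g; split; last by split=> //; lia.
  by apply: exec_while_false => //; apply: Hf Ig.
have [st1 [T1 [E1 [g1 Ig1 lt1]]]] := Hs _ _ Ig hb.
have [|st' [T [g' [E [Ig' nb le]]]]] := IH g1 st1 Ig1; first by lia.
exists st', (T1 + T).+1, g'; split; last by split=> //; lia.
by apply: exec_while_true (Hf _ _ Ig) hb E1 E.
Qed.

(* A word bound X on the memory makes every expression whose value is at most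
   the product of eight words fit below X ^ 8. *)
Fixpoint iex (e : iexp) : nat :=
  match e with
  | ICst _ | IGet _ _ => 1
  | IAdd e1 e2 | ISub e1 e2 | IMul e1 e2 | IDiv e1 e2 => iex e1 + iex e2
  end.

Fixpoint iok (e : iexp) : bool :=
  (iex e <= 8) &&
  match e with
  | ICst k => k < 64
  | IGet _ e1 => iok e1
  | IAdd e1 e2 | ISub e1 e2 | IMul e1 e2 | IDiv e1 e2 => iok e1 && iok e2
  end.

Fixpoint rok (e : rexp) : bool :=
  match e with
  | RInt e1 | RGet _ e1 => iok e1
  | RAdd e1 e2 | RSub e1 e2 | RMul e1 e2 | RDiv e1 e2 => rok e1 && rok e2
  end.

Fixpoint bok (b : bexp) : bool :=
  match b with
  | BILe e1 e2 => iok e1 && iok e2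
  | BRLe e1 e2 => rok e1 && rok e2
  | BNot b1 => bok b1
  | BAnd b1 b2 => bok b1 && bok b2
  end.

Definition wb X st : Prop := forall a i, imem st a i < X.

Section Fits.
Variable X : nat.
Hypothesis X64 : 64 <= X.
Hypothesis XB : X ^ 8 <= B.

Lemma ival_lt st e : wb X st -> iok e -> ival st e < X ^ iex e.
Proof.
move=> w; have X1 : 1 < X by lia.
have X0 : 0 < X by lia.
have gt0 e' : 0 < iex e' by elim: e' => //= e1 h1 e2 h2; rewrite addn_gt0 h1.
have ge e' : X <= X ^ iex e' by rewrite -{1}(expn1 X) leq_exp2l // gt0.
elim: e => [k|a e1 _|e1 IH1 e2 IH2|e1 IH1 e2 IH2|e1 IH1 e2 IH2|e1 IH1 e2 IH2] /=.
- by move=> h; rewrite expn1; lia.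
- by move=> _; rewrite expn1.
- move=> /and3P[_ /IH1 h1 /IH2 h2]; rewrite expnD.
  by have := ge e1; have := ge e2; nia.
- move=> /and3P[_ /IH1 h1 /IH2 h2]; rewrite expnD.
  by have := ge e1; have := ge e2; nia.
- by move=> /and3P[_ /IH1 h1 /IH2 h2]; rewrite expnD; nia.
- move=> /and3P[_ /IH1 h1 /IH2 h2]; rewrite expnD.
  have := leq_div (ival st e1) (ival st e2).
  by have := ge e1; have := ge e2; nia.
Qed.

Lemma ifits_ok st e : wb X st -> iok e -> ifits B st e.
Proof.
move=> w; have hv e' : iok e' -> ival st e' < B.
  move=> h; apply: leq_trans (ival_lt w h) _; apply: leq_trans XB.
  by rewrite leq_exp2l; [case: e' h => /= *; lia|lia].
elim: e => [k|a e1 IH1|e1 IH1 e2 IH2|e1 IH1 e2 IH2|e1 IH1 e2 IH2|e1 IH1 e2 IH2] h.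
1: by rewrite /= (hv _ h).
1: by move: (hv _ h) => /= ->; move/andP: h => [_ /IH1].
all: move: (hv _ h) => /= ->.
all: by move/and3P: h => [_ /IH1 -> /IH2 ->].
Qed.

Lemma rfits_ok st e : wb X st -> rok e -> rfits B st e.
Proof.
move=> w; elim: e => [e|a e|e1 IH1 e2 IH2|e1 IH1 e2 IH2|e1 IH1 e2 IH2|e1 IH1 e2 IH2] /=.
1,2: exact: ifits_ok.
all: by move=> /andP[/IH1 -> /IH2 ->].
Qed.

Lemma bfits_ok st b : wb X st -> bok b -> bfits B st b.
Proof.
move=> w; elim: b => [e1 e2|e1 e2|b IH|b1 IH1 b2 IH2] //=.
- by move=> /andP[h1 h2]; rewrite !ifits_ok.
- by move=> /andP[h1 h2]; rewrite !rfits_ok.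
- by move=> /andP[/IH1 -> /IH2 ->].
Qed.

Lemma wb_iupd st a i x : wb X st -> x < X -> wb X (iupd st a i x).
Proof. by move=> w h b j; rewrite /= /upd; case: ifP. Qed.

Lemma wb_rupd st a i x : wb X st -> wb X (rupd st a i x).
Proof. by []. Qed.

End Fits.
End Hoare.

(** * The program *)

(* Words: array 4 holds scalars, 5/6 and 7/8 the out- and in-adjacency lists
   (links are ids plus one, 0 is the end), 9 the arrival flags, 10 the
   multipliers mu, 11 the level of a vertex, 12 and 13 the level lists and their
   sizes, 14 the parent edges and 15 the extraction order of the last Dijkstra
   run, 16 the subtree sums of the blame, 17 the degrees, 18 the powers of two,
   19 the membership flags of the top list.
   Reals: array 4 holds the internal distances, 5 the keys, 6 the tournament
   tree, 7 scalars, 8 the blame. *)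

Declare Scope cmd_scope.
Delimit Scope cmd_scope with cmd.
Notation "c1 ;; c2" := (Seq c1 c2) (at level 61, right associativity) : cmd_scope.
Local Open Scope cmd_scope.

Notation C := ICst (only parsing).
Notation V k := (IGet 4 (ICst k)).
Notation F k := (RGet 7 (ICst k)).
Notation setV k e := (ISet 4 (ICst k) e).
Notation setF k e := (RSet 7 (ICst k) e).
Notation nV := (IGet 0 (ICst 0)).
Notation mV := (IGet 0 (ICst 1)).
Notation sV := (IGet 0 (ICst 2)).
Notation BILt e1 e2 := (BILe (IAdd e1 (ICst 1)) e2).
Notation BRLt e1 e2 := (BNot (BRLe e2 e1)).
Notation eid := (ISub (V 13) (ICst 1)).

(** The tree has root 1, children [2 * i] and [2 * i + 1], and leaves [n + v]. This layout works for
    every [n], not just for powers of two. *)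
Definition treeset (h : iexp) (x : rexp) : cmd :=
  RSet 6 (IAdd nV h) x ;;
  setV 11 (IDiv (IAdd nV h) (C 2)) ;;
  While (BILe (C 1) (V 11))
    (If (BRLe (RGet 6 (IMul (C 2) (V 11))) (RGet 6 (IAdd (IMul (C 2) (V 11)) (C 1))))
       (RSet 6 (V 11) (RGet 6 (IMul (C 2) (V 11))))
       (RSet 6 (V 11) (RGet 6 (IAdd (IMul (C 2) (V 11)) (C 1)))) ;;
     setV 11 (IDiv (V 11) (C 2))).

Definition findmin : cmd :=
  setV 11 (C 1) ;;
  While (BILt (V 11) nV)
    (If (BRLe (RGet 6 (IMul (C 2) (V 11))) (RGet 6 (V 11)))
       (setV 11 (IMul (C 2) (V 11)))
       (setV 11 (IAdd (IMul (C 2) (V 11)) (C 1)))) ;;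
  setV 12 (ISub (V 11) nV).

Definition xval (b : rexp) : cmd :=
  If (BILe (C 1) (IGet 9 eid)) (setF 7 (RAdd b (RGet 1 eid)))
  (If (BAnd (BILt eid mV) (BAnd (BILe (V 4) (IAdd eid (V 1)))
        (BAnd (BILe eid (V 15)) (BILt (IGet 10 eid) (V 16)))))
      (setF 7 (RMul (RAdd b (RGet 1 eid))
                 (RAdd (RInt (C 1)) (RMul (F 6) (RInt (IGet 10 eid))))))
      (setF 7 (F 0))).

Definition improve : cmd :=
  If (BRLt (F 7) (RGet 5 (V 14)))
    (RSet 5 (V 14) (F 7) ;; ISet 14 (V 14) (V 13) ;; treeset (V 14) (F 7))
    Skip.

Definition scan (nx : nat) (test : bexp) : cmd :=
  While (BILe (C 1) (V 13))
    (setV 22 (IGet 1 eid) ;;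
     setV 14 (IGet 2 eid) ;;
     If test (xval (RGet 5 (V 22)) ;; improve) Skip ;;
     setV 13 (IGet nx eid)).

Notation lelem := (IGet 12 (IAdd (IMul (V 20) nV) (V 18))).
Notation test_in := (BILt (V 20) (IGet 11 (V 22))).
Notation test_out := (BILe (IGet 11 (V 14)) (V 20)).

(** Tails outside the list keep their distances during the run, so their edges are relaxed once in
    advance and only edges inside the list remain for the main loop. *)
Definition dij_init : cmd :=
  setV 18 (C 0) ;;
  While (BILt (V 18) (IGet 13 (V 20)))
    (setV 12 lelem ;;
     ISet 14 (V 12) (C 0) ;;
     treeset (V 12) (RGet 5 (V 12)) ;;
     setV 13 (IGet 7 (V 12)) ;;
     scan 8 test_in ;;
     setV 18 (IAdd (V 18) (C 1))).

Definition dij_main : cmd :=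
  setV 17 (C 0) ;;
  While (BRLt (RGet 6 (C 1)) (F 0))
    (findmin ;;
     ISet 15 (V 17) (V 12) ;;
     setV 17 (IAdd (V 17) (C 1)) ;;
     treeset (V 12) (F 0) ;;
     setV 13 (IGet 5 (V 12)) ;;
     scan 6 test_out).

Definition dij : cmd := dij_init ;; dij_main.

Definition tree_ok (R : realType) (n : nat) (T : nat -> R) : Prop :=
  forall i, (1 <= i < n)%N -> T i = Num.min (T (2 * i)%N) (T (2 * i + 1)%N).

Lemma tree_root_le (R : realType) n (T : nat -> R) i :
  tree_ok n T -> (1 <= i < 2 * n)%N -> T 1%N <= T i.
Proof.
move=> ok; elim/ltn_ind: i => i IH hi.
have [->//|i1] := eqVneq i 1%N.
apply: le_trans (IH (i %/ 2)%N _ _) _; [lia|lia|].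
rewrite (ok (i %/ 2)%N); last by lia.
rewrite ge_min; have [e|e] : i = (2 * (i %/ 2))%N \/ i = (2 * (i %/ 2) + 1)%N by lia.
  by rewrite -e lexx.
by rewrite -e lexx orbT.
Qed.

(** A command that rewrites many cells of one row is described by the final contents of the row, not
    by a chain of updates. *)
Definition seta (T : Type) (mem : nat -> nat -> T) (a : nat) (f : nat -> T) :
  nat -> nat -> T := fun b => if b == a then f else mem b.

Definition upd1 (T : Type) (f : nat -> T) (i : nat) (x : T) : nat -> T :=
  fun j => if j == i then x else f j.

Lemma updE (T : Type) (mem : nat -> nat -> T) a i x :
  upd mem a i x = seta mem a (upd1 (mem a) i x).
Proof.
apply/funext => b; apply/funext => j; rewrite /upd /seta /upd1.
by case: eqP => [->|] //=.
Qed.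

Lemma seta_seta (T : Type) (mem : nat -> nat -> T) a f g :
  seta (seta mem a f) a g = seta mem a g.
Proof. by apply/funext => b; rewrite /seta; case: eqP. Qed.

Lemma upd_upd (T : Type) (mem : nat -> nat -> T) a i x y :
  upd (upd mem a i x) a i y = upd mem a i y.
Proof.
by apply/funext => b; apply/funext => j; rewrite /upd; case: (_ && _).
Qed.

Lemma ival_imem (R : realType) (st st' : state R) e :
  imem st = imem st' -> ival st e = ival st' e.
Proof.
by move=> h; elim: e => //= [a e ->|e1 -> e2 ->|e1 -> e2 ->|e1 -> e2 ->|e1 -> e2 ->] //; rewrite h.
Qed.

Section Tree.
Context {R : realType}.
Variables (B X n H : nat).
Hypothesis X64 : (64 <= X)%N.
Hypothesis XB : (X ^ 8 <= B)%N.
Hypothesis n_gt0 : (0 < n)%N.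
Hypothesis nX : (2 * n < X)%N.
Hypothesis nH : (2 * n <= 2 ^ H)%N.
Implicit Types (st : state R) (Q : state R -> nat -> Prop).

Local Ltac fits := solve [apply: (bfits_ok X64 XB); [eassumption|by []]
 | apply: (ifits_ok X64 XB); [eassumption|by []]
 | apply: (rfits_ok X64 XB); [eassumption|by []]].

Lemma treesetP he xe Q st :
  wb X st -> iok (IDiv (IAdd nV he) (C 2)) -> rok xe -> imem st 0 0 = n ->
  (ival st he < n)%N -> tree_ok n (rmem st 6) ->
  (forall T' tm, tree_ok n T' ->
    (forall u, (u < n)%N ->
      T' (n + u)%N = if u == ival st he then rval st xe else rmem st 6 (n + u)%N) ->
    (tm <= 5 * H + 5)%N ->
    Q (State (upd (imem st) 4 11 0%N) (seta (rmem st) 6 T')) tm) ->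
  wpt B (treeset he xe) Q st.
Proof.
move=> w ok1 ok2 en hn okT HQ.
have ok1' : iok (IAdd nV he) by move/andP: ok1 => [_ /andP[]].
apply: wpt_seq; apply: wpt_rset; [exact: (ifits_ok X64 XB)|exact: (rfits_ok X64 XB)|].
set h := ival st he in hn HQ; set x := rval st xe in HQ.
have ev : ival st (IAdd nV he) = (n + h)%N by rewrite /= en.
rewrite ev; apply: wpt_seq.
set st1 := rupd _ _ _ _.
have w1 : wb X st1 by [].
have eh : ival st1 he = h by apply: ival_imem.
apply: wpt_iset; [fits|exact: (ifits_ok X64 XB)|].
have -> : ival st1 (IDiv (IAdd nV he) (C 2)) = ((n + h) %/ 2)%N by rewrite /= eh en.
rewrite /=; set T1 := upd1 (rmem st 6) (n + h)%N x.
(* The minimum may be wrong at the single node [g.1.1], which moves up to the root; [2 ^ g.2] bounds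
   this node and hence [g.2] the rounds that remain. *)
pose I (g : nat * (nat -> R) * nat) (s : state R) :=
  [/\ s = State (upd (imem st) 4 11 g.1.1) (seta (rmem st) 6 g.1.2),
    (g.1.1 < n)%N /\ (g.1.1 < 2 ^ g.2)%N,
    forall j, (1 <= j < n)%N -> j != g.1.1 ->
      g.1.2 j = Num.min (g.1.2 (2 * j)%N) (g.1.2 (2 * j + 1)%N) &
    forall u, (u < n)%N -> g.1.2 (n + u)%N = T1 (n + u)%N].
have wI g s : I g s -> wb X s.
  by case=> -> [h1 _] _ _ a i; rewrite /= /upd; case: ifP => // _; lia.
apply: (@wpt_while _ _ _ I (fun g => (5 * g.2)%N) _ _ _ ((n + h) %/ 2, T1, H)%N).
- split=> //=; first by rewrite /st1 /iupd /rupd /= [upd (rmem st) _ _ _]updE.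
  + by split; [lia|apply: leq_trans nH; lia].
  + move=> j hj jn; rewrite /T1 /upd1 okT //.
    have /negPf -> : j != (n + h)%N by lia.
    have /negPf -> : (2 * j)%N != (n + h)%N by lia.
    by have /negPf -> : (2 * j + 1)%N != (n + h)%N by lia.
- by move=> g s /wI ws; fits.
- move=> [[i T] k] s Ig; have ws := wI _ _ Ig.
  case: Ig => es [lin lik] okI leafI; rewrite /= in es lin lik okI leafI.
  move=> hb0; have hi : (1 <= i)%N by move: hb0; rewrite es.
  rewrite es.
  have k0 : (0 < k)%N by case: k lik => // /=; lia.
  have lik' : (i %/ 2 < 2 ^ k.-1)%N by move: lik; rewrite -[in (2 ^ k)%N](prednK k0) expnS; lia.
  pose T' := upd1 T i (Num.min (T (2 * i)%N) (T (2 * i + 1)%N)).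
  apply: wpt_seq; apply: wpt_if.
  + by rewrite -es; fits.
  + move=> hb; apply: wpt_rset; [by rewrite -es; fits|by rewrite -es; fits|].
    apply: wpt_iset; [by apply: (ifits_ok X64 XB) => //; move=> a b; rewrite /= /upd; case: ifP=> //; lia|by apply: (ifits_ok X64 XB) => //; move=> a b; rewrite /= /upd; case: ifP=> //; lia|].
    exists (i %/ 2, T', k.-1)%N; last by rewrite /=; lia.
    split=> //=.
    * congr State; first exact: upd_upd.
      rewrite /= updE seta_seta; congr seta; apply/funext => j; rewrite /T' /upd1 /seta /upd /=.
      by case: eqP => // _; move: hb; rewrite /= /upd /= => hb; rewrite min_l.
    * by split=> //; lia.
    * move=> j hj hji; rewrite /T' /upd1.
      have [->|nji] := eqVneq j i.
        have /negPf -> : (2 * i)%N != i by lia.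
        by have /negPf -> : (2 * i + 1)%N != i by lia.
      have /negPf -> : (2 * j)%N != i by lia.
      have /negPf -> : (2 * j + 1)%N != i by lia.
      exact: okI.
    * by move=> u hu; rewrite -leafI // /T' /upd1; have /negPf -> : (n + u)%N != i by lia.
  + move=> hb; apply: wpt_rset; [by rewrite -es; fits|by rewrite -es; fits|].
    apply: wpt_iset; [by apply: (ifits_ok X64 XB) => //; move=> a b; rewrite /= /upd; case: ifP=> //; lia|by apply: (ifits_ok X64 XB) => //; move=> a b; rewrite /= /upd; case: ifP=> //; lia|].
    exists (i %/ 2, T', k.-1)%N; last by rewrite /=; lia.
    split=> //=.
    * congr State; first exact: upd_upd.
      rewrite /= updE seta_seta; congr seta; apply/funext => j; rewrite /T' /upd1 /seta /upd /=.
      by case: eqP => // _; move: hb; rewrite /= /upd /= -ltNge => /ltW hb; rewrite min_r.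
    * by split=> //; lia.
    * move=> j hj hji; rewrite /T' /upd1.
      have [->|nji] := eqVneq j i.
        have /negPf -> : (2 * i)%N != i by lia.
        by have /negPf -> : (2 * i + 1)%N != i by lia.
      have /negPf -> : (2 * j)%N != i by lia.
      have /negPf -> : (2 * j + 1)%N != i by lia.
      exact: okI.
    * by move=> u hu; rewrite -leafI // /T' /upd1; have /negPf -> : (n + u)%N != i by lia.
- move=> [[i T] k] s tm [-> /= _ okI leafI]; rewrite /upd /= -leqNgt leqn0 => /eqP i0 le.
  rewrite i0 in okI *; apply: HQ.
  + by move=> j hj; apply: okI => //; lia.
  + by move=> u hu; rewrite leafI // /T1 /upd1 eqn_add2l.
  + by lia.
Qed.

Lemma findminP Q st :
  wb X st -> imem st 0 0 = n -> tree_ok n (rmem st 6) ->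
  (forall v sc tm, (v < n)%N -> rmem st 6 (n + v)%N = rmem st 6 1%N ->
    (forall k, k != 11%N -> k != 12%N -> sc k = imem st 4 k) -> sc 12%N = v ->
    (sc 11%N < X)%N -> (tm <= 5 * H + 5)%N ->
    Q (State (seta (imem st) 4 sc) (rmem st)) tm) ->
  wpt B findmin Q st.
Proof.
move=> w en ok HQ.
apply: wpt_seq; apply: wpt_iset; [fits|fits|].
apply: wpt_seq => /=.
(* Every node on the way down carries the value of the root, and [g.2] bounds the remaining
   depth. *)
pose I (g : nat * nat) (s : state R) :=
  [/\ s = State (upd (imem st) 4 11 g.1) (rmem st), (1 <= g.1 < 2 * n)%N,
     (n <= g.1 * 2 ^ g.2)%N & rmem st 6 g.1 = rmem st 6 1%N].
have wI g s : I g s -> wb X s.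
  by case=> -> h1 _ _ a i; rewrite /= /upd; case: ifP => // _; lia.
apply: (@wpt_while _ _ _ I (fun g => (4 * g.2)%N) _ _ _ (1, H)%N).
- by split=> //=; lia.
- by move=> g s /wI ws; fits.
- move=> [i k] s Ig; have ws := wI _ _ Ig.
  case: Ig => es /= hi hk hT; move=> hb0; have lti : (i < n)%N by move: hb0; rewrite es /= /upd /= en addn1.
  rewrite es.
  have k0 : (0 < k)%N by rewrite lt0n; apply: contraTneq hk => ->; rewrite expn0 muln1 -ltnNge.
  have e2 : (2 ^ k = 2 * 2 ^ k.-1)%N by rewrite -[in LHS](prednK k0) expnS.
  apply: wpt_if.
  + by rewrite -es; fits.
  + move=> hb; apply: wpt_iset; [by rewrite -es; fits|by rewrite -es; fits|].
    exists (2 * i, k.-1)%N; last by rewrite /=; lia.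
    split=> //=; first by congr State; exact: upd_upd.
    * by lia.
    * by rewrite (leq_trans hk) // e2; lia.
    * move: hb; rewrite /= /upd /= => hb; apply/eqP; rewrite eq_le.
      by rewrite -{1}hT hb /= (tree_root_le ok) //; lia.
  + move=> hb; apply: wpt_iset; [by rewrite -es; fits|by rewrite -es; fits|].
    exists (2 * i + 1, k.-1)%N; last by rewrite /=; lia.
    split=> //=; first by congr State; exact: upd_upd.
    * by lia.
    * by rewrite (leq_trans hk) // e2; lia.
    * move: hb; rewrite /= /upd /= -ltNge => hb.
      have hm : rmem st 6 i = Num.min (rmem st 6 (2 * i)%N) (rmem st 6 (2 * i + 1)%N).
        by apply: ok; lia.
      by move: hm hb; rewrite -hT minEle; case: ifP => // _ <-; rewrite ?ltxx.
- move=> [i k] s tm Ig; have ws := wI _ _ Ig.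
  case: Ig => es /= hi hk hT; move=> hb0 le; have lti : (n <= i)%N by move: hb0; rewrite es /= /upd /= en addn1 -leqNgt.
  rewrite es.
  apply: wpt_iset; [by rewrite -es; fits|by rewrite -es; fits|].
  rewrite /= /iupd /= updE updE seta_seta; apply: (HQ (i - n)%N) => //.
  + by lia.
  + by rewrite subnKC.
  + by move=> j h11 h12; rewrite /upd1 /seta /= (negPf h11) (negPf h12).
  + by rewrite /upd1 /seta /= en.
  + by rewrite /upd1 /seta /=; lia.
  + by lia.
Qed.

End Tree.

(** * Local Dijkstra *)

Fixpoint chain (nx : nat -> nat) (e : nat) (l : seq nat) : Prop :=
  if l is j :: l' then e = j.+1 /\ chain nx (nx j) l' else e = 0%N.

(** What a run of Dijkstra's algorithm may change. Distances, flags, multipliers and levels are not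
    among it, so the function [ext] of offers is constant during the run. *)
Definition dframe (R : realType) (st st' : state R) : Prop :=
  [/\ forall a, a \notin [:: 4; 14; 15]%N -> imem st' a = imem st a,
      forall k, k \notin [:: 11; 12; 13; 14; 17; 18; 22]%N ->
        imem st' 4 k = imem st 4 k,
      forall a, a \notin [:: 5; 6; 7]%N -> rmem st' a = rmem st a &
      forall k, k != 7%N -> rmem st' 7 k = rmem st 7 k].

Lemma dframe_trans (R : realType) (st1 st2 st3 : state R) :
  dframe st1 st2 -> dframe st2 st3 -> dframe st1 st3.
Proof.
move=> [a1 b1 c1 d1] [a2 b2 c2 d2]; split=> k hk.
- by rewrite a2 ?a1.
- by rewrite b2 ?b1.
- by rewrite c2 ?c1.
- by rewrite d2 ?d1.
Qed.

Definition candidate (R : realType) (st : state R) (j : nat) : bool :=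
  [&& j < imem st 0 1, imem st 4 4 <= j + imem st 4 1, j <= imem st 4 15 &
      imem st 10 j < imem st 4 16]%N.

(* Value of the key offered through edge j by a tail with key b; M, the value of
   +oo, when the edge may not be used. *)
Definition ext (R : realType) (st : state R) (j : nat) (b : R) : R :=
  if (1 <= imem st 9 j)%N then b + rmem st 1 j
  else if candidate st j then
    (b + rmem st 1 j) * (1 + rmem st 7 6 * (imem st 10 j)%:R)
  else rmem st 7 0.

Lemma ext_frame (R : realType) (st st' : state R) j b :
  dframe st st' -> ext st' j b = ext st j b.
Proof.
move=> [h1 h2 h3 h4]; rewrite /ext /candidate.
by rewrite (h1 0%N) // (h1 9%N) // (h1 10%N) // !h2 // h3 // !h4.
Qed.

Section Relax.
Context {R : realType}.
Variables (B X n H : nat).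
Hypothesis X64 : (64 <= X)%N.
Hypothesis XB : (X ^ 8 <= B)%N.
Hypothesis n_gt0 : (0 < n)%N.
Hypothesis nX : (2 * n < X)%N.
Hypothesis nH : (2 * n <= 2 ^ H)%N.
Implicit Types (st : state R) (Q : state R -> nat -> Prop).

Local Ltac fits := solve [apply: (bfits_ok X64 XB); [eassumption|by []]
 | apply: (ifits_ok X64 XB); [eassumption|by []]
 | apply: (rfits_ok X64 XB); [eassumption|by []]].

Definition leaf st u : R := rmem st 6 (n + u)%N.

Lemma xvalP b Q st : wb X st -> rok b -> (0 < imem st 4 13)%N ->
  (forall tm, (tm <= 3)%N ->
    Q (rupd st 7 7 (ext st (imem st 4 13).-1 (rval st b))) tm) ->
  wpt B (xval b) Q st.
Proof.
move=> w okb h0 HQ; rewrite -subn1 in HQ *.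
apply: wpt_if; first by fits.
  move=> h1; apply: wpt_rset; [fits|by apply: (rfits_ok X64 XB) => //=; rewrite okb|].
  by have := HQ 2%N isT; rewrite /ext; move: h1 => /= ->.
move=> /negPf h1; apply: wpt_if; first by fits.
  move=> h2; apply: wpt_rset; [fits|by apply: (rfits_ok X64 XB) => //=; rewrite okb|].
  have := HQ 3%N isT; rewrite /ext; move: h1 h2 => /= -> h2.
  by rewrite (_ : candidate _ _) //; move: h2; rewrite /candidate !addn1.
move=> h2; apply: wpt_rset; [fits|fits|].
have := HQ 3%N isT; rewrite /ext; move: h1 h2 => /= -> h2.
by rewrite (_ : candidate _ _ = false) //; move: h2; rewrite /candidate !addn1 => /negbTE.
Qed.

Definition relax1 (Y Y' lf lf' : nat -> R) (par par' : nat -> nat) h x e : Prop :=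
  if x < Y h then [/\ Y' = upd1 Y h x, par' = upd1 par h e &
                      forall u, (u < n)%N -> lf' u = upd1 lf h x u]
  else [/\ Y' = Y, par' = par & forall u, (u < n)%N -> lf' u = lf u].

Lemma relax_edgeP Q st :
  wb X st -> imem st 0 0 = n -> (0 < imem st 4 13)%N -> (imem st 4 14 < n)%N ->
  tree_ok n (rmem st 6) ->
  (forall st' tm, wb X st' -> dframe st st' ->
    (forall k, k != 11%N -> imem st' 4 k = imem st 4 k) ->
    imem st' 15 = imem st 15 -> tree_ok n (rmem st' 6) ->
    relax1 (rmem st 5) (rmem st' 5) (leaf st) (leaf st') (imem st 14) (imem st' 14)
      (imem st 4 14) (ext st (imem st 4 13).-1 (rmem st 5 (imem st 4 22)))
      (imem st 4 13) ->
    (tm <= 5 * H + 15)%N -> Q st' tm) ->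
  wpt B (xval (RGet 5 (V 22)) ;; improve) Q st.
Proof.
move=> w en h13 h14 ok HQ; apply: wpt_seq; apply: xvalP => // tm1 le1.
rewrite [rval _ _]/=; set x := ext _ _ _ in HQ *; set st1 := rupd _ _ _ _.
have w1 : wb X st1 by [].
apply: wpt_if; first by fits.
- rewrite /= /upd /= -ltNge => lt.
  apply: wpt_seq; apply: wpt_rset; [fits|fits|].
  apply: wpt_seq; apply: wpt_iset; [fits|fits|].
  set st2 := iupd _ _ _ _.
  have w2 : wb X st2.
    by apply: wb_iupd => //; apply: w.
  apply: (@treesetP R B X n H) => //.
  move=> T' tm2 okT' leafT' le2; apply: HQ.
  + by move=> a i; rewrite /= /upd; case: ifP => // _; [lia|exact: w2].
  + split.
    * move=> a; rewrite !inE !negb_or => /and3P[/negPf n4 /negPf n14 /negPf n15].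
      by apply/funext => i; rewrite /= /upd n4 /= n14.
    * move=> k; rewrite !inE !negb_or => /andP[/negPf n11 _].
      by rewrite /= /upd /= n11.
    * move=> a; rewrite !inE !negb_or => /and3P[/negPf n5 /negPf n6 /negPf n7].
      by apply/funext => i; rewrite /= /upd /seta n6 n5 /= n7.
    * by move=> k /negPf nk; rewrite /= /seta /= /upd /= nk.
  + by move=> k /negPf nk; rewrite /= /upd /= nk.
  + by [].
  + exact: okT'.
  + rewrite /relax1 lt; split.
    * by rewrite /= /seta /=; apply/funext => i; rewrite /upd /upd1 /=.
    * by rewrite /=; apply/funext => i; rewrite /upd /upd1 /=.
    * by move=> u hu; rewrite /leaf /= /seta /= leafT' // /upd1 /= /upd /=.
  + by lia.
- rewrite /= /upd /= negbK => le.
  apply: wpt_skip; apply: HQ => //.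
  + split=> //.
    * move=> a; rewrite !inE !negb_or => /and3P[/negPf n5 /negPf n6 /negPf n7].
      by apply/funext => i; rewrite /= /upd n7.
    * by move=> k /negPf nk; rewrite /= /upd /= nk.
  + by rewrite /relax1 ltNge le /=; split=> //; apply/funext => i.
  + by lia.
Qed.

Definition relaxed (st0 : state R) (tl hd : nat -> nat) (cond : nat -> bool) (l : seq nat)
    (Y Y' lf lf' : nat -> R) (par par' : nat -> nat) : Prop :=
  (forall u, (u < n)%N ->
     [/\ Y' u = Y u, par' u = par u & lf' u = lf u] \/
     exists j, [/\ j \in l, cond j, hd j = u, par' u = j.+1 &
                 [/\ Y' u = ext st0 j (Y (tl j)), Y' u < Y u & lf' u = Y' u]]) /\
  forall j, j \in l -> cond j -> Y' (hd j) <= ext st0 j (Y (tl j)).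

(** Offers are computed from the current keys of the tails. The hypothesis comparing two edges [j]
    and [j'] of the list says that the scan cannot improve any of these tails, so the keys in
    [relaxed] are those before the scan. *)
Lemma scanP (tl hd : nat -> nat) (cond : nat -> bool) nx test l Q st :
  wb X st -> imem st 0 0 = n -> nx \notin [:: 4; 14; 15]%N -> bok test ->
  chain (imem st nx) (imem st 4 13) l ->
  (forall j, j \in l -> [/\ tl j = imem st 1 j, hd j = imem st 2 j, (tl j < n)%N & (hd j < n)%N]) ->
  (forall st' j, dframe st st' -> j \in l -> imem st' 4 22 = tl j ->
     imem st' 4 14 = hd j -> bval st' test = cond j) ->
  (forall j j', j \in l -> cond j -> j' \in l -> cond j' -> hd j' = tl j ->
     rmem st 5 (tl j) <= ext st j' (rmem st 5 (tl j'))) ->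
  tree_ok n (rmem st 6) ->
  (forall st' tm, wb X st' -> dframe st st' ->
    (forall k, k \notin [:: 11; 13; 14; 22]%N -> imem st' 4 k = imem st 4 k) ->
    imem st' 15 = imem st 15 -> tree_ok n (rmem st' 6) ->
    relaxed st tl hd cond l (rmem st 5) (rmem st' 5) (leaf st) (leaf st')
      (imem st 14) (imem st' 14) ->
    (tm <= (5 * H + 30) * size l + 1)%N -> Q st' tm) ->
  wpt B (scan nx test) Q st.
Proof.
move=> w en nnx okt ch hl ht hsrc ok HQ.
pose I (g : seq nat * seq nat) (s : state R) := let: (p, r) := g in
  [/\ l = p ++ r, wb X s, dframe st s,
    (forall k, k \notin [:: 11; 13; 14; 22]%N -> imem s 4 k = imem st 4 k) &
    [/\ imem s 15 = imem st 15, tree_ok n (rmem s 6),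
     chain (imem st nx) (imem s 4 13) r &
    relaxed st tl hd cond p (rmem st 5) (rmem s 5) (leaf st) (leaf s)
      (imem st 14) (imem s 14)]].
apply: (@wpt_while _ _ _ I (fun g => ((5 * H + 30) * size g.2)%N) _ _ _ ([::], l)).
- split=> //; split=> //; split=> // u hu; by left.
- by move=> [p r] s [_ ws _ _ _]; fits.
- move=> [p r] s [el ws fr hk [h15 okT chr [rel1 rel2]]].
  case: r el chr => [|j r] el; first by rewrite /= => ->.
  case=> e13 chr _.
  have jl : j \in l by rewrite el mem_cat inE eqxx orbT.
  have [etl ehd tln hdn] := hl j jl.
  have [fra frb frc frd] := fr.
  apply: wpt_seq; apply: wpt_iset; [fits|fits|].
  have -> : ival s (IGet 1 eid) = tl j by rewrite /= e13 subn1 etl fra.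
  rewrite [ival _ (ICst _)]/=.
  set s1 := iupd _ _ _ _.
  have w1 : wb X s1 by apply: wb_iupd => //; rewrite etl.
  apply: wpt_seq; apply: wpt_iset; [fits|fits|].
  have -> : ival s1 (IGet 2 eid) = hd j by rewrite /= /upd /= e13 subn1 ehd fra.
  rewrite [ival _ (ICst _)]/=.
  set s2 := iupd _ _ _ _.
  have w2 : wb X s2 by apply: wb_iupd => //; lia.
  have fr2 : dframe st s2.
    apply: dframe_trans fr _; split=> //.
      move=> a; rewrite !inE !negb_or => /and3P[/negPf n4 _ _].
      by apply/funext => i; rewrite /= /upd n4.
    move=> k; rewrite !inE !negb_or => /and5P[_ _ _ /negPf n14 /and3P[_ _ /negPf n22]].
    by rewrite /= /upd /= n14 n22.
  have tj := ht _ _ fr2 jl erefl erefl.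
  have src k : k \in l -> cond k -> rmem s 5 (tl k) = rmem st 5 (tl k).
    move=> kl ck; have [_ _ lt _] := hl k kl.
    case: (rel1 (tl k) lt) => [[//]|[j' [j'p cj' hj' _ [e' lt' _]]]].
    have j'l : j' \in l by rewrite el mem_cat j'p.
    by move: (hsrc k j' kl ck j'l cj' hj'); rewrite leNgt -e' lt'.
  have nxt s3 tm3 : wb X s3 -> dframe st s3 -> (tm3 <= 5 * H + 20)%N ->
    (forall k, k \notin [:: 11; 13; 14; 22]%N -> imem s3 4 k = imem st 4 k) ->
    imem s3 4 13 = j.+1 ->
    imem s3 15 = imem st 15 -> tree_ok n (rmem s3 6) ->
    relaxed st tl hd cond (rcons p j) (rmem st 5) (rmem s3 5) (leaf st) (leaf s3)
      (imem st 14) (imem s3 14) ->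
    wpt B (setV 13 (IGet nx eid)) (fun st2 T2 => exists2 g', I g' st2 &
      (tm3 + T2 + 4 + (5 * H + 30) * size g'.2 < (5 * H + 30) * size (j :: r))%N) s3.
    move=> w3 fr3 le3 hk3 e3 h15' ok3 rel3.
    apply: wpt_iset; [fits| |].
      by apply: (ifits_ok X64 XB) w3 _.
    exists (rcons p j, r); last by rewrite /=; lia.
    have [fa fb fc fd] := fr3.
    have env : ival s3 (IGet nx eid) = imem st nx j by rewrite /= e3 subn1 fa.
    rewrite env; split.
    - by rewrite cat_rcons.
    - by apply: wb_iupd => //; apply: w.
    - apply: dframe_trans fr3 _; split=> //.
        move=> a; rewrite !inE !negb_or => /and3P[/negPf n4 _ _].
        by apply/funext => i; rewrite /= /upd n4.
      move=> k; rewrite !inE !negb_or => /and5P[_ _ /negPf n13 _ _].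
      by rewrite /= /upd /= n13.
    - move=> k hk'; rewrite -hk3 //; move: hk'.
      rewrite !inE !negb_or => /and4P[_ /negPf n13 _ _].
      by rewrite /= /upd /= n13.
    - by split.
  have hk2 k : k \notin [:: 11; 13; 14; 22]%N -> imem s2 4 k = imem st 4 k.
    move=> hk'; rewrite -hk //; move: hk'.
    rewrite !inE !negb_or => /and4P[_ _ /negPf n14 /negPf n22].
    by rewrite /= /upd /= n14 n22.
  apply: wpt_seq; apply: wpt_if; first by fits.
  + rewrite tj => cj; apply: relax_edgeP => //.
      by rewrite /= /upd /= fra.
      by rewrite /= /upd /= e13.
    move=> s3 tm3 w3 fr3 hk3 h15' ok3 rel3 le3.
    apply: (wpt_conseq _ (nxt s3 tm3 w3 (dframe_trans fr2 fr3) _ _ _ _ ok3 _)).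
    * by move=> s' T' [g' Ig' le']; exists g' => //; move: le' => /=; lia.
    * by lia.
    * move=> k hk'; rewrite hk3 ?hk2 //; move: hk'.
      by rewrite !inE !negb_or => /and4P[].
    * by rewrite hk3 // /= /upd /= e13.
    * by rewrite h15'.
    * have e22 : imem s2 4 22 = tl j by [].
      have e14 : imem s2 4 14 = hd j by [].
      have e13' : imem s2 4 13 = j.+1 by rewrite /= /upd /= e13.
      move: rel3; rewrite e22 e14 e13' [j.+1.-1]/= [rmem s2 5]/= (src j jl cj).
      rewrite (ext_frame _ _ fr2) [imem s2 14]/= [leaf s2]/=.
      set x := ext st j _; rewrite /relax1; case: ifP => [lt [eY ep el']|ge [eY ep el']].
        have lt0 : x < rmem st 5 (hd j).
          case: (rel1 (hd j) hdn) => [[<- _ _] //|[j' [_ _ _ _ [_ l2 _]]]].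
          exact: lt_trans lt l2.
        split.
          move=> u hu; have [->|nu] := eqVneq u (hd j).
            right; exists j; rewrite mem_rcons inE eqxx eY ep el' // /upd1 eqxx.
            by split.
          have nu' := negPf nu.
          case: (rel1 u hu) => [[a1 a2 a3]|[j' [b1 b2 b3 b4 b5]]].
            by left; rewrite eY ep el' // /upd1 nu'.
          right; exists j'; rewrite mem_rcons inE b1 orbT eY ep el' // /upd1 nu'.
          by split.
        move=> k; rewrite mem_rcons inE => /orP[/eqP -> _|kp ck].
          by rewrite eY /upd1 eqxx.
        rewrite eY /upd1; case: eqP => [eh|_]; last exact: rel2.
        by apply: le_trans (ltW lt) _; rewrite -eh; exact: rel2.
      split.
        move=> u hu; rewrite eY ep el' //.
        case: (rel1 u hu) => [[a1 a2 a3]|[j' [b1 b2 b3 b4 b5]]]; first by left.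
        by right; exists j'; rewrite mem_rcons inE b1 orbT.
      move=> k; rewrite mem_rcons inE => /orP[/eqP -> _|kp ck].
        by rewrite eY leNgt ge.
      by rewrite eY; exact: rel2.
  + rewrite tj => ncj; apply: wpt_skip; apply: (wpt_conseq _ (nxt s2 1%N w2 fr2 _ hk2 _ _ _ _)) => //.
      by move=> s' T' [g' Ig' le']; exists g' => //; move: le' => /=; lia.
      by lia.
    split.
      move=> u hu; case: (rel1 u hu) => [[a1 a2 a3]|[j' [b1 b2 b3 b4 b5]]]; first by left.
      by right; exists j'; rewrite mem_rcons inE b1 orbT.
    move=> k; rewrite mem_rcons inE => /orP[/eqP -> |kp ck].
      by rewrite (negPf ncj).
    exact: rel2.
- move=> [p r] s tm [el ws fr hk [h15 okT chr rel]] nb le.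
  apply: HQ => //; last by move: le => /=; lia.
  suff er : r = [::] by rewrite el er cats0.
  by case: r chr nb {el le} => //= j r [-> _].
Qed.
End Relax.

Lemma dframe_sc (R : realType) (st : state R) k x :
  k \in [:: 11; 12; 13; 14; 17; 18; 22]%N -> dframe st (iupd st 4 k x).
Proof.
move=> hk; split=> //.
  move=> a; rewrite !inE !negb_or => /and3P[/negPf n4 _ _].
  by apply/funext => i; rewrite /= /upd n4.
by move=> i hi; rewrite /= /upd /=; case: eqP hi => // ->; rewrite hk.
Qed.

Lemma dframe_row (R : realType) (st : state R) a i x :
  a \in [:: 14; 15]%N -> dframe st (iupd st a i x).
Proof.
rewrite !inE => ha; split=> //.
  move=> b; rewrite !inE !negb_or => /and3P[n4 n14 n15].
  apply/funext => k; rewrite /= /upd; case: eqP => // e; move: n14 n15.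
  by rewrite e; case/orP: ha => /eqP ->.
by move=> k _; rewrite /= /upd; case/orP: ha => /eqP ->.
Qed.

Lemma dframe_tree (R : realType) (st : state R) T' :
  dframe st (State (upd (imem st) 4 11 0%N) (seta (rmem st) 6 T')).
Proof.
have fr : dframe st (iupd st 4 11 0%N) by apply: dframe_sc.
apply: dframe_trans fr _; split=> // a /=.
by rewrite /seta; case: eqP => // ->.
Qed.

Lemma dframe_find (R : realType) (st : state R) sc :
  (forall k, k != 11%N -> k != 12%N -> sc k = imem st 4 k) ->
  dframe st (State (seta (imem st) 4 sc) (rmem st)).
Proof.
move=> h; split=> // a; rewrite !inE !negb_or /= /seta /=.
  by move=> /andP[/negPf ->].
by move=> /and3P[? ? _]; rewrite h.
Qed.

Section Dij.
Context {R : realType}.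
Variables (B X n H : nat).
Hypothesis X64 : (64 <= X)%N.
Hypothesis XB : (X ^ 8 <= B)%N.
Hypothesis n_gt0 : (0 < n)%N.
Hypothesis nX : (2 * n < X)%N.
Hypothesis nH : (2 * n <= 2 ^ H)%N.
Implicit Types (st : state R) (Q : state R -> nat -> Prop).

Local Ltac fits := solve [apply: (bfits_ok X64 XB); [eassumption|by []]
 | apply: (ifits_ok X64 XB); [eassumption|by []]
 | apply: (rfits_ok X64 XB); [eassumption|by []]].

Variables (st0 : state R) (tl hd : nat -> nat) (inl outl : nat -> seq nat) (sl : seq nat).
Let c := imem st0 4 20.
Let M := rmem st0 7 0.
Let D := rmem st0 5.
Hypothesis w0 : wb X st0.
Hypothesis en : imem st0 0 0 = n.
Hypothesis chi : forall v, (v < n)%N -> chain (imem st0 8) (imem st0 7 v) (inl v).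
Hypothesis cho : forall v, (v < n)%N -> chain (imem st0 6) (imem st0 5 v) (outl v).
Hypothesis inlP : forall v j, (v < n)%N -> j \in inl v ->
  [/\ tl j = imem st0 1 j, hd j = imem st0 2 j, (tl j < n)%N & hd j = v].
Hypothesis outlP : forall v j, (v < n)%N -> j \in outl v ->
  [/\ tl j = imem st0 1 j, hd j = imem st0 2 j, (hd j < n)%N & tl j = v].
Hypothesis in_out : forall v j, (v < n)%N -> j \in inl v -> j \in outl (tl j).
Hypothesis out_in : forall v j, (v < n)%N -> j \in outl v -> j \in inl (hd j).
Hypothesis slU : uniq sl.
Hypothesis sl_lt : forall v, v \in sl -> (v < n)%N.
Hypothesis slsz : imem st0 13 c = size sl.
Hypothesis slX : (size sl < X)%N.
Hypothesis slnth : forall i, (i < size sl)%N -> imem st0 12 (c * n + i) = nth 0%N sl i.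
Hypothesis slP : forall v, (v < n)%N -> (v \in sl) = (imem st0 11 v <= c)%N.
Hypothesis D0 : forall v, (v < n)%N -> 0 <= D v <= M.
Hypothesis M0 : 0 < M.
(** An offer may contain a penalty factor or be the constant [M]. Dijkstra's algorithm is therefore
    based on these two properties and not on additive nonnegative weights. *)
Hypothesis extP : forall v j b, (v < n)%N -> j \in inl v -> 0 <= b <= M ->
  (b < M -> b < ext st0 j b) /\ (b = M -> M <= ext st0 j b).
Hypothesis ok0 : tree_ok n (rmem st0 6).
Hypothesis lf0 : forall u, (u < n)%N -> leaf n st0 u = M.

Definition initd st u : Prop :=
  [/\ leaf n st u = rmem st 5 u, rmem st 5 u <= D u,
    (forall j, j \in inl u -> tl j \notin sl -> rmem st 5 u <= ext st0 j (D (tl j))) &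
    (imem st 14 u = 0%N /\ rmem st 5 u = D u) \/
    exists j, [/\ j \in inl u, tl j \notin sl, imem st 14 u = j.+1,
      rmem st 5 u = ext st0 j (D (tl j)) & rmem st 5 u < D u]].

Definition init_post st : Prop :=
  [/\ wb X st, dframe st0 st, tree_ok n (rmem st 6),
     (forall u, (u < n)%N -> u \notin sl -> rmem st 5 u = D u /\ leaf n st u = M) &
     (forall u, u \in sl -> initd st u)].

Lemma dij_initP Q :
  (forall st tm, init_post st ->
    (tm <= (5 * H + 30) * (\sum_(v <- sl) (size (inl v) + 2)) + 2)%N -> Q st tm) ->
  wpt B dij_init Q st0.
Proof.
move=> HQ; apply: wpt_seq; apply: wpt_iset; [fits|fits|].
pose I (k : nat) st := [/\ (k <= size sl)%N, wb X st, dframe st0 st /\ imem st 4 18 = k,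
  tree_ok n (rmem st 6) &
  (forall u, (u < n)%N -> u \notin take k sl -> rmem st 5 u = D u /\ leaf n st u = M) /\
  (forall u, u \in take k sl -> initd st u)].
apply: (@wpt_while _ _ _ I
  (fun k => (5 * H + 30) * (\sum_(v <- drop k sl) (size (inl v) + 2)))%N _ _ _ 0%N).
- split=> //; first by apply: wb_iupd => //=; lia.
  by split=> //; apply: dframe_sc.
  by rewrite take0; split=> // u hu _; split=> //; exact: lf0.
- by move=> k st [_ ws _ _ _]; fits.
- move=> k st [lek ws [fr e18] okT [h1 h2]].
  have [fra frb frc frd] := fr.
  have e20 : imem st 4 20 = c by rewrite frb.
  rewrite /= e20 e18 fra // slsz addn1 => ltk.
  set v := nth 0%N sl k.
  have vsl : v \in sl by rewrite mem_nth.
  have vn := sl_lt vsl.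
  have vnt : v \notin take k sl.
    have : uniq (take k.+1 sl) by rewrite take_uniq.
    by rewrite (take_nth 0%N ltk) rcons_uniq => /andP[].
  have [Yv lfv] := h1 v vn vnt.
  apply: wpt_seq; apply: wpt_iset; [fits|fits|].
  have -> : ival st lelem = v by rewrite /= e20 e18 !fra // en slnth.
  rewrite [ival _ (ICst _)]/=; set s1 := iupd _ _ _ _.
  have w1 : wb X s1 by apply: wb_iupd => //; lia.
  apply: wpt_seq; apply: wpt_iset; [fits|fits|].
  rewrite [ival _ (ICst _)]/= (_ : ival s1 (V 12) = v) //; set s2 := iupd _ _ _ _.
  have w2 : wb X s2 by apply: wb_iupd => //; lia.
  apply: wpt_seq; apply: (@treesetP R B X n H) => //; first by rewrite /= /upd /= fra.
  move=> T' t3 okT' leafT' le3; set s3 := State _ _.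
  have w3 : wb X s3 by move=> a i; rewrite /= /upd; case: ifP => // _; [lia|exact: w2].
  have fr3 : dframe st0 s3.
    apply: dframe_trans fr (dframe_trans (dframe_sc _ _ _) (dframe_trans (dframe_row _ _ _ _) (dframe_tree _ _))) => //.
  have Y3 : rmem s3 5 = rmem st 5 by [].
  have p3 : imem s3 14 = upd1 (imem st 14) v 0%N by apply/funext => i.
  have lf3 u : (u < n)%N -> leaf n s3 u = if u == v then D v else leaf n st u.
    by move=> hu; rewrite /leaf /s3 /= /seta /= leafT' //= /upd /= Yv.
  apply: wpt_seq; apply: wpt_iset; [fits|fits|].
  have -> : ival s3 (IGet 7 (V 12)) = imem st0 7 v by rewrite /= /upd /= fra.
  rewrite [ival _ (ICst _)]/=; set s4 := iupd _ _ _ _.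
  have w4 : wb X s4 by apply: wb_iupd => //.
  have fr4 : dframe st0 s4 by apply: dframe_trans fr3 (dframe_sc _ _ _).
  have [f4a f4b f4c f4d] := fr4.
  have Y4 : rmem s4 5 = rmem st 5 by [].
  have lf4 u : (u < n)%N -> leaf n s4 u = if u == v then D v else leaf n st u by exact: lf3.
  apply: wpt_seq.
  apply: (@scanP R B X n H X64 XB n_gt0 nX nH tl hd (fun j => tl j \notin sl) 8 test_in (inl v)) => //.
  + by rewrite f4a.
  + by rewrite f4a //; apply: chi.
  + move=> j jl; have [a1 a2 a3 a4] := inlP vn jl.
    by rewrite (f4a 1%N) // (f4a 2%N) //; split=> //; rewrite a4.
  + move=> s' j frs jl e22 e14; have [a1 a2 a3 a4] := inlP vn jl.
    have [fsa fsb _ _] := frs.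
    by rewrite /= addn1 e22 fsb // f4b // fsa // f4a // slP // -ltnNge.
  + move=> j j' jl cj j'l cj' e; have [_ _ _ e'] := inlP vn j'l.
    by move: cj; rewrite -e e' vsl.
  move=> s5 t5 w5 fr5 hk5 h15 ok5 [rel1 rel2] le5.
  have fr05 := dframe_trans fr4 fr5.
  have e18' : imem s5 4 18 = k by rewrite hk5.
  have ext4 j b : ext s4 j b = ext st0 j b by apply: ext_frame.
  have srcD j : j \in inl v -> tl j \notin sl -> rmem s4 5 (tl j) = D (tl j).
    move=> jl cj; have [_ _ a3 _] := inlP vn jl.
    rewrite Y4; have [] // := h1 (tl j) a3 _.
    by apply: contra cj => /mem_take.
  apply: wpt_iset; [fits|fits|].
  set s6 := iupd _ _ _ _.
  have Y6 : rmem s6 5 = rmem s5 5 by [].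
  have p6 : imem s6 14 = imem s5 14 by [].
  have lf6 u : leaf n s6 u = leaf n s5 u by [].
  exists k.+1; last first.
    rewrite (drop_nth 0%N ltk) big_cons -/v /=.
    move: le3 le5; rewrite mulnDr; set Z := (_ * \sum_(_ <- _) _)%N; nia.
  split=> //.
  + by apply: wb_iupd => //=; lia.
  + split; first by apply: dframe_trans fr05 (dframe_sc _ _ _).
    by rewrite /= /upd /= e18' addn1.
  + rewrite (take_nth 0%N ltk) -/v; split.
      move=> u hu; rewrite mem_rcons inE negb_or => /andP[/negPf nuv nut].
      have [a1 a2] := h1 u hu nut.
      case: (rel1 u hu) => [[b1 b2 b3]|[j [jl _ ej _ _]]].
        rewrite Y6 lf6 b1 b3 lf4 // nuv.
        by rewrite Y4.
      have [_ _ _ ev] := inlP vn jl.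
      by move: nuv; rewrite -ej ev eqxx.
    move=> u; rewrite mem_rcons inE => /orP[/eqP ->|ut].
      rewrite /initd Y6 lf6 p6.
      case: (rel1 v vn) => [[b1 b2 b3]|[j [jl cj ej b2 [b1 b3 b4]]]].
        rewrite b1 b2 b3 lf4 // eqxx Y4 Yv; split=> //.
          move=> j jl cj; have := rel2 j jl cj.
          have [_ _ _ ->] := inlP vn jl.
          by rewrite ext4 (srcD j jl cj) b1 Y4 Yv.
        by left; split=> //; rewrite -[imem s4 14]/(imem s3 14) p3 /upd1 eqxx.
      move: b1; rewrite ext4 srcD // => b1.
      split=> //.
        by apply: ltW; rewrite -Yv -Y4.
        move=> j' jl' cj'; have := rel2 j' jl' cj'.
        have [_ _ _ ->] := inlP vn jl'.
        by rewrite ext4 srcD.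
      right; exists j; split=> //.
      by rewrite -Yv -Y4.
    have nuv : (u == v) = false by apply: contraNF vnt => /eqP <-.
    have hu : (u < n)%N by apply: sl_lt; apply: mem_take ut.
    have hI := h2 u ut.
    case: (rel1 u hu) => [[b1 b2 b3]|[j [jl _ ej _ _]]]; last first.
      have [_ _ _ ev] := inlP vn jl.
      by move: nuv; rewrite -ej ev eqxx.
    move: hI; rewrite /initd Y6 lf6 p6 b1 b2 b3 lf4 // nuv Y4.
    by rewrite (_ : imem s4 14 u = imem st 14 u) // -[imem s4 14]/(imem s3 14) p3 /upd1 nuv.
- move=> k st tm [lek ws [fr e18] okT [h1 h2]] nb le.
  have [fra frb frc frd] := fr.
  have ek : k = size sl.
    apply/eqP; rewrite eqn_leq lek /=; move: nb.
    by rewrite /= e18 frb // fra // slsz addn1 -leqNgt.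
  rewrite ek take_size in h1 h2.
  apply: HQ; last by move: le; rewrite drop0; lia.
  by split.
Qed.

Lemma sum_rcons (f : nat -> nat) (l o : seq nat) v :
  v \in l -> uniq l -> v \notin o ->
  (\sum_(x <- l | x \notin o) f x = f v + \sum_(x <- l | x \notin rcons o v) f x)%N.
Proof.
move=> vl ul vo; rewrite big_mkcond (bigD1_seq v) //= vo; congr addn.
rewrite big_mkcond /= [RHS]big_mkcond; apply: eq_bigr => x _.
by rewrite mem_rcons inE negb_or; case: (x == v).
Qed.

Definition par_ok st (ord : seq nat) u : Prop :=
  (imem st 14 u = 0%N /\ rmem st 5 u = D u) \/
  exists j, [/\ j \in inl u, imem st 14 u = j.+1,
    rmem st 5 u = ext st0 j (rmem st 5 (tl j)), rmem st 5 u < D u &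
    tl j \in sl -> tl j \in ord].

(* ord is the extraction order: the tail of a parent edge precedes its head. *)
Definition ord_ok st (ord : seq nat) : Prop :=
  [/\ imem st 4 17 = size ord,
      (forall i, (i < size ord)%N -> imem st 15 i = nth 0%N ord i),
      uniq ord, {subset ord <= sl} &
      forall i j, (i < size ord)%N -> imem st 14 (nth 0%N ord i) = j.+1 ->
        tl j \in sl -> tl j \in take i ord].

(** Extraction resets a leaf to [M], and vertices with key [M] are never extracted; so the loop ends
    as soon as the root of the tree is [M]. *)
Definition main_inv (ord : seq nat) st : Prop :=
  [/\ wb X st, dframe st0 st, tree_ok n (rmem st 6), ord_ok st ord &
  [/\ (forall u, (u < n)%N -> u \notin sl -> rmem st 5 u = D u /\ leaf n st u = M),
     (forall u, u \in sl -> leaf n st u = if u \in ord then M else rmem st 5 u),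
     (forall u, u \in sl -> [/\ 0 <= rmem st 5 u <= D u, par_ok st ord u &
        forall j, j \in inl u -> tl j \notin sl -> rmem st 5 u <= ext st0 j (D (tl j))]),
     (forall u j, u \in ord -> j \in outl u -> hd j \in sl ->
        rmem st 5 (hd j) <= ext st0 j (rmem st 5 u)) &
     (forall u, u \in ord -> rmem st 5 u < M /\
        forall x, x \in sl -> x \notin ord -> rmem st 5 u <= rmem st 5 x)]].

Definition dij_post (ord : seq nat) st : Prop :=
  [/\ wb X st, dframe st0 st, tree_ok n (rmem st 6) /\
       (forall u, (u < n)%N -> leaf n st u = M), ord_ok st ord &
  [/\ (forall u, (u < n)%N -> u \notin sl -> rmem st 5 u = D u),
      (forall u, u \in sl -> 0 <= rmem st 5 u <= D u),
      (forall u, u \in sl -> par_ok st ord u),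
      (forall u j, u \in sl -> j \in inl u ->
         rmem st 5 u <= ext st0 j (rmem st 5 (tl j))) &
      (forall u, u \in sl -> u \notin ord -> rmem st 5 u = M)]].

Lemma dij_mainP Q st1 : init_post st1 ->
  (forall st ord tm, dij_post ord st ->
    (tm <= (5 * H + 30) * (\sum_(v <- sl) (size (outl v) + 3)) + 2)%N -> Q st tm) ->
  wpt B dij_main Q st1.
Proof.
move=> [w1 fr1 ok1 hout hin] HQ.
have slo v j : v \in sl -> j \in inl v -> tl j \notin sl -> (tl j < n)%N.
  by move=> /sl_lt vn jl _; have [] := inlP vn jl.
apply: wpt_seq; apply: wpt_iset; [fits|fits|].
pose pot (ord : seq nat) := ((5 * H + 30) * (\sum_(v <- sl | v \notin ord) (size (outl v) + 3)))%N.
apply: (@wpt_while _ _ _ main_inv pot _ _ _ [::]).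
- set s := iupd _ _ _ _.
  have fs : dframe st0 s by apply: dframe_trans fr1 (dframe_sc _ _ _).
  split=> //; first by apply: wb_iupd => //=; lia.
  split=> //.
  + by move=> u us; have [a1 _ _ _] := hin u us.
  + move=> u us; have [a1 a2 a3 a4] := hin u us.
    have hD := D0 (sl_lt us).
    split=> //.
    * apply/andP; split=> //; rewrite -[rmem s 5]/(rmem st1 5); case: a4 => [[_ ->]|[j [jl cj _ -> _]]].
        by case/andP: hD.
      have tn := slo _ _ us jl cj.
      have [e1 e2] := extP (sl_lt us) jl (D0 tn).
      have /andP[d0 dM] := D0 tn.
      have [lt|ge] := ltP (D (tl j)) M; first by apply: le_trans d0 (ltW (e1 lt)).
      have eM : D (tl j) = M by apply/eqP; rewrite eq_le dM ge.
      by apply: le_trans (e2 eM); apply: ltW.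
    * case: a4 => [?|[j [jl cj b1 b2 b3]]]; first by left.
      right; exists j; split=> //; last by rewrite (negPf cj).
      by rewrite -[rmem s 5]/(rmem st1 5) b2; have [-> _] := hout _ (slo _ _ us jl cj) cj.
- by move=> ord st [ws _ _ _ _]; fits.
- move=> ord st [ws fr okT [e17 e15 uo so oo] [h1 h2 h3 h4 h5]].
  have [fra frb frc frd] := fr.
  rewrite /= -ltNge frd // -/M => ltM.
  apply: wpt_seq; apply: (@findminP R B X n H) => //; first by rewrite fra.
  move=> v sc t1 vn eT hsc sc12 sc11 le1; set s1 := State _ _.
  have lv : leaf n st v = rmem st 6 1%N by [].
  have vsl : v \in sl.
    apply/negPn/negP => nv; have [_ e] := h1 v vn nv.
    by move: ltM; rewrite -lv e ltxx.
  have vo : v \notin ord.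
    apply/negP => ov; have := h2 v vsl; rewrite ov lv => e.
    by move: ltM; rewrite e ltxx.
  have Yv : rmem st 5 v = rmem st 6 1%N by have := h2 v vsl; rewrite (negPf vo) lv.
  have minv x : x \in sl -> x \notin ord -> rmem st 5 v <= rmem st 5 x.
    move=> xs xo; have := h2 x xs; rewrite (negPf xo) => <-; rewrite Yv.
    by apply: (tree_root_le okT); have := sl_lt xs; lia.
  have szo : (size ord < size sl)%N.
    have : uniq (v :: ord) by rewrite /= vo.
    move=> /uniq_leq_size; apply => x; rewrite inE => /orP[/eqP -> //|]; exact: so.
  have w1' : wb X s1.
    move=> a i; rewrite /= /seta; case: eqP => // _.
    have [->//|n11] := eqVneq i 11%N; have [->|n12] := eqVneq i 12%N; first by lia.
    by rewrite hsc.
  have f1 : dframe st0 s1 by apply: dframe_trans fr (dframe_find _).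
  apply: wpt_seq; apply: wpt_iset; [fits|fits|].
  have -> : ival s1 (V 17) = size ord by rewrite /= /seta /= hsc.
  have -> : ival s1 (V 12) = v by [].
  set s2 := iupd _ _ _ _.
  have w2 : wb X s2 by apply: wb_iupd => //; lia.
  have f2 : dframe st0 s2 by apply: dframe_trans f1 (dframe_row _ _ _ _).
  apply: wpt_seq; apply: wpt_iset; [fits|fits|].
  have -> : ival s2 (IAdd (V 17) (C 1)) = (size ord).+1.
    by rewrite /= /upd /= /seta /= hsc // e17 addn1.
  rewrite [ival _ (ICst _)]/=; set s3 := iupd _ _ _ _.
  have w3 : wb X s3 by apply: wb_iupd => //; lia.
  have f3 : dframe st0 s3 by apply: dframe_trans f2 (dframe_sc _ _ _).
  have [f3a f3b f3c f3d] := f3.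
  have e12 : imem s3 4 12 = v by rewrite /= /upd /= /seta /=.
  apply: wpt_seq; apply: (@treesetP R B X n H) => //.
    by rewrite f3a.
    by rewrite -[ival _ _]/(imem s3 4 12) e12.
  move=> T' t4 okT' leafT' le4; set s4 := State _ _.
  have w4 : wb X s4 by move=> a i; rewrite /= /upd; case: ifP => // _; [lia|exact: w3].
  have f4 : dframe st0 s4 by apply: dframe_trans f3 (dframe_tree _ _).
  have [f4a f4b f4c f4d] := f4.
  have e12' : imem s4 4 12 = v by rewrite -e12.
  apply: wpt_seq; apply: wpt_iset; [fits|fits|].
  have -> : ival s4 (IGet 5 (V 12)) = imem st0 5 v.
    by rewrite -[ival _ _]/(imem s4 5 (imem s4 4 12)) e12' f4a.
  rewrite [ival _ (ICst _)]/=; set s5 := iupd _ _ _ _.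
  have w5 : wb X s5 by apply: wb_iupd.
  have f5 : dframe st0 s5 by apply: dframe_trans f4 (dframe_sc _ _ _).
  have [f5a f5b f5c f5d] := f5.
  have Y5 : rmem s5 5 = rmem st 5 by [].
  have p5 : imem s5 14 = imem st 14 by [].
  have e15' : imem s5 15 = upd1 (imem st 15) (size ord) v by apply/funext.
  have lf5 u : (u < n)%N -> leaf n s5 u = if u == v then M else leaf n st u.
    move=> hu; rewrite /leaf -[rmem s5 6]/T' leafT' // -[ival s3 _]/(imem s3 4 12) e12.
    by rewrite -[rval s3 _]/(rmem s3 7 0) f3d.
  have ext5 j b : ext s5 j b = ext st0 j b by apply: ext_frame.
  have Yv0 : 0 <= rmem st 5 v <= M.
    have [/andP[-> /le_trans a1] _ _] := h3 v vsl; apply: a1.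
    by have /andP[] := D0 vn.
  have extv j : j \in outl v -> rmem st 5 v < ext st0 j (rmem st 5 v).
    move=> jl; have [_ _ hn _] := outlP vn jl.
    have [e1 _] := extP hn (out_in vn jl) Yv0; apply: e1.
    by rewrite Yv.
  apply: (@scanP R B X n H X64 XB n_gt0 nX nH tl hd (fun j => hd j \in sl) 6 test_out (outl v)) => //.
  + by rewrite f5a.
  + by rewrite f5a //; apply: cho.
  + move=> j jl; have [a1 a2 a3 a4] := outlP vn jl.
    by rewrite (f5a 1%N) // (f5a 2%N) //; split=> //; rewrite a4.
  + move=> s' j frs jl e22 e14; have [a1 a2 a3 a4] := outlP vn jl.
    have [fsa fsb _ _] := frs.
    by rewrite /= e14 fsb // f5b // fsa // f5a // slP.
  + move=> j j' jl cj j'l cj' e.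
    have [_ _ _ ->] := outlP vn jl; have [_ _ _ ->] := outlP vn j'l.
    by rewrite ext5 Y5; apply: ltW; apply: extv.
  move=> s6 t6 w6 fr6 hk6 h15 ok6 [rel1 rel2] le6.
  have f6 := dframe_trans f5 fr6.
  exists (rcons ord v); last first.
    rewrite /pot (sum_rcons (fun x => size (outl x) + 3)%N vsl slU vo) /=.
    by move: le1 le4 le6; set Z := (\sum_(_ <- _ | _) _)%N; nia.
  have e17' : imem s6 4 17 = (size ord).+1 by rewrite hk6.
  have imp u : (u < n)%N -> u \notin rcons ord v -> 
     [/\ rmem s6 5 u = rmem st 5 u, imem s6 14 u = imem st 14 u &
         leaf n s6 u = leaf n st u] \/
     exists j, [/\ j \in outl v, hd j \in sl, hd j = u, imem s6 14 u = j.+1 &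
       [/\ rmem s6 5 u = ext st0 j (rmem st 5 v), rmem s6 5 u < rmem st 5 u &
            leaf n s6 u = rmem s6 5 u]].
    move=> hu; rewrite mem_rcons inE negb_or => /andP[/negPf nuv _].
    case: (rel1 u hu) => [[b1 b2 b3]|[j [jl cj ej b2 [b1 b3 b4]]]].
      by left; rewrite b1 b2 b3 lf5 // nuv Y5 p5.
    have [_ _ _ etj] := outlP vn jl.
    by right; exists j; split=> //; split=> //; rewrite b1 ext5 etj Y5.
  (* An extracted key is final: offers from [v] exceed the key of [v], which is at least that of
     [u]. This also excludes loops at [v]. *)
  have same u : u \in rcons ord v -> [/\ rmem s6 5 u = rmem st 5 u,
      imem s6 14 u = imem st 14 u & leaf n s6 u = M].
    move=> uo'; have us : u \in sl.
      by move: uo'; rewrite mem_rcons inE => /orP[/eqP -> //|/so].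
    have Yuv : rmem st 5 u <= rmem st 5 v.
      move: uo'; rewrite mem_rcons inE => /orP[/eqP -> //|uo']; have [_] := h5 u uo'; exact.
    case: (rel1 u (sl_lt us)) => [[b1 b2 b3]|[j [jl cj ej b2 [b1 b3 b4]]]].
      rewrite b1 b2 b3 lf5 ?sl_lt // Y5 p5; split=> //; case: eqP => // nuv.
      by move: uo'; rewrite mem_rcons inE => /orP[/eqP //|uo']; rewrite h2 // uo'.
    have [_ _ _ etj] := outlP vn jl; move: b1 b3; rewrite ext5 etj Y5 => b1 b3.
    have a1 := extv j jl; rewrite -b1 in a1.
    by move: (lt_le_trans (lt_trans a1 b3) Yuv); rewrite ltxx.
  have le6u u : (u < n)%N -> rmem s6 5 u <= rmem st 5 u.
    move=> hu; have [uo'|uo'] := boolP (u \in rcons ord v).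
      by have [-> _ _] := same u uo'.
    by case: (imp u hu uo') => [[-> _ _] //|[j [_ _ _ _ [_ /ltW]]]].
  have [f6a f6b f6c f6d] := f6.
  have par6 u : u \in sl -> par_ok s6 (rcons ord v) u.
    move=> us; have hu := sl_lt us; have [_ pu _] := h3 u us.
    have old : rmem s6 5 u = rmem st 5 u -> imem s6 14 u = imem st 14 u ->
       par_ok s6 (rcons ord v) u.
      move=> b1 b2; case: pu => [[a1 a2]|[j [jl a1 a2 a3 a4]]].
        by left; rewrite b1 b2.
      right; exists j; rewrite b1 b2; split=> //; last first.
        by move=> /a4 a5; rewrite mem_rcons inE a5 orbT.
      rewrite a2; congr ext; have [_ _ tn _] := inlP hu jl.
      have [ts|ts] := boolP (tl j \in sl).
        have to : tl j \in rcons ord v by rewrite mem_rcons inE a4 ?orbT.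
        by have [-> _ _] := same _ to.
      have nt : tl j \notin rcons ord v.
        by apply: contra ts; rewrite mem_rcons inE => /orP[/eqP -> //|/so].
      case: (imp (tl j) tn nt) => [[-> _ _] //|[j' [_ cj' ej' _ _]]].
      by move: ts; rewrite -ej' cj'.
    have [uo'|uo'] := boolP (u \in rcons ord v).
      by have [b1 b2 _] := same u uo'; apply: old.
    case: (imp u hu uo') => [[b1 b2 _]|[j [jl cj ej b2 [b1 b3 b4]]]]; first exact: old.
    have [_ _ _ etj] := outlP vn jl.
    right; exists j; split=> //.
    - by rewrite -ej; apply: out_in vn jl.
    - have vo' : v \in rcons ord v by rewrite mem_rcons inE eqxx.
      by rewrite etj; have [-> _ _] := same _ vo'.
    - by apply: lt_le_trans b3 _; have [/andP[]] := h3 u us.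
    - by move=> _; rewrite etj mem_rcons inE eqxx.
  split=> //.
  + split=> //.
    * by rewrite size_rcons.
    * move=> i; rewrite size_rcons h15 e15' /upd1 nth_rcons ltnS leq_eqVlt.
      by case/orP => [/eqP ->|lt]; rewrite ?eqxx ?ltnn // lt (ltn_eqF lt) e15.
    * by rewrite rcons_uniq vo.
    * by move=> x; rewrite mem_rcons inE => /orP[/eqP -> //|/so].
    * move=> i j; rewrite size_rcons ltnS => li.
      have io : nth 0%N (rcons ord v) i \in rcons ord v by rewrite mem_nth // size_rcons ltnS.
      have [_ -> _] := same _ io.
      rewrite nth_rcons; move: li; rewrite leq_eqVlt => /orP[/eqP ->|lt].
        rewrite ltnn eqxx => a1 a2; rewrite -cats1 take_size_cat //.
        have [_ pv _] := h3 v vsl; case: pv => [[]|[j' [_ a3 _ _ a4]]]; first by rewrite a1.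
        by move: a3; rewrite a1 => -[e]; rewrite e in a2 *; exact: a4.
      by rewrite lt => a1 a2; rewrite -cats1 take_cat lt; apply: oo.
  + split.
    * move=> u hu us; have [a1 a2] := h1 u hu us.
      have nt : u \notin rcons ord v.
        by apply: contra us; rewrite mem_rcons inE => /orP[/eqP -> //|/so].
      case: (imp u hu nt) => [[-> _ ->] //|[j' [_ cj' ej' _ _]]].
      by move: us; rewrite -ej' cj'.
    * move=> u us; case: ifP => [uo'|/negbT uo']; first by have [] := same u uo'.
      case: (imp u (sl_lt us) uo') => [[-> _ ->]|[j [_ _ _ _ []]] //].
      by rewrite h2 //; move: uo'; rewrite mem_rcons inE negb_or => /andP[_ /negPf ->].
    * move=> u us; have [/andP[a1 a2] _ a3] := h3 u us.
      split; last 1 first.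
        by move=> j jl cj; apply: le_trans (le6u _ (sl_lt us)) (a3 j jl cj).
      - apply/andP; split; last by apply: le_trans (le6u _ (sl_lt us)) a2.
        have [uo'|uo'] := boolP (u \in rcons ord v); first by have [-> _ _] := same u uo'.
        case: (imp u (sl_lt us) uo') => [[-> _ _] //|[j [jl _ _ _ [-> _ _]]]].
        by apply: le_trans (ltW (extv j jl)); case/andP: Yv0.
      - exact: par6.
    * move=> u j uo' jl hs; have [-> _ _] := same u uo'.
      move: uo'; rewrite mem_rcons inE => /orP[/eqP eu|uo'].
        rewrite eu in jl *; have [_ _ _ etj] := outlP vn jl.
        by have := rel2 j jl hs; rewrite ext5 etj Y5.
      apply: le_trans (le6u _ (sl_lt hs)) _; exact: h4.
    * move=> u uo'; have [-> _ _] := same u uo'.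
      have [uM ux] : rmem st 5 u < M /\ rmem st 5 u <= rmem st 5 v.
        move: uo'; rewrite mem_rcons inE => /orP[/eqP ->|uo']; first by rewrite Yv.
        by have [a1 a2] := h5 u uo'; split=> //; apply: a2.
      split=> // x xs xo; apply: le_trans ux _.
      case: (imp x (sl_lt xs) xo) => [[-> _ _]|[j [jl _ _ _ [-> _ _]]]].
        by apply: minv => //; move: xo; rewrite mem_rcons inE negb_or => /andP[].
      exact: ltW (extv j jl).
- move=> ord st tm [ws fr okT hord [h1 h2 h3 h4 h5]] nb le.
  have [fra frb frc frd] := fr.
  have MT : M <= rmem st 6 1%N by move: nb; rewrite /= negbK frd.
  have nM u : u \in sl -> u \notin ord -> rmem st 5 u = M.
    move=> us uo; have := h2 u us; rewrite (negPf uo) => e.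
    apply/eqP; rewrite eq_le -{2}e; apply/andP; split.
      have [/andP[_ a] _ _] := h3 u us; apply: le_trans a _.
      by have /andP[] := D0 (sl_lt us).
    by apply: le_trans MT _; apply: (tree_root_le okT); have := sl_lt us; lia.
  apply: (HQ st ord); last first.
    have := leq_trans (leq_addr _ _) le.
    by rewrite /pot (eq_bigl xpredT) //; lia.
  split=> //.
  + split=> // u hu; have [us|us] := boolP (u \in sl); last by have [] := h1 u hu us.
    by rewrite h2 //; case: ifP => // /negbT uo; apply: nM.
  + split=> //.
    * by move=> u hu us; have [] := h1 u hu us.
    * by move=> u us; have [] := h3 u us.
    * by move=> u us; have [] := h3 u us.
    * move=> u j us jl; have hu := sl_lt us; have [_ _ tn ej] := inlP hu jl.
      have [ts|ts] := boolP (tl j \in sl); last first.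
        by have [_ _ a] := h3 u us; have [-> _] := h1 _ tn ts; apply: a.
      have [to|to] := boolP (tl j \in ord).
        by have := h4 (tl j) j to (in_out hu jl); rewrite ej; apply.
      rewrite (nM _ ts to).
      have MM : 0 <= M <= M by rewrite lexx ltW.
      have [_ e2] := extP hu jl MM; apply: le_trans (e2 erefl).
      have [/andP[_ a] _ _] := h3 u us; apply: le_trans a _.
      by have /andP[] := D0 hu.
Qed.

Lemma dijP Q :
  (forall st ord tm, dij_post ord st ->
    (tm <= (5 * H + 30) * (\sum_(v <- sl) (size (inl v) + size (outl v) + 5)) + 4)%N ->
    Q st tm) ->
  wpt B dij Q st0.
Proof.
move=> HQ; apply: wpt_seq; apply: dij_initP => st1 t1 h1 le1.
apply: (dij_mainP h1) => st2 ord t2 h2 le2; apply: (HQ _ ord) => //.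
apply: leq_trans (leq_add le1 le2) _.
rewrite addnACA -mulnDr -big_split /= leq_add2r leq_mul2l; apply/orP; right.
by apply: leq_sum => v _; lia.
Qed.

End Dij.

Local Open Scope cmd_scope.

(** * The commands of an insertion *)

Definition for_ (k : nat) (bnd : iexp) (c : cmd) : cmd :=
  While (BILt (V k) bnd) (c ;; setV k (IAdd (V k) (C 1))).

(** A vertex joins the list of level [L] with its first in-edge. Every listed vertex thus has
    positive degree, and the length of a list is at most its degree sum. *)
Definition add_edge : cmd :=
  setV 22 (IGet 1 (V 7)) ;;
  setV 14 (IGet 2 (V 7)) ;;
  ISet 6 (V 7) (IGet 5 (V 22)) ;;
  ISet 5 (V 22) (IAdd (V 7) (C 1)) ;;
  If (BILe (IGet 7 (V 14)) (C 0))
    (ISet 12 (IAdd (IMul (V 0) nV) (IGet 13 (V 0))) (V 14) ;;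
     ISet 13 (V 0) (IAdd (IGet 13 (V 0)) (C 1)) ;;
     ISet 11 (V 14) (V 0))
    Skip ;;
  ISet 8 (V 7) (IGet 7 (V 14)) ;;
  ISet 7 (V 14) (IAdd (V 7) (C 1)) ;;
  ISet 17 (V 22) (IAdd (IGet 17 (V 22)) (C 1)) ;;
  ISet 17 (V 14) (IAdd (IGet 17 (V 14)) (C 1)).

Notation BIEq e1 e2 := (BAnd (BILe e1 e2) (BILe e2 e1)).
Notation same_edge i := (BAnd (BIEq (IGet 1 i) (IGet 3 (C 0)))
  (BAnd (BIEq (IGet 2 i) (IGet 3 (C 1)))
        (BAnd (BRLe (RGet 1 i) (RGet 2 (C 0))) (BRLe (RGet 2 (C 0)) (RGet 1 i))))).

(** The prediction is searched from position [t] outwards in both directions, so the time for a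
    predicted edge is proportional to its error. *)
Definition lookup : cmd :=
  setV 8 (C 0) ;;
  setV 21 (C 0) ;;
  While (BAnd (BILe (V 8) (C 0)) (BILe (V 21) mV))
    (If (BAnd (BILt (IAdd (V 4) (V 21)) mV) (same_edge (IAdd (V 4) (V 21))))
        (setV 7 (IAdd (V 4) (V 21)) ;; setV 8 (C 1)) Skip ;;
     If (BAnd (BILe (V 21) (V 4)) (same_edge (ISub (V 4) (V 21))))
        (setV 7 (ISub (V 4) (V 21)) ;; setV 8 (C 1)) Skip ;;
     setV 21 (IAdd (V 21) (C 1))).

Definition newedge : cmd :=
  If (BILe (V 8) (C 0))
    (setV 7 (IAdd mV (V 4)) ;;
     ISet 1 (V 7) (IGet 3 (C 0)) ;;
     ISet 2 (V 7) (IGet 3 (C 1)) ;;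
     RSet 1 (V 7) (RGet 2 (C 0)) ;;
     add_edge)
    Skip ;;
  ISet 9 (V 7) (C 1).

Definition clock : cmd :=
  setV 19 (C 0) ;;
  If (BILe (V 4) (C 0)) (setV 19 (C 1)) Skip ;;
  If (BAnd (BILt (V 7) mV) (BAnd (BILe (V 7) (IAdd (V 4) (V 1))) (BILe (V 4) (IAdd (V 7) (V 1)))))
    Skip
    (setV 19 (C 1) ;;
     If (BILt (V 3) (V 1)) (setV 3 (IAdd (V 3) (C 1)))
       (setV 1 (IMul (C 2) (V 1)) ;; setV 2 (IAdd (V 2) (C 1)) ;; setV 3 (C 0))).

Definition settop : cmd :=
  If (BILe (C 1) (V 19)) (setV 5 (C 0) ;; setV 9 (V 0))
  (setV 9 (C 0) ;;
   If (BILe (V 4) (IMul (IDiv (V 4) (IGet 18 (V 2))) (IGet 18 (V 2))))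
     (setV 5 (C 0) ;;
      While (BAnd (BILt (V 9) (V 0)) (BILe (V 4) (IMul (IDiv (V 4) (IGet 18 (V 9))) (IGet 18 (V 9)))))
        (setV 9 (IAdd (V 9) (C 1))))
     (setV 6 (IAdd (V 5) (IGet 10 (V 7))) ;;
      While (BAnd (BILt (V 9) (V 2)) (BILt (IDiv (V 5) (IGet 18 (V 9))) (IDiv (V 6) (IGet 18 (V 9)))))
        (setV 9 (IAdd (V 9) (C 1))) ;;
      setV 5 (V 6))).

(** [V 16] is a strict upper bound for the multipliers of usable unarrived edges. The value 0
    excludes all of them, so this run relaxes arrived edges only. All vertices of the list are put
    on level [top], since the levels below are about to be rebuilt. *)
Definition relax : cmd :=
  setV 20 (V 9) ;;
  setV 16 (C 0) ;;
  setV 18 (C 0) ;;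
  for_ 18 (IGet 13 (V 20)) (ISet 11 lelem (V 20)) ;;
  dij ;;
  setV 18 (C 0) ;;
  for_ 18 (IGet 13 (V 20))
    (setV 12 lelem ;;
     RSet 4 (V 12) (RGet 5 (V 12)) ;;
     If (BRLe (F 0) (RGet 5 (V 12)))
       (RSet 3 (V 12) (RSub (RInt (C 0)) (RInt (C 1))))
       (RSet 3 (V 12) (RGet 5 (V 12)))).

(** [F 6] is the penalty per unit of multiplier, [F 8] the alarm threshold, and [V 15] the last
    candidate. At a high level the limit [V 16] exceeds every multiplier and the penalty is 0. *)
Definition parameters : cmd :=
  setV 20 (IAdd (V 10) (C 1)) ;;
  If (BILt (V 10) (V 2))
    (setV 16 (IGet 18 (V 10)) ;;
     setF 6 (RDiv (F 1) (RInt (IGet 18 (V 10)))) ;;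
     setF 8 (F 5) ;;
     setV 23 (IGet 18 (V 2)))
    (setV 16 (IAdd (IGet 18 (V 0)) (C 1)) ;;
     setF 6 (RInt (C 0)) ;;
     setF 8 (F 4) ;;
     setV 23 (IGet 18 (V 10))) ;;
  setV 15 (IAdd (IMul (IAdd (IDiv (V 4) (V 23)) (C 1)) (V 23)) (V 1)).

Definition select : cmd :=
  ISet 13 (V 10) (C 0) ;;
  setV 18 (C 0) ;;
  for_ 18 (IGet 13 (V 20))
    (setV 12 lelem ;;
     ISet 16 (V 12) (C 0) ;;
     If (BRLt (RMul (F 8) (RGet 5 (V 12))) (RGet 4 (V 12)))
       (ISet 16 (V 12) (IGet 17 (V 12)) ;;
        ISet 11 (V 12) (V 10) ;;
        ISet 12 (IAdd (IMul (V 10) nV) (IGet 13 (V 10))) (V 12) ;;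
        ISet 13 (V 10) (IAdd (IGet 13 (V 10)) (C 1)))
       Skip).

(** The extraction order is traversed backwards, so the children of a vertex have added their sums
    to it before it is treated. An unarrived parent edge is charged with the total degree of the
    alarmed vertices in the subtree below it. *)
Definition blame : cmd :=
  While (BILe (C 1) (V 17))
    (setV 17 (ISub (V 17) (C 1)) ;;
     setV 12 (IGet 15 (V 17)) ;;
     setV 13 (IGet 14 (V 12)) ;;
     If (BILe (C 1) (V 13))
       (setV 22 (IGet 1 eid) ;;
        If (BILe (IGet 11 (V 22)) (V 20))
          (ISet 16 (V 22) (IAdd (IGet 16 (V 22)) (IGet 16 (V 12)))) Skip ;;
        If (BILe (IGet 9 eid) (C 0))
          (RSet 8 eid (RAdd (RGet 8 eid) (RInt (IGet 16 (V 12)))) ;;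
           If (BRLe (F 3) (RGet 8 eid))
             (ISet 10 eid (IMul (C 2) (IGet 10 eid)) ;; RSet 8 eid (RInt (C 0))) Skip)
          Skip)
       Skip).

Definition restore : cmd :=
  setV 18 (C 0) ;;
  for_ 18 (IGet 13 (V 20)) (setV 12 lelem ;; RSet 5 (V 12) (RGet 4 (V 12))).

Definition level : cmd :=
  parameters ;; dij ;; select ;; If (BILt (V 10) (V 2)) blame Skip ;; restore.

Definition levels : cmd :=
  setV 10 (ISub (V 9) (C 1)) ;;
  While (BILe (C 1) (V 10)) (level ;; setV 10 (ISub (V 10) (C 1))).

Definition insertion : cmd :=
  lookup ;; newedge ;; clock ;; settop ;; relax ;; levels ;; setV 4 (IAdd (V 4) (C 1)).

(** A frame condition given by three lists: the rows of words, the scalars of row 4, and the rows of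
    reals that may change. Row 4 is framed cell by cell, because every command writes to it. *)
Definition fr (R : realType) (ia ks ra : seq nat) (st st' : state R) : Prop :=
  [/\ forall a, a \notin 4%N :: ia -> imem st' a = imem st a,
      forall k, k \notin ks -> imem st' 4 k = imem st 4 k &
      forall a, a \notin ra -> rmem st' a = rmem st a].

Lemma fr_refl (R : realType) ia ks ra (st : state R) : fr ia ks ra st st.
Proof. by []. Qed.

Lemma fr_trans (R : realType) ia ks ra (st1 st2 st3 : state R) :
  fr ia ks ra st1 st2 -> fr ia ks ra st2 st3 -> fr ia ks ra st1 st3.
Proof.
move=> [a1 b1 c1] [a2 b2 c2]; split=> k hk; first by rewrite a2 ?a1.
  by rewrite b2 ?b1.
by rewrite c2 ?c1.
Qed.

Lemma fr_sub (R : realType) ia ks ra ia' ks' ra' (st st' : state R) :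
  {subset ia <= ia'} -> {subset ks <= ks'} -> {subset ra <= ra'} ->
  fr ia ks ra st st' -> fr ia' ks' ra' st st'.
Proof.
move=> h1 h2 h3 [a b c]; split=> k hk.
- apply: a; apply: contra hk; rewrite !inE => /orP[->//|/h1 ->]; exact: orbT.
- by apply: b; apply: contra hk => /h2.
- by apply: c; apply: contra hk => /h3.
Qed.

Lemma fr_row (R : realType) ia ks ra (st0 st : state R) a i x : a != 4%N -> a \in ia ->
  fr ia ks ra st0 st -> fr ia ks ra st0 (iupd st a i x).
Proof.
move=> a4 ha; move=> /fr_trans; apply; split=> // k hk.
  apply/funext => j; rewrite /= /upd; case: eqP hk => // ->.
  by rewrite inE ha orbT.
by rewrite /= /upd eq_sym (negPf a4).
Qed.

Lemma fr_sc (R : realType) ia ks ra (st0 st : state R) k x : k \in ks ->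
  fr ia ks ra st0 st -> fr ia ks ra st0 (iupd st 4 k x).
Proof.
move=> hk; move=> /fr_trans; apply; split=> // i hi.
  by apply/funext => j; move: hi; rewrite inE negb_or => /andP[/negPf h _]; rewrite /= /upd h.
by rewrite /= /upd /=; case: eqP hi => // ->; rewrite hk.
Qed.

Lemma fr_rrow (R : realType) ia ks ra (st0 st : state R) a i x : a \in ra ->
  fr ia ks ra st0 st -> fr ia ks ra st0 (rupd st a i x).
Proof.
move=> ha; move=> /fr_trans; apply; split=> // k hk.
by apply/funext => j; rewrite /= /upd; case: eqP hk => // ->; rewrite ha.
Qed.

Ltac frt := repeat first [assumption | apply: fr_refl | apply: fr_sc; [by []|]
  | apply: fr_row; [by []|by []|] | apply: fr_rrow; [by []|]].

Lemma chain_ext nx nx' e l : {in l, nx =1 nx'} -> chain nx e l -> chain nx' e l.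
Proof.
elim: l e => //= j l IH e h [-> hc]; split=> //; rewrite -h ?mem_head //.
by apply: IH hc => i hi; apply: h; rewrite inE hi orbT.
Qed.

Lemma upd1_eq (T : Type) (f : nat -> T) i x : upd1 f i x i = x.
Proof. by rewrite /upd1 eqxx. Qed.

(** * Stepping rules for commands *)

Section Rules.
Context {R : realType}.
Variables (B X : nat).
Hypothesis X64 : (64 <= X)%N.
Hypothesis XB : (X ^ 8 <= B)%N.
Implicit Types (st : state R) (Q : state R -> nat -> Prop).

Lemma forP k bnd c (I : nat -> state R -> Prop) (cost : nat -> nat) i0 N Q st :
  iok bnd -> (k < 64)%N -> (i0 <= N)%N -> I i0 st ->
  (forall i st, (i <= N)%N -> I i st -> [/\ imem st 4 k = i, ival st bnd = N & wb X st]) ->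
  (forall i st, (i < N)%N -> I i st -> wpt B c (fun st' T =>
     [/\ imem st' 4 k = i, wb X st', I i.+1 (iupd st' 4 k i.+1) & (T <= cost i)%N]) st) ->
  (forall st' T, I N st' -> (T <= \sum_(i0 <= i < N) (cost i + 2) + 1)%N -> Q st' T) ->
  wpt B (for_ k bnd c) Q st.
Proof.
move=> okb k64 i0N I0 HI Hs HQ.
have okt : bok (BILt (V k) bnd).
  rewrite /= okb !andbT; have := okb; case: (bnd) => *; lia.
apply: (@wpt_while _ B nat (fun i s => (i <= N)%N /\ I i s)
   (fun i => \sum_(i <= j < N) (cost j + 2))%N _ _ _ i0) => //.
- by move=> i s [hi /(HI _ _ hi) [_ _ w]]; apply: (bfits_ok X64 XB).
- move=> i s [hi Ii]; have [e1 e2 w] := HI _ _ hi Ii.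
  rewrite /= e1 e2 addn1 => lt; apply: wpt_seq.
  apply: wpt_conseq (Hs _ _ lt Ii) => s' T [e1' w' Ii' le].
  apply: wpt_iset; [by apply: (ifits_ok X64 XB w'); rewrite /= k64|by apply: (ifits_ok X64 XB w'); rewrite /= k64|].
  exists i.+1; first by rewrite /= e1' addn1.
  by rewrite (big_ltn lt); set S := (\sum_(_ <= _ < _) _)%N; lia.
- move=> i s T [hi Ii]; have [e1 e2 w] := HI _ _ hi Ii.
  rewrite /= e1 e2 addn1 -leqNgt => le; have eN : i = N by lia.
  rewrite eN in Ii *; rewrite [X in (_ + X)%N]big_geq // => h; apply: HQ Ii _; lia.
Qed.

Lemma ws a e1 e2 i x c Q st : wb X st -> iok e1 -> iok e2 -> ival st e1 = i -> ival st e2 = x ->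
  (x < X)%N -> (wb X (iupd st a i x) -> wpt B c (fun s T => Q s T.+1) (iupd st a i x)) ->
  wpt B (ISet a e1 e2 ;; c) Q st.
Proof.
move=> w o1 o2 <- <- hx h; apply: wpt_seq; apply: wpt_iset; [exact: (ifits_ok X64 XB)|exact: (ifits_ok X64 XB)|].
by apply: wpt_conseq (h _) => //; apply: wb_iupd.
Qed.

Lemma wl a e1 e2 i x Q st : wb X st -> iok e1 -> iok e2 -> ival st e1 = i -> ival st e2 = x ->
  (x < X)%N -> (wb X (iupd st a i x) -> Q (iupd st a i x) 1%N) -> wpt B (ISet a e1 e2) Q st.
Proof.
move=> w o1 o2 <- <- hx h; apply: wpt_iset; [exact: (ifits_ok X64 XB)|exact: (ifits_ok X64 XB)|].
by apply: h; apply: wb_iupd.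
Qed.

Lemma rs a e1 e2 i x c Q st : wb X st -> iok e1 -> rok e2 -> ival st e1 = i -> rval st e2 = x ->
  (wb X (rupd st a i x) -> wpt B c (fun s T => Q s T.+1) (rupd st a i x)) ->
  wpt B (RSet a e1 e2 ;; c) Q st.
Proof.
move=> w o1 o2 <- <- h; apply: wpt_seq; apply: wpt_rset; [exact: (ifits_ok X64 XB)|exact: (rfits_ok X64 XB)|].
by apply: wpt_conseq (h _).
Qed.

Lemma rl a e1 e2 i x Q st : wb X st -> iok e1 -> rok e2 -> ival st e1 = i -> rval st e2 = x ->
  (wb X (rupd st a i x) -> Q (rupd st a i x) 1%N) -> wpt B (RSet a e1 e2) Q st.
Proof.
move=> w o1 o2 <- <- h; apply: wpt_rset; [exact: (ifits_ok X64 XB)|exact: (rfits_ok X64 XB)|].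
exact: h.
Qed.

(** The continuation is moved into both branches, which saves an intermediate postcondition where
    they join. *)
Lemma wif b c1 c2 c Q st : wb X st -> bok b ->
  (bval st b -> wpt B (c1 ;; c) (fun s T => Q s T.+1) st) ->
  (~~ bval st b -> wpt B (c2 ;; c) (fun s T => Q s T.+1) st) ->
  wpt B (If b c1 c2 ;; c) Q st.
Proof.
move=> w o h1 h2; apply: wpt_seq; apply: wpt_if; first exact: (bfits_ok X64 XB).
  move=> /h1 [s' [T [E q]]]; inversion E as [| | |? ? ? ? ? T1 T2 E1 E2| | |]; subst.
  by exists st2, T1; split=> //; exists s', T2.
move=> /h2 [s' [T [E q]]]; inversion E as [| | |? ? ? ? ? T1 T2 E1 E2| | |]; subst.
by exists st2, T1; split=> //; exists s', T2.
Qed.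

Lemma wskip c Q st : wpt B c (fun s T => Q s T.+1) st -> wpt B (Skip ;; c) Q st.
Proof. by move=> h; apply: wpt_seq; apply: wpt_skip. Qed.

Lemma wassoc c1 c2 c3 Q st : wpt B (c1 ;; c2 ;; c3) Q st -> wpt B ((c1 ;; c2) ;; c3) Q st.
Proof.
move=> [s' [T [E q]]]; inversion E as [| | |? ? ? ? ? T1 T2 E1 E2| | |]; subst.
inversion E2 as [| | |? ? ? ? ? T3 T4 E3 E4| | |]; subst.
exists s', ((T1 + T3) + T4)%N; split; last by rewrite -addnA.
by apply: exec_seq E4; apply: exec_seq E1 E3.
Qed.

End Rules.

(** * Adjacency lists and the lookup of an arriving edge *)

Section Pieces.
Context {R : realType}.
Variables (B X n m L : nat) (tl hd : nat -> nat) (wt : nat -> R).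
Hypothesis X64 : (64 <= X)%N.
Hypothesis XB : (X ^ 8 <= B)%N.
Implicit Types (st : state R) (Q : state R -> nat -> Prop) (A : seq nat).

Local Ltac bnd := solve [assumption | lia | match goal with w : wb _ _ |- _ => exact: w end].
Local Ltac ev tac := solve [by [] | rewrite /= /upd /=; tac; by [] | rewrite /= /upd /=; tac; lia].
Local Ltac iw i x tac := apply: (@ws _ _ _ X64 XB _ _ _ i x); [eassumption|by []|by []|ev tac|ev tac|bnd|].
Local Ltac iwl i x tac := apply: (@wl _ _ _ X64 XB _ _ _ i x); [eassumption|by []|by []|ev tac|ev tac|bnd|].
Local Ltac rw i x tac := apply: (@rs _ _ _ X64 XB _ _ _ i x); [eassumption|by []|by []|ev tac|ev tac|].
Local Ltac rwl i x tac := apply: (@rl _ _ _ X64 XB _ _ _ i x); [eassumption|by []|by []|ev tac|ev tac|].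

Definition adj_ok st A : Prop :=
  [/\ uniq A,
   (forall j, j \in A -> [/\ (tl j < n)%N, (hd j < n)%N, imem st 1 j = tl j,
      imem st 2 j = hd j & rmem st 1 j = wt j]),
   (forall v, (v < n)%N -> chain (imem st 8) (imem st 7 v) [seq j <- A | hd j == v]),
   (forall v, (v < n)%N -> chain (imem st 6) (imem st 5 v) [seq j <- A | tl j == v]) &
   (forall v, (v < n)%N -> imem st 17 v = (count (fun j => hd j == v) A + count (fun j => tl j == v) A)%N)].

(** [S_a] is represented twice: as the vertices of level at most [a], for constant-time membership
    tests, and as an explicit list, for traversal in time proportional to its size. *)
Definition lst st a (sl : seq nat) : Prop :=
  [/\ uniq sl, (forall v, v \in sl -> (v < n)%N), imem st 13 a = size sl,
   (forall i, (i < size sl)%N -> imem st 12 (a * n + i)%N = nth 0%N sl i) &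
   (forall v, (v < n)%N -> (v \in sl) = (imem st 11 v <= a)%N)].

Definition lists st lo : Prop :=
  forall a, (lo <= a <= L)%N -> exists sl, lst st a sl.

Definition top_ok st A : Prop := forall v, (v < n)%N ->
  (imem st 11 v <= L)%N = has (fun j => hd j == v) A.

Lemma lst_size st a sl : lst st a sl -> (size sl <= n)%N.
Proof.
move=> [u h _ _ _]; rewrite -(size_iota 0 n); apply: uniq_leq_size => // v /h.
by rewrite mem_iota.
Qed.

Lemma chain_head nx e l : chain nx e l -> (e <= 0)%N = nilp l.
Proof. by case: l => [|j l] /= => [->|[-> _]]. Qed.

Lemma add_edgeP A id Q st :
  wb X st -> imem st 0 0 = n -> imem st 4 0 = L -> (0 < L)%N -> adj_ok st A -> id \notin A ->
  imem st 1 id = tl id -> imem st 2 id = hd id -> rmem st 1 id = wt id ->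
  (tl id < n)%N -> (hd id < n)%N -> imem st 4 7 = id ->
  (id.+1 < X)%N -> (2 * size A + 2 < X)%N -> (L + n + 1 < X)%N ->
  lists st 1 -> top_ok st A ->
  (forall st' tm, wb X st' -> fr [:: 5; 6; 7; 8; 11; 12; 13; 17]%N [:: 14; 22]%N [::] st st' ->
     adj_ok st' (id :: A) -> lists st' 1 -> top_ok st' (id :: A) ->
     (forall v a, (v < n)%N -> (a < L)%N -> (imem st' 11 v <= a)%N = (imem st 11 v <= a)%N) ->
     (tm <= 20)%N -> Q st' tm) ->
  wpt B add_edge Q st.
Proof.
move=> w en eL L0 [uA hA chi cho hdg] nA e1 e2 e3 tn hn e7 idX szX LX hl ht HQ.
have [sl lsl] := hl L ltac:(lia); have szsl := lst_size lsl; have [usl sln szl nsl psl] := lsl.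
have cs (p : pred nat) : (count p A <= size A)%N by rewrite count_size.
have [d1 d2] := (hdg _ tn, hdg _ hn).
have d1X : (imem st 17 (tl id) + 2 < X)%N by have := cs (fun j => hd j == tl id); have := cs (fun j => tl j == tl id); lia.
have d2X : (imem st 17 (hd id) + 2 < X)%N by have := cs (fun j => hd j == hd id); have := cs (fun j => tl j == hd id); lia.
have fin s T : wb X s -> fr [:: 5; 6; 11; 12; 13]%N [:: 14; 22]%N [::] st s ->
   imem s 4 22 = tl id -> imem s 4 14 = hd id -> imem s 5 = upd1 (imem st 5) (tl id) id.+1 ->
   imem s 6 = upd1 (imem st 6) id (imem st 5 (tl id)) -> lists s 1 -> top_ok s (id :: A) ->
   (forall v a, (v < n)%N -> (a < L)%N -> (imem s 11 v <= a)%N = (imem st 11 v <= a)%N) -> (T <= 10)%N ->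
   wpt B (ISet 8 (V 7) (IGet 7 (V 14)) ;; ISet 7 (V 14) (IAdd (V 7) (C 1)) ;;
     ISet 17 (V 22) (IAdd (IGet 17 (V 22)) (C 1)) ;; ISet 17 (V 14) (IAdd (IGet 17 (V 14)) (C 1)))
     (fun s' T' => Q s' (T' + T)%N) s.
  move=> ws' F E22 E14 M5 M6 hl' ht' hlv leT; have [Fa Fb Fc] := F.
  iw id (imem st 7 (hd id)) ltac:(rewrite ?E14 ?Fb ?Fa //) => w1.
  iw (hd id) id.+1 ltac:(rewrite ?Fb // ?e7 ?addn1) => w2.
  iw (tl id) (imem st 17 (tl id)).+1 ltac:(rewrite ?E22 ?Fa // ?addn1) => w3.
  set x := (if hd id == tl id then (imem st 17 (tl id)).+1 else imem st 17 (hd id)).+1.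
  apply: (@wl _ _ _ X64 XB _ _ _ (hd id) x) => //.
    by rewrite /= /upd /= E14 Fa // /x; case: eqP => //= _; rewrite addn1.
    by rewrite /x; case: ifP => _; lia.
  move=> w4; apply: HQ => //; last by lia.
  - by frt; apply: fr_sub F => // i; rewrite !inE => /or4P[|||/orP[]] ->; rewrite ?orbT.
  - split.
    + by rewrite /= nA.
    + move=> j; rewrite inE => /orP[/eqP ->|jA]; first by rewrite /= /upd /= !Fa // Fc.
      by have [? ? ? ? ?] := hA j jA; rewrite /= /upd /= !Fa // Fc.
    + move=> v hv; rewrite [[seq _ <- _ | _]]/=.
      have ch : chain (upd1 (imem st 8) id (imem st 7 (hd id))) (imem st 7 v) [seq j <- A | hd j == v].
        apply: chain_ext (chi _ hv) => i; rewrite mem_filter /upd1 => /andP[_ iA].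
        by case: eqP => [ei|_] //; move: nA; rewrite -ei iA.
      have -> : imem (iupd (iupd (iupd (iupd s 8 id (imem st 7 (hd id))) 7 (hd id) id.+1) 17 (tl id) (imem st 17 (tl id)).+1) 17 (hd id) x) 8 = upd1 (imem st 8) id (imem st 7 (hd id)).
        by apply/funext => i; rewrite /= /upd /= /upd1 Fa.
      rewrite /= /upd /= Fa // eq_sym; case: eqP => [ev|_] //.
      by split=> //; rewrite upd1_eq ev; move: ch; rewrite -ev.
    + move=> v hv; rewrite [[seq _ <- _ | _]]/=.
      have ch : chain (upd1 (imem st 6) id (imem st 5 (tl id))) (imem st 5 v) [seq j <- A | tl j == v].
        apply: chain_ext (cho _ hv) => i; rewrite mem_filter /upd1 => /andP[_ iA].
        by case: eqP => [ei|_] //; move: nA; rewrite -ei iA.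
      rewrite -[imem (iupd _ _ _ _) 6]/(imem s 6) -[imem (iupd _ _ _ _) 5]/(imem s 5) M5 M6.
      rewrite -[upd1 (imem st 5) _ _ v]/(if v == tl id then id.+1 else imem st 5 v).
      rewrite eq_sym; case: eqP => [ev|_] //.
      by split=> //; rewrite upd1_eq ev; move: ch; rewrite -ev.
    + move=> v hv; rewrite /= /upd /= Fa // (hdg _ hv).
      rewrite /x [hd id == v]eq_sym [tl id == v]eq_sym.
      case: (eqVneq v (hd id)) => [->|nh]; case: (eqVneq (hd id) (tl id)) => [eh|neh] //=.
      * by rewrite -?eh ?eqxx ?d2; lia.
      * by rewrite ?(negPf neh) ?d2; lia.
      * by rewrite -?eh ?(negPf nh); lia.
      * by case: eqP => [->|_]; rewrite ?d1; lia.
iw 22%N (tl id) ltac:(rewrite ?e7 ?e1) => w1.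
iw 14%N (hd id) ltac:(rewrite ?e7 ?e2) => w2.
iw id (imem st 5 (tl id)) ltac:(rewrite ?e7) => w3.
iw (tl id) id.+1 ltac:(rewrite ?e7 ?addn1).
set s4 := iupd _ 5 _ _ => w4.
have F4 : fr [:: 5; 6; 11; 12; 13]%N [:: 14; 22]%N [::] st s4 by rewrite /s4; frt.
have E14 : imem s4 4 14 = hd id by [].
have hb : bval s4 (BILe (IGet 7 (V 14)) (C 0)) = ~~ has (fun j => hd j == hd id) A.
  rewrite -[bval _ _]/(imem st 7 (hd id) <= 0)%N (chain_head (chi _ hn)).
  by rewrite /nilp size_filter has_count lt0n negbK.
apply: (wif X64 XB) => //; rewrite hb => hh; last first.
  apply: wskip; apply: wpt_conseq (fin s4 6%N _ _ _ _ _ _ _ _ _ _) => //.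
  - by move=> s' T; rewrite addnC.
  - move=> v hv; rewrite -[imem s4 11 v]/(imem st 11 v) ht //= .
    by case: eqP => // <-; rewrite negbK in hh; rewrite hh.
apply: wassoc; iw (L * n + size sl)%N (hd id) ltac:(rewrite ?eL ?en ?szl) => w5.
apply: wassoc; iw L (size sl).+1 ltac:(rewrite ?eL ?szl ?addn1) => w6.
iw (hd id) L ltac:(rewrite ?eL).
set s7 := iupd _ 11 _ _ => w7.
have levh : (L < imem st 11 (hd id))%N by rewrite ltnNge ht.
have M11 v : imem s7 11 v = if v == hd id then L else imem st 11 v by [].
apply: wpt_conseq (fin s7 8%N _ _ _ _ _ _ _ _ _ _) => //.
- by move=> s' T; rewrite addnC.
- by rewrite /s7; frt.
- move=> a ha; have [l ll] := hl a ha; have szl' := lst_size ll; have [ul lln lsz lnth lp] := ll.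
  have [ea|na] := eqVneq a L.
    exists (rcons sl (hd id)); rewrite ea; split.
    + by rewrite rcons_uniq usl psl // -ltnNge levh.
    + by move=> v; rewrite mem_rcons inE => /orP[/eqP ->|/sln].
    + by rewrite size_rcons /s7 /= /upd /= eqxx.
    + move=> i; rewrite size_rcons ltnS leq_eqVlt nth_rcons /s7 /= /upd /=.
      case/orP=> [/eqP ->|hi]; first by rewrite ltnn !eqxx.
      by rewrite hi eqn_add2l (ltn_eqF hi) nsl.
    + by move=> v hv; rewrite mem_rcons inE M11 psl //; case: eqP => //= _; rewrite leqnn.
  exists l; split=> //.
  + by rewrite /s7 /= /upd /= (negPf na).
  + move=> i hi; rewrite /s7 /= /upd /= -lnth //; case: eqP => // e.
    have : ((a.+1 * n) <= L * n)%N by rewrite leq_mul2r; lia.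
    by rewrite mulSn; lia.
  + move=> v hv; rewrite M11 lp //; case: eqP => [->|//]; lia.
- move=> v hv; rewrite M11 /= eq_sym; case: eqP => [_|_]; [by rewrite leqnn|exact: ht].
- by move=> v a hv ha; rewrite M11; case: eqP => [->|//]; lia.
Qed.

Lemma bvalA st b1 b2 : bval st (BAnd b1 b2) = bval st b1 && bval st b2.
Proof. by []. Qed.

Definition hat_ok st : Prop := forall i, (i < m)%N ->
  [/\ imem st 1 i = tl i, imem st 2 i = hd i & rmem st 1 i = wt i].

Lemma lookupP id0 t Q st : wb X st -> imem st 0 1 = m -> imem st 4 4 = t -> (t < m)%N ->
  (2 * m + 2 < X)%N -> hat_ok st ->
  (forall i, (i < m)%N -> [&& tl i == imem st 3 0, hd i == imem st 3 1 & wt i == rmem st 2 0] = (i == id0)) ->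
  (forall st' tm, wb X st' -> fr [::] [:: 7; 8; 21]%N [::] st st' ->
     imem st' 4 8 = (id0 < m)%N -> ((id0 < m)%N -> imem st' 4 7 = id0) ->
     (tm <= 10 * (if (id0 < m)%N then maxn (id0 - t) (t - id0) else m) + 14)%N -> Q st' tm) ->
  wpt B lookup Q st.
Proof.
move=> w em e4 tm mX hh hid HQ; set dst := (if _ then _ else _) in HQ.
iw 8%N 0%N ltac:(idtac) => w1.
iw 21%N 0%N ltac:(idtac).
set s2 := iupd _ _ _ _ => w2.
(* [g.1] is the radius searched so far and [g.2] tells whether the edge has been found. The radius
   [dst] suffices for a predicted edge. *)
pose I (g : nat * bool) s := [/\ wb X s, fr [::] [:: 7; 8; 21]%N [::] st s,
  imem s 4 21 = g.1, imem s 4 8 = g.2 :> nat & if g.2 then (id0 < m)%N /\ imem s 4 7 = id0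
   else (g.1 <= dst.+1)%N /\ ((id0 < m)%N -> forall d, (d < g.1)%N -> id0 != (t + d)%N /\ ((d <= t)%N -> id0 != (t - d)%N))].
pose pot (g : nat * bool) := if g.2 then 0%N else (10 * (dst.+1 - g.1) + 1)%N.
have sameP s e : fr [::] [:: 7; 8; 21]%N [::] st s -> (ival s e < m)%N ->
   bval s (same_edge e) = (ival s e == id0).
  move=> [Fa _ Fc] he; have [h1 h2 h3] := hh _ he.
  by rewrite -hid //= !Fa // !Fc // h1 h2 h3 -!eqn_leq -eq_le.
have nope s : fr [::] [:: 7; 8; 21]%N [::] st s -> (forall k, k \notin [:: 7; 8; 21]%N -> imem s 4 k = imem st 4 k) by case.
apply: (@wpt_while _ B _ I pot _ _ _ (0%N, false)).
- by split=> //; rewrite ?/s2; frt.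
- by move=> g s [ws' _ _ _ _]; apply: (bfits_ok X64 XB).
- move=> [d fl] s [ws' F /= e21 /= e8 /= hg]; have [Fa Fb Fc] := F.
  have e4s : imem s 4 4 = t by rewrite Fb.
  have ems : imem s 0 1 = m by rewrite Fa.
  rewrite /= e21 e8 ems /= => /andP[+ dm]; case: fl e8 hg => //= e8 [hd1 hd2] _.
  have hd1' : (d <= dst)%N.
    rewrite leqNgt; apply/negP => h; have ed : d = dst.+1 by lia.
    move: (hd2); rewrite ed /dst; case: ifP => hm h2; last by move: dm; rewrite ed /dst hm ltnn.
    have [h3 h4] := h2 isT (maxn (id0 - t) (t - id0))%N (ltnSn _).
    by move: h3 h4; clear; lia.
  have last s' T' : wb X s' -> fr [::] [:: 7; 8; 21]%N [::] st s' -> imem s' 4 21 = d ->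
     (T' <= 8)%N ->
     ((imem s' 4 8 = 1%N /\ (id0 < m)%N /\ imem s' 4 7 = id0) \/
      (imem s' 4 8 = 0%N /\ ((id0 < m)%N -> id0 != (t + d)%N /\ ((d <= t)%N -> id0 != (t - d)%N)))) ->
     wpt B (setV 21 (IAdd (V 21) (C 1))) (fun st' T => exists2 g', I g' st' & (T + T' + pot g' < pot (d, false))%N) s'.
    move=> wss Fs e21' leT hc; iwl 21%N d.+1 ltac:(rewrite ?e21' ?addn1) => wn.
    case: hc => [[h8 [h1 h2]]|[h8 h]].
      exists (d.+1, true); last by rewrite /pot /=; lia.
      by split=> //; frt.
    exists (d.+1, false); last by rewrite /pot /=; lia.
    split=> //=; [by frt|split=> //].
    move=> hm d' hd'; have [->|ne] := eqVneq d' d; first exact: h.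
    by apply: hd2 => //; lia.
  apply: (wif X64 XB) => //; rewrite bvalA.
    move=> /andP[hlt]; rewrite /= e4s e21 ems in hlt.
    rewrite sameP //=; last by rewrite e4s e21; lia.
    rewrite e4s e21 => /eqP hid0.
    apply: wassoc; iw 7%N id0 ltac:(rewrite ?e4s ?e21 ?hid0) => w3.
    iw 8%N 1%N ltac:(idtac) => w4.
    set s4 := iupd _ 4 8 _ in w4 *.
    have F4 : fr [::] [:: 7; 8; 21]%N [::] st s4 by rewrite /s4; frt.
    have id0m : (id0 < m)%N by lia.
    apply: (wif X64 XB) => //.
      move=> hb; apply: wassoc; apply: (@ws _ _ _ X64 XB _ _ _ 7%N id0) => //; [|lia|move=> w5].
        move: hb; rewrite bvalA => /andP[h5].
        by rewrite sameP //= /upd /= e4s e21; [move=> /eqP|lia].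
      iw 8%N 1%N ltac:(idtac) => w6.
      apply: wpt_conseq (last _ 8%N _ _ _ _ _) => //; [|by frt|by left].
      by move=> s' T [g' h1 h2]; exists g' => //; lia.
    move=> _; apply: wskip; apply: wpt_conseq (last _ 8%N _ _ _ _ _) => //; [|by left].
    by move=> s' T [g' h1 h2]; exists g' => //; lia.
  move=> hn; apply: wskip; apply: (wif X64 XB) => //.
    rewrite bvalA => /andP[hdt].
    rewrite /= e21 e4s in hdt; rewrite sameP //= e4s e21; last by lia.
    move=> /eqP hid0; have id0m : (id0 < m)%N by lia.
    apply: wassoc; iw 7%N id0 ltac:(rewrite ?e4s ?e21 ?hid0) => w3.
    iw 8%N 1%N ltac:(idtac) => w4.
    apply: wpt_conseq (last _ 8%N _ _ _ _ _) => //; [|by frt|by left].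
    by move=> s' T [g' h1 h2]; exists g' => //; lia.
  move=> hn2; apply: wskip; apply: wpt_conseq (last _ 8%N _ _ _ _ _) => //.
    by move=> s' T [g' h1 h2]; exists g' => //; lia.
  right; split=> // hm; split.
    apply: contra hn => /eqP e; have E : ival s (IAdd (V 4) (V 21)) = id0 by rewrite /= e4s e21 -e.
    by rewrite sameP ?E // eqxx andbT /= e4s e21 ems; lia.
  move=> hdt; apply: contra hn2 => /eqP e; have E : ival s (ISub (V 4) (V 21)) = id0 by rewrite /= e4s e21 -e.
  by rewrite bvalA sameP ?E // eqxx andbT /= e4s e21.
- move=> [d fl] s T [ws' F /= e21 /= e8 /= hg] nb le; have [Fa Fb Fc] := F.
  apply: HQ => //.
  + rewrite e8; move: nb; rewrite /= e8 e21 Fa // em; case: fl e8 hg {le} => //= e8 hg; first by rewrite (proj1 hg).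
    move=> hmd; case: ltnP => // hm; case: hg => _ /(_ hm) h.
    have [h1 h2] := h (maxn (id0 - t) (t - id0))%N ltac:(lia); lia.
  + move=> hm; move: nb; rewrite /= e8 e21 Fa // em; case: fl e8 hg {le} => //= e8 hg; first by case: hg.
    move=> hmd; case: hg => _ /(_ hm) h.
    have [h1 h2] := h (maxn (id0 - t) (t - id0))%N ltac:(lia); lia.
  + by rewrite -/dst; move: le; rewrite /pot /=; lia.
Qed.

End Pieces.

(** * Unpredicted edges, the guess, and the choice of the top level *)

Section Steps.
Context {R : realType}.
Variables (B X n m L : nat) (tl hd : nat -> nat) (wt : nat -> R).
Hypothesis X64 : (64 <= X)%N.
Hypothesis XB : (X ^ 8 <= B)%N.
Implicit Types (st : state R) (Q : state R -> nat -> Prop) (A : seq nat).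

Local Ltac bnd := solve [assumption | lia | match goal with w : wb _ _ |- _ => exact: w end].
Local Ltac ev tac := solve [by [] | rewrite /= /upd /=; tac; by [] | rewrite /= /upd /=; tac; lia].
Local Ltac iw i x tac := apply: (@ws _ _ _ X64 XB _ _ _ i x); [eassumption|by []|by []|ev tac|ev tac|bnd|].
Local Ltac iwl i x tac := apply: (@wl _ _ _ X64 XB _ _ _ i x); [eassumption|by []|by []|ev tac|ev tac|bnd|].
Local Ltac rw i x tac := apply: (@rs _ _ _ X64 XB _ _ _ i x); [eassumption|by []|by []|ev tac|ev tac|].
Local Ltac rwl i x tac := apply: (@rl _ _ _ X64 XB _ _ _ i x); [eassumption|by []|by []|ev tac|ev tac|].
Local Ltac ifs := apply: (wif X64 XB); [eassumption|by []| |].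

Notation adj_ok := (adj_ok n tl hd wt).
Notation hat_ok := (hat_ok m tl hd wt).
Notation lists := (lists n L).
Notation top_ok := (top_ok n L hd).
Notation lst := (lst n).

Lemma newedgeP A id0 t Q st :
  wb X st -> imem st 0 0 = n -> imem st 0 1 = m -> imem st 4 4 = t -> imem st 4 0 = L -> (0 < L)%N ->
  (t < m)%N -> adj_ok st A -> hat_ok st -> lists st 1 -> top_ok st A -> (forall j, j \in A -> (j < m + t)%N) ->
  imem st 4 8 = (id0 < m)%N -> ((id0 < m)%N -> imem st 4 7 = id0) ->
  (~~ (id0 < m)%N -> [/\ tl (m + t)%N = imem st 3 0, hd (m + t)%N = imem st 3 1, wt (m + t)%N = rmem st 2 0,
     (tl (m + t) < n)%N & (hd (m + t) < n)%N]) ->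
  (2 * m + 2 < X)%N -> (2 * size A + 2 < X)%N -> (L + n + 1 < X)%N ->
  (forall st' tm, let id := (if id0 < m then id0 else m + t)%N in
     wb X st' -> fr [:: 1; 2; 5; 6; 7; 8; 9; 11; 12; 13; 17]%N [:: 7; 14; 22]%N [:: 1%N] st st' ->
     imem st' 4 7 = id -> (forall i, imem st' 9 i = if i == id then 1%N else imem st 9 i) ->
     adj_ok st' (if (id0 < m)%N then A else (m + t)%N :: A) -> hat_ok st' -> lists st' 1 ->
     top_ok st' (if (id0 < m)%N then A else (m + t)%N :: A) ->
     (forall v a, (v < n)%N -> (a < L)%N -> (imem st' 11 v <= a)%N = (imem st 11 v <= a)%N) ->
     ((id0 < m)%N -> fr [:: 9]%N [::] [::] st st') ->
     (tm <= 30)%N -> Q st' tm) ->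
  wpt B newedge Q st.
Proof.
move=> w en em e4 eL L0 tm ha hh hl ht hAm e8 e7 hnew mX szX LX HQ.
ifs; rewrite [bval _ _]/= e8; case: (ltnP id0 m) hnew HQ => hm hnew HQ //= _; last first.
  apply: wskip; iwl id0 1%N ltac:(rewrite ?e7) => w1.
  have F9 : fr [:: 9]%N [::] [::] st (iupd st 9 id0 1) by frt.
  have [Fa Fb Fc] := F9; have [uA hA chi cho hdg] := ha.
  by apply: HQ => //; first [by frt | exact: e7 | by move=> i; rewrite /= /upd /=].
have [t1 t2 t3 t4 t5] := hnew isT.
apply: wassoc; iw 7%N (m + t)%N ltac:(rewrite ?em ?e4) => w1.
apply: wassoc; iw (m + t)%N (imem st 3 0) ltac:(idtac) => w2.
apply: wassoc; iw (m + t)%N (imem st 3 1) ltac:(idtac) => w3.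
apply: wassoc; rw (m + t)%N (rmem st 2 0) ltac:(idtac).
set s := rupd _ _ _ _ => w4.
have Fs : fr [:: 1; 2; 5; 6; 7; 8; 9; 11; 12; 13; 17]%N [:: 7; 14; 22]%N [:: 1%N] st s by rewrite /s; frt.
have s1 i : imem s 1 i = if i == (m + t)%N then tl (m + t)%N else imem st 1 i by rewrite /s /= /upd /= t1.
have s2 i : imem s 2 i = if i == (m + t)%N then hd (m + t)%N else imem st 2 i by rewrite /s /= /upd /= t2.
have s3 i : rmem s 1 i = if i == (m + t)%N then wt (m + t)%N else rmem st 1 i by rewrite /s /= /upd /= t3.
have nA : (m + t)%N \notin A by apply/negP => /hAm; rewrite ltnn.
have has_ : adj_ok s A.
  have [uA hA chi cho hdg] := ha; split=> // j jA; have := hAm j jA; have [h1 h2 h3 h4 h5] := hA j jA.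
  by move=> hj; rewrite s1 s2 s3 (ltn_eqF hj).
have hhs : hat_ok s.
  by move=> i hi; rewrite s1 s2 s3; have [h1 h2 h3] := hh i hi; rewrite ltn_eqF //; lia.
apply: wpt_seq; apply: (@add_edgeP _ B X n L tl hd wt X64 XB A (m + t)%N) => //.
- by rewrite s1 eqxx.
- by rewrite s2 eqxx.
- by rewrite s3 eqxx.
- by lia.
move=> s' tm' w' F' ha' hl' ht' hlv le.
have [Fa Fb Fc] := F'.
apply: (@wl _ _ _ X64 XB _ _ _ (m + t)%N 1%N) => //; [by rewrite /= Fb|lia|move=> w''].
have F2 : fr [:: 1; 2; 5; 6; 7; 8; 9; 11; 12; 13; 17]%N [:: 7; 14; 22]%N [:: 1%N] st s'.
  apply: fr_trans Fs (fr_sub _ _ _ F') => // i; rewrite !inE; first by do ! (case/orP=> [->|]; rewrite ?orbT //); move=> ->; rewrite ?orbT.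
  by case/orP=> ->; rewrite ?orbT.
have [hu hA hci hco hdg] := ha'.
apply: HQ => //.
- by frt.
- by rewrite /= /upd /= Fb.
- by move=> i; rewrite /= /upd /= Fa.
- by move=> i hi; have [h1 h2 h3] := hhs i hi; rewrite /= /upd /= !Fa // Fc.
- by lia.
Qed.

Lemma clockP idf t Q st :
  wb X st -> imem st 0 1 = m -> imem st 4 4 = t -> imem st 4 7 = idf t ->
  imem st 4 1 = (2 ^ (kc m idf t).1)%N -> imem st 4 2 = (kc m idf t).1.+1 -> imem st 4 3 = (kc m idf t).2 ->
  (2 ^ (kc m idf t).1.+1 + (kc m idf t).1.+2 < X)%N ->
  (forall st' tm, wb X st' -> fr [::] [:: 1; 2; 3; 19]%N [::] st st' ->
     imem st' 4 1 = (2 ^ (kc m idf t.+1).1)%N -> imem st' 4 2 = (kc m idf t.+1).1.+1 ->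
     imem st' 4 3 = (kc m idf t.+1).2 -> imem st' 4 19 = full m idf t -> (tm <= 12)%N -> Q st' tm) ->
  wpt B clock Q st.
Proof.
move=> w em e4 e7 e1 e2 e3 kX HQ; rewrite kcS in HQ; rewrite expnS in kX.
have k0 : (0 < 2 ^ (kc m idf t).1)%N by rewrite expn_gt0.
have kl := kc_le m idf t.
iw 19%N 0%N ltac:(idtac) => w1.
have fin s T : wb X s -> fr [::] [:: 1; 2; 3; 19]%N [::] st s -> imem s 4 1 = imem st 4 1 ->
   imem s 4 2 = imem st 4 2 -> imem s 4 3 = imem st 4 3 -> imem s 4 19 = (t == 0)%N -> (T <= 4)%N ->
   wpt B (If (BAnd (BILt (V 7) mV) (BAnd (BILe (V 7) (IAdd (V 4) (V 1))) (BILe (V 4) (IAdd (V 7) (V 1)))))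
    Skip
    (setV 19 (C 1) ;;
     If (BILt (V 3) (V 1)) (setV 3 (IAdd (V 3) (C 1)))
       (setV 1 (IMul (C 2) (V 1)) ;; setV 2 (IAdd (V 2) (C 1)) ;; setV 3 (C 0)))) (fun s' T' => Q s' (T + T')%N) s.
  move=> wss F f1 f2 f3 f19 le; have [Fa Fb Fc] := F.
  apply: wpt_if; first exact: (bfits_ok X64 XB).
    rewrite [bval _ _]/= (Fb 7%N) // (Fb 4%N) // (Fa 0%N) // em e7 e4 f1 e1 addn1 => hn; apply: wpt_skip.
    have hev : ~~ ev m idf t by rewrite /ev negbK /near.
    rewrite hev in HQ; apply: HQ => //; rewrite ?f1 ?f2 ?f3 ?f19 //; last by lia.
    by rewrite /full (negPf hev).
  rewrite [bval _ _]/= (Fb 7%N) // (Fb 4%N) // (Fa 0%N) // em e7 e4 f1 e1 addn1 => hn.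
  have hev : ev m idf t by rewrite /ev /near.
  have hf : full m idf t by rewrite /full hev.
  rewrite hev hf /= in HQ.
  iw 19%N 1%N ltac:(idtac) => w2.
  apply: wpt_if; first exact: (bfits_ok X64 XB).
    rewrite [bval _ _]/= /upd /= f3 f1 e3 e1 addn1 => h; rewrite h in HQ.
    iwl 3%N (kc m idf t).2.+1 ltac:(rewrite ?f3 ?e3 ?addn1) => w3.
    by apply: HQ => //; first [by frt | by rewrite /= /upd /= f1 | by rewrite /= /upd /= f2 | lia].
  rewrite [bval _ _]/= /upd /= f3 f1 e3 e1 addn1 => /negPf h; rewrite h in HQ.
  have kX2 : (2 ^ (kc m idf t).1.+1 < X)%N by rewrite expnS; lia.
  iw 1%N (2 ^ (kc m idf t).1.+1)%N ltac:(rewrite ?f1 ?e1 ?expnS) => w3.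
  iw 2%N (kc m idf t).1.+2 ltac:(rewrite ?f2 ?e2 ?addn1) => w4.
  iwl 3%N 0%N ltac:(idtac) => w5.
  by apply: HQ => //; first [by frt | lia].
ifs; rewrite [bval _ _]/= /upd /= e4 => ht.
  iw 19%N 1%N ltac:(idtac) => w2.
  apply: wpt_conseq (fin _ 3%N _ _ _ _ _ _ _) => //; first [by frt | by move: ht; rewrite leqn0 => ->].
apply: wskip; apply: wpt_conseq (fin _ 3%N _ _ _ _ _ _ _) => //;
  first [by frt | by move: ht; rewrite leqn0 => /negPf ->].
Qed.

Lemma dvd_test d t : (0 < d)%N -> (t <= t %/ d * d)%N = (d %| t)%N.
Proof.
move=> d0; rewrite /dvdn {1}(divn_eq t d); move: (t %% d)%N => r.
by rewrite -[X in (_ <= X)%N]addn0 leq_add2l leqn0.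
Qed.

Lemma settopP (fu : bool) (q t Th mu id : nat) Q st :
  wb X st -> imem st 4 19 = fu -> imem st 4 0 = L -> imem st 4 2 = q -> imem st 4 4 = t -> imem st 4 5 = Th ->
  imem st 4 7 = id -> imem st 10 id = mu -> (~~ fu -> (0 < mu)%N) -> (0 < q < L)%N -> (L < X)%N -> (Th + mu < X)%N ->
  (forall i, (i <= L)%N -> imem st 18 i = (2 ^ i)%N) ->
  (forall st' tm tp, wb X st' -> fr [::] [:: 5; 6; 9]%N [::] st st' -> imem st' 4 9 = tp ->
     (0 < tp <= L)%N ->
     (forall c, (c < L)%N -> (if fu then true else if 2 ^ q %| t then 2 ^ c %| t else
        (c < q) && (Th %/ 2 ^ c != (Th + mu) %/ 2 ^ c))%N = (c < tp)%N) ->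
     imem st' 4 5 = (if fu || (2 ^ q %| t) then 0 else Th + mu)%N ->
     (tm <= 3 * L + 10)%N -> Q st' tm) ->
  wpt B settop Q st.
Proof.
move=> w e19 e0 e2 e4 e5 e7 e10 mu0 qL LX TX hp HQ.
have p0 c : (0 < 2 ^ c)%N by rewrite expn_gt0.
apply: wpt_if; first exact: (bfits_ok X64 XB).
  rewrite [bval _ _]/= e19; case: fu e19 mu0 HQ => // e19 mu0 HQ _.
  iw 5%N 0%N ltac:(idtac) => w1; iwl 9%N L ltac:(rewrite ?e0) => w2.
  by apply: (HQ _ _ L) => //; first [by frt | lia | by move=> c ->].
rewrite [bval _ _]/= e19; case: fu e19 mu0 HQ => // e19 /(_ isT) mu0 HQ _ /=.
iw 9%N 0%N ltac:(idtac) => w1.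
apply: wpt_if; first exact: (bfits_ok X64 XB).
  rewrite [bval _ _]/= /upd /= e4 e2 hp ?dvd_test //; last by lia.
  move=> hal; rewrite hal in HQ.
  iw 5%N 0%N ltac:(idtac); set s := iupd _ _ 5 _ => w2.
  have Fs : fr [::] [:: 5; 6; 9]%N [::] st s by rewrite /s; frt.
  apply: (@wpt_while _ B nat (fun c s => [/\ wb X s, fr [::] [:: 5; 6; 9]%N [::] st s, imem s 4 9 = c,
     imem s 4 5 = 0%N & (c <= L)%N /\ forall c', (c' < c)%N -> (2 ^ c' %| t)%N])
     (fun c => 3 * (L - c))%N _ _ _ 0%N).
  - by [].
  - by move=> c s' [ws' _ _ _ _]; apply: (bfits_ok X64 XB).
  - move=> c s' [ws' F e9 e5' [hc hc']]; have [Fa Fb Fc] := F.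
    rewrite [bval _ _]/= e9 (Fb 0%N) // (Fb 4%N) // (Fa 18%N) // e4 e0 hp // dvd_test // addn1 => /andP[lt hd'].
    iwl 9%N c.+1 ltac:(rewrite ?e9 ?addn1) => wn.
    exists c.+1; last by lia.
    split=> //; first by frt.
    by split=> // c'; rewrite ltnS leq_eqVlt => /orP[/eqP ->|/hc'].
  - move=> c s' T [ws' F e9 e5' [hc hc']] nb le; have [Fa Fb Fc] := F.
    move: nb; rewrite [bval _ _]/= e9 (Fb 0%N) // (Fb 4%N) // (Fa 18%N) // e4 e0 hp // dvd_test // addn1 => nb.
    have c0 : (0 < c)%N by case: c {e9 le hc hc'} nb => //; rewrite dvd1n andbT -ltnNge; lia.
    have HH c' : (c' < L)%N -> (2 ^ c' %| t)%N = (c' < c)%N; last first.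
      by apply: (HQ _ _ c) => //; lia.
    move=> hc'L; have [/hc' ->//|h] := ltnP c' c.
    apply/negP => hd'; move: nb; rewrite negb_and.
    have -> : (c < L)%N by lia.
    by rewrite /= => /negP; apply; apply: dvdn_trans hd'; rewrite dvdn_exp2l.
rewrite [bval _ _]/= /upd /= e4 e2 hp ?dvd_test //; last by lia.
move=> /negPf hal; rewrite hal in HQ.
iw 6%N (Th + mu)%N ltac:(rewrite ?e5 ?e7 ?e10); set s := iupd _ _ 6 _ => w2.
have Fs : fr [::] [:: 5; 6; 9]%N [::] st s by rewrite /s; frt.
have s5 : imem s 4 5 = Th by rewrite /s /= /upd /= e5.
have mono c : (Th %/ 2 ^ c <= (Th + mu) %/ 2 ^ c)%N by rewrite leq_div2r // leq_addr.
apply: wpt_seq; apply: (@wpt_while _ B nat (fun c s => [/\ wb X s, fr [::] [:: 5; 6; 9]%N [::] st s, imem s 4 9 = c,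
   imem s 4 5 = Th /\ imem s 4 6 = (Th + mu)%N & (c <= q)%N /\ forall c', (c' < c)%N -> (Th %/ 2 ^ c' < (Th + mu) %/ 2 ^ c')%N])
   (fun c => 3 * (q - c))%N _ _ _ 0%N).
- by [].
- by move=> c s' [ws' _ _ _ _]; apply: (bfits_ok X64 XB).
- move=> c s' [ws' F e9 [e5' e6'] [hc hc']]; have [Fa Fb Fc] := F.
  rewrite [bval _ _]/= e9 (Fb 2%N) // (Fa 18%N) // e2 e5' e6' hp //; last by lia.
  rewrite !addn1 => /andP[lt hd'].
  iwl 9%N c.+1 ltac:(rewrite ?e9 ?addn1) => wn.
  exists c.+1; last by lia.
  split=> //; first by frt.
  by split=> // c'; rewrite ltnS leq_eqVlt => /orP[/eqP ->|/hc'].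
- move=> c s' T [ws' F e9 [e5' e6'] [hc hc']] nb le; have [Fa Fb Fc] := F.
  move: nb; rewrite [bval _ _]/= e9 (Fb 2%N) // (Fa 18%N) // e2 e5' e6' hp //; last by lia.
  rewrite !addn1 => nb.
  have c0 : (0 < c)%N.
    case: c {e9 le hc hc'} nb => //; rewrite expn0 !divn1; lia.
  iwl 5%N (Th + mu)%N ltac:(rewrite ?e6') => wn.
  have HH c' : (c' < L)%N -> ((c' < q) && (Th %/ 2 ^ c' != (Th + mu) %/ 2 ^ c'))%N = (c' < c)%N; last first.
    by apply: (HQ _ _ c) => //; first [by frt | lia].
  move=> hc'L; have [h|h] := ltnP c' c.
    by rewrite (leq_trans h hc) /= neq_ltn hc'.
  apply/negbTE; rewrite negb_and; case: (ltnP c' q) => //= hq'; rewrite negbK.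
  move: nb; rewrite negb_and (leq_ltn_trans h hq') /= -leqNgt => nb.
  have ec : (Th %/ 2 ^ c = (Th + mu) %/ 2 ^ c)%N by apply/eqP; rewrite eqn_leq mono.
  by apply/eqP; rewrite -(subnK h) addnC expnD !divnMA ec.
Qed.

End Steps.

(** * Relaxation of the top list and selection of the alarmed vertices *)

Section Runs.
Context {R : realType}.
Variables (B X n L Hh : nat) (tl hd : nat -> nat) (wt : nat -> R) (M : R).
Hypothesis X64 : (64 <= X)%N.
Hypothesis XB : (X ^ 8 <= B)%N.
Hypothesis n_gt0 : (0 < n)%N.
Hypothesis nX : (2 * n < X)%N.
Hypothesis nH : (2 * n <= 2 ^ Hh)%N.
Hypothesis M0 : 0 < M.
Implicit Types (st : state R) (Q : state R -> nat -> Prop) (A sl : seq nat).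

Local Ltac bnd := solve [assumption | lia | match goal with w : wb _ _ |- _ => exact: w end].
Local Ltac ev tac := solve [by [] | rewrite /= /upd /=; tac; by [] | rewrite /= /upd /=; tac; lia].
Local Ltac iw i x tac := apply: (@ws _ _ _ X64 XB _ _ _ i x); [eassumption|by []|by []|ev tac|ev tac|bnd|].
Local Ltac iwl i x tac := apply: (@wl _ _ _ X64 XB _ _ _ i x); [eassumption|by []|by []|ev tac|ev tac|bnd|].
Local Ltac rw i x tac := apply: (@rs _ _ _ X64 XB _ _ _ i x); [eassumption|by []|by []|ev tac|ev tac|].
Local Ltac rwl i x tac := apply: (@rl _ _ _ X64 XB _ _ _ i x); [eassumption|by []|by []|ev tac|ev tac|].

Notation adj_ok := (adj_ok n tl hd wt).
Notation lst := (lst n).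

(** The state between two runs: the queue is empty and the keys agree with the distances, so a run
    needs no initialisation outside its own list. *)
Definition keys_ok st : Prop :=
  [/\ tree_ok n (rmem st 6), (forall u, (u < n)%N -> leaf n st u = M),
      (forall v, (v < n)%N -> rmem st 5 v = rmem st 4 v), rmem st 7 0 = M &
      (forall v, (v < n)%N -> 0 <= rmem st 4 v <= M)].

Definition dij_res st A sl (ord : seq nat) st' : Prop :=
  [/\ wb X st', dframe st st', tree_ok n (rmem st' 6) /\ (forall u, (u < n)%N -> leaf n st' u = M),
      ord_ok tl sl st' ord &
  [/\ (forall u, (u < n)%N -> u \notin sl -> rmem st' 5 u = rmem st 4 u),
      (forall u, u \in sl -> 0 <= rmem st' 5 u <= rmem st 4 u),
      (forall u, u \in sl -> (imem st' 14 u = 0%N /\ rmem st' 5 u = rmem st 4 u) \/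
         exists j, [/\ j \in A, hd j = u, imem st' 14 u = j.+1,
           rmem st' 5 u = ext st j (rmem st' 5 (tl j)) & rmem st' 5 u < rmem st 4 u]),
      (forall j, j \in A -> hd j \in sl -> rmem st' 5 (hd j) <= ext st j (rmem st' 5 (tl j))) &
      (forall u, u \in sl -> u \notin ord -> rmem st' 5 u = M)]].

Definition listW st sl := (\sum_(v <- sl) imem st 17 v)%N.

Lemma size_listW st A sl : adj_ok st A -> (forall v, v \in sl -> (v < n)%N && has (fun j => hd j == v) A) ->
  (size sl <= listW st sl)%N.
Proof.
move=> [_ _ _ _ hdg] h; rewrite /listW -sum1_size big_seq [X in (_ <= X)%N]big_seq.
by apply: leq_sum => v /h /andP[hv]; rewrite has_count hdg //; lia.
Qed.

Lemma dij_callP A sl Q st : wb X st -> imem st 0 0 = n -> adj_ok st A -> lst st (imem st 4 20) sl ->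
  keys_ok st -> (forall j, j \in A -> 1 <= wt j) -> 0 <= rmem st 7 6 ->
  (forall v, v \in sl -> has (fun j => hd j == v) A) ->
  (forall st' ord tm, dij_res st A sl ord st' ->
     (tm <= (5 * Hh + 30) * (6 * listW st sl) + 4)%N -> Q st' tm) ->
  wpt B dij Q st.
Proof.
move=> w en ha hl [tr lf eY eM hD] w1 f0 hs HQ.
have szl := lst_size hl; have [usl sln slsz slnth slP] := hl; have [uA hA chi cho hdg] := ha.
apply: (@dijP R B X n Hh X64 XB n_gt0 nX nH st tl hd (fun v => [seq j <- A | hd j == v])
   (fun v => [seq j <- A | tl j == v]) sl) => //.
- by move=> v j hv; rewrite mem_filter => /andP[/eqP e /hA [? ? -> -> _]].
- by move=> v j hv; rewrite mem_filter => /andP[/eqP e /hA [? ? -> -> _]].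
- by move=> v j hv; rewrite !mem_filter => /andP[_ ->]; rewrite eqxx.
- by move=> v j hv; rewrite !mem_filter => /andP[_ ->]; rewrite eqxx.
- by lia.
- by move=> v hv; rewrite eY // eM hD.
- by rewrite eM.
- move=> v j b hv; rewrite mem_filter => /andP[_ jA] /andP[b0 bM].
  have [_ _ _ _ ew] := hA j jA; have wj := w1 j jA.
  have key : b < b + wt j by lra.
  have fm : 0 <= rmem st 7 6 * (imem st 10 j)%:R by rewrite mulr_ge0.
  have key2 : b + wt j <= (b + wt j) * (1 + rmem st 7 6 * (imem st 10 j)%:R) by nra.
  rewrite /ext ew; case: ifP => _; first by split; lra.
  by case: ifP => _; split=> //; lra.
- by move=> u hu; rewrite lf.
move=> st' ord tm [h1 h2 [h3 h3'] h4 [h5 h6 h7 h8 h9]] le; apply: (HQ _ ord).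
  split=> //; first by split=> // u hu; rewrite h3'.
  split.
  - by move=> u hu nu; rewrite h5 ?eY.
  - by move=> u us; rewrite -eY ?h6 //; apply: sln.
  - move=> u us; have hu := sln _ us; rewrite -eY //; case: (h7 u us) => [?|[j [jl e1 e2 e3 _]]]; first by left.
    by right; exists j; move: jl; rewrite mem_filter => /andP[/eqP -> ->].
  - by move=> j jA js; apply: h8 => //; rewrite mem_filter eqxx.
  - by move=> u us uo; rewrite h9 // eM.
apply: leq_trans le _; rewrite leq_add2r leq_mul2l; apply/orP; right.
rewrite /listW big_distrr /= big_seq [X in (_ <= X)%N]big_seq; apply: leq_sum => v vs.
have := hs v vs; rewrite has_count !size_filter hdg ?sln //.
by set x := count _ _; set y := count _ _; lia.
Qed.

Lemma take_mem (l : seq nat) i v : (i < size l)%N ->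
  (v \in take i.+1 l) = (v == nth 0%N l i) || (v \in take i l).
Proof. by move=> h; rewrite (take_nth 0%N h) mem_rcons inE. Qed.

Lemma sum_const_le (i N c : nat) : (\sum_(i <= j < N) (c + 2) <= (c + 2) * N)%N.
Proof. by rewrite sum_nat_const_nat mulnC leq_mul2l leq_subr orbT. Qed.

Lemma relaxP A sl c Q st : wb X st -> imem st 0 0 = n -> adj_ok st A -> imem st 4 9 = c -> lst st c sl ->
  (c < X)%N -> keys_ok st -> (forall j, j \in A -> 1 <= wt j) -> 0 <= rmem st 7 6 ->
  (forall v, v \in sl -> has (fun j => hd j == v) A) ->
  (forall v, (v < n)%N -> rmem st 3 v = if M <= rmem st 4 v then -1 else rmem st 4 v) ->
  (forall st' tm, wb X st' ->
     fr [:: 11; 14; 15]%N [:: 11; 12; 13; 14; 16; 17; 18; 20; 22]%N [:: 3; 4; 5; 6; 7]%N st st' ->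
     (forall k, k != 7%N -> rmem st' 7 k = rmem st 7 k) -> keys_ok st' ->
     (forall v, (v < n)%N -> imem st' 11 v = if (imem st 11 v <= c)%N then c else imem st 11 v) ->
     (forall v, (v < n)%N -> rmem st' 4 v <= rmem st 4 v) ->
     (forall v, (v < n)%N -> ~~ (imem st 11 v <= c)%N -> rmem st' 4 v = rmem st 4 v) ->
     (forall j, j \in A -> (0 < imem st 9 j)%N -> (imem st 11 (hd j) <= c)%N ->
        rmem st' 4 (hd j) <= rmem st' 4 (tl j) + wt j) ->
     (forall v, (v < n)%N -> rmem st' 4 v < rmem st 4 v -> exists j,
        [/\ j \in A, (0 < imem st 9 j)%N, hd j = v & rmem st' 4 v = rmem st' 4 (tl j) + wt j]) ->
     (forall v, (v < n)%N -> rmem st' 3 v = if M <= rmem st' 4 v then -1 else rmem st' 4 v) ->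
     (tm <= (5 * Hh + 40) * (6 * listW st sl) + 20)%N -> Q st' tm) ->
  wpt B relax Q st.
Proof.
move=> w en ha e9 hl cX hk w1 f0 hs hout HQ.
have szl := lst_size hl; have [usl sln slsz slnth slP] := hl; have [uA hA chi cho hdg] := ha.
have szW : (size sl <= listW st sl)%N by apply: size_listW ha _ => v vs; rewrite sln ?hs.
iw 20%N c ltac:(rewrite ?e9) => w2; iw 16%N 0%N ltac:(idtac) => w3; iw 18%N 0%N ltac:(idtac).
set s1 := iupd _ 4 18 _ => w4.
have F1 : fr [:: 11; 14; 15]%N [:: 11; 12; 13; 14; 16; 17; 18; 20; 22]%N [:: 3; 4; 5; 6; 7]%N st s1 by rewrite /s1; frt.
apply: wpt_seq; apply: (@forP _ B X X64 XB 18 _ _ (fun i s => [/\ wb X s, fr [:: 11]%N [:: 18]%N [::] s1 s,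
  imem s 4 18 = i & forall v, imem s 11 v = if v \in take i sl then c else imem st 11 v]) (fun=> 1%N) 0%N (size sl)) => //.
- by split=> //; rewrite take0.
- move=> i s hi [ws' F e18 _]; have [Fa Fb Fc] := F; split=> //.
  by rewrite /= Fb // Fa.
- move=> i s hi [ws' F e18 hlev]; have [Fa Fb Fc] := F.
  have evl : ival s lelem = nth 0%N sl i.
    by rewrite /= (Fb 20%N) // e18 (Fa 12%N) // (Fa 0%N) // /s1 /= /upd /= en slnth.
  have e20s : imem s 4 20 = c by rewrite Fb.
  iwl (nth 0%N sl i) c ltac:(idtac) => wn.
  have wn' : wb X (iupd (iupd s 11 (nth 0%N sl i) c) 4 18 i.+1) by apply: wb_iupd => //; lia.
  split=> //; split=> //; first by frt.
  by move=> v; rewrite /= /upd /= hlev take_mem //; case: eqP.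
move=> s2 T2 [w5 F2 e18 hlev] le2; rewrite take_size in hlev.
have [F2a F2b F2c] := F2.
have e20 : imem s2 4 20 = c by rewrite F2b.
have F2' : fr [:: 11; 14; 15]%N [:: 11; 12; 13; 14; 16; 17; 18; 20; 22]%N [:: 3; 4; 5; 6; 7]%N st s2.
  by apply: fr_trans F1 (fr_sub _ _ _ F2) => // i; rewrite !inE => /eqP ->.
have ha2 : adj_ok s2 A.
  by split=> // [j jA|v hv|v hv|v hv]; rewrite ?F2c // ?(F2a 1%N) ?(F2a 2%N) ?(F2a 8%N) ?(F2a 7%N) ?(F2a 6%N) ?(F2a 5%N) ?(F2a 17%N) //;
     [apply: hA|apply: chi|apply: cho|apply: hdg].
have hl2 : lst s2 c sl.
  split=> // [|i hi|v hv]; rewrite ?(F2a 13%N) ?(F2a 12%N) //; first exact: slnth.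
  by rewrite hlev; case: (boolP (v \in sl)) => vs; [rewrite leqnn|rewrite -slP // (negPf vs)].
have hk2 : keys_ok s2 by move: hk; rewrite /keys_ok /leaf !F2c.
have W2 : listW s2 sl = listW st sl by rewrite /listW F2a.
apply: wpt_seq; apply: (@dij_callP A sl _ s2) => //; rewrite ?e20 ?F2a ?F2c //.
move=> s3 ord T3 [w6 fr3 [tr3 lf3] _ [g1 g2 g3 g4 _]]; rewrite W2 => le3.
have [f3a f3b f3c f3d] := fr3.
have lim0 : imem s2 4 16 = 0%N by rewrite F2b.
have extE j b : j \in A -> ext s2 j b = if (0 < imem st 9 j)%N then b + wt j else M.
  move=> jA; have [_ _ _ _ ew] := hA j jA.
  rewrite /ext /candidate lim0 ltn0 !andbF F2a // F2c // ew F2c //.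
  by have [_ _ _ -> _] := hk.
iw 18%N 0%N ltac:(idtac); set s4 := iupd _ 4 18 _ => w7.
pose Y := rmem s3 5.
have eD : rmem s2 4 = rmem st 4 by rewrite F2c.
have e20' : imem s4 4 20 = c by rewrite /s4 /= /upd /= f3b.
have eM4 : rmem s4 7 0 = M by rewrite -[rmem s4 7 0]/(rmem s3 7 0) f3d // F2c //; have [_ _ _ -> _] := hk.
apply: (@forP _ B X X64 XB 18 _ _ (fun i s => [/\ wb X s, fr [::] [:: 12; 18]%N [:: 3; 4]%N s4 s,
  imem s 4 18 = i, (forall v, rmem s 4 v = if v \in take i sl then Y v else rmem st 4 v) &
  (forall v, rmem s 3 v = if v \in take i sl then (if M <= Y v then -1 else Y v) else rmem st 3 v)])
  (fun=> 4%N) 0%N (size sl)) => //.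
- by split=> // v; rewrite take0 -?[rmem s4 _]/(rmem s3 _) f3c // ?eD // F2c.
- move=> i s hi [ws' F e18' _ _]; have [Fa Fb Fc] := F; split=> //.
  by rewrite /= Fb // e20' Fa // -[imem s4 13]/(imem s3 13) f3a // F2a.
- move=> i s hi [ws' F e18' h4 h3]; have [Fa Fb Fc] := F; set v := nth 0%N sl i.
  have vn : (v < n)%N by apply: sln; apply: mem_nth.
  have ev12 : ival s lelem = v.
    by rewrite /= (Fb 20%N) // e20' e18' (Fa 12%N) // (Fa 0%N) // -[imem s4 12]/(imem s3 12) -[imem s4 0]/(imem s3 0)
      (f3a 12%N) // (f3a 0%N) // (F2a 12%N) // (F2a 0%N) // /s1 /= /upd /= en slnth.
  iw 12%N v ltac:(rewrite ?ev12 //) => w8.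
  have Yv : rmem s 5 v = Y v by rewrite Fc.
  have M7 : rmem s 7 0 = M by rewrite Fc.
  rw v (Y v) ltac:(rewrite ?Yv) => w9.
  have fin x : wb X (rupd (rupd (iupd s 4 12 v) 4 v (Y v)) 3 v x) -> x = (if M <= Y v then -1 else Y v) ->
     [/\ imem (rupd (rupd (iupd s 4 12 v) 4 v (Y v)) 3 v x) 4 18 = i, wb X (rupd (rupd (iupd s 4 12 v) 4 v (Y v)) 3 v x),
     [/\ wb X (iupd (rupd (rupd (iupd s 4 12 v) 4 v (Y v)) 3 v x) 4 18 i.+1),
       fr [::] [:: 12; 18]%N [:: 3; 4]%N s4 (iupd (rupd (rupd (iupd s 4 12 v) 4 v (Y v)) 3 v x) 4 18 i.+1), 
       imem (iupd (rupd (rupd (iupd s 4 12 v) 4 v (Y v)) 3 v x) 4 18 i.+1) 4 18 = i.+1,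
       (forall v0, rmem (iupd (rupd (rupd (iupd s 4 12 v) 4 v (Y v)) 3 v x) 4 18 i.+1) 4 v0 = if v0 \in take i.+1 sl then Y v0 else rmem st 4 v0) &
       (forall v0, rmem (iupd (rupd (rupd (iupd s 4 12 v) 4 v (Y v)) 3 v x) 4 18 i.+1) 3 v0 = if v0 \in take i.+1 sl then (if M <= Y v0 then -1 else Y v0) else rmem st 3 v0)] & (4 <= 4)%N].
    move=> wx ex; split=> //; split=> //; [by apply: wb_iupd => //; lia|by frt| |].
    - by move=> u; rewrite /= /upd /= h4 take_mem // -/v; case: eqP => [->|].
    - by move=> u; rewrite /= /upd /= h3 take_mem // -/v; case: eqP => [->|].
  apply: wpt_if; first exact: (bfits_ok X64 XB).
    rewrite [bval _ _]/= /upd /= Yv M7 => hb; rwl v (-1 : R) ltac:(rewrite ?sub0r) => w10.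
    by have [] := fin (-1) w10 _; rewrite ?hb.
  rewrite [bval _ _]/= /upd /= Yv M7 => hb; rwl v (Y v) ltac:(rewrite ?Yv) => w10.
  by have [] := fin (Y v) w10 _; rewrite ?(negPf hb).
move=> s5 T5 [w8 F5 e18'' h4 h3] le5; rewrite take_size in h4 h3; have [F5a F5b F5c] := F5.
have lev5 v : imem s5 11 v = if v \in sl then c else imem st 11 v by rewrite F5a // -[imem s4 11]/(imem s3 11) f3a // hlev.
have D5 v : (v < n)%N -> rmem s5 4 v = Y v.
  by move=> hv; rewrite h4; case: ifP => // /negbT hn; rewrite /Y g1 // eD.
apply: HQ => //.
- apply: fr_trans F2' _; split=> [a hna|k hnk|a hna].
  + rewrite F5a; last by move: hna; rewrite !inE !negb_or => /and4P[-> ].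
    have -> : imem s4 a = imem s3 a.
      apply/funext => z; move: hna; rewrite !inE !negb_or => /and4P[/negPf n4 _ _ _].
      by rewrite /s4 /= /upd n4.
    by apply: f3a; move: hna; rewrite !inE !negb_or => /and4P[-> _ -> ->].
  + have [k12 k18] : k != 12%N /\ k != 18%N by move: hnk; rewrite !inE; do 9! case: eqP => //.
    rewrite F5b; last by rewrite !inE negb_or k12 k18.
    rewrite /s4 /= /upd /= (negPf k18) f3b //.
    by move: hnk; rewrite !inE !negb_or => /and5P[-> -> -> -> /and5P[_ -> -> _ ->]].
  + rewrite F5c; last by move: hna; rewrite !inE !negb_or => /and5P[-> -> _ _ _].
    by rewrite -[rmem s4 a]/(rmem s3 a) f3c //; move: hna; rewrite !inE !negb_or => /and5P[_ _ -> -> ->].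
- by move=> k hk7; rewrite F5c // -[rmem s4 7]/(rmem s3 7) f3d // F2c.
- have [t1 t2 t3 t4 t5] := hk.
  split.
  + by rewrite F5c.
  + by move=> u hu; rewrite /leaf F5c //; exact: lf3.
  + by move=> v hv; rewrite D5 // F5c.
  + by rewrite F5c.
  + move=> v hv; rewrite D5 //; have [vs|vs] := boolP (v \in sl).
      have /andP[-> h] := g2 v vs; apply: le_trans h _; rewrite eD; by have /andP[] := t5 v hv.
    by rewrite /Y g1 // eD t5.
- by move=> v hv; rewrite lev5 slP.
- move=> v hv; rewrite D5 //; have [vs|vs] := boolP (v \in sl); last by rewrite /Y g1 // eD.
  by have /andP[_] := g2 v vs; rewrite eD.
- by move=> v hv nv; rewrite D5 // /Y g1 ?eD // slP.
- move=> j jA aj lj; have [tn hn _ _ _] := hA j jA; have := g4 j jA; rewrite slP // extE // aj !D5 //.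
  by apply.
- move=> v hv; rewrite D5 // => lt.
  have vs : v \in sl by apply: contraTT lt => vs; rewrite -leNgt /Y g1 // eD.
  case: (g3 v vs) => [[_ e]|[j [jA ej _ e _]]]; first by move: lt; rewrite /Y e eD ltxx.
  have [tn hn _ _ _] := hA j jA; exists j; rewrite D5 // /Y e extE //.
  move: e; rewrite extE //; case: ifP => // _ e; move: lt; rewrite /Y e.
  by have [_ _ _ _ t5] := hk; have /andP[_ h] := t5 v hv; rewrite ltNge h.
- move=> v hv; rewrite h3 h4; case: ifP => // /negbT hn; by rewrite hout.
- move: le2 le3 le5; have := sum_const_le 0 (size sl) 1; have := sum_const_le 0 (size sl) 4.
  set x1 := (\sum_(_ <= _ < _) _)%N; set x2 := (\sum_(_ <= _ < _) _)%N; set x3 := listW st sl in szW *.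
  by set y := (5 * Hh)%N; nia.
Qed.

Lemma restoreP sl c Q st : wb X st -> imem st 0 0 = n -> imem st 4 20 = c -> imem st 13 c = size sl ->
  (forall i, (i < size sl)%N -> imem st 12 (c * n + i)%N = nth 0%N sl i) -> (size sl <= n)%N ->
  (forall v, v \in sl -> (v < n)%N) ->
  (forall st' tm, wb X st' -> fr [::] [:: 12; 18]%N [:: 5]%N st st' ->
     (forall v, rmem st' 5 v = if v \in sl then rmem st 4 v else rmem st 5 v) ->
     (tm <= 4 * size sl + 3)%N -> Q st' tm) ->
  wpt B restore Q st.
Proof.
move=> w en e20 e13 e12 szn sln HQ.
iw 18%N 0%N ltac:(idtac); set s1 := iupd _ 4 18 _ => w1.
have F1 : fr [::] [:: 12; 18]%N [:: 5]%N st s1 by rewrite /s1; frt.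
apply: (@forP _ B X X64 XB 18 _ _ (fun i s => [/\ wb X s, fr [::] [:: 12; 18]%N [:: 5]%N st s, imem s 4 18 = i &
  forall v, rmem s 5 v = if v \in take i sl then rmem st 4 v else rmem st 5 v]) (fun=> 2%N) 0%N (size sl)) => //.
- by split=> // v; rewrite take0.
- move=> i s hi [ws' F e18 _]; have [Fa Fb Fc] := F; split=> //.
  by rewrite /= Fb // e20 Fa.
- move=> i s hi [ws' F e18 h5]; have [Fa Fb Fc] := F; set v := nth 0%N sl i.
  have vn : (v < n)%N by apply: sln; apply: mem_nth.
  have ev12 : ival s lelem = v by rewrite /= Fb // e20 e18 !Fa // en e12.
  iw 12%N v ltac:(rewrite ?ev12 //) => w8.
  rwl v (rmem st 4 v) ltac:(rewrite ?Fc //) => w9.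
  split=> //; split=> //; [by apply: wb_iupd => //; lia|by frt|].
  by move=> u; rewrite /= /upd /= h5 take_mem // -/v; case: eqP => [->|].
move=> s T [ws' F e18 h5] le; rewrite take_size in h5; apply: HQ => //.
by move: le; have := sum_const_le 0 (size sl) 2; set x := (\sum_(_ <= _ < _) _)%N; lia.
Qed.

Lemma selectP sl a c th Q st : wb X st -> imem st 0 0 = n -> imem st 4 20 = c -> imem st 4 10 = a ->
  (0 < a < c)%N -> (c < X)%N -> lst st c sl -> rmem st 7 8 = th ->
  (forall v, (v < n)%N -> (a < imem st 11 v)%N) ->
  (forall st' tm, wb X st' -> fr [:: 11; 12; 13; 16]%N [:: 12; 18]%N [::] st st' ->
     (forall v, imem st' 11 v = if (v \in sl) && (th * rmem st 5 v < rmem st 4 v) then a else imem st 11 v) ->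
     (forall v, v \in sl -> imem st' 16 v = if th * rmem st 5 v < rmem st 4 v then imem st 17 v else 0%N) ->
     (forall b l, (a < b)%N -> lst st b l -> (c <= b)%N -> lst st' b l) ->
     lst st' a [seq v <- sl | th * rmem st 5 v < rmem st 4 v] ->
     (tm <= 10 * size sl + 5)%N -> Q st' tm) ->
  wpt B select Q st.
Proof.
move=> w en e20 e10 ac cX hl e8 hlev HQ.
have szl := lst_size hl; have [usl sln slsz slnth slP] := hl.
pose p v := th * rmem st 5 v < rmem st 4 v.
iw a 0%N ltac:(rewrite ?e10) => w1; iw 18%N 0%N ltac:(idtac); set s1 := iupd _ 4 18 _ => w2.
have F1 : fr [:: 11; 12; 13; 16]%N [:: 12; 18]%N [::] st s1 by rewrite /s1; frt.
apply: (@forP _ B X X64 XB 18 _ _ (fun i s => [/\ wb X s, fr [:: 11; 12; 13; 16]%N [:: 12; 18]%N [::] st s, imem s 4 18 = i,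
  (forall v, imem s 11 v = if (v \in take i sl) && p v then a else imem st 11 v) /\
  (forall v, v \in take i sl -> imem s 16 v = if p v then imem st 17 v else 0%N) &
  [/\ imem s 13 a = size [seq v <- take i sl | p v], (forall b, b != a -> imem s 13 b = imem st 13 b),
   (forall k, (k < size [seq v <- take i sl | p v])%N -> imem s 12 (a * n + k)%N = nth 0%N [seq v <- take i sl | p v] k) &
   (forall k, (c * n <= k)%N -> imem s 12 k = imem st 12 k)]]) (fun=> 8%N) 0%N (size sl)) => //.
- split=> //; first by rewrite take0.
  rewrite take0 /= /upd /= eqxx; split=> // b /negPf ->; by rewrite /= ?andbF.
- move=> i s hi [ws' F e18 _ [h13 h13' _ _]]; have [Fa Fb Fc] := F; split=> //.
  by rewrite /= Fb // e20 h13' //; lia.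
- move=> i s hi [ws' F e18 [hl11 h16] [h13 h13' h12 h12']]; have [Fa Fb Fc] := F; set v := nth 0%N sl i.
  have vs : v \in sl by apply: mem_nth.
  have vn : (v < n)%N by apply: sln.
  have ev12 : ival s lelem = v by rewrite /= (Fb 20%N) // e20 e18 (Fa 0%N) // en h12' ?slnth // leq_addr.
  have vnt : v \notin take i sl.
    have : uniq (take i.+1 sl) by rewrite take_uniq.
    by rewrite (take_nth 0%N hi) rcons_uniq => /andP[].
  have tk : take i.+1 sl = rcons (take i sl) v by rewrite (take_nth 0%N hi).
  have szf : (size [seq u <- take i sl | p u] < n)%N.
    rewrite size_filter; apply: leq_ltn_trans (count_size _ _) _; rewrite size_take hi; lia.
  iw 12%N v ltac:(rewrite ?ev12 //) => w3; iw v 0%N ltac:(idtac) => w4.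
  apply: wpt_if; first exact: (bfits_ok X64 XB).
    rewrite [bval _ _]/= /upd /= !Fc // e8 -ltNge -/(p v) => pv.
    have e10s : imem s 4 10 = a by rewrite Fb.
    have ens : imem s 0 0 = n by rewrite Fa.
    iw v (imem st 17 v) ltac:(rewrite ?Fa //) => w5.
    iw v a ltac:(rewrite ?e10s) => w6.
    iw (a * n + size [seq u <- take i sl | p u])%N v ltac:(rewrite ?e10s ?ens ?h13) => w7.
    iwl a (size [seq u <- take i sl | p u]).+1 ltac:(rewrite ?e10s ?h13 ?addn1) => w8.
    split=> //; split=> //; [by apply: wb_iupd => //; lia|by frt| |].
      split=> u; rewrite /= /upd /= ?tk ?mem_rcons ?inE.
        by case: eqP => [->|_] /=; rewrite ?pv ?hl11.
      by case: eqP => [->|_] /=; [rewrite pv|apply: h16].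
    rewrite tk filter_rcons pv size_rcons /= /upd /= eqxx; split=> // [b nb|k|k hk].
    - by rewrite (negPf nb) h13'.
    - rewrite ltnS leq_eqVlt nth_rcons eqn_add2l => /orP[/eqP ->|hlt]; first by rewrite ltnn !eqxx.
      by rewrite hlt (ltn_eqF hlt) h12.
    - rewrite gtn_eqF ?h12' //; have : (a.+1 * n <= c * n)%N by rewrite leq_mul2r; lia.
      by rewrite mulSn; lia.
  rewrite [bval _ _]/= /upd /= !Fc // e8 -ltNge -/(p v) => /negPf pv.
  apply: wpt_skip.
  split=> //; split=> //; [by apply: wb_iupd => //; lia|by frt| |].
    split=> u; rewrite /= /upd /= ?tk ?mem_rcons ?inE.
      by case: eqP => [->|_] /=; rewrite ?pv ?hl11 ?(negPf vnt).
    by case: eqP => [->|_] /=; [rewrite pv|apply: h16].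
  by rewrite tk filter_rcons pv /= /upd /=; split.
move=> s T [ws' F e18 [hl11 h16] [h13 h13' h12 h12']] le; rewrite take_size in hl11 h16 h13 h12.
have [Fa Fb Fc] := F; apply: HQ => //.
- move=> b l ab [ul ln lsz lnth lP] cb; split=> //.
  + by rewrite h13' //; lia.
  + move=> i hi; rewrite h12' ?lnth //; apply: leq_trans (leq_addr _ _); by rewrite leq_mul2r cb orbT.
  + move=> v hv; rewrite lP // hl11; case: ifP => // /andP[vs _].
    by move: vs; rewrite slP // => h; lia.
- split=> //; first by rewrite filter_uniq.
  + by move=> v; rewrite mem_filter => /andP[_ /sln].
  + move=> v hv; rewrite mem_filter hl11 andbC -/(p v); case: ifP => //; first by rewrite leqnn.
    by have := hlev v hv; lia.
- by move: le; have := sum_const_le 0 (size sl) 8; set x := (\sum_(_ <= _ < _) _)%N; lia.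
Qed.

End Runs.

(** * Paths in the tree of parent edges, and blame *)

Section Tree.
Variables (par tl : nat -> nat) (sl ord : seq nat).
Hypothesis ord_par : forall i j, (i < size ord)%N -> par (nth 0%N ord i) = j.+1 ->
  tl j \in sl -> tl j \in take i ord.

Fixpoint tpath k v : seq nat :=
  if k is k'.+1 then
    if par v is j.+1 then (if tl j \in sl then rcons (tpath k' (tl j)) j else [:: j]) else [::]
  else [::].

(** Parents are extracted before their children, so the position of a vertex in the extraction order
    bounds its depth, and more fuel changes nothing. *)
Lemma tpath_stable i k : (i < size ord)%N -> (i < k)%N ->
  tpath k (nth 0%N ord i) = tpath i.+1 (nth 0%N ord i).
Proof.
elim/ltn_ind: i k => i IH [|k] hi //; rewrite ltnS => ik /=.
case ep : (par (nth 0%N ord i)) => [//|j]; case: ifP => // js.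
have h := ord_par hi ep js.
have [i' hi' e'] : exists2 i', (i' < i)%N & nth 0%N ord i' = tl j.
  exists (index (tl j) (take i ord)); first by rewrite -index_mem size_take hi in h.
  rewrite -(nth_take 0%N (n0 := i)); first by rewrite nth_index.
  by rewrite -index_mem size_take hi in h.
by rewrite -e' (IH i' hi' k) ?(IH i' hi' i) //; lia.
Qed.

Definition tree_path v := tpath (size ord) v.

Lemma tree_pathE v : v \in ord -> tree_path v =
  if par v is j.+1 then (if tl j \in sl then rcons (tree_path (tl j)) j else [:: j]) else [::].
Proof.
move=> vo; have hi : (index v ord < size ord)%N by rewrite index_mem.
rewrite /tree_path -{1}(nth_index 0%N vo) tpath_stable // nth_index //=.
case ep : (par v) => [//|j]; case: ifP => // js.
have h := ord_par hi; rewrite nth_index // in h; have {}h := h j ep js.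
have [i' hi' e'] : exists2 i', (i' < index v ord)%N & nth 0%N ord i' = tl j.
  exists (index (tl j) (take (index v ord) ord)); first by rewrite -index_mem size_take hi in h.
  rewrite -(nth_take 0%N (n0 := index v ord)); first by rewrite nth_index.
  by rewrite -index_mem size_take hi in h.
by rewrite -e' tpath_stable ?(@tpath_stable i' (size ord)) //; lia.
Qed.

Lemma tree_ind (P : nat -> Prop) :
  (forall v, v \in ord -> (forall j, par v = j.+1 -> tl j \in sl -> tl j \in ord /\ P (tl j)) -> P v) ->
  forall v, v \in ord -> P v.
Proof.
move=> H v vo; rewrite -(nth_index 0%N vo); have hi : (index v ord < size ord)%N by rewrite index_mem.
move: (index v ord) hi => i; elim/ltn_ind: i => i IH hi.
apply: H; first exact: mem_nth.
move=> j ep js; have h := ord_par hi ep js.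
have hlt : (index (tl j) (take i ord) < i)%N by rewrite -index_mem size_take hi in h.
have e' : nth 0%N ord (index (tl j) (take i ord)) = tl j by rewrite -(nth_take 0%N hlt) nth_index.
split; first by apply: mem_take h.
by rewrite -e'; apply: IH => //; lia.
Qed.

End Tree.

Lemma sum_bump (l : seq nat) (f h : nat -> nat) u d : uniq l -> u \in l ->
  (\sum_(x <- l) (if x == u then f x + d else f x) * h x = \sum_(x <- l) f x * h x + d * h u)%N.
Proof.
move=> ul ul'; rewrite (bigD1_seq u) //= eqxx [X in _ = (X + _)%N](bigD1_seq u) //= mulnDl -!addnA; congr addn.
rewrite addnC; congr addn; apply: eq_bigr => x /negPf ->; by [].
Qed.

Section Blame.
Context {R : realType}.
Variables (B X n : nat) (tl hd : nat -> nat).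
Hypothesis X64 : (64 <= X)%N.
Hypothesis XB : (X ^ 8 <= B)%N.
Implicit Types (st : state R) (Q : state R -> nat -> Prop) (sl ord : seq nat).

Local Ltac bnd := solve [assumption | lia | match goal with w : wb _ _ |- _ => exact: w end].
Local Ltac ev tac := solve [by [] | rewrite /= /upd /=; tac; by [] | rewrite /= /upd /=; tac; lia].
Local Ltac iw i x tac := apply: (@ws _ _ _ X64 XB _ _ _ i x); [eassumption|by []|by []|ev tac|ev tac|bnd|].
Local Ltac iwl i x tac := apply: (@wl _ _ _ X64 XB _ _ _ i x); [eassumption|by []|by []|ev tac|ev tac|bnd|].
Local Ltac rw i x tac := apply: (@rs _ _ _ X64 XB _ _ _ i x); [eassumption|by []|by []|ev tac|ev tac|].
Local Ltac rwl i x tac := apply: (@rl _ _ _ X64 XB _ _ _ i x); [eassumption|by []|by []|ev tac|ev tac|].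

Definition charged (Cb : R) st st' j d : Prop :=
  if Cb <= rmem st 8 j + d%:R then imem st' 10 j = (2 * imem st 10 j)%N /\ rmem st' 8 j = 0
  else imem st' 10 j = imem st 10 j /\ rmem st' 8 j = rmem st 8 j + d%:R.

(** [ps] adds up [g] from the root of the tree to a vertex. It is dual to the subtree sums that
    [blame] forms. *)
Definition path_sum (par : nat -> nat) sl ord (g ps : nat -> nat) : Prop :=
  forall v, v \in ord -> ps v = (g v + if par v is j.+1 then (if tl j \in sl then ps (tl j) else 0) else 0)%N.

(** The identity for [path_sum] is a double counting: subtree sums weighed by [g] equal initial
    weights weighed by path sums. In the invariant the vertices still to be treated, [take k ord],
    are weighed by [ps] and the finished ones by [g]; treating a vertex moves the difference to its
    parent. With constant 1 in place of [ps] the same sum shows that the words do not overflow. *)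
Lemma blameP sl ord Cb Q st : wb X st -> ord_ok tl sl st ord -> rmem st 7 3 = Cb ->
  (forall u, (u < n)%N -> (imem st 11 u <= imem st 4 20)%N = (u \in sl)) ->
  (forall v j, v \in ord -> imem st 14 v = j.+1 -> [/\ hd j = v, (tl j < n)%N & imem st 1 j = tl j]) ->
  (forall j, (2 * imem st 10 j < X)%N) -> (size ord < X)%N -> (n < X)%N -> {in ord, forall v, (v < n)%N} ->
  (\sum_(v <- ord) imem st 16 v < X)%N ->
  (forall st' tm, wb X st' -> fr [:: 10; 16]%N [:: 12; 13; 17; 22]%N [:: 8]%N st st' ->
    (forall v j, v \in ord -> imem st 14 v = j.+1 -> (imem st 9 j <= 0)%N -> charged Cb st st' j (imem st' 16 v)) ->
    (forall j, (forall v, v \in ord -> imem st 14 v = j.+1 -> ~~ (imem st 9 j <= 0)%N) ->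
       imem st' 10 j = imem st 10 j /\ rmem st' 8 j = rmem st 8 j) ->
    (forall g ps, path_sum (imem st 14) sl ord g ps ->
       \sum_(v <- ord) imem st' 16 v * g v = \sum_(v <- ord) imem st 16 v * ps v)%N ->
    (forall v, v \in ord -> (imem st' 16 v <= \sum_(v <- ord) imem st 16 v)%N) ->
    (tm <= 14 * size ord + 1)%N -> Q st' tm) ->
  wpt B blame Q st.
Proof.
move=> w [e17 e15 uo so op] e3 hlev hpar hmu szX nX on sX HQ.
pose I (k : nat) s := [/\ wb X s, fr [:: 10; 16]%N [:: 12; 13; 17; 22]%N [:: 8]%N st s, imem s 4 17 = k /\ (k <= size ord)%N,
  (forall v j, v \in drop k ord -> imem st 14 v = j.+1 -> (imem st 9 j <= 0)%N -> charged Cb st s j (imem s 16 v)) /\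
    (forall j, (forall v, v \in drop k ord -> imem st 14 v = j.+1 -> ~~ (imem st 9 j <= 0)%N) ->
       imem s 10 j = imem st 10 j /\ rmem s 8 j = rmem st 8 j) &
  (forall g ps, path_sum (imem st 14) sl ord g ps ->
     \sum_(v <- take k ord) imem s 16 v * ps v + \sum_(v <- drop k ord) imem s 16 v * g v = \sum_(v <- ord) imem st 16 v * ps v)%N /\
  (\sum_(v <- take k ord) imem s 16 v * 1 <= \sum_(v <- ord) imem st 16 v)%N /\
  forall v, v \in drop k ord -> (imem s 16 v <= \sum_(v <- ord) imem st 16 v)%N].
apply: (@wpt_while _ B nat I (fun k => 14 * k)%N _ _ _ (size ord)).
- split=> //; first by rewrite drop_size; split.
  rewrite take_size drop_size; split=> [g ps _|]; first by rewrite big_nil addn0.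
  by split=> //; under eq_bigr do rewrite muln1.
- by move=> k s [ws' _ _ _ _]; apply: (bfits_ok X64 XB).
- move=> [|k] s [ws' F [e17s lek] [hc hn] [hs [hS hB]]]; rewrite [bval _ _]/= e17s // => _.
  have [Fa Fb Fc] := F; set v := nth 0%N ord k.
  have vo : v \in ord by apply: mem_nth.
  have vn : (v < n)%N by apply: on.
  have tk : take k.+1 ord = rcons (take k ord) v by rewrite (take_nth 0%N).
  have dk : drop k ord = v :: drop k.+1 ord by rewrite (drop_nth 0%N).
  have ut : uniq (rcons (take k ord) v) by rewrite -tk take_uniq.
  have vnt : v \notin take k ord by move: ut; rewrite rcons_uniq => /andP[].
  have utk : uniq (take k ord) by rewrite take_uniq.
  have vnd : v \notin drop k.+1 ord by have : uniq (drop k ord); [rewrite drop_uniq|rewrite dk /= => /andP[]].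
  have leS : (\sum_(x <- take k ord) imem s 16 x * 1 + imem s 16 v <= \sum_(x <- ord) imem st 16 x)%N.
    by move: hS; rewrite tk -cats1 big_cat /= big_seq1 muln1.
  have leSv : (imem s 16 v <= \sum_(x <- ord) imem st 16 x)%N by apply: leq_trans (leq_addl _ _) leS.
  have hB' u : u \in drop k ord -> (imem s 16 u <= \sum_(x <- ord) imem st 16 x)%N.
    by rewrite dk inE => /orP[/eqP ->|/hB].
  have e15s : imem s 15 k = v by rewrite Fa // e15.
  have e14s : imem s 14 = imem st 14 by rewrite Fa.
  iw 17%N k ltac:(rewrite ?e17s ?subn1) => w1.
  iw 12%N v ltac:(rewrite ?e15s) => w2.
  iw 13%N (imem st 14 v) ltac:(rewrite ?e14s); set s3 := iupd _ 4 13 _ => w3.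
  have F3 : fr [:: 10; 16]%N [:: 12; 13; 17; 22]%N [:: 8]%N st s3 by rewrite /s3; frt.
  apply: wpt_if; first exact: (bfits_ok X64 XB); rewrite [bval _ _]/= {1}/upd /=; last first.
    rewrite -ltnNge ltnS leqn0 => /eqP ep; apply: wpt_skip; exists k; last by clear; lia.
    split=> //; first by split=> //; lia.
      split=> [u j|j hj]; first by rewrite dk inE => /orP[/eqP ->|ud]; [rewrite ep|exact: hc].
      by apply: hn => u ud; apply: hj; rewrite dk inE ud orbT.
    split=> [g ps hps|]; last by split=> //; apply: leq_trans leS; apply: leq_addr.
    rewrite -(hs g ps hps) tk dk -cats1 big_cat /= big_cons big_seq1 (hps v vo) ep addn0 -addnA; congr addn.
  move=> ep; set j := (imem st 14 v).-1; have {}ep : imem st 14 v = j.+1 by rewrite /j prednK.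
  have [hj tn ej] := hpar v j vo ep.
  have eidj s' : imem s' 4 13 = imem s3 4 13 -> ival s' eid = j by move=> /= ->; rewrite /s3 /= /upd /= ep subn1.
  iw 22%N (tl j) ltac:(rewrite ?ep ?subn1 /= ?Fa // ?ej) => w4.
  set s4 := iupd _ 4 22 _ in w4 *.
  have F4 : fr [:: 10; 16]%N [:: 12; 13; 17; 22]%N [:: 8]%N st s4 by rewrite /s4; frt.
  have htest : bval s4 (BILe (IGet 11 (V 22)) (V 20)) = (tl j \in sl).
    by rewrite -hlev // /s4 /= /upd /= Fa // Fb.
  have tlk : tl j \in sl -> tl j \in take k ord by apply: op.
  have injp u : u \in ord -> imem st 14 u = j.+1 -> u = v by move=> uo' eu; have [<- _ _] := hpar u j uo' eu.
  have muj : imem s 10 j = imem st 10 j /\ rmem s 8 j = rmem st 8 j.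
    apply: hn => u ud eu; have e := injp u (mem_drop ud) eu; by move: ud vnd; rewrite e => ->.
  have fin s5 T : wb X s5 -> fr [:: 10; 16]%N [:: 12; 13; 17; 22]%N [:: 8]%N st s5 -> imem s5 4 17 = k -> imem s5 4 12 = v ->
     imem s5 4 13 = j.+1 -> imem s5 10 = imem s 10 -> rmem s5 8 = rmem s 8 -> imem s5 16 v = imem s 16 v ->
     (forall u, u \in drop k.+1 ord -> imem s5 16 u = imem s 16 u) ->
     (forall g ps, path_sum (imem st 14) sl ord g ps ->
       \sum_(v <- take k ord) imem s5 16 v * ps v + \sum_(v <- drop k ord) imem s5 16 v * g v = \sum_(v <- ord) imem st 16 v * ps v)%N ->
     (\sum_(v <- take k ord) imem s5 16 v * 1 <= \sum_(v <- ord) imem st 16 v)%N -> (T <= 7)%N ->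
     wpt B (If (BILe (IGet 9 eid) (C 0))
          (RSet 8 eid (RAdd (RGet 8 eid) (RInt (IGet 16 (V 12)))) ;;
           If (BRLe (RGet 7 (C 3)) (RGet 8 eid))
             (ISet 10 eid (IMul (C 2) (IGet 10 eid)) ;; RSet 8 eid (RInt (C 0))) Skip)
          Skip) (fun s' T' => exists2 k', I k' s' & (T' + T + 14 * k' < 14 * k.+1)%N) s5.
    move=> w5 F5 e17' e12' e13' e10' e8' e16v e16d hs' hS' leT; have [F5a F5b F5c] := F5.
    have eid5 : ival s5 eid = j by rewrite /= e13' subn1.
    have end_ s6 : wb X s6 -> fr [:: 10; 16]%N [:: 12; 13; 17; 22]%N [:: 8]%N st s6 -> imem s6 4 17 = k -> imem s6 16 = imem s5 16 ->
       ((imem st 9 j <= 0)%N -> charged Cb st s6 j (imem s 16 v)) ->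
       (~~ (imem st 9 j <= 0)%N -> imem s6 10 j = imem st 10 j /\ rmem s6 8 j = rmem st 8 j) ->
       (forall i, i != j -> imem s6 10 i = imem s 10 i /\ rmem s6 8 i = rmem s 8 i) -> I k s6.
      move=> w6 F6 e6 e16 h1 h2 h3; split=> //; [by split=> //; move: lek; clear; lia| |].
        2: by rewrite e16; split=> //; split=> // u ud; move: (ud); rewrite dk inE => /orP[/eqP ->|ud']; rewrite ?e16v ?e16d // hB.
      split=> [u i|i hi].
        rewrite dk inE => /orP[/eqP -> |ud].
          by rewrite ep => -[<-] /h1; rewrite e16 e16v.
        move=> eu ai; have nij : i != j.
          apply/eqP => e; rewrite e in eu; have := injp u (mem_drop ud) eu => e2; by move: ud vnd; rewrite e2 => ->.
        have := hc u i ud eu ai; have [m1 m2] := h3 i nij; rewrite /charged m1 m2 e16 e16d //.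
      have [e|nij] := eqVneq i j; last first.
        have [-> ->] := h3 i nij; apply: hn => u ud; apply: hi; by rewrite dk inE ud orbT.
      rewrite e; apply: h2; have := hi v; rewrite dk mem_head e; exact.
    apply: wpt_if; first exact: (bfits_ok X64 XB); rewrite -[bval s5 _]/(imem s5 9 (ival s5 eid) <= 0)%N eid5 F5a // => ha.
      rw j (rmem st 8 j + (imem s 16 v)%:R) ltac:(rewrite ?e13' ?subn1 /= ?e8' ?e12' ?e16v ?(proj2 muj)) => w6.
      apply: wpt_if; first exact: (bfits_ok X64 XB); rewrite [bval _ _]/= /upd /= e13' subn1 /= eqxx F5c // e3 => hb.
        have muX : (2 * imem st 10 j < X)%N := hmu j.
        iw j (2 * imem st 10 j)%N ltac:(rewrite ?e13' ?subn1 /= ?e10' ?(proj1 muj)) => w7.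
        rwl j (0 : R) ltac:(rewrite ?e13' ?subn1) => w8.
        exists k; last by move: leT; clear; lia.
        apply: end_ => //; [by frt| |by rewrite ha|].
          by move=> _; rewrite /charged hb /= /upd /= eqxx.
        by move=> i /negPf ni; rewrite /= /upd /= ni e10' e8'.
      apply: wpt_skip; exists k; last by move: leT; clear; lia.
      apply: end_ => //; [by frt| |by rewrite ha|].
        by move=> _; rewrite /charged (negPf hb) /= /upd /= eqxx e10' (proj1 muj).
      by move=> i /negPf ni; rewrite /= /upd /= ni e10' e8'.
    apply: wpt_skip; exists k; last by move: leT; clear; lia.
    apply: end_ => //; [by rewrite (negPf ha)|by rewrite e10' e8'|by move=> i _; rewrite e10' e8'].
  have e16v4 : imem s4 16 v = imem s 16 v by [].
  apply: (wif X64 XB) => //; rewrite htest => ht.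
    have tk' := tlk ht; have nev : tl j != v by apply: contraNneq vnt => <-.
    have subu : (imem s 16 (tl j) <= \sum_(x <- take k ord) imem s 16 x * 1)%N.
      by rewrite (bigD1_seq (tl j)) //= muln1 leq_addr.
    iw (tl j) (imem s 16 (tl j) + imem s 16 v)%N ltac:(idtac); set s5 := iupd _ 16 _ _ => w5.
    have E16 x : imem s5 16 x = if x == tl j then (imem s 16 x + imem s 16 v)%N else imem s 16 x.
      by rewrite /s5 /= /upd /=; case: eqP => [->|].
    apply: wpt_conseq (fin s5 7%N _ _ _ _ _ _ _ _ _ _ _ _) => //.
    - by move=> s' T' [k' h1 h2]; exists k' => //; move: h2; clear; lia.
    - by rewrite /s5; frt.
    - by rewrite E16 eq_sym (negPf nev).
    - move=> u ud; rewrite E16; case: eqP => // e; have : uniq (take k ord ++ drop k ord) by rewrite cat_take_drop.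
      by rewrite cat_uniq dk => /and3P[_ /hasPn h _]; have := h u; rewrite inE ud orbT e tk' => /(_ isT).
    - clearbody s5; move=> g ps hps; rewrite -(hs g ps hps) tk dk !big_cons -cats1 big_cat /= big_seq1 E16 eq_sym (negPf nev).
      under eq_bigr do rewrite E16; rewrite sum_bump // (hps v vo) ep ht.
      have -> : (\sum_(x <- drop k.+1 ord) imem s5 16 x * g x = \sum_(x <- drop k.+1 ord) imem s 16 x * g x)%N.
        rewrite big_seq [RHS]big_seq; apply: eq_bigr => u ud; rewrite E16; case: eqP => // e.
        have : uniq (take k ord ++ drop k ord) by rewrite cat_take_drop.
        by rewrite cat_uniq dk => /and3P[_ /hasPn h _]; have := h u; rewrite inE ud orbT e tk' => /(_ isT).
      by rewrite mulnDr; set a1 := (\sum_(_ <- _) _)%N; set a2 := (\sum_(_ <- _) _)%N; lia.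
    - by under eq_bigr do rewrite E16; rewrite sum_bump // muln1.
  apply: wskip; apply: wpt_conseq (fin s4 7%N _ _ _ _ _ _ _ _ _ _ _ _) => //.
  - by move=> s' T' [k' h1 h2]; exists k' => //; move: h2; clear; lia.
  - move=> g ps hps; rewrite -(hs g ps hps) tk dk !big_cons -cats1 big_cat /= big_seq1 (hps v vo) ep (negPf ht) addn0.
    by rewrite -addnA.
  - by apply: leq_trans leS; apply: leq_addr.
- move=> [|k] s T [ws' F [e17s lek] [hc hn] [hs [hS hB]]]; rewrite [bval _ _]/= e17s // => _ le.
  rewrite drop0 in hc hn hs hB; apply: HQ => //; last by move: le; clear; lia.
  by move=> g ps hps; rewrite -(hs g ps hps) take0 big_nil add0n.
Qed.

End Blame.

(** * Lengths and penalties along tree paths *)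

Section TreeGen.
Context {R : realType}.
Variables (par tl hd : nat -> nat) (wt : nat -> R) (sl ord : seq nat) (us : pred nat) (pn : nat -> R).
Variables (Y D : nat -> R).
Hypothesis ordU : uniq ord.
Hypothesis ord_sl : {subset ord <= sl}.
Hypothesis ord_par : forall i j, (i < size ord)%N -> par (nth 0%N ord i) = j.+1 ->
  tl j \in sl -> tl j \in take i ord.
Hypothesis pn1 : forall j, us j -> 1 <= pn j.
Hypothesis wt1 : forall j, us j -> 1 <= wt j.
Hypothesis Y0 : forall v, 0 <= Y v.

Lemma usable_len p : all us p -> 0 <= plen wt p.
Proof. by apply: plen_ge0. Qed.

Lemma prod_ge1 p : all us p -> 1 <= \prod_(j <- p) pn j.
Proof.
elim: p => [|j p IH] /=; first by rewrite big_nil.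
by move=> /andP[h /IH h2]; rewrite big_cons mulr_ege1 // pn1.
Qed.

Lemma keys_along u p v : (forall j, us j -> hd j \in sl -> Y (hd j) <= (Y (tl j) + wt j) * pn j) ->
  ipath tl hd us u p v -> all (fun j => hd j \in sl) p ->
  Y v <= \prod_(j <- p) pn j * (Y u + plen wt p).
Proof.
move=> H; elim: p u => [|j p IH] u /=; first by move=> /eqP -> _; rewrite big_nil mul1r plen_nil addr0.
move=> /and3P[uj /eqP ej hp] /andP[hj ha]; have h := IH _ hp ha; apply: le_trans h _.
rewrite big_cons plen_cons.
have p1 := prod_ge1 (ipath_all hp); have l0 := usable_len (ipath_all hp).
have h1 := H j uj hj; rewrite ej in h1; have h2 := pn1 uj; have h3 := wt1 uj; have yu := Y0 u.
rewrite [pn j * _]mulrC -mulrA ler_wpM2l //; first by lra.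
by move: h1; set x := Y (hd j); set y := plen wt p in l0 *; nra.
Qed.

Hypothesis parP : forall v, v \in sl -> (par v = 0%N /\ Y v = D v) \/
  exists j, [/\ us j, hd j = v, par v = j.+1 & Y v = (Y (tl j) + wt j) * pn j].
Hypothesis Y_out : forall j, us j -> tl j \notin sl -> Y (tl j) = D (tl j).

Notation P := (tree_path par tl sl ord).

(** A key dominates two quantities of its tree path: the length without penalties, which makes the
    path a witness, and the product of the penalties, because a nonempty path contains a weight of
    at least 1. *)
Lemma tree_pathP v : v \in ord -> exists u, [/\ ipath tl hd us u (P v) v,
  all (fun j => hd j \in sl) (P v), D u + plen wt (P v) <= Y v &
  P v != [::] -> \prod_(j <- P v) pn j <= Y v].
Proof.
move: v; apply: (tree_ind ord_par) => v vo IH.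
rewrite (tree_pathE ord_par vo); case: (parP (ord_sl vo)) => [[-> eY]|[j [uj hj ep eY]]].
  by exists v; rewrite /= plen_nil addr0 eY.
rewrite ep; have p1 := pn1 uj; have w1 := wt1 uj; have y0 := Y0 (tl j).
case: ifP => js.
  have [to [u [h1 h2 h3 h4]]] := IH j ep js; exists u; split.
  - by rewrite -cats1; apply: ipath_cat h1 _; rewrite /= uj hj !eqxx.
  - by rewrite all_rcons hj ord_sl.
  - rewrite -cats1 plen_cat plen_cons plen_nil eY; nra.
  - move=> _; rewrite -cats1 big_cat /= big_seq1 eY ler_wpM2r //; first by lra.
    by case: (eqVneq (P (tl j)) [::]) => [->|/h4]; rewrite ?big_nil; lra.
exists (tl j); split.
- by rewrite /= uj hj !eqxx.
- by rewrite /= hj ord_sl.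
- rewrite plen_cons plen_nil eY -Y_out ?js //; nra.
- by move=> _; rewrite big_seq1 eY; nra.
Qed.

Lemma tree_sum (f : nat -> nat) :
  path_sum tl par sl ord (fun v => if par v is j.+1 then f j else 0%N) (fun v => \sum_(j <- P v) f j)%N.
Proof.
move=> v vo; rewrite (tree_pathE ord_par vo); case: (par v) => [|j]; first by rewrite big_nil.
by case: ifP => _; rewrite ?big_seq1 ?addn0 // -cats1 big_cat /= big_seq1 addnC.
Qed.

(** The product of the penalties is at most the key, hence at most [(1 + delta) ^ N]. Its power with
    exponent [2 ^ a] is at least [1 + delta] to the sum of the multipliers, by [pen_lower] for each
    edge. *)
Lemma pen_sum (delta M : R) (N a : nat) (un : pred nat) (mu : nat -> nat) v : 0 < delta -> M <= (1 + delta) ^+ N ->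
  (0 < N)%N -> v \in ord -> Y v <= M -> delta <= 1 / 2 ->
  (forall j, us j -> un j -> (mu j <= 2 ^ a)%N /\ pn j = 1 + delta * (mu j)%:R / (2 ^ a)%:R) ->
  (\sum_(j <- P v) (if un j then mu j else 0) <= N * 2 ^ a)%N.
Proof.
move=> d0 MN N0 vo yM d1 hpn; have [u [hp _ _ hY]] := tree_pathP vo.
have [->|ne] := eqVneq (P v) [::]; first by rewrite big_nil.
have b0 : (0 < 2 ^ a)%N by rewrite expn_gt0.
rewrite -(@ler_eXn2l _ (1 + delta)); last by lra.
apply: le_trans (_ : (\prod_(j <- P v) pn j) ^+ (2 ^ a) <= _).
  rewrite expr_sum -prodrXl; have := ipath_all hp; elim: (P v) => [|j p IH]; first by rewrite !big_nil.
  rewrite !big_cons /= => /andP[uj /IH h]; have p1 := pn1 uj.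
  apply: ler_pM => //.
  - by case: ifP => _; rewrite exprn_ge0 //; lra.
  - by apply: prodr_ge0 => i _; case: ifP => _; rewrite exprn_ge0 //; lra.
  case: ifP => hu; last by rewrite expr0 exprn_ege1.
  have [h1 ->] := hpn j uj hu; by apply: pen_lower => //; apply: ltW.
have p1 := prod_ge1 (ipath_all hp).
rewrite mulnC exprM [X in _ <= X]exprAC.
by apply: lerXn2r; rewrite ?nnegrE; [lra|rewrite exprn_ge0 //; lra|apply: le_trans (hY ne) (le_trans yM MN)].
Qed.

End TreeGen.

Ltac flia := repeat match goal with H : ?T |- _ =>
  lazymatch type of T with Prop => idtac end;
  lazymatch T with
  | is_true (leq _ _) => fail
  | is_true (leq _ _ && leq _ _) => fail
  | is_true (~~ (_ == _)) => fail
  | is_true (~~ leq _ _) => fail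
  | @eq nat _ _ => fail
  | _ => clear H
  end end; lia.

Lemma subl (l l' : seq nat) : all (mem l') l -> {subset l <= l'}.
Proof. by move/allP. Qed.

(** * Rebuilding the levels below the top *)

Section Level.
Context {R : realType}.
Variables (B X n m L Hh N Cb t k W4 : nat) (tl hd : nat -> nat) (wt : nat -> R) (M delta ts : R) (A : seq nat).
Hypothesis X64 : (64 <= X)%N.
Hypothesis XB : (X ^ 8 <= B)%N.
Hypothesis n_gt0 : (0 < n)%N.
Hypothesis nX : (2 * n < X)%N.
Hypothesis nH : (2 * n <= 2 ^ Hh)%N.
Hypothesis M0 : 0 < M.
Hypothesis delta_gt0 : 0 < delta.
Hypothesis delta_le : delta <= 1 / 2.
Hypothesis ts_ge1 : 1 <= ts.
Hypothesis MN : M <= (1 + delta) ^+ N.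
Hypothesis N_gt0 : (0 < N)%N.
Hypothesis Cb_gt0 : (0 < Cb)%N.
Hypothesis kL : (k.+1 < L)%N.
Hypothesis tX : (t + 3 * 2 ^ L + L + W4 + 2 < X)%N.
Hypothesis wtA : forall j, j \in A -> 1 <= wt j.
Implicit Types (st : state R) (Q : state R -> nat -> Prop) (sl ord : seq nat).

Local Ltac bnd := solve [assumption | lia | match goal with w : wb _ _ |- _ => exact: w end].
Local Ltac ev tac := solve [by [] | rewrite /= /upd /=; tac; by [] | rewrite /= /upd /=; tac; lia].
Local Ltac iw i x tac := apply: (@ws _ _ _ X64 XB _ _ _ i x); [eassumption|by []|by []|ev tac|ev tac|bnd|].
Local Ltac iwl i x tac := apply: (@wl _ _ _ X64 XB _ _ _ i x); [eassumption|by []|by []|ev tac|ev tac|bnd|].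
Local Ltac rw i x tac := apply: (@rs _ _ _ X64 XB _ _ _ i x); [eassumption|by []|by []|ev tac|ev tac|].
Local Ltac rwl i x tac := apply: (@rl _ _ _ X64 XB _ _ _ i x); [eassumption|by []|by []|ev tac|ev tac|].

Notation adj_ok := (adj_ok n tl hd wt).
Notation lst := (lst n).
Notation keys_ok := (keys_ok n M).

Definition lc st : Prop :=
  [/\ imem st 0 0 = n, imem st 0 1 = m, imem st 4 0 = L, imem st 4 1 = (2 ^ k)%N &
  [/\ imem st 4 2 = k.+1, imem st 4 4 = t, (forall i, (i <= L)%N -> imem st 18 i = (2 ^ i)%N), adj_ok st A &
  [/\ rmem st 7 1 = delta, rmem st 7 3 = Cb%:R, rmem st 7 4 = 1 + delta, rmem st 7 5 = ts & keys_ok st]]].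

(** Blame is stored as a real, since its threshold [Cb] grows with [W] and [1 / eps] and may exceed
    every machine word. Its values are natural numbers, being sums of degrees. *)
Definition bln st j := Num.truncn (rmem st 8 j).
(** A doubling of the multiplier [mu] adds [mu * Cb] to the first term, which is what [Cb] units of
    blame weighed by [mu] have contributed to the second. *)
Definition chi st j := ((imem st 10 j).-1 * Cb + bln st j * imem st 10 j)%N.
(** Total blame, with [Cb + W4] for each doubling: the part [W4] makes up for the charge that
    triggers the doubling and is lost when the blame is reset. *)
Definition psi st j := (trunc_log 2 (imem st 10 j) * (Cb + W4) + bln st j)%N.

Definition muok st : Prop := (forall j, (j < m)%N ->
  (exists2 e, imem st 10 j = (2 ^ e)%N & (e <= L)%N) /\ exists2 b, rmem st 8 j = b%:R & (b < Cb)%N) /\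
  forall j, (m <= j)%N -> imem st 10 j = 0%N.

(** If the multiplier doubles, then the old blame [b] satisfies [b + d >= Cb]. So [chi] grows by
    [(Cb - b) * mu <= d * mu], and [psi] grows by [Cb + W4 - b >= d]. *)
Lemma chargedP st st' j d : (j < m)%N -> muok st -> charged Cb%:R st st' j d -> (d <= W4)%N ->
  (2 * imem st 10 j <= 2 ^ L)%N ->
  [/\ (chi st' j <= chi st j + d * imem st 10 j)%N, (psi st j + d <= psi st' j)%N, (imem st 10 j <= imem st' 10 j)%N &
    (exists2 e, imem st' 10 j = (2 ^ e)%N & (e <= L)%N) /\ exists2 b, rmem st' 8 j = b%:R & (b < Cb)%N].
Proof.
move=> jm [/(_ j jm) [[e em eL] [b eb bC]] _];
  have tr x : Num.truncn (x%:R : R) = x by exact: natrK.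
have tr0 : Num.truncn (0 : R) = 0%N by exact: (tr 0%N).
 rewrite /charged /chi /psi /bln eb em -natrD ler_nat.
have p0 : (0 < 2 ^ e)%N by rewrite expn_gt0.
case: leqP => hb [-> ->] dW hL.
  rewrite !tr tr0 -expnS !trunc_expnK //.
  split; [|nia|by rewrite expnS; lia|split].
  - rewrite expnS mul0n addn0; have : (Cb * 2 ^ e <= (b + d) * 2 ^ e)%N by rewrite leq_mul2r hb orbT.
    have -> : ((2 * 2 ^ e).-1 = (2 ^ e).-1 + 2 ^ e)%N by move: p0; clear; lia.
    by rewrite !mulnDl [(2 ^ e * Cb)%N]mulnC; move: (_.-1 * _)%N (Cb * _)%N (b * _)%N (d * _)%N; clear; lia.
  - by exists e.+1 => //; rewrite -(@leq_exp2l 2) // expnS.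
  - by exists 0%N.
rewrite !tr trunc_expnK //; split; [by rewrite mulnDl; lia|by lia|by []|split].
  by exists e.
by exists (b + d)%N.
Qed.

Definition hib a := ((t %/ 2 ^ maxn a k.+1).+1 * 2 ^ maxn a k.+1 + 2 ^ k)%N.
Definition cnd a j := [&& (j < m)%N, j \in A, (t <= j + 2 ^ k)%N & (j <= hib a)%N].
Definition th a : R := if (a < k.+1)%N then ts else 1 + delta.
Definition arr st j := (0 < imem st 9 j)%N && (j \in A).
Definition lim a := if (a < k.+1)%N then (2 ^ a)%N else (2 ^ L).+1.
Definition fac a : R := if (a < k.+1)%N then delta / (2 ^ a)%:R else 0.

Lemma parametersP a Q st : wb X st -> lc st -> imem st 4 10 = a -> (0 < a < L)%N ->
  (forall st' tm, wb X st' -> fr [::] [:: 15; 16; 20; 23]%N [:: 7]%N st st' ->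
     (forall i, i != 6%N -> i != 8%N -> rmem st' 7 i = rmem st 7 i) ->
     imem st' 4 20 = a.+1 -> imem st' 4 16 = lim a -> imem st' 4 15 = hib a ->
     rmem st' 7 6 = fac a -> rmem st' 7 8 = th a -> (tm <= 8)%N -> Q st' tm) ->
  wpt B parameters Q st.
Proof.
move=> w [e0 em eL eK [e2 e4 hp ha [d1 d3 d4 d5 hk]]] e10 haL HQ.
have p0 c : (0 < 2 ^ c)%N by rewrite expn_gt0.
have hibX : (hib a < X)%N.
  rewrite /hib mulSn; have := leq_trunc_div t (2 ^ maxn a k.+1).
  have : (2 ^ maxn a k.+1 <= 2 ^ L)%N by rewrite leq_exp2l //; lia.
  have : (2 ^ k <= 2 ^ L)%N by rewrite leq_exp2l //; lia.
  by lia.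
iw 20%N a.+1 ltac:(rewrite ?e10 ?addn1) => w1.
have fin s T P : wb X s -> fr [::] [:: 15; 16; 20; 23]%N [:: 7]%N st s ->
  (forall i, i != 6%N -> i != 8%N -> rmem s 7 i = rmem st 7 i) -> imem s 4 20 = a.+1 -> imem s 4 16 = lim a ->
  rmem s 7 6 = fac a -> rmem s 7 8 = th a -> imem s 4 23 = P -> P = (2 ^ maxn a k.+1)%N -> (T <= 7)%N ->
  wpt B (setV 15 (IAdd (IMul (IAdd (IDiv (V 4) (V 23)) (C 1)) (V 23)) (V 1))) (fun s' T' => Q s' (T' + T)%N) s.
  move=> ws' F f7 f20 f16 f6 f8 f23 eP leT; have [Fa Fb Fc] := F.
  have f1 : imem s 4 1 = (2 ^ k)%N by rewrite Fb.
  have f4 : imem s 4 4 = t by rewrite Fb.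
  iwl 15%N (hib a) ltac:(rewrite ?f23 ?eP ?f4 ?f1 ?addn1) => wn.
  by apply: HQ => //; first [by frt | lia].
have a2 : (2 ^ a < 2 ^ L)%N by rewrite ltn_exp2l //; lia.
have q2 : (2 ^ k.+1 < 2 ^ L)%N by rewrite ltn_exp2l.
have pa : imem st 18 a = (2 ^ a)%N by apply: hp; lia.
have pq : imem st 18 k.+1 = (2 ^ k.+1)%N by apply: hp; lia.
have pL : imem st 18 L = (2 ^ L)%N by apply: hp.
apply: (wif X64 XB) => //; rewrite [bval _ _]/= /upd /= e10 e2 addn1 => hq.
  have [l1 l2 l3] : [/\ lim a = (2 ^ a)%N, fac a = delta / (2 ^ a)%:R & th a = ts] by rewrite /lim /fac /th hq.
  apply: wassoc; iw 16%N (2 ^ a)%N ltac:(rewrite ?e10 ?pa) => w2.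
  apply: wassoc; rw 6%N (delta / (2 ^ a)%:R) ltac:(rewrite ?e10 ?pa ?d1) => w3.
  apply: wassoc; rw 8%N ts ltac:(rewrite ?d5) => w4.
  iw 23%N (2 ^ k.+1)%N ltac:(rewrite ?e2 ?pq); set s := iupd _ 4 23 _ => w5.
  apply: wpt_conseq (fin s 6%N (2 ^ k.+1)%N _ _ _ _ _ _ _ _ _ _) => //.
  - by move=> s' T'; rewrite addnC.
  - by rewrite /s; frt.
  - by move=> i /negPf h6 /negPf h8; rewrite /s /= /upd /= h6 h8.
  - by congr (2 ^ _)%N; lia.
have [l1 l2 l3] : [/\ lim a = (2 ^ L).+1%N, fac a = 0 & th a = 1 + delta] by rewrite /lim /fac /th (negPf hq).
apply: wassoc; iw 16%N (2 ^ L).+1 ltac:(rewrite ?eL ?pL ?addn1) => w2.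
apply: wassoc; rw 6%N (0 : R) ltac:(idtac) => w3.
apply: wassoc; rw 8%N (1 + delta) ltac:(rewrite ?d4) => w4.
iw 23%N (2 ^ a)%N ltac:(rewrite ?e10 ?pa); set s := iupd _ 4 23 _ => w5.
apply: wpt_conseq (fin s 6%N (2 ^ a)%N _ _ _ _ _ _ _ _ _ _) => //.
- by move=> s' T'; rewrite addnC.
- by rewrite /s; frt.
- by move=> i /negPf h6 /negPf h8; rewrite /s /= /upd /= h6 h8.
- by congr (2 ^ _)%N; lia.
Qed.

Lemma dframe_fr st st' : dframe st st' ->
  fr [:: 14; 15]%N [:: 11; 12; 13; 14; 17; 18; 22]%N [:: 5; 6; 7]%N st st'.
Proof. by case. Qed.

Lemma sum_inj_le (l : seq nat) (f h : nat -> nat) (Z : pred nat) :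
  uniq [seq f v | v <- l] -> (forall v, v \in l -> (f v < m)%N && Z (f v)) ->
  (\sum_(v <- l) h (f v) <= \sum_(j < m | Z j) h j)%N.
Proof.
move=> u hl; rewrite -(big_mkord Z h) -[X in (_ <= X)%N]big_filter -(big_map f xpredT h).
apply: uniq_sum_sub u _ => j /mapP[v /hl /andP[h1 h2] ->].
by rewrite mem_filter h2 mem_index_iota h1.
Qed.

(* What rebuilding level a establishes: the certificate, the witnesses of the
   alarms, and the accounting of the blame. *)
Definition level_fact a st st' : Prop :=
  [/\ (forall u p v, (v < n)%N ->
      ipath tl hd (fun j => arr st j || (cnd a j && ((a < k.+1)%N ==> (imem st 10 j < 2 ^ a)%N))) u p v ->
      all (fun j => (imem st 11 (hd j) <= a.+1)%N) p -> ~~ (imem st' 11 v <= a)%N ->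
      rmem st 4 v <= th a * (\prod_(j <- p)
        (if (a < k.+1)%N && ~~ arr st j then 1 + delta * (imem st 10 j)%:R / (2 ^ a)%:R else 1)) *
        (rmem st 4 u + plen wt p)),
    (forall Z : pred nat, exists Xa : pred nat, (forall v, Xa v -> exists j, Z j) /\
      ((a < k.+1)%N -> (\sum_(v < n | (imem st' 11 v <= a)%N && Xa v) imem st 17 v <=
         \sum_(j < m | Z j) (psi st' j - psi st j))%N) /\
      forall v, (v < n)%N -> (imem st' 11 v <= a)%N -> ~~ Xa v -> exists u p,
        [/\ ipath tl hd (fun j => arr st j || (cnd a j && ~~ Z j)) u p v,
          all (fun j => (imem st 11 (hd j) <= a.+1)%N) p & th a * (rmem st 4 u + plen wt p) < rmem st 4 v]),
    ((a < k.+1)%N -> (\sum_(j < m) chi st' j <= \sum_(j < m) chi st j +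
       N * (2 ^ a * \sum_(v < n | imem st' 11 v <= a) imem st 17 v))%N),
    (forall j, (j < m)%N -> (psi st j <= psi st' j)%N /\ (imem st 10 j <= imem st' 10 j)%N) &
    (~~ (a < k.+1)%N -> imem st' 10 = imem st 10 /\ rmem st' 8 = rmem st 8)].

(** One run of Dijkstra's algorithm yields everything. Its keys are relaxed, which certifies the
    vertices that are not selected. The tree path of a selected vertex is no longer than its key and
    is the witness of the alarm. The unarrived edges of these tree paths receive the blame. *)
Lemma levelP a Q st : wb X st -> lc st -> imem st 4 10 = a -> (0 < a < L)%N ->
  (forall b, (a < b <= L)%N -> exists sl, lst st b sl) -> (forall v, (v < n)%N -> (a < imem st 11 v)%N) ->
  (forall v, (v < n)%N -> (imem st 11 v <= L)%N -> has (fun j => hd j == v) A) ->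
  muok st -> (forall j, j \in A -> (m <= j)%N -> (0 < imem st 9 j)%N) -> (\sum_(v < n) imem st 17 v <= W4)%N ->
  (forall st' tm, wb X st' -> lc st' ->
    fr [:: 10; 11; 12; 13; 14; 15; 16]%N [:: 11; 12; 13; 14; 15; 16; 17; 18; 20; 22; 23]%N [:: 5; 6; 7; 8]%N st st' ->
    (forall i, i \notin [:: 6; 7; 8]%N -> rmem st' 7 i = rmem st 7 i) -> 0 <= rmem st' 7 6 ->
    (forall b, (a <= b <= L)%N -> exists sl, lst st' b sl) -> (forall v, (v < n)%N -> (a <= imem st' 11 v)%N) ->
    (forall v b, (v < n)%N -> (a < b)%N -> (imem st' 11 v <= b)%N = (imem st 11 v <= b)%N) ->
    muok st' -> level_fact a st st' ->
    (tm <= (5 * Hh + 80) * (6 * \sum_(v < n | imem st 11 v <= a.+1) imem st 17 v) + 60)%N -> Q st' tm) ->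
  wpt B level Q st.
Proof.
move=> w hlc e10 haL hlists hlev hhas hmu hAm hW HQ.
have [e0 em eL eK [e2 e4 hpw ha [d1 d3 d4 d5 hk]]] := hlc.
have [uA hA chi_ cho hdg] := ha; have [kt1 kt2 kt3 kt4 kt5] := hk.
have p0 c : (0 < 2 ^ c)%N by rewrite expn_gt0.
have [sl hl] := hlists a.+1 ltac:(flia).
have [usl sln slsz slnth slP] := hl; have szl := lst_size hl.
have slh v : v \in sl -> has (fun j => hd j == v) A.
  by move=> vs; have hv := sln v vs; apply: hhas => //; move: vs; rewrite slP //; flia.
have mu2 j : (2 * imem st 10 j < X)%N.
  have [h1 h2] := hmu; have [jm|jm] := ltnP j m; last by rewrite h2 // muln0; flia.
  have [[e -> eL'] _] := h1 j jm; have : (2 ^ e <= 2 ^ L)%N by rewrite leq_exp2l.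
  by flia.
have th1 : 1 <= th a by rewrite /th; case: ifP => _ //; have := delta_gt0; lra.
have fac0 : 0 <= fac a by rewrite /fac; case: ifP => _ //; rewrite divr_ge0 // ltW.
have W_E : (\sum_(v < n | imem st 11 v <= a.+1) imem st 17 v = \sum_(v <- sl) imem st 17 v)%N.
  rewrite -(big_mkord (fun v => (imem st 11 v <= a.+1)%N) (imem st 17)) -big_filter; apply: perm_big.
  apply: uniq_perm => //; first by rewrite filter_uniq ?iota_uniq.
  move=> v; rewrite mem_filter mem_index_iota /=; case: (ltnP v n) => hv; first by rewrite andbT slP.
  by rewrite andbF; apply/esym/negbTE/negP => /sln; rewrite ltnNge hv.
apply: wpt_seq; apply: (@parametersP a _ st) => // s1 T1 w1 F1 f7 e20 e16 e15 e6 e8 le1.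
have [F1a F1b F1c] := F1.
have ha1 : adj_ok s1 A by move: ha; rewrite /adj_ok !F1a // !F1c.
have hl1 : lst s1 (imem s1 4 20) sl by rewrite e20; move: hl; rewrite /lst !F1a.
have hk1 : keys_ok s1.
  split; [by rewrite F1c|by move=> u; rewrite /leaf F1c //; exact: kt2|by move=> v; rewrite !F1c //; exact: kt3|by rewrite f7|by move=> v; rewrite F1c //; exact: kt5].
apply: wpt_seq; apply: (@dij_callP R B X n Hh tl hd wt M X64 XB n_gt0 nX nH M0 A sl _ s1) => //; rewrite ?F1a ?e6 //.
move=> s2 ord T2 [w2 fr2 [tr2 lf2] ok2 [g1 g2 g3 g4 g5]] le2; have [f2a f2b f2c f2d] := fr2.
have [h17 h15 oU oS oP] := ok2.
have eD : rmem s1 4 = rmem st 4 by rewrite F1c.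
rewrite eD in g1 g2 g3.
pose arr0 j := (0 < imem st 9 j)%N; pose mu j := imem st 10 j.
pose us j := (j \in A) && (arr0 j || candidate s1 j).
pose pn j : R := if arr0 j then 1 else 1 + fac a * (mu j)%:R.
(* Beyond the vertices the keys are set to 0, so that they are nonnegative for all naturals. *)
pose Y v := if (v < n)%N then rmem s2 5 v else 0.
have YE v : (v < n)%N -> Y v = rmem s2 5 v by rewrite /Y => ->.
have candE j : candidate s1 j = [&& (j < m)%N, (t <= j + 2 ^ k)%N, (j <= hib a)%N & (mu j < lim a)%N].
  by rewrite /candidate (F1a 0%N) // (F1a 10%N) // em (F1b 4%N) // e4 (F1b 1%N) // eK e15 e16.
have extE j b' : j \in A -> ext s1 j b' = if us j then (b' + wt j) * pn j else M.
  move=> jA; have [_ _ _ _ ew] := hA j jA; rewrite /ext /us /pn jA F1a // F1c // ew e6 /arr0 /mu.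
  case: ifP => _ /=; first by rewrite mulr1.
  by case: ifP => _; rewrite ?F1a // f7.
have us_tl j : us j -> [/\ (tl j < n)%N, (hd j < n)%N & j \in A] by move=> /andP[jA _]; have [] := hA j jA.
have pn1 j : us j -> 1 <= pn j by move=> _; rewrite /pn; case: ifP => _ //; rewrite lerDl mulr_ge0.
have wt1 j : us j -> 1 <= wt j by move=> /us_tl[_ _ /wtA].
have D0 v : (v < n)%N -> 0 <= rmem st 4 v <= M by apply: kt5.
have Ybd v : (v < n)%N -> 0 <= rmem s2 5 v <= rmem st 4 v.
  move=> hv; have [vs|vs] := boolP (v \in sl); first exact: g2.
  by rewrite g1 // lexx andbT; have /andP[] := D0 v hv.
have Y0 v : 0 <= Y v by rewrite /Y; case: ifP => // /Ybd /andP[].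
have parP v : v \in sl -> (imem s2 14 v = 0%N /\ Y v = rmem st 4 v) \/
    exists j, [/\ us j, hd j = v, imem s2 14 v = j.+1 & Y v = (Y (tl j) + wt j) * pn j].
  move=> vs; have hv := sln v vs; rewrite YE //; case: (g3 v vs) => [[h1 h2]|[j [jA hj ep eY lt]]]; first by left.
  have [tn hn _ _ _] := hA j jA.
  right; exists j; rewrite YE //; move: eY; rewrite extE //; case: ifP => // _ eY; move: lt; rewrite eY.
  by have /andP[_ h] := D0 v hv; rewrite ltNge h.
have Yout j : us j -> tl j \notin sl -> Y (tl j) = rmem st 4 (tl j) by move=> /us_tl[tn _ _] hs; rewrite YE // g1.
have tpP := @tree_pathP R (imem s2 14) tl hd wt sl ord us pn Y (rmem st 4) oS oP pn1 wt1 Y0 parP Yout.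
have pnE j : j \in A -> pn j = if (a < k.+1)%N && ~~ arr st j then 1 + delta * (mu j)%:R / (2 ^ a)%:R else 1.
  move=> jA; rewrite /pn /arr jA andbT /fac -/(arr0 j); case: (arr0 j) => /=; first by rewrite andbF.
  by rewrite andbT; case: ifP => _; rewrite ?mul0r ?addr0 // mulrAC.
have cndP j : us j -> ~~ arr st j -> cnd a j /\ (mu j < lim a)%N.
  move=> /andP[jA]; rewrite /arr jA andbT -/(arr0 j) candE => /orP[->//|/and4P[h1 h2 h3 h4]] _.
  by rewrite /cnd h1 jA h2 h3.
have us_sub (Z : pred nat) p : {in p, forall j, ~~ arr0 j -> ~~ Z j} ->
    {in p, forall j, us j -> arr st j || (cnd a j && ~~ Z j)}.
  move=> hZ j jp uj; have [//|na] := boolP (arr st j); have [-> _] := cndP j uj na; apply: hZ => //.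
  by move: na; rewrite /arr; have [_ _ ->] := us_tl j uj; rewrite andbT.
have l2 : lst s2 a.+1 sl by move: hl; rewrite /lst !f2a // !F1a.
have e20' : imem s2 4 20 = a.+1 by rewrite f2b.
have lev2 : imem s2 11 = imem st 11 by rewrite f2a // F1a.
apply: wpt_seq; apply: (@selectP R B X n Hh M X64 XB n_gt0 nX nH M0 sl a a.+1 (th a) _ s2) => //.
- by rewrite f2a // F1a.
- by rewrite f2b // F1b.
- by flia.
- by flia.
- by rewrite f2d.
- by move=> v hv; rewrite lev2; apply: hlev.
move=> s3 T3 w3 F3 lev3 sub3 keep3 lst3 le3; have [F3a F3b F3c] := F3.
rewrite lev2 in lev3; have eD2 : rmem s2 4 = rmem st 4 by rewrite f2c // eD.
have deg2 : imem s2 17 = imem st 17 by rewrite f2a // F1a.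
rewrite eD2 in lev3 lst3; rewrite eD2 deg2 in sub3.
pose sel v := th a * rmem s2 5 v < rmem st 4 v.
have S0E v : (v < n)%N -> (imem s3 11 v <= a)%N = (v \in sl) && sel v.
  move=> hv; rewrite lev3 -/(sel v); case: (_ && _); first by rewrite leqnn.
  by apply/negbTE; rewrite -ltnNge; apply: hlev.
(* A vertex that was not extracted has key [M], which no distance exceeds; so it is not selected and
   every selected vertex has a tree path. *)
have sel_ord v : (v \in sl) && sel v -> v \in ord.
  move=> /andP[vs hs]; apply: contraLR hs => vo; rewrite /sel g5 // -leNgt.
  have /andP[_ h] := D0 v (sln v vs); apply: le_trans h _; by rewrite ler_peMl // ltW.
have S0sum (h : nat -> nat) : (\sum_(v < n | imem s3 11 v <= a) h v = \sum_(v <- ord) (if sel v then h v else 0))%N.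
  rewrite -(big_mkord (fun v => (imem s3 11 v <= a)%N) h) -[RHS]big_mkcond -big_filter -[RHS]big_filter.
  apply: perm_big; apply: uniq_perm; rewrite ?filter_uniq ?iota_uniq // => v.
  rewrite !mem_filter mem_index_iota /=; case: (ltnP v n) => hv.
    rewrite andbT S0E //; apply/idP/idP => [h0|/andP[h1 h2]]; last by rewrite h1 oS.
    by rewrite (sel_ord v h0) andbT; case/andP: h0.
  by rewrite !andbF; apply/esym/negbTE/negP => /andP[_ /oS /sln]; rewrite ltnNge hv.
have sub3E v : v \in ord -> imem s3 16 v = if sel v then imem st 17 v else 0%N by move=> /oS; apply: sub3.
have sub3W : (\sum_(v <- ord) imem s3 16 v <= W4)%N.
  apply: leq_trans hW; rewrite big_seq (eq_bigr _ (fun v hv => sub3E v hv)) -big_seq -S0sum big_mkcond /=.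
  by apply: leq_sum => v _; case: ifP.
have wit v : (v < n)%N -> (imem s3 11 v <= a)%N -> exists u, [/\ ipath tl hd us u (tree_path (imem s2 14) tl sl ord v) v,
    all (fun j => hd j \in sl) (tree_path (imem s2 14) tl sl ord v) &
    th a * (rmem st 4 u + plen wt (tree_path (imem s2 14) tl sl ord v)) < rmem st 4 v].
  move=> hv; rewrite S0E // => h; have [u [h1 h2 h3 _]] := tpP v (sel_ord v h); exists u; split=> //.
  case/andP: h => _; apply: le_lt_trans; rewrite -YE //; apply: ler_wpM2l => //; lra.
have all_sl p : all (fun j => hd j \in sl) p -> all us p -> all (fun j => (imem st 11 (hd j) <= a.+1)%N) p.
  move=> /allP h1 /allP h2; apply/allP => j jp; rewrite -slP ?h1 //; by have [] := us_tl j (h2 j jp).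
have fact1 : forall u p v, (v < n)%N ->
      ipath tl hd (fun j => arr st j || (cnd a j && ((a < k.+1)%N ==> (imem st 10 j < 2 ^ a)%N))) u p v ->
      all (fun j => (imem st 11 (hd j) <= a.+1)%N) p -> ~~ (imem s3 11 v <= a)%N ->
      rmem st 4 v <= th a * (\prod_(j <- p)
        (if (a < k.+1)%N && ~~ arr st j then 1 + delta * (imem st 10 j)%:R / (2 ^ a)%:R else 1)) *
        (rmem st 4 u + plen wt p).
  move=> u p v hv hp hall nS.
  have /andP[dv0 _] := D0 v hv.
  case/lastP: p hp hall => [|p j] hp hall.
    by move: hp => /= /eqP ->; rewrite big_nil plen_nil mulr1 addr0; nra.
  have hpu : ipath tl hd us u (rcons p j) v.
    apply: ipath_sub hp => i ip /orP[/andP[h1 h2]|/andP[/and4P[h1 h2 h3 h4] h5]]; rewrite /us ?h2 /arr0 ?h1 //.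
    rewrite candE h1 h3 h4 /lim /=; case: ifP h5 => [_ /= -> |_ _]; first exact: orbT.
    have [hm _] := hmu; have [[e he eL'] _] := hm i h1; rewrite /mu he ltnS leq_exp2l // eL' orbT //.
  have hjv : hd j = v.
    elim: (p) u hpu {hp hall} => [|i p' IHp] x /=; last by move=> /and3P[_ _ /IHp].
    by move=> /and3P[_ _ /eqP].
  have allsl : all (fun i => hd i \in sl) (rcons p j).
    apply/allP => i ip; have [_ hn _] := us_tl i (allP (ipath_all hpu) i ip); rewrite slP //.
    by apply: (allP hall).
  have vs : v \in sl by rewrite -hjv; apply: (allP allsl); rewrite mem_rcons mem_head.
  have hY : rmem st 4 v <= th a * Y v.
    move: nS; rewrite S0E // vs /= /sel -leNgt YE //.
  have un : (u < n)%N.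
    case: (p) hpu => [|i p'] /= /and3P[ui /eqP <- _]; by have [] := us_tl _ ui.
  have hk' := @keys_along R tl hd wt sl us pn Y pn1 wt1 Y0 u (rcons p j) v.
  have {}hk' : Y v <= \prod_(i <- rcons p j) pn i * (Y u + plen wt (rcons p j)).
    apply: hk' => // i ui hi; have [tn hn iA] := us_tl i ui; rewrite !YE //.
    by have := g4 i iA hi; rewrite extE // ui.
  rewrite -mulrA; apply: le_trans hY _; rewrite ler_wpM2l //; first by lra.
  have -> : \prod_(i <- rcons p j) (if (a < k.+1)%N && ~~ arr st i then 1 + delta * (imem st 10 i)%:R / (2 ^ a)%:R else 1) =
      \prod_(i <- rcons p j) pn i.
    rewrite big_seq [RHS]big_seq; apply: eq_bigr => i ip; rewrite pnE //.
    by have [] := us_tl i (allP (ipath_all hpu) i ip).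
  apply: le_trans hk' _; rewrite ler_wpM2l //.
    by have := prod_ge1 pn1 (ipath_all hpu); lra.
  by rewrite lerD2r YE //; have /andP[] := Ybd u un.
have fin s4 T4 : wb X s4 -> fr [:: 10; 16]%N [:: 12; 13; 17; 22]%N [:: 8]%N s3 s4 -> muok s4 ->
   level_fact a st s4 -> (T4 <= 14 * size sl + 6)%N ->
   wpt B restore (fun s' T => Q s' (T1 + (T2 + (T3 + (T4 + T))))%N) s4.
  move=> w4 F4 hmu4 hfact le4; have [F4a F4b F4c] := F4.
  have [_ _ sz3 nth3 sP3] := keep3 a.+1 sl (ltnSn _) l2 (leqnn _).
  apply: (@restoreP R B X n Hh M X64 XB n_gt0 nX nH M0 sl a.+1 _ s4) => //.
  - by rewrite F4a // F3a // f2a // F1a.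
  - by rewrite F4b // F3b.
  - by rewrite F4a.
  - by move=> i hi; rewrite F4a ?nth3.
  move=> s5 T5 w5 F5 hY5 le5; have [F5a F5b F5c] := F5.
  have G2 := dframe_fr fr2.
  pose ia := [:: 10; 11; 12; 13; 14; 15; 16]%N; pose ks := [:: 11; 12; 13; 14; 15; 16; 17; 18; 20; 22; 23]%N.
  pose ra := [:: 5; 6; 7; 8]%N.
  have FF : fr ia ks ra st s5.
    apply: fr_trans (_ : fr ia ks ra st s4) _; last by apply: fr_sub F5; apply: subl.
    apply: fr_trans (_ : fr ia ks ra st s3) _; last by apply: fr_sub F4; apply: subl.
    apply: fr_trans (_ : fr ia ks ra st s2) _; last by apply: fr_sub F3; apply: subl.
    apply: fr_trans (_ : fr ia ks ra st s1) _; last by apply: fr_sub G2; apply: subl.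
    by apply: fr_sub F1; apply: subl.
  have [FFa FFb FFc] := FF.
  have c7 i : i \notin [:: 6; 7; 8]%N -> rmem s5 7 i = rmem st 7 i.
    rewrite !inE !negb_or => /and3P[i6 i7 i8].
    by rewrite F5c // F4c // F3c // f2d // f7.
  have f6 : 0 <= rmem s5 7 6 by rewrite F5c // F4c // F3c // f2d // e6.
  have D5 : rmem s5 4 = rmem st 4 by rewrite FFc.
  have lev5 v : imem s5 11 v = imem s3 11 v by rewrite F5a // F4a.
  have hf5 : level_fact a st s5.
    have e10' : imem s5 10 = imem s4 10 by rewrite F5a.
    have e8' : rmem s5 8 = rmem s4 8 by rewrite F5c.
    have e11' : imem s5 11 = imem s4 11 by rewrite F5a.
    by move: hfact; rewrite /level_fact /psi /chi /bln e10' e8' e11'.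
  have hk5 : keys_ok s5.
    split.
    - by rewrite F5c // F4c // F3c.
    - by move=> u hu; rewrite /leaf F5c // F4c // F3c //; apply: lf2.
    - move=> v hv; rewrite hY5 D5 F4c // F3c // eD2; case: ifP => // /negbT hs.
      by rewrite F4c // F3c // g1.
    - by rewrite c7.
    - by rewrite D5.
  apply: HQ => //.
  - split; [by rewrite (FFa 0%N)|by rewrite (FFa 0%N)|by rewrite FFb|by rewrite FFb|].
    split; [by rewrite FFb|by rewrite FFb|by rewrite (FFa 18%N)|by move: ha; rewrite /adj_ok !FFa // !FFc|].
    by split=> //; rewrite c7.
  - move=> b hb; have [eb|nb] := eqVneq b a.
      by rewrite eb; exists [seq v <- sl | th a * rmem s2 5 v < rmem st 4 v]; move: lst3; rewrite /lst !F5a // !F4a.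
    have [slb hlb] := hlists b ltac:(flia); exists slb.
    have : lst s3 b slb by apply: keep3; [flia|move: hlb; rewrite /lst !f2a // !F1a|flia].
    by rewrite /lst !F5a // !F4a.
  - move=> v hv; rewrite lev5 lev3; case: ifP => // _; exact: ltnW (hlev v hv).
  - move=> v b hv hb; rewrite lev5 lev3; case: ifP => // /andP[vs _].
    by move: vs; rewrite slP // => h; flia.
  - by move: hmu4; rewrite /muok !F5a // F5c.
  - rewrite W_E; have szW : (size sl <= \sum_(v <- sl) imem st 17 v)%N.
      rewrite -sum1_size big_seq [X in (_ <= X)%N]big_seq; apply: leq_sum => v vs; have hv := sln v vs.
      by have := slh v vs; rewrite has_count hdg //; clear; lia.
    have e17 : listW s1 sl = (\sum_(v <- sl) imem st 17 v)%N by rewrite /listW F1a.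
    rewrite e17 in le2; move: le1 le2 le3 le4 le5 szW; set x := (\sum_(_ <- _) _)%N; set y := (5 * Hh)%N.
    by clear; lia.
have bfalse : bval s3 (BILt (V 10) (V 2)) = (a < k.+1)%N.
  by rewrite /= !F3b // !f2b // !F1b // e10 e2 addn1.
apply: (wif X64 XB) => //; rewrite bfalse => hq.
  have par3 : imem s3 14 = imem s2 14 by rewrite F3a.
  have arr3 : imem s3 9 = imem st 9 by rewrite F3a // f2a // F1a.
  have mu3 : imem s3 10 = imem st 10 by rewrite F3a // f2a // F1a.
  have bl3 : rmem s3 8 = rmem st 8 by rewrite F3c // f2c // F1c.
  have lima : lim a = (2 ^ a)%N by rewrite /lim hq.
  have szo : (size ord <= size sl)%N by apply: uniq_leq_size.
  have par_us v j : v \in ord -> imem s2 14 v = j.+1 -> us j /\ hd j = v.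
    by move=> /oS /parP [[-> //]|[j' [uj hj -> _]]] [<-].
  apply: wpt_seq; apply: (@blameP R B X n tl hd X64 XB sl ord Cb%:R _ s3) => //.
  - by split; [rewrite F3b|rewrite (F3a 15%N)| | |rewrite (F3a 14%N)].
  - by rewrite F3c // f2d // f7.
  - move=> u hu; rewrite F3b // e20' lev3; case: ifP => [/andP[-> _]|_]; first by rewrite leqnSn.
    by rewrite slP.
  - move=> v j vo; rewrite par3 => ep; have [uj hj] := par_us v j vo ep; have [tn _ jA] := us_tl j uj.
    by have [_ _ e _ _] := hA j jA; split=> //; rewrite F3a // f2a // F1a.
  - by move=> j; rewrite mu3.
  - by flia.
  - by flia.
  - by move=> v /oS /sln.
  - by flia.
  rewrite par3 arr3 mu3 => s4 T4 w4 F4 hch hun hid hbd le4; have [F4a F4b F4c] := F4.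
  have unarr j : us j -> ~~ arr0 j -> (j < m)%N /\ (mu j < 2 ^ a)%N.
    move=> /andP[jA]; rewrite candE => /orP[->//|/and4P[h1 _ _ h4]] _; by rewrite -lima.
  have aL2 : (2 ^ a * 2 <= 2 ^ L)%N by rewrite -expnSr leq_exp2l //; flia.
  have chg v j : v \in ord -> imem s2 14 v = j.+1 -> ~~ arr0 j -> [/\ (j < m)%N,
     (chi s4 j <= chi st j + imem s4 16 v * mu j)%N, (psi st j + imem s4 16 v <= psi s4 j)%N, (mu j <= imem s4 10 j)%N &
     (exists2 e, imem s4 10 j = (2 ^ e)%N & (e <= L)%N) /\ exists2 b, rmem s4 8 j = b%:R & (b < Cb)%N].
    move=> vo ep na; have [uj hj] := par_us v j vo ep; have [jm jmu] := unarr j uj na.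
    have := hch v j vo ep; rewrite leqNgt => /(_ na) hc.
    have hc' : charged Cb%:R st s4 j (imem s4 16 v) by move: hc; rewrite /charged mu3 bl3.
    have [] := chargedP jm hmu hc' _ _ => //; first by apply: leq_trans (hbd v vo) sub3W.
    by rewrite mulnC; apply: leq_trans aL2; rewrite leq_mul2r ltnW.
  have same j : (forall v, v \in ord -> imem s2 14 v = j.+1 -> arr0 j) ->
      imem s4 10 j = imem st 10 j /\ rmem s4 8 j = rmem st 8 j.
    move=> h; have := hun j; rewrite bl3; apply=> v vo ep; by rewrite -ltnNge; apply: h vo ep.
  (* An edge is the parent edge of at most one vertex, namely its head. Sums over these vertices are
     therefore sums over the charged edges, without repetition. *)
  pose ord' := [seq v <- ord | (imem s2 14 v != 0%N) && ~~ arr0 (imem s2 14 v).-1].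
  have o'P v : v \in ord' -> exists j, [/\ v \in ord, imem s2 14 v = j.+1, ~~ arr0 j & (imem s2 14 v).-1 = j].
    rewrite mem_filter => /andP[/andP[h1 h2] h3]; exists (imem s2 14 v).-1; by rewrite prednK // lt0n.
  have o'U : uniq [seq (imem s2 14 v).-1 | v <- ord'].
    rewrite map_inj_in_uniq ?filter_uniq // => v v' /o'P[j [vo ep _ ->]] /o'P[j' [vo' ep' _ ->]] e.
    by have [_ <-] := par_us v j vo ep; have [_ <-] := par_us v' j' vo' ep'; rewrite e.
  have same' j : j \notin [seq (imem s2 14 v).-1 | v <- ord'] ->
      imem s4 10 j = imem st 10 j /\ rmem s4 8 j = rmem st 8 j.
    move=> hj; apply: same => v vo ep; apply: contraNT hj => na; apply/mapP; exists v; last by rewrite ep.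
    by rewrite mem_filter ep /= na.
  have split_j j : (exists v, [/\ v \in ord', imem s2 14 v = j.+1 & ~~ arr0 j]) \/
      (imem s4 10 j = imem st 10 j /\ rmem s4 8 j = rmem st 8 j).
    have [/mapP[v vo' ej]|h] := boolP (j \in [seq (imem s2 14 v).-1 | v <- ord']); last by right; apply: same'.
    by left; exists v; have [j' [vo ep na e]] := o'P v vo'; rewrite ej e.
  have gsum (f : nat -> nat) : (\sum_(v <- ord) imem s4 16 v *
      (if imem s2 14 v is j.+1 then (if arr0 j then 0 else f j) else 0) = \sum_(v <- ord') imem s4 16 v * f (imem s2 14 v).-1)%N.
    rewrite big_filter [RHS]big_mkcond; apply: eq_bigr => v _.
    by case: (imem s2 14 v) => [|j] /=; rewrite ?muln0 //; case: (arr0 j); rewrite ?muln0.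
  have ts' (f : nat -> nat) := hid _ _ (@tree_sum (imem s2 14) tl sl ord oP (fun j => if arr0 j then 0%N else f j)).
  have sum3 (h : nat -> nat) : (\sum_(v <- ord) imem s3 16 v * h v = \sum_(v <- ord) (if sel v then imem st 17 v * h v else 0))%N.
    rewrite big_seq [RHS]big_seq; apply: eq_bigr => v vo; rewrite sub3E //; by case: ifP.
  have hmu4 : muok s4.
    split=> j jm.
      have [[v [vo' ep na]]|[-> ->]] := split_j j; last by have [h _] := hmu; apply: h.
      by have [j' [vo _ _ _]] := o'P v vo'; have [] := chg v j vo ep na.
    have [[v [vo' ep na]]|[-> _]] := split_j j; last by have [_ h] := hmu; apply: h.
    by have [j' [vo _ _ _]] := o'P v vo'; have [jm' _ _ _ _] := chg v j vo ep na; flia.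
  have lev4 : imem s4 11 = imem s3 11 by rewrite F4a.
  have psi_m j : (psi st j <= psi s4 j)%N /\ (imem st 10 j <= imem s4 10 j)%N.
    have [[v [vo' ep na]]|[e1 e2']] := split_j j; last by rewrite /psi /bln e1 e2'.
    by have [j' [vo _ _ _]] := o'P v vo'; have [_ _ h3 h4 _] := chg v j vo ep na; split=> //; flia.
  apply: wpt_conseq (fin s4 T4.+1 w4 F4 hmu4 _ _).
  - by move=> s' T'; rewrite addSn addnS.
  - split.
    + by move=> u p v hv hp hall nS; apply: fact1 => //; rewrite -lev4.
    + move=> Z; pose P0 := tree_path (imem s2 14) tl sl ord.
      (* The excepted vertices are those whose tree path meets an unarrived edge of [Z]; their
         degrees are part of the charges of the edges in [Z]. *)
      exists (fun v => has (fun j => ~~ arr0 j && Z j) (P0 v)); split; first by move=> v /hasP[j _ /andP[_ zj]]; exists j.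
      split.
        move=> _; rewrite lev4.
        apply: leq_trans (_ : \sum_(v <- ord) (if sel v then imem st 17 v * (\sum_(j <- P0 v) (if arr0 j then 0 else Z j)) else 0) <= _)%N.
          rewrite -(S0sum (fun v => imem st 17 v * (\sum_(j <- P0 v) (if arr0 j then 0 else Z j)))%N).
          rewrite big_mkcond [X in (_ <= X)%N]big_mkcond /=; apply: leq_sum => v _; case: (imem s3 11 v <= a)%N => //=.
          case: ifP => // /hasP[j jp /andP[na zj]]; rewrite leq_pmulr // (big_rem j) //= (negPf na) zj //.
        rewrite -sum3 -(ts' (fun j => nat_of_bool (Z j))) gsum.
        apply: leq_trans (_ : \sum_(v <- [seq v <- ord' | Z (imem s2 14 v).-1]) (psi s4 (imem s2 14 v).-1 - psi st (imem s2 14 v).-1) <= _)%N.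
          rewrite [X in (_ <= X)%N]big_filter [X in (_ <= X)%N]big_mkcond big_seq [X in (_ <= X)%N]big_seq.
          apply: leq_sum => v /o'P[j [vo ep na ej]]; rewrite ej; case: (Z j); rewrite ?muln0 // muln1.
          by have [_ _ h3 _ _] := chg v j vo ep na; flia.
        apply: (@sum_inj_le _ (fun v => (imem s2 14 v).-1) (fun j => psi s4 j - psi st j)%N Z).
          by move: o'U; apply: subseq_uniq; apply: map_subseq; apply: filter_subseq.
        move=> v; rewrite mem_filter => /andP[zj /o'P[j [vo ep na ej]]]; rewrite zj andbT ej.
        by have [] := chg v j vo ep na.
      move=> v hv hS nX'; rewrite lev4 in hS; have [u [h1 h2 h3]] := wit v hv hS.
      exists u, (P0 v); split=> //; last by apply: all_sl h2 (ipath_all h1).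
      apply: ipath_sub h1; apply: us_sub => j jp na; apply: contra nX' => zj; apply/hasP; exists j => //.
      by rewrite na.
    + move=> _; rewrite lev4.
      have cd j : (chi s4 j <= chi st j + (chi s4 j - chi st j))%N by flia.
      have cd' : (\sum_(j < m) chi s4 j <= \sum_(j < m) (chi st j + (chi s4 j - chi st j)))%N by apply: leq_sum => j _.
      apply: leq_trans cd' _; rewrite big_split /= leq_add2l.
      apply: leq_trans (_ : \sum_(v <- ord') imem s4 16 v * mu (imem s2 14 v).-1 <= _)%N.
        apply: leq_trans (_ : \sum_(v <- ord') (chi s4 (imem s2 14 v).-1 - chi st (imem s2 14 v).-1) <= _)%N; last first.
          rewrite big_seq [X in (_ <= X)%N]big_seq; apply: leq_sum => v /o'P[j [vo ep na ->]].
          by have [_ h _ _ _] := chg v j vo ep na; flia.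
        rewrite -(big_mkord xpredT (fun j => chi s4 j - chi st j)%N).
        rewrite -(big_map (fun v => (imem s2 14 v).-1) xpredT (fun j => chi s4 j - chi st j)%N).
        rewrite (bigID (fun j => j \in [seq (imem s2 14 v).-1 | v <- ord'])) /= [X in (_ + X <= _)%N]big1 ?addn0; last first.
          by move=> j /same' [e1 e2']; rewrite /chi /bln e1 e2' subnn.
        rewrite -big_filter; apply: uniq_sum_sub; first by rewrite filter_uniq ?iota_uniq.
        by move=> j; rewrite mem_filter => /andP[].
      rewrite -(gsum mu) (ts' mu) sum3 S0sum !big_distrr /= big_seq [X in (_ <= X)%N]big_seq; apply: leq_sum => v vo.
      case: ifP => // _; rewrite mulnA [X in (_ <= X)%N]mulnC leq_mul2l; apply/orP; right.
      have hv := sln v (oS v vo).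
      have hYM : Y v <= M by rewrite YE //; have /andP[_ h] := Ybd v hv; apply: le_trans h _; by have /andP[] := D0 v hv.
      (* The unarrived multipliers on a tree path sum to at most [N * 2 ^ a], so an alarm raises
         [chi] by at most that much per unit of degree. *)
      have := @pen_sum R (imem s2 14) tl hd wt sl ord us pn Y (rmem st 4) oS oP pn1 wt1 Y0 parP Yout delta M N a (fun j => ~~ arr0 j) mu v
        delta_gt0 MN N_gt0 vo hYM delta_le.
      rewrite (eq_bigr (fun j => if arr0 j then 0%N else mu j)); last by move=> j _; case: (arr0 j).
      apply=> j uj na; have [_ h] := unarr j uj na; split; first exact: ltnW.
      by rewrite /pn (negPf na) /fac hq mulrAC.
    + by move=> j _; apply: psi_m.
    + by rewrite hq.
  - by flia.
apply: wskip; apply: wpt_conseq (fin s3 2%N w3 _ _ _ _) => //.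
- by move: hmu; rewrite /muok F3a // f2a // F1a // F3c // f2c // F1c.
- have mu3 : imem s3 10 = imem st 10 by rewrite F3a // f2a // F1a.
  have bl3 : rmem s3 8 = rmem st 8 by rewrite F3c // f2c // F1c.
  split=> //.
  + move=> Z; pose P0 := tree_path (imem s2 14) tl sl ord.
    exists (fun v => has (fun j => ~~ arr0 j && Z j) (P0 v)); split; first by move=> v /hasP[j _ /andP[_ zj]]; exists j.
    split; first by rewrite (negPf hq).
    move=> v hv hS nX'; have [u [h1 h2 h3]] := wit v hv hS.
    exists u, (P0 v); split=> //; last by apply: all_sl h2 (ipath_all h1).
    apply: ipath_sub h1; apply: us_sub => j jp na; apply: contra nX' => zj; apply/hasP; exists j => //.
    by rewrite na.
  + by rewrite (negPf hq).
  + by move=> j _; rewrite /psi /bln mu3 bl3.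
- by flia.
Qed.

(** The facts of all levels from [c] to [tp - 1], stated for the last state. The multipliers [muc]
    are those with which a level was rebuilt; blame may have raised them since, hence the
    inequality. *)
Definition levs_fact c tp st st' : Prop :=
  [/\ (forall a, (c <= a < tp)%N -> exists muc : nat -> nat, (forall j, (muc j <= imem st' 10 j)%N) /\
      forall u p v, (v < n)%N ->
      ipath tl hd (fun j => arr st' j || (cnd a j && ((a < k.+1)%N ==> (muc j < 2 ^ a)%N))) u p v ->
      all (fun j => (imem st' 11 (hd j) <= a.+1)%N) p -> ~~ (imem st' 11 v <= a)%N ->
      rmem st' 4 v <= th a * (\prod_(j <- p)
        (if (a < k.+1)%N && ~~ arr st' j then 1 + delta * (muc j)%:R / (2 ^ a)%:R else 1)) *
        (rmem st' 4 u + plen wt p)),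
    (forall a v, (c <= a < tp)%N -> (k.+1 <= a)%N -> (v < n)%N -> (imem st' 11 v <= a)%N -> exists u p,
        [/\ ipath tl hd (fun j => arr st' j || cnd a j) u p v,
          all (fun j => (imem st' 11 (hd j) <= a.+1)%N) p & (1 + delta) * (rmem st' 4 u + plen wt p) < rmem st' 4 v]),
    (forall Z : pred nat, exists Xf : nat -> nat -> bool,
      (\sum_(c <= a < minn tp k.+1) \sum_(v < n | (imem st' 11 v <= a)%N && Xf a v) imem st' 17 v <=
         \sum_(j < m | Z j) (psi st' j - psi st j))%N /\
      forall a v, (c <= a < minn tp k.+1)%N -> (v < n)%N -> (imem st' 11 v <= a)%N -> ~~ Xf a v -> exists u p,
        ipath tl hd (fun j => arr st' j || (cnd a j && ~~ Z j)) u p v /\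
        ts * (rmem st' 4 u + plen wt p) < rmem st' 4 v),
    (\sum_(j < m) chi st' j <= \sum_(j < m) chi st j +
       N * \sum_(c <= a < minn tp k.+1) 2 ^ a * \sum_(v < n | imem st' 11 v <= a) imem st' 17 v)%N &
    (forall j, (j < m)%N -> (psi st j <= psi st' j)%N) /\ (forall j, (imem st 10 j <= imem st' 10 j)%N)].

Lemma levs_fact0 tp st : levs_fact tp tp st st.
Proof.
split=> //.
- by move=> a; lia.
- by move=> a v; lia.
- move=> Z; exists (fun _ _ => false); split; first by rewrite big_geq ?geq_minl.
  by move=> a v; lia.
- exact: leq_addr.
Qed.

(** Rebuilding level [a] leaves the distances and the membership in higher lists alone, and
    multipliers only grow; so the facts about higher levels stay true and the increments of [psi]
    and [chi] add up. *)
Lemma levs_step a tp st s s' : (0 < a < tp)%N -> (forall j, j \in A -> (hd j < n)%N) ->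
  imem s' 9 = imem s 9 -> imem s' 17 = imem s 17 -> rmem s' 4 = rmem s 4 ->
  (forall v b, (v < n)%N -> (a < b)%N -> (imem s' 11 v <= b)%N = (imem s 11 v <= b)%N) ->
  muok s -> muok s' -> levs_fact a.+1 tp st s -> level_fact a s s' -> levs_fact a tp st s'.
Proof.
move=> atp hAn e9 e17 e4 hst [mu1 mu2] [mu1' mu2'] [c1 c2 c3 c4 [c5 c6]] [l1 l2 l3 l4 l5].
have mono j : (imem s 10 j <= imem s' 10 j)%N.
  by have [/l4 []//|h] := ltnP j m; rewrite mu2 // mu2'.
have earr : arr s' = arr s by apply/funext => j; rewrite /arr e9.
have all_st b p (Pr : pred nat) u v : (a < b)%N -> ipath tl hd Pr u p v -> (forall j, Pr j -> j \in A) ->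
    all (fun j => (imem s' 11 (hd j) <= b)%N) p = all (fun j => (imem s 11 (hd j) <= b)%N) p.
  move=> ab /ipath_all /allP hp hPr; apply: eq_in_all => j /hp /hPr /hAn hj; exact: hst.
have arrA j : arr s j -> j \in A by case/andP.
have cndA b j : cnd b j -> j \in A by case/and4P.
have sum_st b (Xf : pred nat) : (a < b)%N -> (\sum_(v < n | (imem s' 11 v <= b)%N && Xf v) imem s' 17 v =
    \sum_(v < n | (imem s 11 v <= b)%N && Xf v) imem s 17 v)%N.
  by move=> ab; rewrite e17; apply: eq_bigl => v; rewrite hst.
split.
- move=> b hb; rewrite earr e4; have [eb|nb] := eqVneq b a.
    rewrite eb; exists (imem s 10); split=> // u p v hv hp hall hS; apply: l1 => //.
    rewrite -(@all_st a.+1 _ _ _ _ _ hp) //.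
    by move=> j /orP[/arrA //|/andP[/cndA]].
  have [muc [h1 h2]] := c1 b ltac:(flia); exists muc; split=> [j|u p v hv hp hall hS]; first exact: leq_trans (h1 j) _.
  apply: h2 => //; last by rewrite -hst //; lia.
  rewrite -(@all_st b.+1 _ _ _ _ _ hp) //; first by lia.
  by move=> j /orP[/arrA //|/andP[/cndA]].
- move=> b v hb kb hv; rewrite earr e4; have [eb|nb] := eqVneq b a.
    rewrite eb => hS; have [Xa [hX [_ h]]] := l2 pred0.
    have nX' : ~~ Xa v by apply/negP => /hX [].
    have [u [p [h1 h2 h3]]] := h v hv hS nX'; exists u, p; split.
    + by apply: ipath_sub h1 => j _; rewrite andbT.
    + by rewrite (@all_st a.+1 _ _ _ _ _ h1) // => j /orP[/arrA //|/andP[/cndA]].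
    + by move: h3; rewrite /th -eb ltnNge kb.
  rewrite hst //; last by lia.
  move=> hS; have [u [p [h1 h2 h3]]] := c2 b v ltac:(flia) kb hv hS; exists u, p; split=> //.
  by rewrite (@all_st b.+1 _ _ _ _ _ h1) //; [flia|move=> j /orP[/arrA //|/cndA]].
- move=> Z; have [Xf [h1 h2]] := c3 Z; have [Xa [hX [h3 h4]]] := l2 Z.
  exists (fun b v => if b == a then Xa v else Xf b v).
  have tele : (\sum_(j < m | Z j) (psi s' j - psi st j) =
      \sum_(j < m | Z j) (psi s' j - psi s j) + \sum_(j < m | Z j) (psi s j - psi st j))%N.
    rewrite -big_split /=; apply: eq_bigr => j _; have := c5 j (ltn_ord j); have [] := l4 j (ltn_ord j); lia.
  have rest lo : (a < lo)%N -> (\sum_(lo <= b < minn tp k.+1) \sum_(v < n | (imem s' 11 v <= b)%N && (if b == a then Xa v else Xf b v)) imem s' 17 v =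
      \sum_(lo <= b < minn tp k.+1) \sum_(v < n | (imem s 11 v <= b)%N && Xf b v) imem s 17 v)%N.
    move=> hlo; rewrite big_nat [RHS]big_nat; apply: eq_bigr => b hb; have ab : (a < b)%N by lia.
    by rewrite (gtn_eqF ab) (sum_st b (Xf b)).
  split.
    rewrite tele; have [hq|hq] := ltnP a (minn tp k.+1).
      rewrite big_ltn // rest // eqxx; apply: leq_add; last exact: h1.
      by rewrite e17; apply: h3; lia.
    by rewrite big_geq.
  move=> b v hb hv; rewrite earr e4; have [eb|nb] := eqVneq b a.
    rewrite eb => hS nX'; have [u [p [g1 _ g3]]] := h4 v hv hS nX'; exists u, p; split=> //.
    by move: g3; rewrite /th; have -> : (a < k.+1)%N by lia.
  rewrite hst //; last by lia.
  by move=> hS nX'; apply: h2 => //; lia.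
- have eW b : (a < b)%N -> (\sum_(v < n | imem s' 11 v <= b) imem s' 17 v = \sum_(v < n | imem s 11 v <= b) imem s 17 v)%N.
    by move=> ab; rewrite e17; apply: eq_bigl => v; rewrite hst.
  have [hq|hq] := ltnP a (minn tp k.+1); last first.
    have [e1 e2] := l5 ltac:(flia); rewrite big_geq // muln0 addn0.
    have -> : (\sum_(j < m) chi s' j = \sum_(j < m) chi s j)%N by apply: eq_bigr => j _; rewrite /chi /bln e1 e2.
    by move: c4; rewrite big_geq ?muln0 ?addn0 //; lia.
  rewrite big_ltn // mulnDr e17; have := l3 ltac:(flia).
  rewrite (eq_big_nat _ _ (F2 := fun b => 2 ^ b * \sum_(v < n | imem s 11 v <= b) imem s 17 v)%N); last first.
    by move=> b hb; rewrite -eW ?e17 //; lia.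
  move: c4; set S1 := (\sum_(_ < m) _)%N; set S2 := (\sum_(_ < m) _)%N; set S3 := (\sum_(_ < m) _)%N.
  by set x := (_ * _)%N; set y := (_ * _)%N; clear; lia.
- split=> j; last exact: leq_trans (c6 j) _.
  by move=> jm; apply: leq_trans (c5 j jm) _; case: (l4 j jm).
Qed.

Lemma levelsP tp Q st : wb X st -> lc st -> imem st 4 9 = tp -> (0 < tp <= L)%N ->
  (forall b, (tp <= b <= L)%N -> exists sl, lst st b sl) -> (forall v, (v < n)%N -> (tp <= imem st 11 v)%N) ->
  (forall v, (v < n)%N -> (imem st 11 v <= L)%N -> has (fun j => hd j == v) A) -> 0 <= rmem st 7 6 ->
  muok st -> (forall j, j \in A -> (m <= j)%N -> (0 < imem st 9 j)%N) -> (\sum_(v < n) imem st 17 v <= W4)%N ->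
  (forall st' tm, wb X st' -> lc st' ->
    fr [:: 10; 11; 12; 13; 14; 15; 16]%N [:: 10; 11; 12; 13; 14; 15; 16; 17; 18; 20; 22; 23]%N [:: 5; 6; 7; 8]%N st st' ->
    0 <= rmem st' 7 6 ->
    (forall b, (0 < b <= L)%N -> exists sl, lst st' b sl) ->
    (forall v b, (v < n)%N -> (tp <= b)%N -> (imem st' 11 v <= b)%N = (imem st 11 v <= b)%N) ->
    muok st' -> levs_fact 1 tp st st' ->
    (tm <= L * ((5 * Hh + 80) * (6 * \sum_(v < n | imem st 11 v <= tp) imem st 17 v) + 64) + 4)%N -> Q st' tm) ->
  wpt B levels Q st.
Proof.
move=> w hlc e9 htp hlists hlev hhas hF6 hmu hAm hW HQ.
have [_ _ _ _ [_ _ _ ha _]] := hlc; have [_ hA _ _ _] := ha.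
have hAn j : j \in A -> (hd j < n)%N by move=> /hA [].
iw 10%N tp.-1 ltac:(rewrite ?e9 ?subn1) => w1.
set W0 := (\sum_(v < n | imem st 11 v <= tp) imem st 17 v)%N in HQ *.
set c0 := ((5 * Hh + 80) * (6 * W0) + 64)%N in HQ *.
pose ia := [:: 10; 11; 12; 13; 14; 15; 16]%N; pose ks := [:: 10; 11; 12; 13; 14; 15; 16; 17; 18; 20; 22; 23]%N.
pose ra := [:: 5; 6; 7; 8]%N.
pose I a s := [/\ wb X s /\ lc s, fr ia ks ra st s, imem s 4 10 = a /\ (a < tp)%N, 0 <= rmem s 7 6 &
  [/\ (forall b, (a < b <= L)%N -> exists sl, lst s b sl), (forall v, (v < n)%N -> (a < imem s 11 v)%N),
    (forall v b, (v < n)%N -> (tp <= b)%N -> (imem s 11 v <= b)%N = (imem st 11 v <= b)%N), muok s &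
    levs_fact a.+1 tp st s]].
apply: (@wpt_while _ B nat I (fun a => a * c0)%N _ _ _ tp.-1).
- split; [by split|by frt|by split=> //; flia|by []|split=> //].
  + by move=> b hb; apply: hlists; flia.
  + by move=> v hv; apply: leq_trans (hlev v hv); flia.
  + have -> : tp.-1.+1 = tp by flia.
    exact: (levs_fact0 tp st).
- by move=> a s [[ws' _] _ _ _ _]; apply: (bfits_ok X64 XB).
- move=> a s [[ws' hlc'] F [e10 atp] hf6 [hl hlv hst hmu' hfact]]; have [Fa Fb Fc] := F.
  rewrite [bval _ _]/= e10 => a0.
  apply: wpt_seq; apply: (@levelP a _ s) => //.
  + by flia.
  + by move=> v hv hL; apply: hhas => //; rewrite -hst //; flia.
  + by rewrite (Fa 9%N).
  + by rewrite (Fa 17%N).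
  move=> s2 T2 w2 hlc2 F2 f7 hf62 hl2 hlv2 hst2 hmu2 hfact2 le2; have [F2a F2b F2c] := F2.
  iwl 10%N a.-1 ltac:(rewrite ?F2b ?e10 ?subn1) => w3.
  exists a.-1.
    have F2' : fr ia ks ra s s2 by apply: fr_sub F2 => i // h; rewrite inE h orbT.
    split; [by split=> //; exact: hlc2|by apply: fr_sc => //; apply: fr_trans F F2'|by split=> //; flia|by []|].
    have aE : a.-1.+1 = a by flia.
    split=> //.
    * by move=> b hb; have [sl hsl] := hl2 b ltac:(flia); exists sl.
    * by move=> v hv; rewrite aE; apply: hlv2.
    * by move=> v b hv hb; rewrite /= hst2 ?hst //; flia.
    * rewrite aE; apply: (@levs_step a tp st s s2) => //; first by flia.
      + by rewrite F2a.
      + by rewrite F2a.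
      + by rewrite F2c.
  have eW : (\sum_(v < n | imem s 11 v <= a.+1) imem s 17 v <= W0)%N.
    rewrite /W0 (Fa 17%N) // big_mkcond [X in (_ <= X)%N]big_mkcond /=; apply: leq_sum => v _.
    case: ifP => // h; rewrite -(hst v tp) //.
    by have -> : (imem s 11 v <= tp)%N by flia.
  have le2' : (T2 <= (5 * Hh + 80) * (6 * W0) + 60)%N.
    by apply: leq_trans le2 _; rewrite leq_add2r !leq_mul2l eW !orbT.
  have -> : (a * c0 = c0 + a.-1 * c0)%N by rewrite -mulSn; congr (_ * _)%N; flia.
  by rewrite /c0; move: le2'; set x := (_ * (6 * _))%N; set y := (_.-1 * _)%N; clear; lia.
- move=> a s T [[ws' hlc'] F [e10 atp] hf6 [hl hlv hst hmu' hfact]] nb le.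
  have a0 : a = 0%N by move: nb; rewrite [bval _ _]/= e10; flia.
  rewrite a0 in hl hfact le *; apply: HQ => //.
  have : (tp.-1 * c0 <= L * c0)%N by rewrite leq_mul2r; apply/orP; right; flia.
  by move: le; set x := (_ * c0)%N; set y := (_ * c0)%N; clear; lia.
Qed.

End Level.

Notation level_weight := W.
Notation nearby := near.

(** * The invariant between insertions *)

Section Invariant.
Context {R : realType}.
Variables (X n m L Cb : nat) (tl hd : nat -> nat) (wt : nat -> R) (M delta ts : R) (A0 : seq nat) (idf : nat -> nat).

(** The edges present in the adjacency lists: the admissible predicted edges from the start, and an
    unpredicted edge from its arrival on. *)
Fixpoint adjl t : seq nat :=
  if t is t'.+1 then (if (idf t' < m)%N then adjl t' else (m + t')%N :: adjl t') else A0.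

(** The bound [t * 2 ^ L] keeps the clock below the word bound, as each arrival advances it by at
    most [2 ^ L]. *)
Definition sinv t (st : state R) : Prop :=
  [/\ wb X st, [/\ imem st 0 0 = n, imem st 0 1 = m, imem st 4 0 = L & imem st 4 4 = t],
    [/\ imem st 4 1 = (2 ^ (kc m idf t).1)%N, imem st 4 2 = (kc m idf t).1.+1, imem st 4 3 = (kc m idf t).2,
      (imem st 4 5 <= t * 2 ^ L)%N & forall i, (i <= L)%N -> imem st 18 i = (2 ^ i)%N],
    [/\ adj_ok n tl hd wt st (adjl t), hat_ok m tl hd wt st, (forall i, (0 < imem st 9 i)%N = arrived idf t i),
      lists n L st 1 & top_ok n L hd st (adjl t)] &
    [/\ muok m L Cb st, keys_ok n M st,
      [/\ rmem st 7 1 = delta, rmem st 7 3 = Cb%:R, rmem st 7 4 = 1 + delta & rmem st 7 5 = ts],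
      0 <= rmem st 7 6 &
      forall v, (v < n)%N -> rmem st 3 v = if M <= rmem st 4 v then -1 else rmem st 4 v]].

Lemma sinv_fr t st st' : fr [:: 3]%N [::] [:: 2]%N st st' -> wb X st' -> sinv t st -> sinv t st'.
Proof.
move=> [Fa Fb Fc] w' [w [e0 em eL e4] [k1 k2 k3 hTh hp] [ha hh h9 hl ht] [hmu hk [d1 d3 d4 d5] hF6 hout]].
split=> //.
- by split; rewrite ?(Fa 0%N) ?Fb.
- by split; rewrite ?(Fa 18%N) ?Fb.
- split; [by move: ha; rewrite /adj_ok !Fa // !Fc|by move: hh; rewrite /hat_ok !Fa // !Fc|by rewrite (Fa 9%N)|..].
    by move: hl; rewrite /lists /lst !Fa.
  by move: ht; rewrite /top_ok !Fa.
- split; [by move: hmu; rewrite /muok (Fa 10%N) // (Fc 8%N)|by move: hk; rewrite /keys_ok /leaf !Fc|..].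
  + by split; rewrite Fc.
  + by rewrite Fc.
  + by rewrite (Fc 3%N) // (Fc 4%N).
Qed.

Hypothesis A0m : forall j, j \in A0 -> (j < m)%N.
Hypothesis A0s : (size A0 <= m)%N.
Hypothesis idfE : forall t, (t < m)%N -> ~~ (idf t < m)%N -> idf t = (m + t)%N.
Hypothesis idA0 : forall t, (t < m)%N -> (idf t < m)%N -> idf t \in A0.
Hypothesis wtA0 : forall j, j \in A0 -> 1 <= wt j.
Hypothesis wtid : forall t, (t < m)%N -> 1 <= wt (idf t).

Lemma adjl_lt t j : j \in adjl t -> (j < m + t)%N.
Proof.
elim: t j => [|t IH] j /=; first by move=> /A0m; rewrite addn0.
case: ifP => _; first by move=> /IH; flia.
by rewrite inE => /orP[/eqP ->|/IH]; flia.
Qed.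

Lemma adjl_ge t j : (t <= m)%N -> j \in adjl t -> (m <= j)%N -> arrived idf t j.
Proof.
elim: t => [|t IH] /= tm; first by move=> /A0m; flia.
have st : arrived idf t j -> arrived idf t.+1 j.
  by rewrite /arrived -addn1 iotaD map_cat mem_cat => ->.
case: ifP => hid; first by move=> ja mj; apply/st/IH => //; exact: ltnW.
rewrite inE => /orP[/eqP -> _|ja mj]; last by apply/st/IH => //; exact: ltnW.
rewrite -(idfE tm) ?hid //; apply/mapP; exists t => //; by rewrite mem_iota /= add0n.
Qed.

Lemma adjl_wt t j : (t <= m)%N -> j \in adjl t -> 1 <= wt j.
Proof.
elim: t => [|t IH] /= tm; first exact: wtA0.
case: ifP => hid; first by apply: IH; exact: ltnW.
rewrite inE => /orP[/eqP ->|]; last by apply: IH; exact: ltnW.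
by rewrite -(idfE tm) ?hid //; apply: wtid.
Qed.

Lemma adjl_size t : (size (adjl t) <= m + t)%N.
Proof. by elim: t => [|t IH] /=; [rewrite addn0|case: ifP => _ /=; flia]. Qed.

Lemma adjl_sub t t' : (t <= t')%N -> {subset adjl t <= adjl t'}.
Proof.
move=> /subnK <-; elim: (t' - t)%N => // d IH j /IH; rewrite addSn /=.
by case: ifP => // _; rewrite inE => ->; rewrite orbT.
Qed.

Lemma adjl_arrived t j : (t <= m)%N -> arrived idf t j -> j \in adjl t.
Proof.
move=> tm /mapP[i]; rewrite mem_iota add0n /= => it ->.
have [h|h] := boolP (idf i < m)%N.
  by apply: (@adjl_sub 0%N) => //; apply: idA0 => //; exact: leq_trans it tm.
apply: (@adjl_sub i.+1) => //=; rewrite (negPf h) idfE ?mem_head //; exact: leq_trans it tm.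
Qed.

Lemma adjl_pred t j : (j < m)%N -> (j \in adjl t) = (j \in A0).
Proof.
move=> jm; elim: t => //= t IH; case: ifP => // _; rewrite inE IH.
by case: eqP => // e; move: jm; rewrite e; flia.
Qed.

Lemma deg_sum A : (\sum_(v < n) (count (fun j => hd j == v) A + count (fun j => tl j == v) A) <= 2 * size A)%N.
Proof.
have hx (x : nat) : (\sum_(v < n) (x == v :> nat) <= 1)%N.
  have [lt|ge] := ltnP x n.
    rewrite (bigD1 (Ordinal lt)) //= eqxx big1 // => v nv.
    by case: eqP => // e; move: nv; rewrite -val_eqE /= -e eqxx.
  by rewrite big1 // => v _; case: eqP => // e; move: ge; rewrite e leqNgt ltn_ord.
elim: A => [|j A IH] /=; first by rewrite big1.
rewrite (eq_bigr (fun v : 'I_n => ((hd j == v) + (tl j == v)) +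
  (count (fun j => hd j == v) A + count (fun j => tl j == v) A))%N); last by move=> v _; clear; lia.
rewrite big_split /= big_split /=; move: (hx (hd j)) (hx (tl j)) IH.
by set a := (\sum_(v < n) _)%N; set b := (\sum_(v < n) _)%N; set c := (\sum_(v < n) _)%N; clear; lia.
Qed.

End Invariant.

Section Insertion.
Context {R : realType}.
Variables (B X n m L Hh N Cb W4 : nat) (tl hd : nat -> nat) (wt : nat -> R) (M delta ts : R) (A0 : seq nat) (idf : nat -> nat).
Hypothesis X64 : (64 <= X)%N.
Hypothesis XB : (X ^ 8 <= B)%N.
Hypothesis n_gt0 : (0 < n)%N.
Hypothesis nX : (2 * n < X)%N.
Hypothesis nH : (2 * n <= 2 ^ Hh)%N.
Hypothesis M0 : 0 < M.
Hypothesis delta_gt0 : 0 < delta.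
Hypothesis delta_le : delta <= 1 / 2.
Hypothesis ts_ge1 : 1 <= ts.
Hypothesis MN : M <= (1 + delta) ^+ N.
Hypothesis N_gt0 : (0 < N)%N.
Hypothesis Cb_gt0 : (0 < Cb)%N.
Hypothesis kL : forall t, (t < m)%N -> ((kap m idf t).+1 < L)%N.
Hypothesis mX : (m + 3 * 2 ^ L + L + W4 + 2 < X)%N.
Hypothesis ThX : (m * 2 ^ L < X)%N.
Hypothesis LX : (L + n + 1 < X)%N.
Hypothesis W4m : (4 * m <= W4)%N.
Hypothesis A0m : forall j, j \in A0 -> (j < m)%N.
Hypothesis A0s : (size A0 <= m)%N.
Hypothesis idfE : forall t, (t < m)%N -> ~~ (idf t < m)%N -> idf t = (m + t)%N.
Hypothesis idA0 : forall t, (t < m)%N -> (idf t < m)%N -> idf t \in A0.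
Hypothesis idn : forall t, (t < m)%N -> (tl (idf t) < n)%N /\ (hd (idf t) < n)%N.
Hypothesis wtA0 : forall j, j \in A0 -> 1 <= wt j.
Hypothesis wtid : forall t, (t < m)%N -> 1 <= wt (idf t).
Implicit Types (st : state R) (Q : state R -> nat -> Prop).

Local Ltac bnd := solve [assumption | flia | match goal with w : wb _ _ |- _ => exact: w end].
Local Ltac ev tac := solve [by [] | rewrite /= /upd /=; tac; by [] | rewrite /= /upd /=; tac; flia].
Local Ltac iw i x tac := apply: (@ws _ _ _ X64 XB _ _ _ i x); [eassumption|by []|by []|ev tac|ev tac|bnd|].
Local Ltac iwl i x tac := apply: (@wl _ _ _ X64 XB _ _ _ i x); [eassumption|by []|by []|ev tac|ev tac|bnd|].
Local Ltac rw i x tac := apply: (@rs _ _ _ X64 XB _ _ _ i x); [eassumption|by []|by []|ev tac|ev tac|].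
Local Ltac rwl i x tac := apply: (@rl _ _ _ X64 XB _ _ _ i x); [eassumption|by []|by []|ev tac|ev tac|].

Notation adjl := (adjl m A0 idf).
Notation sinv := (sinv X n m L Cb tl hd wt M delta ts A0 idf).
Notation kapt := (kap m idf).
Notation fullt := (full m idf).

(** The contribution of one insertion to [trace_ok] and [cost_ok], expressed in machine states. *)
Definition step_fact t st st' : Prop :=
  let top := imem st' 4 9 in let Th := imem st 4 5 in let mu := imem st 10 (idf t) in
  [/\ (0 < top <= L)%N,
    (forall c, (c < L)%N -> (if fullt t then true else if 2 ^ (kapt t).+1 %| t then 2 ^ c %| t else
        (c < (kapt t).+1) && (Th %/ 2 ^ c != (Th + mu) %/ 2 ^ c))%N = (c < top)%N),
    imem st' 4 5 = (if fullt t || (2 ^ (kapt t).+1 %| t) then 0 else Th + mu)%N,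
    (forall v a, (v < n)%N -> (0 < a < L)%N -> ~~ (a < top)%N -> (imem st' 11 v <= a)%N = (imem st 11 v <= a)%N) &
  [/\ (forall v, (v < n)%N -> rmem st' 4 v <= rmem st 4 v),
    (forall v, (v < n)%N -> ~~ (imem st' 11 v <= top)%N -> rmem st' 4 v = rmem st 4 v),
    (forall j, arrived idf t.+1 j -> (imem st' 11 (hd j) <= top)%N -> rmem st' 4 (hd j) <= rmem st' 4 (tl j) + wt j),
    (forall v, (v < n)%N -> rmem st' 4 v < rmem st 4 v -> exists j,
        [/\ arrived idf t.+1 j, hd j = v & rmem st' 4 v = rmem st' 4 (tl j) + wt j]) &
    levs_fact n m N Cb t (kapt t) W4 tl hd wt delta ts (adjl t.+1) 1 top st st']].

(** The relaxation and the rebuilds of the lower levels all take place inside the top list, so its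
    weight bounds each of the at most [L.+1] runs. The first term of the time is the lookup, and the
    term in [L] collects all steps that do not depend on list weights. *)
Lemma insertionP t Q st : (t < m)%N -> sinv t st ->
  (forall i, (i < m)%N -> [&& tl i == imem st 3 0, hd i == imem st 3 1 & wt i == rmem st 2 0] = (i == idf t)) ->
  (~~ (idf t < m)%N -> [/\ tl (m + t)%N = imem st 3 0, hd (m + t)%N = imem st 3 1 & wt (m + t)%N = rmem st 2 0]) ->
  (forall st' tm, sinv t.+1 st' -> step_fact t st st' ->
     (tm <= 10 * (if (idf t < m)%N then maxn (idf t - t) (t - idf t) else m) + 200 * L +
        L.+1 * ((5 * Hh + 80) * (6 * \sum_(v < n | imem st' 11 v <= imem st' 4 9) imem st' 17 v)))%N -> Q st' tm) ->
  wpt B insertion Q st.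
Proof.
move=> ltm hinv hlk hnew HQ.
have [w [e0 em eL e4] [k1 k2 k3 hTh hp] [ha hh h9 hl ht] [hmu hk [d1 d3 d4 d5] hF6 hout]] := hinv.
have p0 c : (0 < 2 ^ c)%N by rewrite expn_gt0.
have kt := kL ltm; have L0 : (0 < L)%N by flia.
have mX2 : (2 * m + 2 < X)%N by flia.
apply: wpt_seq; apply: (@lookupP R B X m tl hd wt X64 XB (idf t) t _ st) => // s1 T1 w1 F1 e8 e7 le1.
have [F1a F1b F1c] := F1.
have hnew1 : ~~ (idf t < m)%N -> [/\ tl (m + t)%N = imem s1 3 0, hd (m + t)%N = imem s1 3 1, wt (m + t)%N = rmem s1 2 0,
     (tl (m + t) < n)%N & (hd (m + t) < n)%N].
  move=> h; have [h1 h2 h3] := hnew h; have [h4 h5] := idn ltm; rewrite idfE // in h4 h5.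
  by split; rewrite ?(F1a 3%N) ?(F1c 2%N).
have sz := adjl_size idf A0s t.
have ha1 : adj_ok n tl hd wt s1 (adjl t) by move: ha; rewrite /adj_ok !F1a // !F1c.
have hh1 : hat_ok m tl hd wt s1 by move: hh; rewrite /hat_ok !F1a // !F1c.
have hl1 : lists n L s1 1 by move: hl; rewrite /lists /lst !F1a.
have ht1 : top_ok n L hd s1 (adjl t) by move: ht; rewrite /top_ok !F1a.
have hlt1 j : j \in adjl t -> (j < m + t)%N by apply: adjl_lt.
have szX : (2 * size (adjl t) + 2 < X)%N by flia.
have z0 : imem s1 0 0 = n by rewrite (F1a 0%N).
have z1 : imem s1 0 1 = m by rewrite (F1a 0%N).
have z4 : imem s1 4 4 = t by rewrite F1b.
have zL : imem s1 4 0 = L by rewrite F1b.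
apply: wpt_seq; apply: (@newedgeP R B X n m L tl hd wt X64 XB (adjl t) (idf t) t _ s1) => // s2 T2 id w2 F2 e7' h92 ha2 hh2 hl2 ht2 hlev2 _ le2.
have [F2a F2b F2c] := F2.
have idE : id = idf t by rewrite /id; case: ifP => // /negbT /(idfE ltm) ->.
have {}ha2 : adj_ok n tl hd wt s2 (adjl t.+1) := ha2.
have {}ht2 : top_ok n L hd s2 (adjl t.+1) := ht2.
have y1 : imem s2 0 1 = m by rewrite (F2a 0%N).
have y4 : imem s2 4 4 = t by rewrite F2b.
have y7 : imem s2 4 7 = idf t by rewrite e7'.
have v1 : imem s2 4 1 = (2 ^ (kc m idf t).1)%N by rewrite F2b // F1b.
have v2 : imem s2 4 2 = (kc m idf t).1.+1 by rewrite F2b // F1b.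
have v3 : imem s2 4 3 = (kc m idf t).2 by rewrite F2b // F1b.
have kle : ((kc m idf t).1 <= kapt t)%N by rewrite /kap kcS; case: ifP => //= _; case: ifP => //= _.
have kX : (2 ^ (kc m idf t).1.+1 + (kc m idf t).1.+2 < X)%N.
  have : (2 ^ (kc m idf t).1.+1 <= 2 ^ L)%N by rewrite leq_exp2l //; flia.
  by flia.
apply: wpt_seq; apply: (@clockP R B X m X64 XB idf t _ s2) => // s3 T3 w3 F3 c1 c2 c3 c19 le3.
have [F3a F3b F3c] := F3.
have x10 : imem s3 10 = imem st 10 by rewrite F3a // F2a // F1a.
have muL : (imem st 10 (idf t) <= 2 ^ L)%N.
  have [h1 h2] := hmu; have [h|h] := ltnP (idf t) m; last by rewrite h2.
  by have [[e -> eL'] _] := h1 _ h; rewrite leq_exp2l.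
have mu0 : ~~ fullt t -> (0 < imem st 10 (idf t))%N.
  rewrite /full negb_or => /andP[/ev_kap /and3P[h _ _] _]; have [h1 _] := hmu.
  by have [[e -> _] _] := h1 _ h.
have TX : (imem st 4 5 + imem st 10 (idf t) < X)%N.
  apply: leq_ltn_trans ThX; apply: leq_trans (leq_add hTh muL) _.
  by rewrite -mulSnr leq_mul2r ltm orbT.
have q1 : imem s3 4 0 = L by rewrite F3b // F2b.
have q4 : imem s3 4 4 = t by rewrite F3b.
have q5 : imem s3 4 5 = imem st 4 5 by rewrite F3b // F2b // F1b.
have q7 : imem s3 4 7 = idf t by rewrite F3b.
have q10 : imem s3 10 (idf t) = imem st 10 (idf t) by rewrite x10.
have q18 i : (i <= L)%N -> imem s3 18 i = (2 ^ i)%N by rewrite F3a // F2a // F1a //; apply: hp.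
have qL : (0 < (kapt t).+1 < L)%N by [].
have LX' : (L < X)%N by flia.
apply: wpt_seq; apply: (@settopP R B X L X64 XB (fullt t) (kapt t).+1 t (imem st 4 5) (imem st 10 (idf t)) (idf t) _ s3) => // s4 T4 tp w4 F4 e9 htp hrb hTh4 le4.
have [F4a F4b F4c] := F4.
have lev42 : imem s4 11 = imem s2 11 by rewrite F4a // F3a.
have ha4 : adj_ok n tl hd wt s4 (adjl t.+1) by move: ha2; rewrite /adj_ok !F4a // !F3a // !F4c // !F3c.
have hl4 : lists n L s4 1 by move: hl2; rewrite /lists /lst !F4a // !F3a.
have ht4 : top_ok n L hd s4 (adjl t.+1) by move: ht2; rewrite /top_ok !F4a // !F3a.
have hk4 : keys_ok n M s4.
  by move: hk; rewrite /keys_ok /leaf !F4c // !F3c // !F2c // !F1c.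
have [sl hsl] := hl4 tp htp; have [usl sln slsz slnth slP] := hsl.
have z0' : imem s4 0 0 = n by rewrite F4a // F3a // F2a.
have tpX : (tp < X)%N by flia.
have wt1 j : j \in adjl t.+1 -> 1 <= wt j by apply: adjl_wt.
have f64 : 0 <= rmem s4 7 6 by rewrite F4c // F3c // F2c // F1c.
have hs4 v : v \in sl -> has (fun j => hd j == v) (adjl t.+1).
  by move=> vs; have hv := sln v vs; rewrite -ht4 //; move: vs; rewrite slP //; flia.
have D4 : rmem s4 4 = rmem st 4 by rewrite F4c // F3c // F2c // F1c.
have o4 v : (v < n)%N -> rmem s4 3 v = if M <= rmem s4 4 v then -1 else rmem s4 4 v.
  by rewrite D4 F4c // F3c // F2c // F1c //; apply: hout.
apply: wpt_seq; apply: (@relaxP R B X n Hh tl hd wt M X64 XB n_gt0 nX nH M0 (adjl t.+1) sl tp _ s4) => //.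
move=> s5 T5 w5 F5 f7 hk5 lev5 Dle Dout Drel Dsup hout5 le5.
have [F5a F5b F5c] := F5.
have levE v b : (v < n)%N -> (tp <= b)%N -> (imem s5 11 v <= b)%N = (imem s4 11 v <= b)%N.
  by move=> hv hb; rewrite lev5 //; case: ifP => // h; rewrite hb; apply/esym; exact: leq_trans h hb.
have a94 i : (0 < imem s4 9 i)%N = arrived idf t.+1 i.
  rewrite F4a // F3a // h92 idE F1a // /arrived -[t.+1]addn1 iotaD map_cat mem_cat inE -/(arrived idf t i) -h9 add0n.
  by case: eqP => // _; rewrite ?orbT ?orbF.
have a95 i : (0 < imem s5 9 i)%N = arrived idf t.+1 i by rewrite F5a.
have ha5 : adj_ok n tl hd wt s5 (adjl t.+1) by move: ha4; rewrite /adj_ok !F5a // !F5c.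
have lc5 : lc n m L Cb t (kapt t) tl hd wt M delta ts (adjl t.+1) s5.
  split; [by rewrite F5a|by rewrite F5a // F4a // F3a|by rewrite F5b // F4b|by rewrite F5b // F4b|].
  split; [by rewrite F5b // F4b|by rewrite F5b // F4b|by move=> i hi; rewrite F5a // F4a // q18|by []|].
  by split=> //; rewrite f7 // F4c // F3c // F2c // F1c.
have hW : (\sum_(v < n) imem s5 17 v <= W4)%N.
  have [_ _ _ _ hdg] := ha5; rewrite (eq_bigr _ (fun (v : 'I_n) _ => hdg v (ltn_ord v))).
  apply: leq_trans (deg_sum n tl hd (adjl t.+1)) _; apply: leq_trans W4m.
  by have := adjl_size idf A0s t.+1; flia.
have tX : (t + 3 * 2 ^ L + L + W4 + 2 < X)%N by flia.
have hmu5 : muok m L Cb s5.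
  by move: hmu; rewrite /muok (F5a 10%N) // (F4a 10%N) // x10 (F5c 8%N) // (F4c 8%N) // (F3c 8%N) // (F2c 8%N) // (F1c 8%N).
apply: wpt_seq; apply: (@levelsP R B X n m L Hh N Cb t (kapt t) W4 tl hd wt M delta ts (adjl t.+1) X64 XB n_gt0 nX nH M0
  delta_gt0 delta_le ts_ge1 MN N_gt0 Cb_gt0 kt tX wt1 tp _ s5) => //.
- by rewrite F5b.
- move=> b hb; have [slb [h1 h2 h3 h4 h5]] := hl4 b ltac:(flia); exists slb; split=> //.
  + by rewrite F5a.
  + by move=> i hi; rewrite F5a // h4.
  + by move=> v hv; rewrite h5 // levE //; flia.
- by move=> v hv; rewrite lev5 //; case: ifP => //; flia.
- by move=> v hv; rewrite levE ?ht4 //; flia.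
- by rewrite f7.
- by move=> j ja mj; rewrite a95; apply: adjl_ge ja mj.
move=> s6 T6 w6 lc6 F6 f66 hl6 hlev6 hmu6 hfact le6.
have [F6a F6b F6c] := F6.
have [g0 gm gL gK [g2 g4 gp ga [i1 i3 i4 i5 hk6]]] := lc6.
have tX1 : (t.+1 < X)%N by flia.
iwl 4%N t.+1 ltac:(rewrite ?g4 ?addn1) => w7.
set s7 := iupd s6 4 4 t.+1 in w7 *.
have tpE : imem s7 4 9 = tp by rewrite -[imem s7 4 9]/(imem s6 4 9) F6b // F5b.
have D7 : rmem s7 4 = rmem s5 4 by rewrite -[rmem s7 4]/(rmem s6 4) F6c.
have a97 i : (0 < imem s7 9 i)%N = arrived idf t.+1 i by rewrite -[imem s7 9]/(imem s6 9) F6a.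
have lev7 v b : (v < n)%N -> (tp <= b)%N -> (imem s7 11 v <= b)%N = (imem s4 11 v <= b)%N.
  by move=> hv hb; rewrite -levE // -hlev6.
have W7 : (\sum_(v < n | imem s7 11 v <= imem s7 4 9) imem s7 17 v = listW s4 sl)%N.
  rewrite tpE /listW -[imem s7 17]/(imem s6 17) F6a // F5a //.
  rewrite (eq_bigl (fun v : 'I_n => (imem s4 11 v <= tp)%N)) => [|v]; last by rewrite lev7.
  rewrite -(big_mkord (fun v => (imem s4 11 v <= tp)%N) (imem s4 17)) -big_filter; apply: perm_big.
  apply: uniq_perm => //; first by rewrite filter_uniq ?iota_uniq.
  move=> v; rewrite mem_filter mem_index_iota /=; case: (ltnP v n) => hv; first by rewrite andbT slP.
  by rewrite andbF; apply/esym/negbTE/negP => /sln; rewrite ltnNge hv.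
have W5 : (\sum_(v < n | imem s5 11 v <= tp) imem s5 17 v = listW s4 sl)%N.
  rewrite -W7 tpE -[imem s7 17]/(imem s6 17) F6a //; apply: eq_bigl => v; by rewrite lev7 // levE.
apply: HQ; last first.
- rewrite W7; rewrite W5 in le6; move: le1 le2 le3 le4 le5 le6 L0; set d := (if _ then _ else _).
  set x := listW _ _; clear; rewrite mulSn mulnDr.
  have : ((5 * Hh + 40) * (6 * x) <= (5 * Hh + 80) * (6 * x))%N by rewrite leq_mul2r; apply/orP; right; lia.
  by set y := ((_ + 80) * _)%N; set z := ((_ + 40) * _)%N; set u := (L * y)%N; lia.
- rewrite /step_fact tpE; split=> //.
  + by rewrite -[imem s7 4 5]/(imem s6 4 5) F6b // F5b.
  + move=> v a hv ha0; rewrite -leqNgt => hta; rewrite lev7 // lev42 hlev2 //; last by case/andP: ha0.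
    by rewrite F1a.
  split.
  + by move=> v hv; rewrite D7 -D4; apply: Dle.
  + by move=> v hv; rewrite lev7 // => h; rewrite D7 Dout // D4.
  + move=> j aj; have ja := adjl_arrived idfE idA0 ltm aj.
    have [_ hA _ _ _] := ga; have [_ hn _ _ _] := hA j ja.
    by rewrite lev7 // => h; rewrite D7; apply: Drel; rewrite ?a94.
  + move=> v hv; rewrite D7 -D4 => h; have [j [h1 h2 h3 h4]] := Dsup v hv h.
    by exists j; rewrite -a94.
  + have e10 : imem s5 10 = imem st 10 by rewrite F5a // F4a.
    have e8' : rmem s5 8 = rmem st 8 by rewrite F5c // F4c // F3c // F2c // F1c.
    by move: hfact; rewrite /levs_fact /psi /chi /bln e10 e8'.
- split=> //.
  + split=> //.
    * by rewrite -[imem s7 4 3]/(imem s6 4 3) F6b // F5b // F4b.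
    * rewrite -[imem s7 4 5]/(imem s6 4 5) F6b // F5b // hTh4; case: ifP => // _.
      by rewrite mulSnr; apply: leq_add.
  + split=> //.
    * by move: hh2; rewrite /hat_ok -[imem s7 1]/(imem s6 1) -[imem s7 2]/(imem s6 2) -[rmem s7 1]/(rmem s6 1) !F6a // !F5a // !F4a // !F3a // F6c // F5c // F4c // F3c.
    * by move=> v hv; rewrite lev7 ?ht4 //; case/andP: htp.
  + split=> //.
    by move=> v hv; rewrite D7 -[rmem s7 3]/(rmem s6 3) F6c // hout5.
Qed.

End Insertion.

(** * Preprocessing *)

Definition pre_pow : cmd :=
  setV 0 (C 0) ;; ISet 18 (C 0) (C 1) ;;
  While (BILt (IGet 18 (V 0)) (IMul (C 16) (IAdd mV (C 1))))
    (ISet 18 (IAdd (V 0) (C 1)) (IMul (C 2) (IGet 18 (V 0))) ;; setV 0 (IAdd (V 0) (C 1))).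

(** A finite distance is at most [n * W], and [M] exceeds [1 + eps] times that, so [M] can stand for
    infinity. The count [N] of multiplications by [1 + delta] needed to reach [M] is kept in a real
    cell, because it may exceed the machine words. *)
Definition pre_reals : cmd :=
  setF 1 (RDiv (RDiv (RGet 0 (C 0)) (RAdd (RInt (C 1)) (RGet 0 (C 0)))) (RInt (IMul (C 32) (IMul (V 0) (V 0))))) ;;
  setF 4 (RAdd (RInt (C 1)) (RGet 7 (C 1))) ;;
  setF 5 (RAdd (RInt (C 1)) (RMul (RInt (IMul (C 2) (IAdd (V 0) (C 1)))) (RGet 7 (C 1)))) ;;
  setF 0 (RAdd (RMul (RAdd (RInt (C 1)) (RGet 0 (C 0))) (RMul (RInt nV) (RGet 0 (C 1)))) (RInt (C 1))) ;;
  setF 9 (RInt (C 1)) ;;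
  setF 3 (RInt (C 0)) ;;
  While (BNot (BRLe (RGet 7 (C 0)) (RGet 7 (C 9))))
    (setF 9 (RMul (RGet 7 (C 9)) (RGet 7 (C 4))) ;; setF 3 (RAdd (RGet 7 (C 3)) (RInt (C 1)))) ;;
  setF 3 (RAdd (RMul (RInt (IMul (C 4) mV)) (RGet 7 (C 3))) (RInt (C 1))).

Definition pre_vertices : cmd :=
  setV 18 (C 0) ;;
  for_ 18 nV
    (RSet 4 (V 18) (RGet 7 (C 0)) ;; RSet 5 (V 18) (RGet 7 (C 0)) ;; RSet 3 (V 18) (RSub (RInt (C 0)) (RInt (C 1))) ;;
     ISet 11 (V 18) (IAdd (V 0) (C 1))).

Definition pre_tree : cmd :=
  setV 18 (C 0) ;;
  for_ 18 (IMul (C 2) nV) (RSet 6 (V 18) (RGet 7 (C 0))).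

Definition pre_mu : cmd :=
  setV 18 (C 0) ;;
  for_ 18 mV (ISet 10 (V 18) (C 1)).

Definition pre_source : cmd :=
  RSet 4 (IGet 0 (C 2)) (RInt (C 0)) ;; RSet 5 (IGet 0 (C 2)) (RInt (C 0)) ;; RSet 3 (IGet 0 (C 2)) (RInt (C 0)).

(** A predicted edge with weight outside [1, W] cannot arrive. Leaving it out makes all weights in
    the lists at least 1. *)
Definition pre_edges : cmd :=
  setV 7 (C 0) ;;
  for_ 7 mV (If (BAnd (BRLe (RInt (C 1)) (RGet 1 (V 7))) (BRLe (RGet 1 (V 7)) (RGet 0 (C 1)))) add_edge Skip) ;;
  setV 1 (C 1) ;; setV 2 (C 1).

Definition preprocessing : cmd :=
  pre_pow ;; pre_reals ;; pre_vertices ;; pre_tree ;; pre_mu ;; pre_source ;; pre_edges.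

Section Preprocessing.
Context {R : realType}.
Variables (B X n m L N Cb s0 : nat) (tl hd : nat -> nat) (wt : nat -> R) (M delta ts eps Wt : R) (A0 : seq nat) (idf : nat -> nat).
Hypothesis X64 : (64 <= X)%N.
Hypothesis XB : (X ^ 8 <= B)%N.
Hypothesis nX : (2 * n < X)%N.
Hypothesis mX : (4 * m + 3 * 2 ^ L + L + n + 2 < X)%N.
Hypothesis L_gt0 : (0 < L)%N.
Hypothesis L_ge : (16 * (m + 1) <= 2 ^ L)%N.
Hypothesis L_lt : (2 ^ L.-1 < 16 * (m + 1))%N.
Hypothesis N_gt0 : (0 < N)%N.
Hypothesis N_ge : M <= (1 + delta) ^+ N.
Hypothesis N_lt : (1 + delta) ^+ N.-1 < M.
Hypothesis delta_gt0 : 0 < delta.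
Hypothesis deltaE : delta = eps / (1 + eps) / (32 * (L * L))%:R.
Hypothesis tsE : ts = 1 + (2 * (L + 1))%:R * delta.
Hypothesis ME : M = (1 + eps) * (n%:R * Wt) + 1.
Hypothesis M0 : 0 < M.
Hypothesis CbE : Cb = (4 * m * N + 1)%N.
Hypothesis s0n : (s0 < n)%N.
Let valid i := 1 <= wt i <= Wt.
Hypothesis A0E : A0 = rev [seq i <- iota 0 m | valid i].
Hypothesis tlhd : forall i, (i < m)%N -> (tl i < n)%N /\ (hd i < n)%N.
Implicit Types (st : state R) (Q : state R -> nat -> Prop).

Local Ltac bnd := solve [assumption | flia | match goal with w : wb _ _ |- _ => exact: w end].
Local Ltac ev tac := solve [by [] | rewrite /= /upd /=; tac; by [] | rewrite /= /upd /=; tac; flia].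
Local Ltac iw i x tac := apply: (@ws _ _ _ X64 XB _ _ _ i x); [eassumption|by []|by []|ev tac|ev tac|bnd|].
Local Ltac iwl i x tac := apply: (@wl _ _ _ X64 XB _ _ _ i x); [eassumption|by []|by []|ev tac|ev tac|bnd|].
Local Ltac rw i x tac := apply: (@rs _ _ _ X64 XB _ _ _ i x); [eassumption|by []|by []|ev tac|ev tac|].
Local Ltac rwl i x tac := apply: (@rl _ _ _ X64 XB _ _ _ i x); [eassumption|by []|by []|ev tac|ev tac|].

Lemma pre_powP Q st : wb X st -> imem st 0 1 = m ->
  (forall st' tm, wb X st' -> fr [:: 18]%N [:: 0]%N [::] st st' -> imem st' 4 0 = L ->
     (forall i, (i <= L)%N -> imem st' 18 i = (2 ^ i)%N) -> Q st' tm) ->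
  wpt B pre_pow Q st.
Proof.
move=> w em HQ; iw 0%N 0%N ltac:(idtac) => w1; iw 0%N 1%N ltac:(idtac); set s := iupd _ 18 _ _ => w2.
pose I l s := [/\ wb X s, fr [:: 18]%N [:: 0]%N [::] st s, imem s 4 0 = l, (l <= L)%N &
  forall i, (i <= l)%N -> imem s 18 i = (2 ^ i)%N].
apply: (@wpt_while _ B nat I (fun l => 10 * (L - l))%N _ _ _ 0%N).
- by split=> //; [rewrite /s; frt|move=> i; rewrite leqn0 => /eqP ->].
- by move=> l s' [ws' _ _ _ _]; apply: (bfits_ok X64 XB).
- move=> l s' [ws' F e0 lL hp]; have [Fa Fb Fc] := F; rewrite [bval _ _]/= e0 hp // (Fa 0%N) // em => hlt.
  have ltL : (l < L)%N.
    rewrite ltnNge; apply/negP => h; have : (2 ^ L <= 2 ^ l)%N by rewrite leq_exp2l.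
    by move: hlt L_ge; clear; lia.
  have pX : (2 * 2 ^ l < X)%N.
    have : (2 ^ l.+1 <= 2 ^ L)%N by rewrite leq_exp2l.
    by rewrite expnS; move: mX; clear; lia.
  iw l.+1 (2 * 2 ^ l)%N ltac:(rewrite ?e0 ?hp ?addn1 //) => w3.
  iwl 0%N l.+1 ltac:(rewrite ?e0 ?addn1) => w4.
  exists l.+1; last by move: ltL; clear; lia.
  split=> //; first by frt.
  move=> i; rewrite leq_eqVlt ltnS => /orP[/eqP ->|h]; first by rewrite /= /upd /= eqxx expnS.
  by rewrite /= /upd /= ltn_eqF ?ltnS // hp.
- move=> l s' T [ws' F e0 lL hp] nb le; have [Fa Fb Fc] := F.
  move: nb; rewrite [bval _ _]/= e0 hp // (Fa 0%N) // em => hge.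
  have lE : l = L.
    apply/eqP; rewrite eqn_leq lL leqNgt; apply/negP => h.
    have : (2 ^ l <= 2 ^ L.-1)%N by rewrite leq_exp2l //; move: h; clear; lia.
    by move: hge L_lt; clear; lia.
  by rewrite lE in e0 hp; apply: HQ.
Qed.

Lemma pre_realsP Q st : wb X st -> imem st 0 0 = n -> imem st 0 1 = m -> imem st 4 0 = L ->
  rmem st 0 0 = eps -> rmem st 0 1 = Wt ->
  (forall st' tm, wb X st' -> fr [::] [::] [:: 7]%N st st' -> rmem st' 7 0 = M -> rmem st' 7 1 = delta ->
     rmem st' 7 3 = Cb%:R -> rmem st' 7 4 = 1 + delta -> rmem st' 7 5 = ts -> rmem st' 7 6 = rmem st 7 6 -> Q st' tm) ->
  wpt B pre_reals Q st.
Proof.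
move=> w en em eL r0 r1 HQ.
rw 1%N delta ltac:(rewrite ?r0 ?eL ?deltaE) => w1.
rw 4%N (1 + delta) ltac:(idtac) => w2.
rw 5%N ts ltac:(rewrite ?eL ?tsE) => w3.
rw 0%N M ltac:(rewrite ?r0 ?r1 ?en ?ME) => w4.
rw 9%N (1 : R) ltac:(idtac) => w5.
rw 3%N (0 : R) ltac:(idtac); set s := rupd _ 7 3 _ => w6.
pose I i s := [/\ wb X s, fr [::] [::] [:: 7]%N st s, rmem s 7 9 = (1 + delta) ^+ i, rmem s 7 3 = i%:R /\ (i <= N)%N &
  [/\ rmem s 7 0 = M, rmem s 7 1 = delta, rmem s 7 4 = 1 + delta, rmem s 7 5 = ts & rmem s 7 6 = rmem st 7 6]].
apply: wpt_seq; apply: (@wpt_while _ B nat I (fun l => 10 * (N - l))%N _ _ _ 0%N).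
- by split=> //; rewrite /s; frt.
- by move=> l s' [ws' _ _ _ _]; apply: (bfits_ok X64 XB).
- move=> i s' [ws' F f9 [f3 iN] [f0 f1 f4 f5 f6]]; rewrite [bval _ _]/= f0 f9 => hlt.
  have ltN : (i < N)%N.
    by rewrite ltn_neqAle iN andbT; apply: contraNneq hlt => ->.
  rw 9%N ((1 + delta) ^+ i.+1) ltac:(rewrite ?f9 ?f4 ?exprSr) => w7.
  rwl 3%N (i%:R + 1 : R) ltac:(rewrite ?f3) => w8.
  exists i.+1; last by move: ltN; clear; lia.
  by split=> //; [frt|split=> //; rewrite /= /upd /= natr1].
- move=> i s' T [ws' F f9 [f3 iN] [f0 f1 f4 f5 f6]]; rewrite [bval _ _]/= f0 f9 negbK => hge _.
  have iE : i = N.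
    apply/eqP; rewrite eqn_leq iN leqNgt; apply/negP => h.
    have : (1 + delta) ^+ i <= (1 + delta) ^+ N.-1.
      by apply: ler_weXn2l; [rewrite lerDl ltW|move: h; clear; lia].
    by move: hge N_lt; lra.
  have [Fa Fb Fc] := F.
  have eC : (4 * m)%:R * N%:R + 1 = Cb%:R :> R by rewrite CbE natrD [(4 * m * N)%:R]natrM.
  rwl 3%N (Cb%:R : R) ltac:(rewrite -?eC ?(Fa 0%N) // ?em ?f3 ?iE) => w7.
  by apply: HQ => //; frt.
Qed.

Lemma pre_verticesP Q st : wb X st -> imem st 0 0 = n -> imem st 4 0 = L -> rmem st 7 0 = M ->
  (forall st' tm, wb X st' -> fr [:: 11]%N [:: 18]%N [:: 3; 4; 5]%N st st' ->
     (forall v, (v < n)%N -> [/\ rmem st' 4 v = M, rmem st' 5 v = M, rmem st' 3 v = -1 & imem st' 11 v = L.+1]) -> Q st' tm) ->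
  wpt B pre_vertices Q st.
Proof.
move=> w en eL f0 HQ; iw 18%N 0%N ltac:(idtac); set s := iupd _ _ _ _ => w1.
have X1 : (1 < X)%N by move: X64; clear; lia.
have LX : (L.+1 < X)%N by move: mX; clear; lia.
pose I i s := [/\ wb X s, fr [:: 11]%N [:: 18]%N [:: 3; 4; 5]%N st s, imem s 4 18 = i &
  forall v, (v < i)%N -> [/\ rmem s 4 v = M, rmem s 5 v = M, rmem s 3 v = -1 & imem s 11 v = L.+1]].
apply: (@forP R B X X64 XB 18 _ _ I (fun _ => 4)%N 0%N n) => //.
- by split=> //; rewrite /s; frt.
- by move=> i s' _ [ws' [Fa _ _] e _]; split=> //; rewrite /= (Fa 0%N).
- move=> i s' lt [ws' F e hv]; have [Fa Fb Fc] := F.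
  have iX : (i.+1 < X)%N by move: lt nX; clear; lia.
  rw i M ltac:(rewrite ?e ?(Fc 7%N) ?f0 //) => w2.
  rw i M ltac:(rewrite ?e ?(Fc 7%N) ?f0 //) => w3.
  rw i (-1 : R) ltac:(rewrite ?e ?mulr0n ?mulr1n ?sub0r //) => w4.
  iwl i L.+1 ltac:(rewrite ?e ?Fb ?eL ?addn1 //) => w5.
  split=> //; split=> //; [by apply: wb_iupd|by frt|].
  move=> v; rewrite ltnS leq_eqVlt => /orP[/eqP ->|h]; rewrite /= /upd /=; first by rewrite eqxx.
  by rewrite ltn_eqF //; apply: hv.
- by move=> s' T [ws' F e hv] _; apply: HQ.
Qed.

Lemma pre_treeP Q st : wb X st -> imem st 0 0 = n -> rmem st 7 0 = M ->
  (forall st' tm, wb X st' -> fr [::] [:: 18]%N [:: 6]%N st st' ->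
     (forall v, (v < 2 * n)%N -> rmem st' 6 v = M) -> Q st' tm) ->
  wpt B pre_tree Q st.
Proof.
move=> w en f0 HQ; iw 18%N 0%N ltac:(idtac); set s := iupd _ _ _ _ => w1.
pose I i s := [/\ wb X s, fr [::] [:: 18]%N [:: 6]%N st s, imem s 4 18 = i &
  forall v, (v < i)%N -> rmem s 6 v = M].
apply: (@forP R B X X64 XB 18 _ _ I (fun _ => 1)%N 0%N (2 * n)%N) => //.
- by split=> //; rewrite /s; frt.
- by move=> i s' _ [ws' [Fa _ _] e _]; split=> //; rewrite /= (Fa 0%N) // en.
- move=> i s' lt [ws' F e hv]; have [Fa Fb Fc] := F.
  have iX : (i.+1 < X)%N by move: lt nX; clear; lia.
  rwl i M ltac:(rewrite ?e ?(Fc 7%N) ?f0 //) => w2.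
  split=> //; split=> //; [by apply: wb_iupd|by frt|].
  move=> v; rewrite ltnS leq_eqVlt => /orP[/eqP ->|h]; rewrite /= /upd /=; first by rewrite eqxx.
  by rewrite ltn_eqF //; apply: hv.
- by move=> s' T [ws' F e hv] _; apply: HQ.
Qed.

Lemma pre_muP Q st : wb X st -> imem st 0 1 = m ->
  (forall st' tm, wb X st' -> fr [:: 10]%N [:: 18]%N [::] st st' ->
     (forall j, imem st' 10 j = if (j < m)%N then 1%N else imem st 10 j) -> Q st' tm) ->
  wpt B pre_mu Q st.
Proof.
move=> w em HQ; iw 18%N 0%N ltac:(idtac); set s := iupd _ _ _ _ => w1.
pose I i s := [/\ wb X s, fr [:: 10]%N [:: 18]%N [::] st s, imem s 4 18 = i &
  forall j, imem s 10 j = if (j < i)%N then 1%N else imem st 10 j].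
apply: (@forP R B X X64 XB 18 _ _ I (fun _ => 1)%N 0%N m) => //.
- by split=> //; rewrite /s; frt.
- by move=> i s' _ [ws' [Fa _ _] e _]; split=> //; rewrite /= (Fa 0%N).
- move=> i s' lt [ws' F e hv]; have [Fa Fb Fc] := F.
  have iX : (i.+1 < X)%N by move: lt mX; clear; lia.
  iwl i 1%N ltac:(rewrite ?e //) => w2.
  split=> //; split=> //; [by apply: wb_iupd|by frt|].
  move=> j; rewrite /= /upd /= ltnS leq_eqVlt; case: eqP => [->//|_] /=.
  by rewrite hv.
- by move=> s' T [ws' F e hv] _; apply: HQ.
Qed.

Lemma pre_edgesP Q st : wb X st -> imem st 0 0 = n -> imem st 0 1 = m -> imem st 4 0 = L -> rmem st 0 1 = Wt ->
  hat_ok m tl hd wt st -> adj_ok n tl hd wt st [::] -> lists n L st 1 -> top_ok n L hd st [::] ->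
  (forall st' tm, wb X st' -> fr [:: 5; 6; 7; 8; 11; 12; 13; 17]%N [:: 1; 2; 7; 14; 22]%N [::] st st' ->
     imem st' 4 1 = 1%N -> imem st' 4 2 = 1%N ->
     adj_ok n tl hd wt st' A0 -> lists n L st' 1 -> top_ok n L hd st' A0 -> Q st' tm) ->
  wpt B pre_edges Q st.
Proof.
move=> w en em eL r1 hh ha hl ht HQ; iw 7%N 0%N ltac:(idtac); set s := iupd _ _ _ _ => w1.
have X2 : (2 < X)%N by move: X64; clear; lia.
pose acc i := rev [seq j <- iota 0 i | valid j].
have accS i : acc i.+1 = if valid i then i :: acc i else acc i.
  by rewrite /acc -addn1 iotaD filter_cat rev_cat /=; case: (valid i).
have acc_lt i j : j \in acc i -> (j < i)%N by rewrite mem_rev mem_filter mem_iota add0n => /andP[_ /andP[_]].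
have acc_sz i : (size (acc i) <= i)%N by rewrite size_rev size_filter; apply: leq_trans (count_size _ _) _; rewrite size_iota.
pose I i s := [/\ wb X s, fr [:: 5; 6; 7; 8; 11; 12; 13; 17]%N [:: 1; 2; 7; 14; 22]%N [::] st s, imem s 4 7 = i &
  [/\ adj_ok n tl hd wt s (acc i), lists n L s 1 & top_ok n L hd s (acc i)]].
apply: wpt_seq; apply: (@forP R B X X64 XB 7 _ _ I (fun _ => 21)%N 0%N m) => //.
- by split=> //; rewrite /s; frt.
- by move=> i s' _ [ws' [Fa _ _] e _]; split=> //; rewrite /= (Fa 0%N).
- move=> i s' lt [ws' F e [ia il it]]; have [Fa Fb Fc] := F.
  have iX : (i.+1 < X)%N by move: lt mX; clear; lia.
  have [h1 h2 h3] := hh i lt; have [tn hn] := tlhd lt.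
  have bE : bval s' (BAnd (BRLe (RInt (C 1)) (RGet 1 (V 7))) (BRLe (RGet 1 (V 7)) (RGet 0 (C 1)))) = valid i.
    by rewrite /= e (Fc 1%N) // (Fc 0%N) // h3 r1.
  apply: wpt_if; first exact: (bfits_ok X64 XB); rewrite bE => hv.
    apply: (@add_edgeP R B X n L tl hd wt X64 XB (acc i) i _ s') => //.
    + by rewrite (Fa 0%N).
    + by rewrite Fb.
    + by apply/negP => /acc_lt; rewrite ltnn.
    + by rewrite (Fa 1%N).
    + by rewrite (Fa 2%N).
    + by rewrite (Fc 1%N).
    + by have := acc_sz i; move: lt mX; clear; lia.
    + by move: mX; clear; lia.
    move=> s2 T2 w2 F2 ja jl jt _ le2; have [F2a F2b F2c] := F2.
    split=> //; first by rewrite F2b.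
    split; [by apply: wb_iupd| |by []|by rewrite accS hv].
    apply: fr_sc => //; apply: fr_trans F _; apply: fr_sub F2; by apply: subl.
  apply: wpt_skip; split=> //; split; [by apply: wb_iupd|by apply: fr_sc|by []|by rewrite accS (negPf hv)].
- move=> s' T [ws' F e [ia il it]] _; rewrite -[acc m]A0E in ia it.
  iw 1%N 1%N ltac:(idtac) => w2; iwl 2%N 1%N ltac:(idtac) => w3.
  by apply: HQ => //; frt.
Qed.

Lemma preprocessingP Q st : wb X st -> imem st 0 0 = n -> imem st 0 1 = m -> imem st 0 2 = s0 ->
  rmem st 0 0 = eps -> rmem st 0 1 = Wt -> hat_ok m tl hd wt st ->
  (forall a i, (4 <= a)%N -> imem st a i = 0%N) -> (forall a i, (4 <= a)%N -> rmem st a i = 0) ->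
  (forall st' tm, sinv X n m L Cb tl hd wt M delta ts A0 idf 0 st' ->
     (forall v, (v < n)%N -> rmem st' 4 v = if v == s0 then 0 else M) ->
     (forall j, imem st' 10 j = (j < m)%N) -> (forall j, rmem st' 8 j = 0) -> Q st' tm) ->
  wpt B preprocessing Q st.
Proof.
move=> w en em es r0 r1 hh hi hr HQ.
apply: wpt_seq; apply: (@pre_powP _ st) => // s1 T1 w1 F1 e0 hp; have [F1a F1b F1c] := F1.
apply: wpt_seq; apply: (@pre_realsP _ s1) => //; rewrite ?(F1a 0%N) ?(F1c 0%N) //.
move=> s2 T2 w2 F2 f0 f1 f3 f4 f5 f6; have [F2a F2b F2c] := F2.
apply: wpt_seq; apply: (@pre_verticesP _ s2) => //; rewrite ?(F2a 0%N) ?(F1a 0%N) ?F2b //.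
move=> s3 T3 w3 F3 hv; have [F3a F3b F3c] := F3.
apply: wpt_seq; apply: (@pre_treeP _ s3) => //; rewrite ?(F3a 0%N) ?(F2a 0%N) ?(F1a 0%N) ?F3c //.
move=> s4 T4 w4 F4 htr; have [F4a F4b F4c] := F4.
apply: wpt_seq; apply: (@pre_muP _ s4) => //; rewrite ?(F4a 0%N) ?(F3a 0%N) ?(F2a 0%N) ?(F1a 0%N) //.
move=> s5 T5 w5 F5 hmu; have [F5a F5b F5c] := F5.
have es5 : imem s5 0 2 = s0 by rewrite F5a // F4a // F3a // F2a // F1a.
apply: wpt_seq; apply: wpt_seq; apply: (@rl _ _ _ X64 XB _ _ _ s0 0) => // w6.
apply: wpt_seq; apply: (@rl _ _ _ X64 XB _ _ _ s0 0) => // w7.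
apply: (@rl _ _ _ X64 XB _ _ _ s0 0) => // w8.
set s6 := rupd (rupd (rupd s5 4 s0 0) 5 s0 0) 3 s0 0 in w8 *.
have F6 : fr [::] [::] [:: 3; 4; 5]%N s5 s6 by rewrite /s6; frt.
have [F6a F6b F6c] := F6.
have I6 a : a \notin [:: 4; 10; 11; 18]%N -> imem s6 a = imem st a.
  rewrite !inE !negb_or => /and4P[a4 a10 a11 a18].
  rewrite F6a ?inE ?a4 // F5a ?inE ?negb_or ?a4 ?a10 // F4a ?inE ?a4 // F3a ?inE ?negb_or ?a4 ?a11 // F2a ?inE ?a4 //.
  by rewrite F1a ?inE ?negb_or ?a4 ?a18.
have K6 a : a != 0%N -> a != 18%N -> imem s6 4 a = 0%N.
  move=> a0 a18; rewrite F6b // F5b ?inE // F4b ?inE // F3b ?inE // F2b // F1b ?inE //; exact: hi.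
have R6 a : a \notin [:: 3; 4; 5; 6; 7]%N -> rmem s6 a = rmem st a.
  rewrite !inE !negb_or => /and5P[a3 a4 a5 a6 a7].
  rewrite F6c ?inE ?negb_or ?a3 ?a4 // F5c // F4c ?inE // F3c ?inE ?negb_or ?a3 ?a4 // F2c ?inE //.
  by rewrite F1c.
have L6 : imem s6 11 = imem s3 11 by rewrite F6a // F5a // F4a.
apply: (@pre_edgesP _ s6) => //.
- by rewrite I6.
- by rewrite I6.
- by rewrite F6b // F5b // F4b // F3b // F2b.
- by rewrite R6.
- by move: hh; rewrite /hat_ok !I6 // R6.
- split=> //= v hv'; rewrite I6 //; exact: hi.
- move=> a ha; exists [::]; split; [by []|by []|by rewrite I6 // hi|by []|].
  move=> v hv'; rewrite L6 in_nil; have [_ _ _ ->] := hv v hv'.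
  by apply/esym/negbTE; rewrite -ltnNge; move: ha; clear; lia.
- by move=> v hv'; rewrite L6 /=; have [_ _ _ ->] := hv v hv'; rewrite ltnn.
move=> s7 T7 w7' F7 k1 k2 ha hl ht; have [F7a F7b F7c] := F7.
have D7 v : (v < n)%N -> rmem s7 4 v = if v == s0 then 0 else M.
  move=> hv'; rewrite F7c // /s6 /= /upd /=; case: eqP => // _.
  by rewrite F5c // F4c //; have [-> _ _ _] := hv v hv'.
have Y7 v : (v < n)%N -> rmem s7 5 v = if v == s0 then 0 else M.
  move=> hv'; rewrite F7c // /s6 /= /upd /=; case: eqP => // _.
  by rewrite F5c // F4c //; have [_ -> _ _] := hv v hv'.
have O7 v : (v < n)%N -> rmem s7 3 v = if v == s0 then 0 else -1.
  move=> hv'; rewrite F7c // /s6 /= /upd /=; case: eqP => // _.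
  by rewrite F5c // F4c //; have [_ _ -> _] := hv v hv'.
have mu7 j : imem s7 10 j = (j < m)%N.
  rewrite F7a // F6a // hmu F4a // F3a // F2a // F1a //; case: ltnP => // _; exact: hi.
have b7 j : rmem s7 8 j = 0 by rewrite F7c // R6 // hr.
have c7 i : rmem s7 7 i = rmem s2 7 i by rewrite F7c // F6c // F5c // F4c // F3c.
apply: HQ => //; split=> //.
- by split; [rewrite F7a // I6|rewrite F7a // I6|rewrite F7b // F6b // F5b // F4b // F3b // F2b|rewrite F7b // K6].
- split=> //; [by rewrite F7b // K6|by rewrite F7b // K6|].
  by move=> i hi'; rewrite F7a // F6a // F5a // F4a // F3a // F2a // hp.
- split=> //; first by move: hh; rewrite /hat_ok !F7a // !I6 // F7c // R6.
  by move=> i; rewrite F7a // I6 // hi.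
- split=> //.
  + split=> j jm; last by rewrite mu7 ltnNge jm.
    split; first by exists 0%N; rewrite ?mu7 ?jm.
    by exists 0%N; rewrite ?b7 // CbE addn1.
  + have tr7 i : (i < 2 * n)%N -> rmem s7 6 i = M by move=> hi'; rewrite F7c // F6c // F5c // htr.
    split.
    * by move=> i hi'; rewrite !tr7 ?minxx //; move: hi'; clear; lia.
    * by move=> u hu; rewrite /leaf tr7 //; move: hu; clear; lia.
    * by move=> v hv'; rewrite D7 // Y7.
    * by rewrite c7.
    * by move=> v hv'; rewrite D7 //; case: eqP => _; rewrite ?lexx ltW.
  + by split; rewrite c7.
  + by rewrite c7 f6 F1c // hr.
  + move=> v hv'; rewrite O7 // D7 //; case: eqP => _; last by rewrite lexx.
    by rewrite leNgt M0.
Qed.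

End Preprocessing.

(** * Numerical estimates *)

Section Numbers.
Context {R : realType}.

Lemma pow2_ex y : (1 < y)%N -> exists l, [/\ (0 < l)%N, (y <= 2 ^ l)%N & (2 ^ l.-1 < y)%N].
Proof.
move=> y1; have ex : exists l, (y <= 2 ^ l)%N by exists y; apply: ltnW; exact: ltn_expl.
case: (ex_minnP ex) => l hl hmin; have l0 : (0 < l)%N by case: l hl {hmin} => //; rewrite expn0; lia.
by exists l; split=> //; rewrite ltnNge; apply/negP => /hmin; lia.
Qed.

Lemma pow_ex (d M : R) : 0 < d -> 1 < M -> exists N,
  [/\ (0 < N)%N, M <= (1 + d) ^+ N & (1 + d) ^+ N.-1 < M].
Proof.
move=> d0 M1; have ex : exists l, M <= (1 + d) ^+ l.
  exists (Num.truncn (M / d)).+1; apply: le_trans (bernoulli _ _); last by lra.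
  have := truncnS_gt (M / d); rewrite ltr_pdivrMr //; set k := (_%:R : R); nra.
case: (ex_minnP ex) => l hl hmin; have l0 : (0 < l)%N.
  by case: l hl {hmin} => //; rewrite expr0 leNgt M1.
by exists l; split=> //; rewrite ltNge; apply/negP => /hmin; lia.
Qed.

Lemma pow_le1 (x : R) b : 0 <= x -> (0 < b)%N -> b%:R * x <= 1 / 2 -> (1 + x) ^+ b <= 1 + 2 * (b%:R * x).
Proof.
move=> x0 b0 h; have bR : (0 : R) < b%:R by rewrite ltr0n.
have := @pen_pow R (b%:R * x) (mulr_ge0 (ltW bR) x0) h b b0.
by rewrite mulrAC divff ?mul1r // gt_eqF.
Qed.

Section Err.
Variables (eps : R) (L : nat).
Hypotheses (eps_gt0 : 0 < eps) (L_gt0 : (0 < L)%N).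
Let y := eps / (1 + eps) / 32.
Let d := eps / (1 + eps) / (32 * (L * L))%:R.
Let ts := 1 + (2 * (L + 1))%:R * d.

Lemma LR1 : (1 : R) <= L%:R. Proof. by rewrite ler1n. Qed.

Lemma y_facts : [/\ 0 < y, y <= 1 / 32 & 32 * y <= eps].
Proof.
have e1 : 0 < 1 + eps by have := eps_gt0; lra.
have q0 : 0 < eps / (1 + eps) by rewrite divr_gt0.
have q1 : eps / (1 + eps) <= 1 by rewrite ler_pdivrMr // mul1r lerDr.
have q2 : eps / (1 + eps) <= eps by rewrite ler_pdivrMr //; have := eps_gt0; nra.
by rewrite /y; split; lra.
Qed.

Lemma d_y : L%:R * (L%:R * d) = y.
Proof.
have l0 : (L%:R : R) != 0 by rewrite pnatr_eq0 -lt0n.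
have e1 : 1 + eps != 0 by rewrite gt_eqF //; have := eps_gt0; lra.
by rewrite /d /y !natrM; field; rewrite l0 e1.
Qed.

Lemma d_facts : [/\ 0 < d, L%:R * d <= y & d <= 1 / 2].
Proof.
have [y0 y1 _] := y_facts; have l1 := LR1; have e := d_y.
have d0 : 0 < d.
  have h : 0 < L%:R * (L%:R * d) by rewrite e.
  have lp : (0 : R) < L%:R by lra.
  by move: h; rewrite !(pmulr_rgt0 _ lp).
have h1 : L%:R * d <= y by rewrite -e ler_peMl // mulr_ge0 ?ltW //; lra.
split=> //; apply: le_trans (_ : L%:R * d <= _); first by rewrite ler_peMl // ltW.
lra.
Qed.

Lemma ts_facts : [/\ 1 <= ts, (1 + d) ^+ L.+1 <= ts & L%:R * (ts - 1) <= 4 * y].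
Proof.
have [y0 y1 _] := y_facts; have [d0 h1 d1] := d_facts; have l1 := LR1; have e := d_y.
have tE : ts = 1 + 2 * (L.+1%:R * d) by rewrite /ts natrM addn1 mulrA.
have lS : L.+1%:R = L%:R + 1 :> R by rewrite -natr1.
have h2 : L.+1%:R * d <= 2 * (L%:R * d) by rewrite lS; nra.
split.
- by rewrite tE lerDl mulr_ge0 // mulr_ge0 // ltW.
- by rewrite tE; apply: pow_le1 => //; [exact: ltW|lra].
- rewrite tE [X in _ * (X - _)]addrC addrK; have : L%:R * (L.+1%:R * d) <= L%:R * (2 * (L%:R * d)) by rewrite ler_wpM2l //; lra.
  lra.
Qed.

(** With [y = L * L * d] the three powers are at most [1 + 2 * y], [1 + 8 * y] and [1 + 4 * y], and
    [32 * y <= eps]. The threshold [ts] has an excess of order [L * d] and enters up to [L] times,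
    which is the reason for [L * L] in the denominator of [d]. *)
Lemma err_le i j : (i <= L)%N -> (j <= L)%N -> (1 + d) ^+ i * (ts * (1 + 2 * d)) ^+ j <= 1 + eps.
Proof.
have [y0 y1 y2] := y_facts; have [d0 h1 d1] := d_facts; have l1 := LR1; have e := d_y.
have [t1 _ t2] := ts_facts => iL jL; rewrite exprMn.
have p1 : (1 + d) ^+ i <= 1 + 2 * y.
  apply: le_trans (_ : (1 + d) ^+ L <= _); first by apply: ler_weXn2l => //; lra.
  by apply: le_trans (pow_le1 _ L_gt0 _) _; lra.
have p2 : ts ^+ j <= 1 + 8 * y.
  apply: le_trans (_ : ts ^+ L <= _); first by apply: ler_weXn2l.
  have -> : ts = 1 + (ts - 1) by lra.
  by apply: le_trans (pow_le1 _ L_gt0 _) _; lra.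
have p3 : (1 + 2 * d) ^+ j <= 1 + 4 * y.
  apply: le_trans (_ : (1 + 2 * d) ^+ L <= _); first by apply: ler_weXn2l => //; lra.
  have e2 : L%:R * (2 * d) = 2 * (L%:R * d) by rewrite mulrCA.
  by apply: le_trans (pow_le1 _ L_gt0 _) _; rewrite ?e2; lra.
have q1 : 0 <= (1 + d) ^+ i by apply: exprn_ge0; lra.
have q2 : 0 <= ts ^+ j by apply: exprn_ge0; lra.
have q3 : 0 <= (1 + 2 * d) ^+ j by apply: exprn_ge0; lra.
have r1 : ts ^+ j * (1 + 2 * d) ^+ j <= 1 + 13 * y.
  by apply: le_trans (ler_pM q2 q3 p2 p3) _; nra.
have r2 := ler_pM q1 (mulr_ge0 q2 q3) p1 r1.
by apply: le_trans r2 _; nra.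
Qed.

End Err.

Lemma ln1D_ge (d : R) : 0 < d -> d <= 1 -> d / 2 <= ln (1 + d).
Proof.
move=> d0 d1; have e0 : 0 < 1 + d by lra.
have h := @le_ln1Dx R (- d / (1 + d)); have ei : 1 + - d / (1 + d) = (1 + d)^-1 by field; lra.
rewrite ei lnV ?posrE // in h.
have h1 : -1 < - d / (1 + d) by rewrite ltr_pdivlMr //; lra.
have h2 : d / 2 <= d / (1 + d) by rewrite ler_pM2l // lef_pV2 ?posrE; lra.
have := h h1; have -> : - d / (1 + d) = - (d / (1 + d)) by rewrite mulNr.
by lra.
Qed.

Lemma ln2_gt0 : 0 < ln (2 : R). Proof. by apply: ln_gt0; lra. Qed.

(** The hypotheses give that [l] is at most 5 plus the binary logarithm of [Y], and this logarithm
    is at least 1. *)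
Lemma pow2_ln l Y : (0 < l)%N -> (2 ^ l.-1 < 16 * Y)%N -> (1 < Y)%N -> l%:R <= 6 / ln (2 : R) * ln (Y%:R : R).
Proof.
move=> l0 h Y1; have k2 := ln2_gt0.
have Y0 : (0 : R) < Y%:R by rewrite ltr0n; lia.
have lY : ln (2 : R) <= ln (Y%:R : R) by rewrite ler_ln ?posrE // ler_nat.
have h1 : (2 : R) ^+ l.-1 <= 2 ^+ 4 * Y%:R.
  by rewrite -!natrX -natrM ler_nat ltnW.
have h2 : ln ((2 : R) ^+ l.-1) <= ln (2 ^+ 4 * Y%:R : R).
  by rewrite ler_ln ?posrE ?mulr_gt0 ?exprn_gt0.
rewrite lnM ?posrE ?exprn_gt0 // !lnXn // in h2.
have h3 : ln (2 : R) *+ l.-1 = l.-1%:R * ln 2 by rewrite mulr_natl.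
have lE : (l%:R : R) = l.-1%:R + 1 by rewrite natr1 prednK.
rewrite mulrAC ler_pdivlMr // lE.
have h4 : ln (2 : R) *+ 4 = 4 * ln (2 : R) by rewrite mulr_natl.
by lra.
Qed.

(** Constants that may depend on [eps0] but not on the input: [tc1] is for the logarithms [L] and
    [Hh], [tc2] for [ln M], [tc3] for [N], and [tc0] is the numerical factor of [total_nat]. *)
Definition tc0 : R := (2000 * 1000)%N%:R.
Definition tc1 : R := 6 / ln 2.
Definition tc2 (eps0 : R) : R := ln (2 + eps0) / ln 2 + 1 + 1 / ln 2.
Definition tc3 (eps0 : R) : R := (1 / ln 2 + 2 * tc2 eps0) * (32 * tc1 ^+ 2 * (1 + eps0)).
Definition tcst (eps0 : R) : R := tc0 * (tc1 ^+ 6 * (2 * tc3 eps0)).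

(** By the choice of [N], the number [N - 1] is below [ln M / ln (1 + d)]. Here [ln M] is at most of
    order [l * Num.max 1 (ln W)] and [1 / d] of order [L ^ 2 / eps], which gives the cube of the
    logarithm and a single factor [1 / eps]. *)
Lemma N_bound (eps0 eps W : R) (n m L N : nat) : 0 < eps <= eps0 -> 1 <= W -> (0 < n)%N -> (0 < L)%N -> (0 < N)%N ->
  (2 ^ L.-1 < 16 * (m + 1))%N ->
  (1 + eps / (1 + eps) / (32 * (L * L))%:R) ^+ N.-1 < (1 + eps) * (n%:R * W) + 1 ->
  N%:R <= tc3 eps0 * ln ((n + m + 2)%:R : R) ^+ 3 * (Num.max 1 (ln W) / eps).
Proof.
move=> /andP[e0 ee] W1 n0 L0 N0 hL; have [d0 _ d1] := d_facts e0 L0.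
set d := eps / (1 + eps) / (32 * (L * L))%:R in d0 d1 *; set M := _ + 1 => hN.
set Y := (n + m + 2)%N; set w := Num.max 1 (ln W); set l := ln (Y%:R : R).
have k2 := ln2_gt0; have Y0 : (0 : R) < Y%:R by rewrite ltr0n /Y; clear; lia.
have lY : ln (2 : R) <= l by rewrite /l ler_ln ?posrE // ler_nat /Y; clear; lia.
have w1 : 1 <= w by rewrite /w le_max lexx.
have wW : ln W <= w by rewrite /w le_max lexx orbT.
have Lb : L%:R <= tc1 * l by apply: pow2_ln => //; rewrite /Y; first [by clear; lia | by move: hL; clear; lia].
have nY : (n%:R : R) <= Y%:R by rewrite ler_nat /Y; clear; lia.
have Y1 : (1 : R) <= Y%:R by rewrite ler1n /Y; clear; lia.
have b0 : 0 <= (1 + eps) * (n%:R * W) by rewrite mulr_ge0 ?mulr_ge0 //; lra.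
have M0 : 0 < M by rewrite /M; lra.
have MY : M <= (2 + eps0) * (Y%:R * W).
  have a1 : n%:R * W <= Y%:R * W by rewrite ler_wpM2r //; lra.
  have a2 : 1 <= Y%:R * W by rewrite mulr_ege1.
  have a3 : (1 + eps) * (n%:R * W) <= (1 + eps0) * (Y%:R * W).
    by apply: ler_pM => //; [lra|rewrite mulr_ge0 //; lra|lra].
  rewrite /M; have -> : (2 + eps0) * (Y%:R * W) = (1 + eps0) * (Y%:R * W) + Y%:R * W by ring.
  lra.
have W0 : 0 < W by lra.
have lnM' : ln M <= ln (2 + eps0) + (l + ln W).
  rewrite /l -!lnM ?posrE ?mulr_gt0 //; last by lra.
  rewrite ler_ln ?posrE ?mulr_gt0 //; lra.
have lw0 : 0 < l * w by rewrite mulr_gt0 //; lra.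
have lw1 : 1 <= l / ln 2 * w.
  by rewrite mulr_ege1 // ler_pdivlMr // mul1r.
have lwl : l <= l * w by rewrite ler_peMr //; lra.
have le0 : 0 <= ln (2 + eps0) by apply: ln_ge0; lra.
have lnMb : ln M <= tc2 eps0 * (l * w).
  have b1 : ln (2 + eps0) <= ln (2 + eps0) / ln 2 * (l * w).
    have -> : ln (2 + eps0) / ln 2 * (l * w) = ln (2 + eps0) * (l / ln 2 * w) by ring.
    by rewrite ler_peMr.
  have b2 : ln W <= 1 / ln 2 * (l * w).
    apply: le_trans wW _; have -> : 1 / ln 2 * (l * w) = l / ln 2 * w by ring.
    by rewrite ler_peMl ?ler_pdivlMr ?mul1r //; lra.
  by rewrite /tc2 !mulrDl mul1r; lra.
have Nb : N%:R <= (1 / ln 2 + 2 * tc2 eps0) * (l * w) * d^-1.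
  have hl := ln1D_ge d0 (_ : d <= 1); have {}hl : d / 2 <= ln (1 + d) by apply: hl; lra.
  have p0 : 0 < (1 + d) ^+ N.-1 by apply: exprn_gt0; lra.
  have h1 : ln ((1 + d) ^+ N.-1) <= ln M by rewrite ler_ln ?posrE // ltW.
  have e1d : 0 < 1 + d by lra.
  have h1' : ln ((1 + d) ^+ N.-1) = N.-1%:R * ln (1 + d) by rewrite lnXn // mulr_natl.
  rewrite h1' in h1.
  have h2 : N.-1%:R * (d / 2) <= ln M by apply: le_trans h1; rewrite ler_wpM2l.
  have NE : (N%:R : R) = N.-1%:R + 1 by rewrite natr1 prednK.
  rewrite ler_pdivlMr // NE mulrDl mul1r.
  have h3 : d <= 1 / ln 2 * (l * w).
    have -> : 1 / ln 2 * (l * w) = l / ln 2 * w by ring.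
    by lra.
  by rewrite mulrDl -mulrA; lra.
have dV : d^-1 <= 32 * tc1 ^+ 2 * (1 + eps0) * l ^+ 2 / eps.
  have -> : d^-1 = 32 * (L%:R * L%:R) * (1 + eps) / eps.
    rewrite /d !natrM; field; have l0 : (L%:R : R) != 0 by rewrite pnatr_eq0 -lt0n.
    by rewrite l0; apply/andP; split; rewrite ?gt_eqF //; lra.
  rewrite ler_pM2r ?invr_gt0 //.
  have LL : L%:R * L%:R <= (tc1 * l) * (tc1 * l) by apply: ler_pM.
  have ll0 : 0 <= (tc1 * l) * (tc1 * l) by rewrite -expr2 sqr_ge0.
  have -> : 32 * tc1 ^+ 2 * (1 + eps0) * l ^+ 2 = 32 * ((tc1 * l) * (tc1 * l)) * (1 + eps0) by ring.
  apply: ler_pM; [by rewrite !mulr_ge0|by lra| |by lra].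
  by rewrite ler_wpM2l.
have c20 : 0 <= tc2 eps0.
  by rewrite /tc2 !addr_ge0 ?divr_ge0 // ltW.
have cc : 0 <= (1 / ln 2 + 2 * tc2 eps0) * (l * w).
  have i0 : 0 <= 1 / ln (2 : R) by rewrite divr_ge0 // ltW.
  have c0 : 0 <= 1 / ln 2 + 2 * tc2 eps0 by lra.
  by rewrite mulr_ge0 // ltW.
apply: le_trans Nb _; apply: le_trans (ler_wpM2l cc dV) _.
rewrite /tc3 le_eqVlt; apply/orP; left; apply/eqP; ring.
Qed.

(** The exponent 9 consists of five factors [L], one factor [Hh], and the cube from [N_bound]. *)
Lemma time_bound (eps0 eps W : R) (n m L Hh N x tot : nat) : 0 < eps <= eps0 -> 1 <= W -> (0 < n)%N ->
  (0 < L)%N -> (0 < Hh)%N -> (0 < N)%N ->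
  (2 ^ L.-1 < 16 * (m + 1))%N -> (2 ^ Hh.-1 < 2 * n)%N ->
  (1 + eps / (1 + eps) / (32 * (L * L))%:R) ^+ N.-1 < (1 + eps) * (n%:R * W) + 1 ->
  (tot <= 2000 * 1000 * (Hh * (L * L * L * L * L) * (2 * x) * m * N))%N ->
  tot%:R <= tcst eps0 * ln ((n + m + 2)%:R : R) ^+ 9 * (m%:R * x%:R * Num.max 1 (ln W) / eps).
Proof.
move=> he W1 n0 L0 H0 N0 hL hH hN htot; have Nb := N_bound he W1 n0 L0 N0 hL hN.
have k2 := ln2_gt0; set l := ln ((n + m + 2)%:R : R) in Nb *.
have Lb : L%:R <= tc1 * l by apply: pow2_ln => //; first [by clear; lia | by move: hL; clear; lia].
have Hb : Hh%:R <= tc1 * l by apply: pow2_ln => //; first [by clear; lia | by move: hH; clear; lia].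
have ht : (tot%:R : R) <= tc0 * (Hh%:R * (L%:R * L%:R * L%:R * L%:R * L%:R) * (2 * x%:R) * m%:R * N%:R).
  by rewrite /tc0 -!natrM ler_nat.
apply: le_trans ht _; set z := tc1 * l in Lb Hb.
have z0 : 0 <= z by apply: le_trans Lb.
have s2 : L%:R * L%:R <= z * z by apply: ler_pM.
have s3 : L%:R * L%:R * L%:R <= z * z * z by apply: ler_pM => //; rewrite mulr_ge0.
have s4 : L%:R * L%:R * L%:R * L%:R <= z * z * z * z by apply: ler_pM => //; rewrite !mulr_ge0.
have s5 : L%:R * L%:R * L%:R * L%:R * L%:R <= z * z * z * z * z by apply: ler_pM => //; rewrite !mulr_ge0.
have s6 : Hh%:R * (L%:R * L%:R * L%:R * L%:R * L%:R) <= z * (z * z * z * z * z) by apply: ler_pM => //; rewrite !mulr_ge0.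
have s7 : Hh%:R * (L%:R * L%:R * L%:R * L%:R * L%:R) * (2 * x%:R) * m%:R <= z * (z * z * z * z * z) * (2 * x%:R) * m%:R.
  by rewrite ler_wpM2r // ler_wpM2r // mulr_ge0.
have s8 := ler_pM _ _ s7 Nb.
have {}s8 := s8 ltac:(by rewrite !mulr_ge0) ltac:(by []).
have t0 : 0 <= tc0 by exact: ler0n.
apply: le_trans (ler_wpM2l t0 s8) _; rewrite /tcst /z le_eqVlt; apply/orP; left; apply/eqP; ring.
Qed.

End Numbers.

(** The runs of Dijkstra's algorithm take at most [2 * 85 * 6 * 1628 * Y = 1660560 * Y] steps, where
    [1628 = 372 * 4 + 90 + 50]; the lookups take at most [50 * Y] and the other steps [200 * Y]. *)
Lemma total_nat (L Hh K m N tot S d : nat) : (0 < L)%N -> (0 < Hh)%N -> (0 < K)%N -> (0 < m)%N -> (0 < N)%N ->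
  (d <= m * K * (2 * L + 3))%N ->
  (S <= K * L ^ 3 * (372 * (N * (4 * m)) + 10 * (L * (4 * m * N + 1 + 4 * m) + (4 * m * N + 1))))%N ->
  (tot <= 10 * d + m * (200 * L) + L.+1 * ((5 * Hh + 80) * (6 * S)))%N ->
  (tot <= 2000 * 1000 * (Hh * (L * L * L * L * L) * K * m * N))%N.
Proof.
move=> L0 H0 K0 m0 N0 hd hS ht.
set Y := (Hh * (L * L * L * L * L) * K * m * N)%N.
have inner : (372 * (N * (4 * m)) + 10 * (L * (4 * m * N + 1 + 4 * m) + (4 * m * N + 1)) <= 1628 * (L * (m * N)))%N.
  have P1 : (m <= m * N)%N by rewrite leq_pmulr.
  have P2 : (0 < m * N)%N by rewrite muln_gt0 m0.
  have -> : (N * (4 * m) = 4 * (m * N))%N by clear; lia.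
  have -> : (4 * m * N = 4 * (m * N))%N by clear; lia.
  move: P1 P2; set P := (m * N)%N => P1 P2.
  have Q1 : (P <= L * P)%N by rewrite leq_pmull.
  have Q2 : (L * (4 * P + 1 + 4 * m) <= 9 * (L * P))%N.
    have : (L * (4 * P + 1 + 4 * m) <= L * (9 * P))%N by rewrite leq_mul2l; apply/orP; right; lia.
    by clear; lia.
  by move: Q1 Q2 P2; clear; set a := (L * P)%N; set b := (L * (_ + _))%N; lia.
have S2 : (S <= K * (L * L * L) * (1628 * (L * (m * N))))%N.
  have e3 : (L ^ 3 = L * L * L)%N by rewrite !expnS expn0 muln1 mulnA.
  by rewrite e3 in hS; apply: leq_trans hS _; rewrite leq_mul2l inner orbT.
have S3 : (L.+1 * ((5 * Hh + 80) * (6 * S)) <= (2 * L) * ((85 * Hh) * (6 * (K * (L * L * L) * (1628 * (L * (m * N)))))))%N.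
  by do 2 (apply: leq_mul; first lia); rewrite leq_mul2l S2 orbT.
have S4 : ((2 * L) * ((85 * Hh) * (6 * (K * (L * L * L) * (1628 * (L * (m * N)))))) = 2 * 85 * 6 * 1628 * Y)%N.
  by rewrite /Y; clear; lia.
have S5 : (m * K * L <= Y)%N.
  have -> : (Y = (m * K * L) * (Hh * (L * L * L * L) * N))%N by rewrite /Y; clear; lia.
  by rewrite leq_pmulr // !muln_gt0 L0 H0 N0.
have S6 : (m * L <= m * K * L)%N by rewrite -mulnA leq_mul2l leq_pmull ?orbT.
have S7 : (d <= 5 * (m * K * L))%N.
  apply: leq_trans hd _; have : (m * K * (2 * L + 3) <= m * K * (5 * L))%N by rewrite leq_mul2l; apply/orP; right; lia.
  by clear; lia.
rewrite S4 in S3; have S8 : (m * (200 * L) = 200 * (m * L))%N by clear; lia.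
rewrite S8 in ht; move: ht S3 S5 S6 S7; clear; set a := (_.+1 * _)%N; set b := (m * L)%N; set c := (m * K * L)%N; lia.
Qed.

(** * The run on a given input *)

Section Run.
Context {R : realType}.
Variables (n m : nat) (s : 'I_n) (W eps : R) (sigma hat : m.-tuple (edge R n)).
Variables (L Hh N : nat).
Hypothesis W1 : 1 <= W.
Hypothesis eps_gt0 : 0 < eps.
Hypothesis us : uniq sigma.
Hypothesis uh : uniq hat.
Hypothesis wtb : forall e, e \in sigma -> 1 <= weight e <= W.
Hypothesis L_gt0 : (0 < L)%N.
Hypothesis L_ge : (16 * (m + 1) <= 2 ^ L)%N.
Hypothesis L_lt : (2 ^ L.-1 < 16 * (m + 1))%N.
Hypothesis nH : (2 * n <= 2 ^ Hh)%N.

Definition e0 : edge R n := (s, s, 0).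
Definition sg t := nth e0 sigma t.
(** Ids below [m] are positions in the prediction; [m + t] is the id of the edge arriving at time
    [t] in case it was not predicted. *)
Definition edg j : edge R n := if (j < m)%N then nth e0 hat j else sg (j - m).
Definition tl j : nat := val (etail (edg j)).
Definition hd j : nat := val (ehead (edg j)).
Definition wt j : R := weight (edg j).
Definition idf t := if (index (sg t) hat < m)%N then index (sg t) hat else (m + t)%N.
Definition dl : R := eps / (1 + eps) / (32 * (L * L))%:R.
Definition ts : R := 1 + (2 * (L + 1))%:R * dl.
Definition Mx : R := (1 + eps) * (n%:R * W) + 1.
Definition Cb := (4 * m * N + 1)%N.
Definition W4 := (4 * m)%N.
(** [X] bounds the words in memory, and [B = X ^ 8] the intermediate values of the expressions, each
    of which combines at most eight words. *)
Definition X := ((n + m + 2) ^ 8)%N.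
Definition B := ((n + m + 2) ^ 64)%N.
Definition A0 : seq nat := rev [seq i <- iota 0 m | 1 <= wt i <= W].

Hypothesis N_gt0 : (0 < N)%N.
Hypothesis N_ge : Mx <= (1 + dl) ^+ N.
Hypothesis N_lt : (1 + dl) ^+ N.-1 < Mx.

Notation adjl := (adjl m A0 idf).
Notation sinvt := (sinv X n m L Cb tl hd wt Mx dl ts A0 idf).
Notation stepf := (step_fact n m L N Cb W4 tl hd wt dl ts A0 idf).
Notation kapt := (kap m idf).
Notation fullt := (full m idf).
Notation arrd := (arrived idf).

Lemma n_gt0 : (0 < n)%N. Proof. by case: (n) s => [[]|]. Qed.

Lemma tl_lt j : (tl j < n)%N. Proof. exact: ltn_ord. Qed.
Lemma hd_lt j : (hd j < n)%N. Proof. exact: ltn_ord. Qed.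

Lemma edg_idf t : edg (idf t) = sg t.
Proof.
rewrite /idf; case: ifP => hi; rewrite /edg; first by rewrite hi nth_index // -index_mem size_tuple.
by rewrite ifN ?addKn // -leqNgt leq_addr.
Qed.

Lemma sg_in t : (t < m)%N -> sg t \in sigma.
Proof. by move=> h; rewrite mem_nth // size_tuple. Qed.

Lemma idf_injm t t' : (t < m)%N -> (t' < m)%N -> idf t = idf t' -> t = t'.
Proof.
move=> h h' e; apply/eqP; rewrite -(nth_uniq e0 _ _ us) ?size_tuple //.
by rewrite -/(sg t) -/(sg t') -edg_idf e edg_idf.
Qed.

Lemma edge_eqE (e e' : edge R n) : (e == e') =
  [&& val (etail e) == val (etail e'), val (ehead e) == val (ehead e') & weight e == weight e'].
Proof.
apply/eqP/and3P => [-> //|[/eqP /val_inj h1 /eqP /val_inj h2 /eqP h3]].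
by case: e e' h1 h2 h3 => [[a b] c] [[a' b'] c']; rewrite /etail /ehead /weight /= => -> -> ->.
Qed.

Lemma idf_spec i t : (i < m)%N -> (edg i == sg t) = (i == idf t).
Proof.
move=> im; apply/eqP/eqP => [|->]; last exact: edg_idf.
rewrite /edg im => e; rewrite /idf -e index_uniq ?size_tuple //; by rewrite im.
Qed.

Lemma idf_ge t : ~~ (idf t < m)%N -> idf t = (m + t)%N.
Proof. by rewrite /idf; case: ifP => // ->. Qed.

Lemma mem_A0 j : (j \in A0) = (j < m)%N && (1 <= wt j <= W).
Proof. by rewrite mem_rev mem_filter mem_iota add0n andbC. Qed.

Lemma wt_idf t : (t < m)%N -> 1 <= wt (idf t) <= W.
Proof. by move=> h; rewrite /wt edg_idf; apply/wtb/sg_in. Qed.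

Lemma A0_lt j : j \in A0 -> (j < m)%N. Proof. by rewrite mem_A0 => /andP[]. Qed.

Lemma A0_size : (size A0 <= m)%N.
Proof. by rewrite size_rev size_filter; apply: leq_trans (count_size _ _) _; rewrite size_iota. Qed.

Lemma A0_wt j : j \in A0 -> 1 <= wt j. Proof. by rewrite mem_A0 => /and3P[]. Qed.

Lemma idf_A0 t : (t < m)%N -> (idf t < m)%N -> idf t \in A0.
Proof. by move=> h h'; rewrite mem_A0 h' wt_idf. Qed.

Lemma idfE t : (t < m)%N -> ~~ (idf t < m)%N -> idf t = (m + t)%N. Proof. by move=> _; apply: idf_ge. Qed.
Lemma wt1 t : (t < m)%N -> 1 <= wt (idf t). Proof. by move=> /wt_idf /andP[]. Qed.

Lemma X_ge : (729 * ((n + m + 2) * (n + m + 2)) <= X)%N.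
Proof.
rewrite /X; have y3 : (3 <= n + m + 2)%N by have := n_gt0; lia.
move: y3; move: (n + m + 2)%N => y y3.
have -> : (y ^ 8 = y ^ 6 * (y * y))%N by rewrite mulnn -expnD.
rewrite leq_mul2r; apply/orP; right.
by have : (3 ^ 6 <= y ^ 6)%N by rewrite leq_exp2r.
Qed.

Lemma XB : (X ^ 8 <= B)%N. Proof. by rewrite /X /B -expnM. Qed.

Lemma L2 : (2 ^ L < 32 * (m + 1))%N /\ (L < 2 ^ L)%N.
Proof.
split; last exact: ltn_expl.
have -> : (2 ^ L = 2 * 2 ^ L.-1)%N by rewrite -expnS prednK.
by move: L_lt; clear; lia.
Qed.

Lemma X_facts : [/\ (64 <= X)%N, (2 * n < X)%N, (m + 3 * 2 ^ L + L + W4 + 2 < X)%N, (m * 2 ^ L < X)%N &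
  (L + n + 1 < X)%N /\ (4 * m + 3 * 2 ^ L + L + n + 2 < X)%N].
Proof.
have [h1 h2] := L2; have h3 := X_ge; have n0 := n_gt0; rewrite /W4.
have y3 : (3 * (n + m + 2) <= (n + m + 2) * (n + m + 2))%N by rewrite leq_mul2r; apply/orP; right; lia.
have my : (m * 2 ^ L <= (n + m + 2) * (32 * (n + m + 2)))%N.
  by apply: leq_mul; [lia|move: h1; clear; lia].
move: my y3 h1 h2 h3 n0; set y2 := ((n + m + 2) * (n + m + 2))%N; set p := (2 ^ L)%N; set q := (m * p)%N.
have -> : ((n + m + 2) * (32 * (n + m + 2)) = 32 * y2)%N by rewrite /y2; clear; lia.
by clear => a b c d e f; split; [lia|lia|lia|lia|split; lia].
Qed.

Lemma dl_facts : [/\ 0 < dl, dl <= 1 / 2, 1 <= ts & (1 + dl) ^+ L.+1 <= ts].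
Proof.
have [h1 _ h2] := d_facts eps_gt0 L_gt0; have [h3 h4 _] := ts_facts eps_gt0 L_gt0.
by split.
Qed.

Lemma nW_ge1 : 1 <= n%:R * W.
Proof. by rewrite mulr_ege1 // ler1n n_gt0. Qed.

Lemma Mx_gt1 : 1 < Mx.
Proof. by rewrite /Mx; have := nW_ge1; have := eps_gt0; nra. Qed.

(** At most [t + 1] arrivals have occurred, so the guess is at most [2 * (t + 1)] by [kap_bound],
    far below [2 ^ L >= 16 * (m + 1)]. *)
Lemma kL t : (t < m)%N -> ((kapt t).+1 < L)%N.
Proof.
move=> tm; have hb : (\sum_(i < t.+1) ~~ nearby m idf t.+1 i <= t.+1)%N.
  by apply: leq_trans (leq_sum _ (fun i _ => leq_b1 _)) _; rewrite sum_nat_const card_ord muln1.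
have := kap_bound hb; rewrite -/(kap m idf t) => h.
rewrite -(@ltn_exp2l 2) // expnS; apply: leq_trans L_ge; move: h; set p := (2 ^ _)%N.
by move: tm; clear; lia.
Qed.

Lemma startP : exists st T, [/\ exec B preprocessing (initial_state s W eps hat) st T, sinvt 0 st,
  (forall v, (v < n)%N -> rmem st 4 v = if v == val s then 0 else Mx),
  (forall j, imem st 10 j = (j < m)%N) & (forall j, rmem st 8 j = 0)].
Proof.
have [x1 x2 x3 x4 [x5 x6]] := X_facts; have [d0 d1 t1 _] := dl_facts; have M1 := Mx_gt1.
have M0 : 0 < Mx by apply: lt_trans M1.
suff : wpt B preprocessing (fun st _ => [/\ sinvt 0 st, (forall v, (v < n)%N -> rmem st 4 v = if v == val s then 0 else Mx),
  (forall j, imem st 10 j = (j < m)%N) & (forall j, rmem st 8 j = 0)]) (initial_state s W eps hat).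
  by move=> [st [T [E [h1 h2 h3 h4]]]]; exists st, T.
have hw : wb X (initial_state s W eps hat).
  have nX : (n < X)%N by move: x2; clear; lia.
  have mX : (m < X)%N by move: x6; clear; lia.
  have X0 : (0 < X)%N by move: x1; clear; lia.
  have bnd (f : edge R n -> 'I_n) i : (nth 0%N [seq val (f e) | e <- hat] i < X)%N.
    have [h|h] := ltnP i (size hat); last by rewrite nth_default // size_map.
    by rewrite (nth_map e0) //; apply: ltn_trans (ltn_ord _) nX.
  move=> [|[|[|a]]] i //=; [|exact: bnd|exact: bnd].
  case: i => [|[|[|i]]] //=; rewrite ?size_tuple // ?nth_nil //; exact: ltn_trans (ltn_ord _) nX.
have hh : hat_ok m tl hd wt (initial_state s W eps hat).
  move=> i im; rewrite /tl /hd /wt /edg im; have hi : (i < size hat)%N by rewrite size_tuple.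
  by split; rewrite /= (nth_map e0).
have tlhd i : (i < m)%N -> (tl i < n)%N /\ (hd i < n)%N by move=> _; split; [exact: tl_lt|exact: hd_lt].
eapply (@preprocessingP R B X n m L N Cb (val s) tl hd wt Mx dl ts eps W A0 idf) => //.
- exact: XB.
- exact: ltn_ord.
- by rewrite /= size_tuple.
- by move=> [|[|[|[|a]]]] i.
- by move=> [|[|[|[|a]]]] i.
Qed.

Lemma stepP t st : (t < m)%N -> sinvt t st -> exists st' T, [/\ exec B insertion (receive (sg t) st) st' T,
  sinvt t.+1 st', stepf t st st' &
  (T <= 10 * (if (idf t < m)%N then maxn (idf t - t) (t - idf t) else m) + 200 * L +
        L.+1 * ((5 * Hh + 80) * (6 * \sum_(v < n | imem st' 11 v <= imem st' 4 9) imem st' 17 v)))%N].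
Proof.
move=> tm hinv.
have [x1 x2 x3 x4 [x5 x6]] := X_facts; have [d0 d1 t1 _] := dl_facts; have M1 := Mx_gt1.
have M0 : 0 < Mx by apply: lt_trans M1.
suff : wpt B insertion (fun st' T => [/\ sinvt t.+1 st', stepf t st st' &
  (T <= 10 * (if (idf t < m)%N then maxn (idf t - t) (t - idf t) else m) + 200 * L +
        L.+1 * ((5 * Hh + 80) * (6 * \sum_(v < n | imem st' 11 v <= imem st' 4 9) imem st' 17 v)))%N]) (receive (sg t) st).
  by move=> [st' [T [E [h1 h2 h3]]]]; exists st', T.
have nX : (n < X)%N by move: x2; clear; lia.
have w : wb X st by case: hinv.
have w' : wb X (receive (sg t) st).
  by apply: wb_rupd; apply: wb_iupd; [apply: wb_iupd => //|]; apply: ltn_trans (ltn_ord _) nX.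
have F : fr [:: 3]%N [::] [:: 2]%N st (receive (sg t) st) by rewrite /receive; frt.
have hinv' := sinv_fr F w' hinv.
have idn u : (u < m)%N -> (tl (idf u) < n)%N /\ (hd (idf u) < n)%N by move=> _; split; [exact: tl_lt|exact: hd_lt].
have Cb0 : (0 < Cb)%N by rewrite /Cb addn1.
eapply (@insertionP R B X n m L Hh N Cb W4 tl hd wt Mx dl ts A0 idf) with (t := t) => //.
- exact: XB.
- exact: n_gt0.
- exact: kL.
- exact: A0_lt.
- exact: A0_size.
- exact: idfE.
- exact: idf_A0.
- exact: A0_wt.
- exact: wt1.
- by move=> i im; rewrite -(idf_spec t im) edge_eqE.
- by move=> h; rewrite /tl /hd /wt -idf_ge // edg_idf.
Qed.

(** * From machine states to the abstract trace *)

Section Trace.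
Variable st : nat -> state R.
Hypothesis st_inv : forall t, (t <= m)%N -> sinvt t (st t).
Hypothesis st_step : forall t, (t < m)%N -> stepf t (st t) (st t.+1).
Hypothesis st_D0 : forall v, (v < n)%N -> rmem (st 0%N) 4 v = if v == val s then 0 else Mx.
Hypothesis st_mu0 : forall j, imem (st 0%N) 10 j = (j < m)%N.
Hypothesis st_bl0 : forall j, rmem (st 0%N) 8 j = 0.

(** Distances are extended by [Mx] to all naturals, the value of an unreachable vertex, because
    [trace_ok] does not restrict vertices to ['I_n]. *)
Definition Dt t v := if (v < n)%N then rmem (st t) 4 v else Mx.
Definition St t a v := (v < n)%N && (imem (st t) 11 v <= a)%N.
Definition mut t j := imem (st t) 10 j.
Definition Tht t := imem (st t) 4 5.
Definition topt t := imem (st t.+1) 4 9.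
Definition deg t v := (count (fun j => hd j == v) (adjl t) + count (fun j => tl j == v) (adjl t))%N.
(** The cap at [m] keeps the degrees below the final ones for every natural [t]. *)
Definition dgt t v := deg (minn t.+1 m) v.
Definition psit t j := if (j < m)%N then psi Cb W4 (st t) j else 0%N.
Definition chit t j := if (j < m)%N then chi Cb (st t) j else 0%N.
Definition PM := (L * (Cb + W4) + Cb)%N.

Lemma D_bd t v : (t <= m)%N -> (v < n)%N -> 0 <= rmem (st t) 4 v <= Mx.
Proof. by move=> /st_inv [_ _ _ _ [_ [_ _ _ _ hb] _ _ _]]; apply: hb. Qed.

Lemma arrE t j : (t < m)%N -> arr (adjl t.+1) (st t.+1) j = arrd t.+1 j.
Proof.
move=> tm; have [_ _ _ [_ _ h9 _ _] _] := st_inv tm; rewrite /arr h9.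
by apply/andP/idP => [[]//|h]; split=> //; apply: (adjl_arrived idfE idf_A0 tm).
Qed.

Lemma cndE a t j : cnd m t (kapt t) (adjl t.+1) a j = cand m idf (fun j => j \in A0) a t j.
Proof.
rewrite /cnd /cand; case: (boolP (j < m)%N) => // h; rewrite !andTb.
have -> : (j \in adjl t.+1) = (j \in A0) by apply: adjl_pred => //; try exact: A0_size; try exact: A0_lt.
by [].
Qed.

Lemma ipath_ends P u p v : ipath tl hd P u p v -> (p = [::] /\ u = v) \/ ((u < n)%N /\ (v < n)%N).
Proof.
case: p => [|j p] /=; first by move/eqP; left.
move=> /and3P[_ /eqP <- h]; right; split; first exact: tl_lt.
elim: p j h => [|i p IH] j /=; first by move/eqP <-; exact: hd_lt.
by move=> /and3P[_ _ /IH].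
Qed.

Lemma ipath_src P u p v : (v < n)%N -> ipath tl hd P u p v -> (u < n)%N.
Proof. by move=> hv /ipath_ends [[_ ->]|[]]. Qed.

Lemma degE t v : (t < m)%N -> (v < n)%N -> imem (st t.+1) 17 v = dgt t v.
Proof.
move=> tm hv; have [_ _ _ [[_ _ _ _ hd'] _ _ _ _] _] := st_inv tm.
by rewrite hd' // /dgt (minn_idPl tm).
Qed.

Lemma all_St t a p : all (fun j => St t a (hd j)) p = all (fun j => (imem (st t) 11 (hd j) <= a)%N) p.
Proof. by apply: eq_all => j; rewrite /St hd_lt. Qed.

Lemma topE t : (t < m)%N -> St t.+1 L =1 fun v => (v < n)%N && has (fun j => hd j == v) (adjl t.+1).
Proof.
move=> tm v; have [_ _ _ [_ _ _ _ ht] _] := st_inv tm; rewrite /St.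
by case: (ltnP v n) => // hv; rewrite ht.
Qed.

Lemma trace : trace_ok m L N (val s) idf tl hd wt (fun j => j \in A0) dl ts Mx Dt St mut Tht topt.
Proof.
have [d0 d1 t1 t2] := dl_facts; have M1 := Mx_gt1; have M0 : 0 < Mx by apply: lt_trans M1.
have Dge t v : (t <= m)%N -> 0 <= Dt t v <= Mx.
  by move=> tm; rewrite /Dt; case: ifP => [/(D_bd tm)//|_]; rewrite (ltW M0) lexx.
have sn : (val s < n)%N := ltn_ord s.
have Dle t v : (t < m)%N -> Dt t.+1 v <= Dt t v.
  move=> tm; have [_ _ _ _ [g1 _ _ _ _]] := st_step tm; rewrite /Dt; case: ifP => // hv; exact: g1.
split=> //.
- exact: kL.
- by move=> t t'; rewrite !inE => h h'; apply: idf_injm.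
- exact: wt1.
- exact: A0_wt.
- exact: idf_A0.
- by move=> t c tm cL; have [_ h2 _ _ _] := st_step tm; apply: h2.
- by move=> t tm; have [h1 _ _ _ _] := st_step tm.
- by move=> t tm; have [_ _ h3 _ _] := st_step tm.
- by move=> t j tm; have [_ _ _ _ [_ _ _ _ [_ _ _ _ [_ c6]]]] := st_step tm; apply: c6.
- move=> t a v tm ha; have [_ h2 _ h4 _] := st_step tm => hrb; rewrite /St; case: (ltnP v n) => //= hv.
  by apply: h4 => //; rewrite -h2 //; case/andP: ha.
- move=> t v tm nf; rewrite topE //; have idm : (idf t < m)%N.
    by move: nf; rewrite /full negb_or => /andP[/ev_kap /and3P[]].
  have [_ _ _ [_ _ _ _ ht] _] := st_inv (ltnW tm); rewrite /St.
  by case: (ltnP v n) => //= hv; rewrite ht //= idm.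
- by move=> t a v tm ha; rewrite /St => /andP[-> h]; apply: leq_trans h _.
- move=> t j tm aj; rewrite topE // hd_lt /=; apply/hasP; exists j => //.
  exact: (adjl_arrived idfE idf_A0 tm).
- elim=> [|t IH] tm; first by rewrite /Dt sn st_D0 // eqxx.
  apply/eqP; rewrite eq_le -{1}(IH (ltnW tm)) Dle //; by have /andP[] := Dge t.+1 (val s) tm.
- by move=> v nv; rewrite /Dt; case: ifP => // hv; rewrite st_D0 // (negPf nv).
- move=> t v tm; have [_ _ _ _ [_ g2 _ _ _]] := st_step tm; rewrite /St /Dt; case: ifP => //= hv h; exact: g2.
- move=> t j tm aj; have [_ _ _ _ [_ _ g3 _ _]] := st_step tm; rewrite /St /Dt hd_lt tl_lt /= => h; exact: g3.
- move=> t v tm; have [_ _ _ _ [_ _ _ g4 _]] := st_step tm; rewrite {1 2}/Dt; case: ifP => [hv h|_]; last by rewrite ltxx.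
  have [j [h1 h2 h3]] := g4 v hv h; exists j; split=> //; by rewrite /Dt hv tl_lt.
- move=> t a tm ha; have [_ _ _ _ [_ _ _ _ [c1 _ _ _ _]]] := st_step tm.
  have [muc [hm hc]] := c1 a ha; exists muc; split=> // u p v hp hall hS.
  case: (ipath_ends hp) => [[ep eu]|[un vn]].
    have /andP[D0 _] := Dge t.+1 v tm.
    rewrite ep eu big_nil plen_nil addr0 mulr1 ler_peMl // /theta; case: ifP => _ //; lra.
  have hp' : ipath tl hd (fun j => arr (adjl t.+1) (st t.+1) j ||
      (cnd m t (kapt t) (adjl t.+1) a j && ((a < (kapt t).+1)%N ==> (muc j < 2 ^ a)%N))) u p v.
    by apply: ipath_sub hp => j _; rewrite arrE // cndE.
  rewrite all_St in hall; rewrite /St vn /= in hS; have := hc u p v vn hp' hall hS.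
  rewrite /Dt un vn (eq_bigr (fun j => pen m idf dl muc a t j)) // => j _.
  by rewrite arrE.
- by apply: le_trans N_ge _; rewrite lerXn2r ?nnegrE; lra.
Qed.

Lemma count_adjl (p : pred nat) t t' : (t <= t')%N -> (count p (adjl t) <= count p (adjl t'))%N.
Proof.
move=> /subnK <-; elim: (t' - t)%N => // d IH; rewrite addSn /=; apply: leq_trans IH _.
by case: ifP => // _ /=; rewrite leq_addl.
Qed.

Lemma WE t a : (t < m)%N -> level_weight n St dgt t a = (\sum_(v < n | imem (st t.+1) 11 v <= a) imem (st t.+1) 17 v)%N.
Proof.
move=> tm; rewrite /level_weight; apply: eq_big => v; first by rewrite /St ltn_ord.
by move=> _; rewrite degE.
Qed.

Lemma cost : cost_ok n m L N idf tl hd wt (fun j => j \in A0) dl ts Mx Dt St mut topt dgt (deg m) W4 PM Cb psit chit.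
Proof.
have [d0 d1 t1 t2] := dl_facts; have M1 := Mx_gt1.
have tr x : Num.truncn (x%:R : R) = x by exact: natrK.
split=> //.
- by move=> t v; rewrite /dgt /deg leq_add // count_adjl // geq_minr.
- move=> t v tm nf; have idm : (idf t.+1 < m)%N.
    by move: nf; rewrite /full negb_or => /andP[/ev_kap /and3P[]].
  by rewrite /dgt (minn_idPl tm) (minn_idPl (ltnW tm)) /deg /= idm.
- apply: leq_trans (deg_sum n tl hd (adjl m)) _; have := adjl_size idf A0_size m; rewrite /W4; clear; lia.
- exact: ltW.
- have := L_ge; have -> : (2 ^ L = 2 * 2 ^ L.-1)%N by rewrite -expnS prednK.
  by clear; lia.
- move=> t j tm; rewrite /psit; case: ifP => // jm.
  by have [_ _ _ _ [_ _ _ _ [_ _ _ _ [c5 _]]]] := st_step tm; apply: c5.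
- move=> t j tm; rewrite /psit; case: ifP => // jm; have [_ _ _ _ [[h _] _ _ _ _]] := st_inv tm.
  have [[e he eL] [b hb bC]] := h j jm; rewrite /psi /bln he hb tr trunc_expnK // /PM.
  by apply: leq_add; [rewrite leq_mul2r eL orbT|exact: ltnW].
- move=> t j tm; rewrite /chit /mut; case: ltnP => jm; first exact: leq_addr.
  by have [_ _ _ _ [[_ h] _ _ _ _]] := st_inv tm; rewrite h.
- move=> j; rewrite /chit /chi /bln st_mu0 st_bl0 (tr 0%N); by case: ifP => // ->.
- by rewrite /W4 /Cb leq_addr.
- move=> t a v tm ha hv; have [_ _ _ _ [_ _ _ _ [_ c2 _ _ _]]] := st_step tm.
  rewrite /St hv /= => hS; have [ha1 ha2] := andP ha.
  have [u [p [h1 h2 h3]]] := c2 a v ltac:(rewrite ha2 andbT; exact: leq_trans ha1) ha1 hv hS.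
  exists u, p; split; [|by rewrite all_St|by rewrite /Dt hv (ipath_src hv h1)].
  by apply: ipath_sub h1 => j _; rewrite arrE // cndE.
- move=> t Z tm; have [_ _ _ _ [_ _ _ _ [_ _ c3 _ _]]] := st_step tm.
  have [Xf [h1 h2]] := c3 Z; exists Xf; split.
    rewrite (eq_bigr (fun j : 'I_m => psi Cb W4 (st t.+1) j - psi Cb W4 (st t) j)%N); last by move=> j _; rewrite /psit ltn_ord.
    apply: leq_trans h1; apply: leq_sum => a _; rewrite leq_eqVlt; apply/orP; left; apply/eqP.
    by apply: eq_big => v; [rewrite /St ltn_ord|rewrite degE].
  move=> a v ha hv; rewrite /St hv /= => hS nX; have [u [p [g1 g2]]] := h2 a v ha hv hS nX.
  exists u, p; split; last by rewrite /Dt hv (ipath_src hv g1).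
  by apply: ipath_sub g1 => j _; rewrite arrE // cndE.
- move=> t tm; have [_ _ _ _ [_ _ _ _ [_ _ _ c4 _]]] := st_step tm.
  have e u : (\sum_(j < m) chit u j = \sum_(j < m) chi Cb (st u) j)%N by apply: eq_bigr => j _; rewrite /chit ltn_ord.
  rewrite !e; apply: leq_trans c4 _; rewrite leq_add2l leq_mul2l; apply/orP; right.
  by apply: leq_sum => a _; rewrite WE.
Qed.

Lemma path_ids t (p : seq (edge R n)) (u v : 'I_n) : is_path (take t sigma) u p v ->
  exists2 q, ipath tl hd (arrd t) (val u) q (val v) & plen wt q = path_length p.
Proof.
elim: p u => [|e p IH] u /=; first by move=> /eqP <-; exists [::]; rewrite /= ?eqxx // /plen /path_length !big_nil.
move=> /and3P[he /eqP hu /IH [q hq eq]]; have [i hi ei] := nthP e0 he.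
have it : (i < t)%N by apply: leq_trans hi _; rewrite size_take_min geq_minl.
rewrite nth_take // -/(sg i) in ei.
exists (idf i :: q); last by rewrite plen_cons eq /path_length big_cons /wt edg_idf ei.
by rewrite /= arrived_idf // /tl /hd edg_idf ei hu eqxx.
Qed.

Lemma ids_path t (q : seq nat) (u v : 'I_n) : (t <= m)%N -> ipath tl hd (arrd t) (val u) q (val v) ->
  exists2 p : seq (edge R n), is_path (take t sigma) u p v & path_length p = plen wt q.
Proof.
move=> tm; elim: q u => [|j q IH] u /=; first by move=> /eqP /val_inj <-; exists [::]; rewrite /= ?eqxx // /plen /path_length !big_nil.
move=> /and3P[/arrivedP [i it ei] /eqP /val_inj hu /IH [p hp ep]].
exists (edg j :: p); last by rewrite /path_length big_cons plen_cons -ep.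
rewrite /= hu eqxx hp andbT -ei edg_idf /sg -(nth_take e0 it) mem_nth // size_take_min size_tuple.
by rewrite leq_min it; apply: leq_trans tm.
Qed.

Lemma approx t v p : (t < m)%N -> ipath tl hd (arrd t.+1) (val s) p v -> Dt t.+1 v <= (1 + eps) * plen wt p.
Proof.
move=> tm hp; apply: le_trans (approx_top trace tm hp) _; rewrite ler_wpM2r //.
  by apply: plen_ge0 (ipath_all hp) => j /(arrived_wt trace tm).
rewrite /er /e1; apply: (err_le eps_gt0 L_gt0); first exact: leq_subr.
by apply: leq_trans (leq_subr _ _) _; apply: ltnW; apply: kL.
Qed.

(** If the stored value is at least [Mx], then [v] is unreachable: a simple path has length at most
    [n * W], and [approx] would give a value below [Mx]. Otherwise [D_path] supplies a path no
    longer than the value, and [approx] compares the value with every path. *)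
Lemma correct t (v : 'I_n) : (1 <= t <= m)%N ->
  (dist (take t sigma) s v <= Defs.D (st t) v)%E /\ (Defs.D (st t) v <= (1 + eps)%:E * dist (take t sigma) s v)%E.
Proof.
case: t => // t /andP[_ tm]; have [_ _ _ _ [_ _ _ _ hout]] := st_inv tm.
have hv := ltn_ord v; have e1 : 0 < 1 + eps by have := eps_gt0; lra.
have DE : Dt t.+1 v = rmem (st t.+1) 4 v by rewrite /Dt hv.
have /andP[D0 _] := D_bd tm hv.
have [hM|hM] := leP Mx (rmem (st t.+1) 4 v); rewrite /Defs.D hout //; first rewrite hM ltrN10; last rewrite (lt_geF hM) (le_gtF D0).
  have -> : dist (take t.+1 sigma) s v = +oo%E.
    apply/eqP; rewrite -leye_eq; apply: le_ereal_inf_tmp => _ [p hp <-]; exfalso.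
    have [q hq _] := path_ids hp.
    have [q' [hq' uq' _ _]] := ipath_simple (fun j => arrived_wt trace tm (j := j)) hq.
    have sz : (size q' <= n)%N.
      rewrite -(size_map hd) -(size_iota 0 n); apply: uniq_leq_size => // x /mapP[j _ ->].
      by rewrite mem_iota add0n hd_lt.
    have pl : plen wt q' <= n%:R * W.
      apply: le_trans (_ : (size q')%:R * W <= _); last by rewrite ler_wpM2r ?ler_nat //; have := W1; lra.
      have /allP ha := ipath_all hq'.
      rewrite /plen big_seq; apply: le_trans (_ : \sum_(j <- q' | j \in q') W <= _).
        by apply: ler_sum => j /ha /arrivedP [i it <-]; have /andP[] := wt_idf (leq_trans it tm).
      by rewrite -big_seq big_const_seq count_predT iter_addr_0 mulr_natl.
    have := approx tm hq'; rewrite DE => h; have : Mx <= (1 + eps) * (n%:R * W).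
      by apply: le_trans hM _; apply: le_trans h _; rewrite ler_wpM2l // ltW.
    by rewrite /Mx; lra.
  by rewrite gt0_muley ?lte_fin // leey.
split.
  have [|q hq lq] := D_path trace tm (v := v); first by rewrite DE.
  have [p hp ep] := ids_path tm hq.
  apply: ge_ereal_inf; exists (path_length p)%:E; first by exists p.
  by rewrite lee_fin ep -DE.
have lb : ((rmem (st t.+1) 4 v / (1 + eps))%:E <= dist (take t.+1 sigma) s v)%E.
  apply: le_ereal_inf_tmp => _ [p hp <-]; have [q hq <-] := path_ids hp.
  by rewrite lee_fin ler_pdivrMr // mulrC -DE; apply: approx.
move: lb; case: (dist _ _ _) => [r| |].
- by rewrite -EFinM !lee_fin ler_pdivrMr // mulrC.
- by move=> _; rewrite gt0_muley ?lte_fin // leey.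
- by rewrite leeNy_eq.
Qed.

(** Let [tau] attain the minimum [x]. If an arrival is not near for [x >= tau], then either its
    error exceeds [tau], so that it belongs to [high], or it is unpredicted with error
    [m - t <= tau]; the latter happens only among the last [tau] arrivals. The sum of both counts is
    at most [x]. *)
Lemma near_count : (\sum_(t < m) ~~ nearby m idf (min_tau_cost sigma hat) t <= min_tau_cost sigma hat)%N.
Proof.
rewrite /min_tau_cost; case: ex_minnP => k /asboolP[tau <-] _; rewrite {2}/tau_cost.
set x := tau_cost sigma hat tau; set H := high sigma hat tau.
have tx : (tau <= x)%N by apply: leq_addr.
apply: leq_trans (_ : \sum_(t < m) ((m - t <= tau) + (sg t \in H))%N <= _)%N.
  apply: leq_sum => t _; have tm := ltn_ord t; case hn: (nearby m idf x t) => //=.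
  have ps : position sigma (sg t) = t.+1 by rewrite /position /sg index_uniq ?size_tuple.
  case: (leqP (m - t) tau) => // hmt; suff -> : sg t \in H by [].
  rewrite /H /high mem_undup mem_filter sg_in // andbT.
  rewrite /Defs.eta ps /position; move: hn; rewrite /nearby /idf; case: ifP => hi.
    rewrite hi /=; move: tx; move: (index _ _) => i; clear; lia.
  move=> _; have -> : index (sg t) hat = m.
    have hs := index_size (sg t) hat; rewrite size_tuple in hs.
    by move: hs (negbT hi); clear; lia.
  by move: hmt; clear; lia.
rewrite big_split /=; apply: leq_add.
  apply: leq_trans (_ : \sum_(t < m) (t < tau) <= _)%N.
    rewrite (reindex_inj rev_ord_inj) /=; apply: leq_sum => t _; have ht := ltn_ord t.
    by rewrite (_ : m - (m - t.+1) = t.+1)%N //; move: ht; clear; lia.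
  have hsum i : (\sum_(t < i) (t < tau) <= minn i tau)%N.
    elim: i => [|i IH]; first by rewrite big_ord0.
    by rewrite big_ord_recr /=; move: IH; set S := (\sum_(_ < _) _)%N; clear; case: ltnP; lia.
  by apply: leq_trans (hsum m) _; rewrite geq_minr.
have -> : (\sum_(t < m) (sg t \in H) = count (mem H) sigma)%N.
  rewrite -sum1_count [RHS]big_mkcond (big_nth e0) size_tuple big_mkord; apply: eq_bigr => t _.
  by rewrite -/(sg t) /=; case: (_ \in _).
rewrite -size_filter; apply: uniq_leq_size; first by rewrite filter_uniq.
by move=> e; rewrite mem_filter => /andP[].
Qed.

(** A near arrival is found within radius [K]. The others occur at full times, cost at most [m]
    each, and by [event_count] number at most [2 * L * K]. *)
Lemma dist_sum : (0 < m)%N ->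
  (\sum_(t < m) (if (idf t < m)%N then maxn (idf t - t) (t - idf t) else m) <= m * 2 ^ kapt m.-1 * (2 * L + 3))%N.
Proof.
move=> m0; set K := (2 ^ kapt m.-1)%N.
have K0 : (0 < K)%N by rewrite expn_gt0.
apply: leq_trans (_ : \sum_(t < m) (K + m * fullt t) <= _)%N.
  apply: leq_sum => t _; have tm := ltn_ord t; have [/orP hf|nf] := boolP (fullt t).
    by rewrite muln1; case: ltnP => hi; move: hi tm; clear; lia.
  move: nf; rewrite /full negb_or => /andP[/ev_kap /and3P[h1 h2 h3] _]; rewrite h1.
  have : (2 ^ kapt t <= K)%N by rewrite leq_exp2l // kap_mono //; move: tm m0; clear; lia.
  by move: h2 h3; clear; lia.
rewrite big_split /= sum_nat_const card_ord -big_distrr /=.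
have := event_count m idf; rewrite big_mkord -/K.
have kl : ((kapt m.-1).+1 <= L)%N by apply: ltnW; apply: kL; move: m0; clear; lia.
set S := (\sum_(_ < _) _)%N => hS.
have hS' : (S <= L * (2 * K))%N by apply: leq_trans hS _; apply: leq_mul => //; move: K0; clear; lia.
have : (m * S <= m * (L * (2 * K)))%N by rewrite leq_mul2l hS' orbT.
by clear; move: (m * S)%N => z; lia.
Qed.

Lemma total (time : 'I_m -> nat) (eps0 : R) : eps <= eps0 -> (0 < Hh)%N -> (2 ^ Hh.-1 < 2 * n)%N ->
  (forall t : 'I_m, (time t <= 10 * (if (idf t < m)%N then maxn (idf t - t) (t - idf t) else m) + 200 * L +
        L.+1 * ((5 * Hh + 80) * (6 * level_weight n St dgt t (topt t))))%N) ->
  (\sum_(t < m) time t)%:R <= tcst eps0 * ln ((n + m + 2)%:R : R) ^+ 9 *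
    (m%:R * (maxn 1 (min_tau_cost sigma hat))%:R * Num.max 1 (ln W) / eps).
Proof.
move=> he H0 hH ht; have [m0|m0] := posnP m.
  have -> : (\sum_(t < m) time t = 0)%N by apply: big1 => t _; have := ltn_ord t; rewrite {2}m0.
  have mz : (m%:R : R) = 0 by rewrite m0.
  by rewrite mz !mul0r mulr0.
set x := maxn 1 _; set K := (2 ^ kapt m.-1)%N.
apply: (@time_bound R eps0 eps W n m L Hh N x) => //; [by rewrite eps_gt0|exact: n_gt0|].
have Kx : (K <= 2 * x)%N.
  have := kap_bound near_count; rewrite /K /kap prednK // /x; clear; lia.
apply: leq_trans (_ : _ <= 2000 * 1000 * (Hh * (L * L * L * L * L) * K * m * N))%N _; last first.
  by rewrite leq_mul2l; apply/orP; right; do 3 (apply: leq_mul => //).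
have hc := total_cost trace cost; rewrite big_mkord in hc.
apply: (total_nat (K := K) (d := \sum_(t < m) (if (idf t < m)%N then maxn (idf t - t) (t - idf t) else m))
  (S := \sum_(t < m) level_weight n St dgt t (topt t)) L_gt0 H0 _ m0 N_gt0 (dist_sum m0) hc).
  by rewrite expn_gt0.
pose F t := (if (idf t < m)%N then maxn (idf t - t) (t - idf t) else m)%N.
pose G t := level_weight n St dgt t (topt t).
apply: leq_trans (_ : \sum_(t < m) (10 * F t + 200 * L + L.+1 * ((5 * Hh + 80) * (6 * G t))) <= _)%N.
  by apply: leq_sum => t _; exact: ht.
have eA : (\sum_(t < m) 10 * F t = 10 * \sum_(t < m) F t)%N by rewrite big_distrr.
have eB : (\sum_(t < m) 200 * L = m * (200 * L))%N by rewrite sum_nat_const card_ord.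
have eC : (\sum_(t < m) L.+1 * ((5 * Hh + 80) * (6 * G t)) = L.+1 * ((5 * Hh + 80) * (6 * \sum_(t < m) G t)))%N.
  by rewrite !big_distrr.
by rewrite -eA -eB -eC -big_split -big_split.
Qed.

End Trace.
Lemma run_exists (eps0 : R) : eps <= eps0 -> (0 < Hh)%N -> (2 ^ Hh.-1 < 2 * n)%N ->
  exists (st : nat -> state R) (time : 'I_m -> nat),
    [/\ run B (Algorithm preprocessing insertion) (initial_state s W eps hat) sigma st time,
        (forall t : nat, (1 <= t <= m)%N -> forall v : 'I_n,
           (dist (take t sigma) s v <= Defs.D (st t) v)%E /\
           (Defs.D (st t) v <= (1 + eps)%:E * dist (take t sigma) s v)%E)
      & (\sum_(t < m) time t)%:R <= tcst eps0 * ln ((n + m + 2)%:R : R) ^+ 9 *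
          (m%:R * (maxn 1 (min_tau_cost sigma hat))%:R * Num.max 1 (ln W) / eps)].
Proof.
move=> he H0 hH; have [s0 [T0 [E0 I0 D0 mu0 bl0]]] := startP.
pose P (x : nat * state R) (y : state R * nat) := (x.1 < m)%N -> sinvt x.1 x.2 ->
  [/\ exec B insertion (receive (sg x.1) x.2) y.1 y.2, sinvt x.1.+1 y.1, stepf x.1 x.2 y.1 &
    (y.2 <= 10 * (if (idf x.1 < m)%N then maxn (idf x.1 - x.1) (x.1 - idf x.1) else m) + 200 * L +
        L.+1 * ((5 * Hh + 80) * (6 * \sum_(v < n | imem y.1 11 v <= imem y.1 4 9) imem y.1 17 v)))%N].
(* The choice covers all pairs of a time and a state, with an arbitrary answer where the invariant
   fails, so that the states can be defined by plain recursion. *)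
have /boolp.choice [f hf] : forall x, exists y, P x y.
  move=> [t u]; rewrite /P /=; have [tm|tm] := ltnP t m; last by exists (u, 0%N).
  have [hi|hi] := pselect (sinvt t u); last by exists (u, 0%N).
  by have [s' [T [h1 h2 h3 h4]]] := stepP tm hi; exists (s', T).
pose st := fix st t := if t is t'.+1 then (f (t', st t')).1 else s0.
have st_inv t : (t <= m)%N -> sinvt t (st t).
  by elim: t => // t IH tm; have [] := hf (t, st t) tm (IH (ltnW tm)).
have st_all t (tm : (t < m)%N) := hf (t, st t) tm (st_inv t (ltnW tm)).
have st_step t : (t < m)%N -> stepf t (st t) (st t.+1) by move=> tm; have [] := st_all t tm.
have D0' v : (v < n)%N -> rmem (st 0%N) 4 v = if v == val s then 0 else Mx by exact: D0.
have mu0' j : imem (st 0%N) 10 j = (j < m)%N by exact: mu0.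
have bl0' j : rmem (st 0%N) 8 j = 0 by exact: bl0.
exists st, (fun t => (f (t : nat, st t)).2); split.
- split; first by exists T0.
  by move=> t; have [h _ _ _] := st_all t (ltn_ord t); rewrite (tnth_nth e0).
- by move=> t tm v; apply: (@correct st).
- apply: (@total st) => // t; have [_ _ _ h] := st_all t (ltn_ord t).
  by rewrite (@WE st).
Qed.

End Run.

Theorem theorem2 (R : realType) :
  exists (A : algorithm) (c k : nat), forall eps0 : R, exists C : R,
  forall (n m : nat) (s : 'I_n) (W eps : R)
         (sigma sigma_hat : m.-tuple (edge R n)),
    1 <= W -> 0 < eps <= eps0 ->
    uniq sigma -> uniq sigma_hat ->
    (forall e, e \in sigma -> 1 <= weight e <= W) ->
  exists (st : nat -> state R) (time : 'I_m -> nat),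
    [/\ run ((n + m + 2) ^ c)%N A (initial_state s W eps sigma_hat) sigma st time,
        (forall t : nat, (1 <= t <= m)%N -> forall v : 'I_n,
           (dist (take t sigma) s v <= D (st t) v)%E /\
           (D (st t) v <= (1 + eps)%:E * dist (take t sigma) s v)%E)
      & (\sum_(t < m) time t)%:R <=
          C * ln ((n + m + 2)%:R) ^+ k *
          (m%:R * (maxn 1 (min_tau_cost sigma sigma_hat))%:R *
           Num.max 1 (ln W) / eps)].
Proof.
(* The exponent 64 is that of the word bound [B], and 9 is the power of the logarithm in
   [time_bound]. The program is the same for all [eps0]; only the constant depends on it. *)
exists (Algorithm preprocessing insertion), 64%N, 9%N => eps0; exists (tcst eps0).
move=> n m s W eps sigma hat W1 /andP[e1 e2] us uh wtb.
have [L [L0 L1 L2']] := @pow2_ex (16 * (m + 1)) ltac:(lia).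
have n0 : (0 < n)%N by case: (n) s => [[]|].
have [Hh [H0 H1 H2]] := @pow2_ex (2 * n) ltac:(move: n0; clear; lia).
have [d0 _ _] := d_facts e1 L0.
have M1 : 1 < Mx n W eps.
  have h : 1 <= n%:R * W by rewrite mulr_ege1 // ler1n.
  by rewrite /Mx; nra.
have [N [N0 N1 N2]] := pow_ex d0 M1.
exact: (@run_exists R n m s W eps sigma hat L Hh N).
Qed.
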